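(* Let $f,g\in L_{\mathbb{T}}[a,b]$, of exponential order, be bicomplex-valued functions with $${}^{C}\mathbb{D}^{l}_{m,n,r,0^+}f(t)+k f(t)=g(t),\qquad f(0^+)=\tau_0,$$ where $k$ and $\tau_0$ are constants and the parameters satisfy $m,n,r\in\mathbb{T}$, $|\operatorname{Im}_j(m)|<\operatorname{Re}(m)$, $|\operatorname{Im}_j(n)|<\operatorname{Re}(n)$, and $l=l_1e_1+l_2e_2\in\mathbb{D}$ with $0<l_1,l_2<1$. The integral (in the fractional operator) is taken from the lower limit $0^+$. Then $$f(t)=(h*g)(t)+\tau_0\,\mathcal{L}^{-1}\left\{\frac{\xi^{n-1}(1-r\xi^{-m})^{l}}{\xi^{n}(1-r\xi^{-m})^{l}+k}\right\}(t),$$ where $$h(t)=\mathcal{L}^{-1}\left\{\frac{1}{\xi^{n}(1-r\xi^{-m})^{l}+k}\right\}(t).$$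
   Context: Bicomplex numbers: $\mathbb{T}=\{x_0+i_1x_1+i_2x_2+jx_3: x_0,\dots,x_3\in\mathbb{R}\}$ is the commutative ring with $i_1^2=i_2^2=-1$, $i_1i_2=i_2i_1=j$, $j^2=1$. For $\xi=x_0+i_1x_1+i_2x_2+jx_3$ put $\operatorname{Re}(\xi)=x_0$, $\operatorname{Im}_j(\xi)=x_3$. Let $e_1=(1+j)/2$, $e_2=(1-j)/2$. Writing $\xi=z_1+i_2z_2$ with $z_1,z_2$ complex (imaginary unit $i_1$), one has uniquely $\xi=\xi_1e_1+\xi_2e_2$ with $\xi_1=z_1-i_1z_2$, $\xi_2=z_1+i_1z_2$; ring operations are componentwise. $\mathbb{D}=\{l_1e_1+l_2e_2:l_1,l_2\in\mathbb{R}\}$ is the set of hyperbolic numbers. Bicomplex-valued functions are written $f=f_1e_1+f_2e_2$; integrals, derivatives and powers $\xi^{\eta}=\xi_1^{\eta_1}e_1+\xi_2^{\eta_2}e_2$ are componentwise. Prabhakar function: $\mathbb{E}_{m,n}^l(\zeta)=\sum_{u=0}^\infty\frac{(l)_u}{u!\,\Gamma_2(mu+n)}\zeta^u$, where $\Gamma_2(\xi)=\Gamma(\xi_1)e_1+\Gamma(\xi_2)e_2$ and $(l)_0=1$, $(l)_u=l(l+1)\cdots(l+u-1)$. Bicomplex Prabhakar integral: $(\mathbb{E}^l_{m,n,r,0^+}f)(t)=\int_0^t(t-y)^{n-1}\mathbb{E}_{m,n}^l\big(r(t-y)^m\big)f(y)\,dy$. Bicomplex regularized Prabhakar derivative: ${}^{C}\mathbb{D}^l_{m,n,r,0^+}f=\mathbb{E}^{-l}_{m,N-n,r,0^+}\frac{d^N}{dt^N}f$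 with $N=\lceil\operatorname{Re}(n_1)\rceil e_1+\lceil\operatorname{Re}(n_2)\rceil e_2$, read componentwise ($N$ stands for $\lceil\operatorname{Re}(n_i)\rceil$ in the $e_i$-component); it is introduced for functions whose components have sufficiently many continuous derivatives, the last of them absolutely continuous. $L_{\mathbb{T}}[a,b]$: functions $f_1e_1+f_2e_2$ with $f_1,f_2$ Lebesgue integrable on $[a,b]$. $f$ is of exponential order $M\in\mathbb{R}$ if $|f_i(t)|\le Ce^{Mt}$ for some constant $C$ and all large $t$, $i=1,2$. Bicomplex Laplace transform: $\mathcal{L}(f(t);\xi)=\tilde f(\xi)=\int_0^\infty f(t)e^{-\xi t}\,dt$, convergent for $\operatorname{Re}(\xi)>M+|\operatorname{Im}_j(\xi)|$; $\mathcal{L}^{-1}$ is the inverse transform. Convolution: $(h*g)(t)=\int_0^t h(t-s)g(s)\,ds$.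
   Formalization: In components with Re(n_i)>1 it is also assumed that f_i^(p)(0+)=0 for 1≤p<N_i (else false: r=k=0, n=3/2, f(t)=t, g=0, τ0=0); where n_i=N_i the order-zero Prabhakar integral, whose kernel has the undefined term t^{-1}/Γ(0), is read with that term as the identity. *)

(* Defs.v *)
From HB Require Import structures.
From mathcomp Require Import all_boot all_order all_algebra.
From mathcomp Require Import all_classical all_reals all_analysis.
From mathcomp Require Import complex ring.

Set Implicit Arguments.
Unset Strict Implicit.
Unset Printing Implicit Defensive.

Import Order.TTheory GRing.Theory Num.Theory.
Import numFieldNormedType.Exports.

Local Open Scope classical_set_scope.
Local Open Scope ring_scope.
Local Open Scope complex_scope.

(* [Bicomplex z1 z2] is z1 + i2 z2, where i1 is the unit 'i of R[i] and
   j = i1 i2; in real coordinates z1 = x0 + i1 x1 and z2 = x2 + i1 x3. *)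
Record bicomplex (R : Type) := Bicomplex { bc_z1 : R[i]; bc_z2 : R[i] }.

Definition bicomplex_pair (R : Type) (x : bicomplex R) : R[i] * R[i] :=
  (bc_z1 x, bc_z2 x).
Definition pair_bicomplex (R : Type) (p : R[i] * R[i]) : bicomplex R :=
  Bicomplex p.1 p.2.
Lemma bicomplex_pairK (R : Type) :
  cancel (@bicomplex_pair R) (@pair_bicomplex R).
Proof. by case. Qed.

HB.instance Definition _ (R : choiceType) :=
  Choice.copy (bicomplex R) (can_type (@bicomplex_pairK R)).

Lemma idem_z1 (K : comPzRingType) (a b c i : K) :
  a * (c * (1 + 0) - 0 * (0 + i)) - 0 * (c * (0 + i) + 0 * (1 + 0)) +
  (b * (c * (1 - 0) - 0 * (0 - i)) - 0 * (c * (0 - i) + 0 * (1 - 0))) =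
  (a + b) * c.
Proof. by ring. Qed.

Lemma idem_z2 (K : comPzRingType) (a b c i : K) :
  a * (c * (0 + i) + 0 * (1 + 0)) + 0 * (c * (1 + 0) - 0 * (0 + i)) +
  (b * (c * (0 - i) + 0 * (1 - 0)) + 0 * (c * (1 - 0) - 0 * (0 - i))) =
  i * ((a - b) * c).
Proof. by ring. Qed.

Section IdempotentIdentities.
Variables (K : comPzRingType) (i c : K).
Hypotheses (ii : i * i = -1) (c2 : c * 2 = 1).

Lemma idem_fst (a b : K) : (a + b) * c - i * (i * ((a - b) * c)) = a.
Proof.
rewrite (_ : _ - _ = (a + b) * c - i * i * ((a - b) * c)); last by ring.
by rewrite ii -[RHS]mulr1 -[in RHS]c2; ring.
Qed.

Lemma idem_snd (a b : K) : (a + b) * c + i * (i * ((a - b) * c)) = b.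
Proof.
rewrite (_ : _ + _ = (a + b) * c + i * i * ((a - b) * c)); last by ring.
by rewrite ii -[RHS]mulr1 -[in RHS]c2; ring.
Qed.

Lemma idem_add (a b : K) : ((a - i * b) + (a + i * b)) * c = a.
Proof. by rewrite -[RHS]mulr1 -[in RHS]c2; ring. Qed.

Lemma idem_sub (a b : K) : i * (((a - i * b) - (a + i * b)) * c) = b.
Proof.
rewrite (_ : _ * _ = - (i * i) * b * (c * 2)); last by ring.
by rewrite ii c2; ring.
Qed.

Lemma idem_mul1 (a b a' b' : K) :
  a * a' - b * b' - i * (a * b' + b * a') = (a - i * b) * (a' - i * b').
Proof.
have -> : b * b' = - (i * i) * (b * b') by rewrite ii; ring.
by ring.
Qed.

Lemma idem_mul2 (a b a' b' : K) :
  a * a' - b * b' + i * (a * b' + b * a') = (a + i * b) * (a' + i * b').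
Proof.
have -> : b * b' = - (i * i) * (b * b') by rewrite ii; ring.
by ring.
Qed.

End IdempotentIdentities.

Section BicomplexRing.
Variable R : rcfType.
Local Notation T := (bicomplex R).
Implicit Types x y z : T.

Definition bc_zero : T := Bicomplex 0 0.
Definition bc_one : T := Bicomplex 1 0.
Definition bc_opp x : T := Bicomplex (- bc_z1 x) (- bc_z2 x).
Definition bc_add x y : T := Bicomplex (bc_z1 x + bc_z1 y) (bc_z2 x + bc_z2 y).
Definition bc_mul x y : T :=
  Bicomplex (bc_z1 x * bc_z1 y - bc_z2 x * bc_z2 y)
            (bc_z1 x * bc_z2 y + bc_z2 x * bc_z1 y).

Lemma bc_addA : associative bc_add.
Proof. by move=> x y z; rewrite /bc_add /= !addrA. Qed.
Lemma bc_addC : commutative bc_add.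
Proof. by move=> x y; congr Bicomplex; rewrite addrC. Qed.
Lemma bc_add0 : left_id bc_zero bc_add.
Proof. by case=> a b; congr Bicomplex; rewrite /= add0r. Qed.
Lemma bc_addN : left_inverse bc_zero bc_opp bc_add.
Proof. by case=> a b; congr Bicomplex; rewrite /= addNr. Qed.

HB.instance Definition _ :=
  GRing.isZmodule.Build T bc_addA bc_addC bc_add0 bc_addN.

Lemma bc_mulA : associative bc_mul.
Proof. by move=> x y z; congr Bicomplex => /=; ring. Qed.
Lemma bc_mulC : commutative bc_mul.
Proof. by move=> x y; congr Bicomplex => /=; ring. Qed.
Lemma bc_mul1 : left_id bc_one bc_mul.
Proof. by case=> a b; congr Bicomplex => /=; ring. Qed.
Lemma bc_mulDl : left_distributive bc_mul bc_add.
Proof. by move=> x y z; congr Bicomplex => /=; ring. Qed.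
Lemma bc_oner_neq0 : bc_one != bc_zero.
Proof. by apply/eqP => -[/eqP]; rewrite oner_eq0. Qed.

HB.instance Definition _ := GRing.Zmodule_isComNzRing.Build T
  bc_mulA bc_mulC bc_mul1 bc_mulDl bc_oner_neq0.

(* The idempotent components xi_1 = z1 - i1 z2 and xi_2 = z1 + i1 z2. *)
Definition bc1 x : R[i] := bc_z1 x - 'i * bc_z2 x.
Definition bc2 x : R[i] := bc_z1 x + 'i * bc_z2 x.

Definition bc_ofC (a : R[i]) : T := Bicomplex a 0.
Definition bc_ofR (t : R) : T := bc_ofC t%:C.
Definition bc_j : T := Bicomplex 0 'i.
Definition bc_e1 : T := bc_ofC 2^-1 * (1 + bc_j).
Definition bc_e2 : T := bc_ofC 2^-1 * (1 - bc_j).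

Definition idem (a b : R[i]) : T := bc_ofC a * bc_e1 + bc_ofC b * bc_e2.

Lemma bc_ii : ('i : R[i]) * 'i = -1.
Proof. by rewrite -expr2 sqr_i. Qed.

Lemma idemE (a b : R[i]) :
  idem a b = Bicomplex ((a + b) / 2) ('i * ((a - b) / 2)).
Proof. by congr Bicomplex; [exact: idem_z1 | exact: idem_z2]. Qed.

Lemma bc_half : (2^-1 * 2 : R[i]) = 1.
Proof. by rewrite mulVf // pnatr_eq0. Qed.

Lemma bc1_idem (a b : R[i]) : bc1 (idem a b) = a.
Proof. by rewrite idemE; exact: (idem_fst bc_ii bc_half). Qed.
Lemma bc2_idem (a b : R[i]) : bc2 (idem a b) = b.
Proof. by rewrite idemE; exact: (idem_snd bc_ii bc_half). Qed.

Lemma bc_idemP x : idem (bc1 x) (bc2 x) = x.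
Proof.
case: x => a b; rewrite idemE; congr Bicomplex.
  exact: (idem_add _ bc_half).
exact: (idem_sub bc_ii bc_half).
Qed.

Lemma bc1_mul x y : bc1 (x * y) = bc1 x * bc1 y.
Proof. exact: (idem_mul1 bc_ii). Qed.
Lemma bc2_mul x y : bc2 (x * y) = bc2 x * bc2 y.
Proof. exact: (idem_mul2 bc_ii). Qed.

Lemma bc1_one : bc1 1 = 1. Proof. by rewrite /bc1 /= mulr0 subr0. Qed.
Lemma bc2_one : bc2 1 = 1. Proof. by rewrite /bc2 /= mulr0 addr0. Qed.

Definition bc_unit : pred T := [pred x | (bc1 x != 0) && (bc2 x != 0)].
Definition bc_inv x : T :=
  if bc_unit x then idem (bc1 x)^-1 (bc2 x)^-1 else x.

Lemma bc_mulVx : {in bc_unit, left_inverse 1 bc_inv *%R}.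
Proof.
move=> x ux; rewrite /bc_inv; case: ifP => [|/negP //].
case/andP=> x1 x2; rewrite -[LHS]bc_idemP bc1_mul bc2_mul bc1_idem bc2_idem.
by rewrite !mulVf // -[RHS]bc_idemP bc1_one bc2_one.
Qed.

Lemma bc_unitP x y : y * x = 1 -> bc_unit x.
Proof.
move=> yx; apply/andP; split; apply/eqP => x0.
  by have := bc1_one; rewrite -yx bc1_mul x0 mulr0 => /esym/eqP; rewrite oner_eq0.
by have := bc2_one; rewrite -yx bc2_mul x0 mulr0 => /esym/eqP; rewrite oner_eq0.
Qed.

Lemma bc_inv_out : {in [predC bc_unit], bc_inv =1 id}.
Proof. by move=> x nux; rewrite /bc_inv; case: ifP => // ux; case/negP: nux. Qed.

HB.instance Definition _ :=
  GRing.ComNzRing_hasMulInverse.Build T bc_mulVx bc_unitP bc_inv_out.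

Definition bc_Re x : R := complex.Re (bc_z1 x).
Definition bc_Imj x : R := complex.Im (bc_z2 x).

End BicomplexRing.

Section ComplexFunctions.
Variable R : realType.
Local Notation C := R[i].
Local Notation mu := (@lebesgue_measure R).

Definition cnorm (z : C) : R := Normc.normc z.

Definition cexp (z : C) : C :=
  (expR (complex.Re z))%:C * (cos (complex.Im z) +i* sin (complex.Im z)).

(* Principal argument, in ]-pi, pi]. *)
Definition carg (z : C) : R :=
  if complex.Im z < 0 then - acos (complex.Re z / cnorm z)
  else acos (complex.Re z / cnorm z).

Definition clog (z : C) : C := ln (cnorm z) +i* carg z.

Definition cpow (z w : C) : C :=
  if z == 0 then (w == 0)%:R else cexp (w * clog z).

Definition cintegrable (A : set R) (u : R -> C) : Prop :=
  mu.-integrable A (fun t => (complex.Re (u t))%:E) /\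
  mu.-integrable A (fun t => (complex.Im (u t))%:E).

Definition cint (A : set R) (u : R -> C) : C :=
  (\int[mu]_(t in A) complex.Re (u t)) +i*
  (\int[mu]_(t in A) complex.Im (u t)).

Definition csum (a : nat -> C) : C :=
  limn (fun p => complex.Re (\sum_(0 <= u < p) a u)) +i*
  limn (fun p => complex.Im (\sum_(0 <= u < p) a u)).

(* Euler's integral for Re z > 0, continued to the other z by
   Gamma(z) = Gamma(z + p) / (z (z + 1) ... (z + p - 1)).
   At the poles 0, -1, -2, ... the denominator vanishes and the value is the
   junk value 0; since 0^-1 = 0, the function (cgamma z)^-1 is nevertheless the
   entire function 1/Gamma everywhere. *)
Definition cgamma (z : C) : C :=
  let p := if 0 < complex.Re z then 0%N
           else (Num.truncn (- complex.Re z)).+1 in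
  cint `]0, +oo[ (fun x => cpow x%:C (z + p%:R - 1) * (expR (- x))%:C)
  / \prod_(i < p) (z + i%:R).

Definition cpoch (l : C) (u : nat) : C := \prod_(i < u) (l + i%:R).

Definition cprabhakar (l m n z : C) : C :=
  csum (fun u => cpoch l u / (u`!%:R * cgamma (m * u%:R + n)) * z ^+ u).

Definition cderiv (p : nat) (u : R -> C) (t : R) : C :=
  derive1n p (fun s => complex.Re (u s)) t +i*
  derive1n p (fun s => complex.Im (u s)) t.

Definition has_lim0 (u : R -> C) (a : C) : Prop :=
  (complex.Re (u t) @[t --> 0^'+] --> complex.Re a) /\
  (complex.Im (u t) @[t --> 0^'+] --> complex.Im a).

Definition abs_continuous_on (A : set R) (v : R -> R) : Prop :=
  forall e : R, 0 < e -> exists2 d : R, 0 < d &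
    forall (p : nat) (x y : 'I_p -> R),
      (forall i, x i <= y i /\ `[x i, y i] `<=` A) ->
      trivIset setT (fun i => `]x i, y i[%classic) ->
      \sum_(i < p) (y i - x i) < d ->
      \sum_(i < p) `|v (y i) - v (x i)| < e.

(* [v] has derivatives up to order N - 1 on ]0, +oo[, the last one being
   absolutely continuous on bounded intervals; only t > 0 matters. Absolute
   continuity on ]0, b] is absolute continuity on [0, b] up to giving 0 the
   limit value at 0+, and makes v, v', ..., v^(N-1) continuous up to 0. *)
Definition AC_order (N : nat) (v : R -> R) : Prop :=
  (forall p, (p.+1 < N)%N -> forall t, 0 < t -> derivable (derive1n p v) t 1) /\
  (forall b, 0 < b -> abs_continuous_on `]0, b] (derive1n N.-1 v)).

Definition cAC_order (N : nat) (u : R -> C) : Prop :=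
  AC_order N (fun t => complex.Re (u t)) /\
  AC_order N (fun t => complex.Im (u t)).

End ComplexFunctions.

Section BicomplexAnalysis.
Variable R : realType.
Local Notation C := R[i].
Local Notation T := (bicomplex R).
Implicit Types (x : T) (f g h : R -> T).

Definition bc_exp x : T := idem (cexp (bc1 x)) (cexp (bc2 x)).

Definition bc_pow x y : T :=
  idem (cpow (bc1 x) (bc1 y)) (cpow (bc2 x) (bc2 y)).

Definition bc_integrable (A : set R) f : Prop :=
  cintegrable A (fun t => bc1 (f t)) /\ cintegrable A (fun t => bc2 (f t)).

Definition bc_int (A : set R) f : T :=
  idem (cint A (fun t => bc1 (f t))) (cint A (fun t => bc2 (f t))).

Definition L_T (a b : R) f : Prop := bc_integrable `[a, b] f.

Definition exp_order (M : R) f : Prop :=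
  exists K : R, \forall t \near +oo,
    cnorm (bc1 (f t)) <= K * expR (M * t) /\
    cnorm (bc2 (f t)) <= K * expR (M * t).

Definition of_exp_order f : Prop := exists M : R, exp_order M f.

Definition bc_continuous_at f (t : R) : Prop :=
  [/\ {for t, continuous (fun s => complex.Re (bc1 (f s)))},
      {for t, continuous (fun s => complex.Im (bc1 (f s)))},
      {for t, continuous (fun s => complex.Re (bc2 (f s)))} &
      {for t, continuous (fun s => complex.Im (bc2 (f s)))}].

Definition bc_conv h g (t : R) : T :=
  bc_int `[0, t] (fun s => h (t - s) * g s).

Definition laplace f x : T :=
  bc_int `[0, +oo[ (fun t => f t * bc_exp (- (x * bc_ofR t))).

(* [h] is an original of [F]. A Laplace transform determines its original only
   up to a null set; requiring continuity on ]0, +oo[ singles out the values of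
   the original at every t > 0. *)
Definition laplace_original (F : T -> T) h : Prop :=
  [/\ forall b, 0 < b -> L_T 0 b h,
      forall t, 0 < t -> bc_continuous_at h t &
      exists2 M : R, exp_order M h &
        forall x, M + `|bc_Imj x| < bc_Re x -> laplace h x = F x].

Definition inverse_laplace (F : T -> T) : R -> T :=
  xget (fun=> 0) [set h | laplace_original F h].

(* Componentwise, since Gamma_2 need not be invertible in T when one component
   of its argument is a pole of Gamma. *)
Definition bc_prabhakar (l m n z : T) : T :=
  idem (cprabhakar (bc1 l) (bc1 m) (bc1 n) (bc1 z))
       (cprabhakar (bc2 l) (bc2 m) (bc2 n) (bc2 z)).

Definition prabhakar_integrand (l m n r : T) f (t y : R) : T :=
  bc_pow (bc_ofR (t - y)) (n - 1)
  * bc_prabhakar l m n (r * bc_pow (bc_ofR (t - y)) m) * f y.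

Definition prabhakar_integral_exists (l m n r : T) f (t : R) : Prop :=
  bc_integrable `[0, t] (prabhakar_integrand l m n r f t).

(* In a component where the order n vanishes, the term u = 0 of the kernel,
   s^(n-1) / Gamma(n), is read as its limit for n -> 0+, the unit of
   convolution: it contributes f itself (a fractional integral of order 0 is
   the identity), while the integral carries the terms u >= 1, because
   1/Gamma(0) = 0. For n != 0 the added term is 0. *)
Definition prabhakar_integral (l m n r : T) f (t : R) : T :=
  idem (if bc1 n == 0 then bc1 (f t) else 0)
       (if bc2 n == 0 then bc2 (f t) else 0)
  + bc_int `[0, t] (prabhakar_integrand l m n r f t).

(* The i-th component of N; used for Re z > 0, so the ceiling is positive. *)
Definition deriv_order (z : C) : nat := `|Num.ceil (complex.Re z)|%N.

Definition bc_deriv_order (n : T) : T :=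
  idem (deriv_order (bc1 n))%:R (deriv_order (bc2 n))%:R.

Definition bc_deriv_N (n : T) f (t : R) : T :=
  idem (cderiv (deriv_order (bc1 n)) (fun s => bc1 (f s)) t)
       (cderiv (deriv_order (bc2 n)) (fun s => bc2 (f s)) t).

Definition prabhakar_derivative_exists (l m n r : T) f (t : R) : Prop :=
  prabhakar_integral_exists (- l) m (bc_deriv_order n - n) r
    (bc_deriv_N n f) t.

Definition prabhakar_derivative (l m n r : T) f (t : R) : T :=
  prabhakar_integral (- l) m (bc_deriv_order n - n) r (bc_deriv_N n f) t.

Definition prabhakar_regular (n : T) f : Prop :=
  cAC_order (deriv_order (bc1 n)) (fun t => bc1 (f t)) /\
  cAC_order (deriv_order (bc2 n)) (fun t => bc2 (f t)).

Definition initial_value f (tau : T) : Prop :=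
  has_lim0 (fun t => bc1 (f t)) (bc1 tau) /\
  has_lim0 (fun t => bc2 (f t)) (bc2 tau).

(* Vacuous in a component with Re n_i <= 1. *)
Definition higher_initial_values_zero (n : T) f : Prop :=
  (forall p, (0 < p < deriv_order (bc1 n))%N ->
     has_lim0 (cderiv p (fun t => bc1 (f t))) 0) /\
  (forall p, (0 < p < deriv_order (bc2 n))%N ->
     has_lim0 (cderiv p (fun t => bc2 (f t))) 0).

End BicomplexAnalysis.

(* Main.v *)
From HB Require Import structures.
Require Import Defs.
From mathcomp Require Import all_boot all_order all_algebra.
From mathcomp Require Import all_classical all_reals all_analysis.
From mathcomp Require Import complex.
From mathcomp Require Import measurable_realfun ring lra.

(** A bicomplex identity is a pair of complex ones: sums, products, powers,
    integrals, Laplace transforms and the equation itself act separately on the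
    idempotent components. The theorem therefore reduces to a scalar problem with
    complex m, n, r, k and real 0 < l < 1. Put w = r z^-m and
    A(z) = z^n (1 - w)^l, let N be the ceiling of Re n, nu = N - n, and let K be
    the kernel of the Prabhakar integral of order nu. Formally the regularized
    derivative becomes A(z) (F(z) - tau / z) on transforms, the equation
    becomes A (F - tau / z) + k F = G, and F = G / (A + k) + tau z^-1 A / (A + k)
    is the assertion. Three points go beyond this computation.

    The originals have to exist. For large Re z, the quotient
    z^-b (1 - w)^(- l j) / (1 + k / A) is a double series of powers z^-c: a
    geometric series in - k / A whose terms are binomial series in w. The original
    of z^-c is t^(c-1) / Gamma(c), and the series of originals converges because
    all exponents c lie in a sector, in which |Gamma(c)| is at least Gamma(Re c)
    up to an exponential factor ([rgamma_le_cgamma], [cnorm_pbase_le]). So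
    [resolvent_original] yields h (b = n, j = 1), the function q multiplied by
    tau (b = 1, j = 0), and an auxiliary function B (b = N, j = 0). Among functions
    continuous on t > 0 they are unique, by [lerch].

    The highest derivative of f is under no growth condition, so that the equation
    cannot be transformed as it stands. Up to a time T one has f = tau + J^N phi,
    where J is integration from 0 and phi is the N-th derivative cut off at T; this
    is Taylor's formula ([AC_order_primitive]), and rests on the fact that an
    absolutely continuous function is the integral of its derivative
    ([abs_continuous_density]). The function F = tau + J^N phi has a transform,
    and comparing transforms gives F = B * phi + k h * F + tau q
    ([solution_identity]).

    The equation g = K * phi + k F, with phi added on the right when nu = 0, holds
    for almost every time. Convolution with h turns it into
    h * g = B * phi + k h * F at every time before T, because h * K = B; the
    associativity h * (K * phi) = (h * K) * phi at a given time holds since the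
    singularities of h and K at the origin are integrable and have a bounded
    convolution ([cconv_assoc_at]). This covers Re nu > 0 and nu = 0. If Re nu = 0
    but nu is not 0, then K behaves like t^(nu-1), which is not integrable at the
    origin; the existence of the derivative at almost every time then forces
    phi = 0 ([density_singular]) and the equation is g = k F. In all cases
    f = F = h * g + tau q. *)

Set Implicit Arguments.
Unset Strict Implicit.
Unset Printing Implicit Defensive.

Import Order.TTheory GRing.Theory Num.Theory.
Import numFieldNormedType.Exports.

Local Open Scope classical_set_scope.
Local Open Scope ring_scope.
Local Open Scope complex_scope.


(** * Complex numbers: two norms, exponential and principal powers *)

Section ComplexElementary.
Variable R : realType.
Local Notation C := R[i].
Implicit Types (x y z w : C) (t s a b : R).

Lemma cReM x y : complex.Re (x * y) =
  complex.Re x * complex.Re y - complex.Im x * complex.Im y.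
Proof. by case: x => a b; case: y => c d. Qed.

Lemma cImM x y : complex.Im (x * y) =
  complex.Re x * complex.Im y + complex.Im x * complex.Re y.
Proof. by case: x => a b; case: y => c d /=. Qed.

Lemma cReD x y : complex.Re (x + y) = complex.Re x + complex.Re y.
Proof. by case: x => a b; case: y => c d. Qed.

Lemma cImD x y : complex.Im (x + y) = complex.Im x + complex.Im y.
Proof. by case: x => a b; case: y => c d. Qed.

Lemma cReN x : complex.Re (- x) = - complex.Re x.
Proof. by case: x. Qed.

Lemma cImN x : complex.Im (- x) = - complex.Im x.
Proof. by case: x. Qed.

Lemma cRe_nat (n : nat) : complex.Re (n%:R : C) = n%:R.
Proof. by elim: n => // n IH; rewrite -natr1 cReD IH -[in RHS]natr1. Qed.

Lemma cIm_nat (n : nat) : complex.Im (n%:R : C) = 0.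
Proof. by elim: n => // n IH; rewrite -natr1 cImD IH addr0. Qed.

Lemma cRe_sum (I : Type) (r : seq I) (P : pred I) (F : I -> C) :
  complex.Re (\sum_(i <- r | P i) F i) = \sum_(i <- r | P i) complex.Re (F i).
Proof.
by elim/big_rec2: _ => // i u v _ <-; rewrite cReD.
Qed.

Lemma cIm_sum (I : Type) (r : seq I) (P : pred I) (F : I -> C) :
  complex.Im (\sum_(i <- r | P i) F i) = \sum_(i <- r | P i) complex.Im (F i).
Proof.
by elim/big_rec2: _ => // i u v _ <-; rewrite cImD.
Qed.

Lemma cplxP x y : complex.Re x = complex.Re y -> complex.Im x = complex.Im y ->
  x = y.
Proof. by case: x => a b; case: y => c d /= -> ->. Qed.

(** The taxicab norm: measurability and integrability of a complex function
    are stated on its two real components, and this norm is the one that is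
    read off from them directly; it is submultiplicative. *)
Definition c1norm z : R := `|complex.Re z| + `|complex.Im z|.

Lemma c1norm_ge0 z : 0 <= c1norm z.
Proof. by rewrite addr_ge0. Qed.

Lemma c1norm0 : c1norm 0 = 0.
Proof. by rewrite /c1norm /= normr0 addr0. Qed.

Lemma c1normN z : c1norm (- z) = c1norm z.
Proof. by rewrite /c1norm cReN cImN !normrN. Qed.

Lemma c1normD x y : c1norm (x + y) <= c1norm x + c1norm y.
Proof.
rewrite /c1norm cReD cImD addrACA.
by apply: lerD; apply: ler_normD.
Qed.


Lemma c1normM x y : c1norm (x * y) <= c1norm x * c1norm y.
Proof.
rewrite /c1norm cReM cImM mulrDl !mulrDr -!normrM.
set a := _ * _; set b := _ * complex.Im y; set c := _ * _; set d := _ * _.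
have H1 := ler_normB a b.
have H2 := ler_normD c d.
lra.
Qed.

Lemma c1norm_real t : c1norm t%:C = `|t|.
Proof. by rewrite /c1norm /= normr0 addr0. Qed.

Lemma c1norm1 : c1norm (1 : C) = 1.
Proof. by rewrite (c1norm_real 1) normr1. Qed.

Lemma c1normMr z t : c1norm (z * t%:C) = c1norm z * `|t|.
Proof. by rewrite /c1norm cReM cImM /= !mulr0 subr0 add0r !normrM mulrDl. Qed.


Lemma c1norm_eq0 z : c1norm z = 0 -> z = 0.
Proof.
move=> /eqP; rewrite paddr_eq0// !normr_eq0 => /andP[/eqP a /eqP b].
exact: cplxP.
Qed.

Lemma c1norm_sum (I : Type) (r : seq I) (P : pred I) (F : I -> C) :
  c1norm (\sum_(i <- r | P i) F i) <= \sum_(i <- r | P i) c1norm (F i).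
Proof.
elim/big_rec2: _ => [|i u v _ h]; first by rewrite c1norm0.
by apply: le_trans (c1normD _ _) _; rewrite lerD2l.
Qed.

Lemma normRe_le z : `|complex.Re z| <= c1norm z.
Proof. by rewrite lerDl. Qed.

Lemma normIm_le z : `|complex.Im z| <= c1norm z.
Proof. by rewrite lerDr. Qed.

Lemma cnormE z : cnorm z = Num.sqrt (complex.Re z ^+ 2 + complex.Im z ^+ 2).
Proof. by case: z. Qed.

Lemma cnorm_ge0 z : 0 <= cnorm z.
Proof. by rewrite cnormE sqrtr_ge0. Qed.

Lemma cnormM x y : cnorm (x * y) = cnorm x * cnorm y.
Proof. exact: Normc.normcM. Qed.

Lemma cnorm0_eq0 z : cnorm z = 0 -> z = 0.
Proof. exact: Normc.eq0_normc. Qed.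

Lemma cnorm_gt0 z : z != 0 -> 0 < cnorm z.
Proof.
by move=> z0; rewrite lt_def cnorm_ge0 andbT; apply: contra z0 => /eqP/cnorm0_eq0->.
Qed.

Lemma normRe_le_cnorm z : `|complex.Re z| <= cnorm z.
Proof. by rewrite cnormE -sqrtr_sqr ler_sqrt ?addr_ge0 ?sqr_ge0// lerDl sqr_ge0. Qed.

Lemma normIm_le_cnorm z : `|complex.Im z| <= cnorm z.
Proof. by rewrite cnormE -sqrtr_sqr ler_sqrt ?addr_ge0 ?sqr_ge0// lerDr sqr_ge0. Qed.

Lemma c1norm_le_cnorm z : c1norm z <= 2 * cnorm z.
Proof. by rewrite mulr_natl mulr2n lerD ?normRe_le_cnorm ?normIm_le_cnorm. Qed.

Lemma cnorm_le_c1norm z : cnorm z <= c1norm z.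
Proof.
rewrite cnormE -[leRHS]ger0_norm ?c1norm_ge0// -sqrtr_sqr ler_sqrt ?sqr_ge0//.
rewrite /c1norm sqrrD !real_normK ?num_real// addrAC lerDl.
by rewrite mulrn_wge0// mulr_ge0.
Qed.

Lemma cnorm_real t : cnorm t%:C = `|t|.
Proof. by rewrite cnormE /= expr0n addr0 sqrtr_sqr. Qed.

Lemma cnorm1 : cnorm (1 : C) = 1.
Proof. by rewrite (cnorm_real 1) normr1. Qed.

Lemma cnormV z : cnorm z^-1 = (cnorm z)^-1.
Proof. exact: Normc.normcV. Qed.

Lemma cnormD x y : cnorm (x + y) <= cnorm x + cnorm y.
Proof. exact: le_normcD. Qed.

Lemma cnorm_cexp z : cnorm (cexp z) = expR (complex.Re z).
Proof.
rewrite /cexp cnormM cnorm_real ger0_norm ?expR_ge0// cnormE /=.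
by rewrite cos2Dsin2 sqrtr1 mulr1.
Qed.

Lemma cexp0 : cexp 0 = 1 :> C.
Proof. by rewrite /cexp /= expR0 cos0 sin0 mul1r. Qed.

Lemma cexpD x y : cexp (x + y) = cexp x * cexp y.
Proof.
rewrite /cexp cReD cImD expRD cosD sinD; apply: cplxP; rewrite !(cReM, cImM) /=; ring.
Qed.

Lemma cexp_neq0 z : cexp z != 0.
Proof.
apply/eqP => /(congr1 (@cnorm R)); rewrite cnorm_cexp cnormE /= expr0n addr0 sqrtr0.
by have := expR_gt0 (complex.Re z) => /[swap] ->; rewrite ltxx.
Qed.

Lemma cexpN z : cexp (- z) = (cexp z)^-1.
Proof.
by apply: (mulfI (cexp_neq0 z)); rewrite -cexpD subrr cexp0 divff// cexp_neq0.
Qed.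

Lemma cexp_real t : cexp t%:C = (expR t)%:C.
Proof. by rewrite /cexp /= cos0 sin0 mulr1. Qed.

Lemma clog_real t : 0 < t -> clog t%:C = (ln t)%:C.
Proof.
move=> t0; rewrite /clog /carg cnorm_real ger0_norm ?ltW//= ltxx.
by rewrite divff ?gt_eqF// acos1.
Qed.

Lemma cpow_real t w : 0 < t -> cpow t%:C w = cexp (w * (ln t)%:C).
Proof.
move=> t0; rewrite /cpow ifF ?clog_real//.
by apply/eqP => -[] /eqP; rewrite gt_eqF.
Qed.


Lemma cpowE z w : z != 0 -> cpow z w = cexp (w * clog z).
Proof. by move=> z0; rewrite /cpow (negbTE z0). Qed.

Lemma cpow_neq0 z w : z != 0 -> cpow z w != 0.
Proof. by move=> z0; rewrite cpowE// cexp_neq0. Qed.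

Lemma cpowD z w w' : z != 0 -> cpow z (w + w') = cpow z w * cpow z w'.
Proof. by move=> z0; rewrite !cpowE// mulrDl cexpD. Qed.

Lemma cpow0 z : z != 0 -> cpow z 0 = 1.
Proof. by move=> z0; rewrite cpowE// mul0r cexp0. Qed.

Lemma cpowN z w : z != 0 -> cpow z (- w) = (cpow z w)^-1.
Proof. by move=> z0; rewrite !cpowE// mulNr cexpN. Qed.

Lemma cpowMn z w (n : nat) : z != 0 -> cpow z (w * n%:R) = cpow z w ^+ n.
Proof.
move=> z0; elim: n => [|n IH]; first by rewrite mulr0 cpow0.
by rewrite -natr1 mulrDr mulr1 cpowD// IH exprSr.
Qed.

Lemma carg_bound z : z != 0 -> -1 <= complex.Re z / cnorm z <= 1.
Proof.
move=> z0; have n0 := cnorm_gt0 z0.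
by rewrite -ler_norml normrM normfV (ger0_norm (ltW n0)) ler_pdivrMr// mul1r normRe_le_cnorm.
Qed.

Lemma norm_carg z : z != 0 -> `|carg z| <= pi.
Proof.
move=> /carg_bound b; rewrite /carg; case: ifP => _; rewrite ?normrN ger0_norm ?acos_lepi// acos_ge0//.
Qed.

Lemma cnorm_cpow_le z w : z != 0 ->
  cnorm (cpow z w) <= cnorm z `^ complex.Re w * expR (`|complex.Im w| * pi).
Proof.
move=> z0; rewrite cpowE// cnorm_cexp cReM /= /powR gt_eqF ?cnorm_gt0// -expRD.
rewrite ler_expR lerD2l -mulNr (le_trans (ler_norm _))// normrM normrN.
by rewrite ler_wpM2l// norm_carg.
Qed.

Lemma cexp_clog z : z != 0 -> cexp (clog z) = z.
Proof.
move=> z0; have n0 := cnorm_gt0 z0; have b := carg_bound z0.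
rewrite /cexp /clog /= lnK ?posrE//.
have sE : Num.sqrt (1 - (complex.Re z / cnorm z) ^+ 2) = `|complex.Im z| / cnorm z.
  rewrite (_ : _ - _ = (complex.Im z / cnorm z) ^+ 2); last first.
    have -> : 1 = (cnorm z ^+ 2) / (cnorm z ^+ 2) by rewrite divff// expf_neq0// gt_eqF.
    rewrite {1}cnormE sqr_sqrtr ?addr_ge0 ?sqr_ge0// !expr_div_n -mulrBl.
    by congr (_ / _); ring.
  by rewrite sqrtr_sqr normrM normfV (ger0_norm (ltW n0)).
have cE : cos (acos (complex.Re z / cnorm z)) = complex.Re z / cnorm z.
  by rewrite acosK// in_itv/=.
rewrite /carg; case: ltP => hI; apply: cplxP; rewrite !(cReM, cImM) /=
  ?cosN ?sinN cE sin_acos// sE mul0r ?subr0 ?addr0.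
- by rewrite mulrC divfK// gt_eqF.
- by rewrite (ltr0_norm hI) mulNr opprK mulrC divfK// gt_eqF.
- by rewrite mulrC divfK// gt_eqF.
- by rewrite (ger0_norm hI) mulrC divfK// gt_eqF.
Qed.

Lemma cpow1 z : z != 0 -> cpow z 1 = z.
Proof. by move=> z0; rewrite cpowE// mul1r cexp_clog. Qed.

Lemma cpow_nat z (n : nat) : z != 0 -> cpow z n%:R = z ^+ n.
Proof. by move=> z0; rewrite -[n%:R]mul1r cpowMn// cpow1. Qed.

(** In the right half-plane the principal argument is the arctangent of the
   slope, which is the form that is differentiated below. *)
Lemma carg_atan z : 0 < complex.Re z ->
  carg z = atan (complex.Im z / complex.Re z).
Proof.
move=> x0; set s := complex.Im z / complex.Re z.
rewrite /carg; have -> : complex.Re z / cnorm z = cos (atan s).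
  rewrite cos_atan; have -> : cnorm z = complex.Re z * Num.sqrt (1 + s ^+ 2).
    rewrite cnormE -{2}(ger0_norm (ltW x0)) -sqrtr_sqr -sqrtrM ?sqr_ge0//.
    by congr (Num.sqrt _); rewrite /s; field; rewrite gt_eqF.
  by rewrite invfM mulrA divff ?gt_eqF// mul1r.
have [] := (atan_gtNpi2 s, atan_ltpi2 s) => h1 h2.
have p0 := pi_gt0 R.
case: (ltP (complex.Im z) 0) => hI; rewrite ?hI.
  have s0 : s < 0 by rewrite /s pmulr_llt0 ?invr_gt0.
  have a0 : atan s <= 0 by rewrite -(@atan0 R) le_atan// ltW.
  by rewrite cosKN ?opprK//; rewrite a0 andbT; lra.
have s0 : 0 <= s by rewrite /s mulr_ge0// invr_ge0 ltW.
have a0 : 0 <= atan s by rewrite -(@atan0 R) le_atan.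
rewrite cosK// in_itv/= a0 /=; lra.
Qed.

End ComplexElementary.

(** * Complex functions of a real variable: derivatives *)

Section ComplexDerivative.
Variable R : realType.
Local Notation C := R[i].
Implicit Types (u v : R -> C) (z w a b : C) (t s : R).

(** Differentiating the two real components separately makes the real calculus
    applicable; only derivatives along the real line occur. *)
Definition cis_derive u t (du : C) : Prop :=
  is_derive t 1 (fun s => complex.Re (u s)) (complex.Re du) /\
  is_derive t 1 (fun s => complex.Im (u s)) (complex.Im du).

Lemma cis_derive_eq u t du du' : cis_derive u t du -> du = du' ->
  cis_derive u t du'.
Proof. by move=> h <-. Qed.

Lemma cis_derive_cst t z : cis_derive (fun=> z) t 0.
Proof. by split; apply: is_derive_cst. Qed.

Lemma cis_derive_real (f : R -> R) t df : is_derive t 1 f df ->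
  cis_derive (fun s => (f s)%:C) t df%:C.
Proof. by move=> h; split => //=; apply: is_derive_cst. Qed.

Lemma cis_deriveD u v t du dv : cis_derive u t du -> cis_derive v t dv ->
  cis_derive (fun s => u s + v s) t (du + dv).
Proof.
move=> [u1 u2] [v1 v2]; split.
  rewrite cReD (_ : (fun _ => _) =
    (fun s => complex.Re (u s)) + (fun s => complex.Re (v s))).
    exact: is_deriveD.
  by apply/funext => s; rewrite cReD.
rewrite cImD (_ : (fun _ => _) =
  (fun s => complex.Im (u s)) + (fun s => complex.Im (v s))).
  exact: is_deriveD.
by apply/funext => s; rewrite cImD.
Qed.

Lemma cis_deriveM u v t du dv : cis_derive u t du -> cis_derive v t dv ->
  cis_derive (fun s => u s * v s) t (du * v t + u t * dv).
Proof.
move=> [u1 u2] [v1 v2]; split.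
  have H := is_deriveB (is_deriveM u1 v1) (is_deriveM u2 v2).
  rewrite (_ : (fun _ => _) =
    (fun s => complex.Re (u s)) * (fun s => complex.Re (v s)) -
    (fun s => complex.Im (u s)) * (fun s => complex.Im (v s))).
    apply: is_derive_eq; rewrite cReD !cReM /GRing.scale/=; ring.
  by apply/funext => s; rewrite cReM.
have H := is_deriveD (is_deriveM u1 v2) (is_deriveM u2 v1).
rewrite (_ : (fun _ => _) =
  (fun s => complex.Re (u s)) * (fun s => complex.Im (v s)) +
  (fun s => complex.Im (u s)) * (fun s => complex.Re (v s))).
  apply: is_derive_eq; rewrite cImD !cImM /GRing.scale/=; ring.
by apply/funext => s; rewrite cImM.
Qed.

Lemma cis_deriveZ z u t du : cis_derive u t du ->
  cis_derive (fun s => z * u s) t (z * du).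
Proof.
move=> h; apply: cis_derive_eq (cis_deriveM (cis_derive_cst t z) h) _.
by rewrite mul0r add0r.
Qed.

Lemma cis_derive_sum (n : nat) (F : nat -> R -> C) (dF : nat -> C) t :
  (forall i, cis_derive (F i) t (dF i)) ->
  cis_derive (fun s => \sum_(0 <= i < n) F i s) t (\sum_(0 <= i < n) dF i).
Proof.
move=> h; elim: n => [|n IH].
  rewrite big_nil (_ : (fun _ => _) = fun=> 0); first exact: cis_derive_cst.
  by apply/funext => s; rewrite big_nil.
rewrite big_nat_recr//= (_ : (fun _ => _) =
  fun s => (\sum_(0 <= i < n) F i s) + F n s); first exact: cis_deriveD.
by apply/funext => s; rewrite big_nat_recr.
Qed.

Lemma cis_derive_affine a b t : cis_derive (fun s => a + b * s%:C) t b.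
Proof.
have H : is_derive t 1 (fun s => s) (1 : R) by apply: is_derive_id.
apply: cis_derive_eq (cis_deriveD (cis_derive_cst t a)
  (cis_deriveZ b (cis_derive_real H))) _.
by rewrite add0r mulr1.
Qed.

Lemma cis_derive_exprn u t du n : cis_derive u t du ->
  cis_derive (fun s => u s ^+ n) t (n%:R * u t ^+ n.-1 * du).
Proof.
move=> h; elim: n => [|n IH].
  by rewrite !mul0r; exact: cis_derive_cst.
apply: cis_derive_eq.
  rewrite (_ : (fun _ => _) = fun s => u s * u s ^+ n); last first.
    by apply/funext => s; rewrite exprS.
  exact: cis_deriveM h IH.
case: n {IH} => [|n] /=; first by rewrite !expr0; ring.
rewrite /= -[in RHS]natr1 [u t ^+ n.+1]exprS; ring.
Qed.

Lemma cis_derive_cexp u t du : cis_derive u t du ->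
  cis_derive (fun s => cexp (u s)) t (du * cexp (u t)).
Proof.
move=> [u1 u2].
have He : is_derive t 1 (expR \o (fun s => complex.Re (u s)))
    (expR (complex.Re (u t)) * complex.Re du).
  exact: is_derive1_comp.
have Hc : is_derive t 1 (cos \o (fun s => complex.Im (u s)))
    (- sin (complex.Im (u t)) * complex.Im du).
  exact: is_derive1_comp.
have Hs : is_derive t 1 (sin \o (fun s => complex.Im (u s)))
    (cos (complex.Im (u t)) * complex.Im du).
  exact: is_derive1_comp.
have H1 := cis_derive_real He.
have H2 : cis_derive (fun s => cos (complex.Im (u s)) +i* sin (complex.Im (u s)))
  t ((- sin (complex.Im (u t)) * complex.Im du) +i*
     (cos (complex.Im (u t)) * complex.Im du)) by split.
apply: cis_derive_eq (cis_deriveM H1 H2) _.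
by rewrite /cexp; apply: cplxP; rewrite !(cReD, cImD, cReM, cImM) /=; ring.
Qed.

Lemma cis_derive_clog a b t : 0 < complex.Re (a + b * t%:C) ->
  cis_derive (fun s => clog (a + b * s%:C)) t (b / (a + b * t%:C)).
Proof.
set z := fun s => a + b * s%:C => x0.
have [zr zi] : cis_derive z t b := cis_derive_affine a b t.
set x := complex.Re (z t) in x0; set y := complex.Im (z t).
have n0 : 0 < x ^+ 2 + y ^+ 2 by rewrite ltr_pwDl ?exprn_gt0 ?sqr_ge0.
have nearx : \forall s \near t, 0 < complex.Re (z s).
  have : {for t, continuous (fun s => complex.Re (z s))}.
    by apply: differentiable_continuous; apply/derivable1_diffP; apply: ex_derive.
  by move/cvgr_gt => /(_ 0 x0).
split.
- have Hln : is_derive t 1 (fun s => ln (complex.Re (z s) ^+ 2 +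
       complex.Im (z s) ^+ 2) / 2)
     (complex.Re (b / z t)).
    have H1 := is_deriveD (is_deriveM zr zr) (is_deriveM zi zi).
    have H2 : is_derive t 1 (@ln R \o (fun s => complex.Re (z s) ^+ 2 +
       complex.Im (z s) ^+ 2)) ((x ^+ 2 + y ^+ 2)^-1 *
         (2 * (x * complex.Re b + y * complex.Im b))).
      apply: is_derive1_comp; first exact: is_derive1_ln.
      rewrite (_ : (fun _ => _) =
       (fun s => complex.Re (z s)) * (fun s => complex.Re (z s)) +
       (fun s => complex.Im (z s)) * (fun s => complex.Im (z s))).
        by apply: is_derive_eq; rewrite /GRing.scale/= -/x -/y; ring.
      by apply/funext => s; rewrite /= !expr2.
    have H3 := is_deriveM H2 (is_derive_cst (2^-1 : R) t 1).
    rewrite (_ : (fun _ => _) = (@ln R \o (fun s => complex.Re (z s) ^+ 2 +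
       complex.Im (z s) ^+ 2)) * cst 2^-1) //.
    apply: is_derive_eq; rewrite /GRing.scale/= mulr0 add0r.
    have -> : b / z t = b * ((x / (x ^+ 2 + y ^+ 2)) +i* (- (y / (x ^+ 2 + y ^+ 2)))).
      by congr (_ * _); rewrite /x /y; case: (z t).
    by rewrite cReM /=; field; rewrite gt_eqF.
  apply: near_eq_is_derive Hln.
  near=> s.
  have xs : 0 < complex.Re (z s) by near: s.
  rewrite /clog /= cnormE; set e := _ + _.
  have e0 : 0 < e by rewrite /e ltr_pwDl ?exprn_gt0 ?sqr_ge0.
  have <- : (Num.sqrt e) ^+ 2 = e by rewrite sqr_sqrtr// ltW.
  rewrite lnXn ?sqrtr_gt0// sqr_sqrtr ?ltW//.
  by rewrite -(mulr_natr (ln _)) mulfK.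
- have Hat : is_derive t 1 (fun s => atan (complex.Im (z s) / complex.Re (z s)))
     (complex.Im (b / z t)).
    have Hi : is_derive t 1 (fun s => (complex.Re (z s))^-1) (- x ^- 2 *: complex.Re b).
      by apply: is_deriveV => //; rewrite gt_eqF.
    have H1 := is_deriveM zi Hi.
    have H2 := is_derive1_comp (is_derive1_atan _) H1.
    rewrite (_ : (fun _ => _) = atan \o
      ((fun s => complex.Im (z s)) * (fun s => (complex.Re (z s))^-1))) //.
    apply: is_derive_eq.
    have -> : b / z t = b * ((x / (x ^+ 2 + y ^+ 2)) +i* (- (y / (x ^+ 2 + y ^+ 2)))).
      by congr (_ * _); rewrite /x /y; case: (z t).
    have -> : ((fun s => complex.Im (z s)) * (fun s => (complex.Re (z s))^-1)) t
      = y / x by [].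
    rewrite cImM /GRing.scale/= -/x -/y; field.
    by rewrite (gt_eqF x0) !gt_eqF.
  apply: near_eq_is_derive Hat.
  by near=> s; rewrite /= carg_atan//; near: s.
Unshelve. all: by end_near. Qed.

Lemma cis_derive_cpow_line w a b t : 0 < complex.Re (a + b * t%:C) ->
  cis_derive (fun s => cexp (w * clog (a + b * s%:C))) t
    (w * (b / (a + b * t%:C)) * cexp (w * clog (a + b * t%:C))).
Proof. by move=> h; apply: cis_derive_cexp; apply/cis_deriveZ/cis_derive_clog. Qed.

Lemma cis_derive_continuous u t du : cis_derive u t du ->
  {for t, continuous (fun s => complex.Re (u s))} /\
  {for t, continuous (fun s => complex.Im (u s))}.
Proof.
by move=> [h1 h2]; split; apply: differentiable_continuous;
  apply/derivable1_diffP; apply: ex_derive.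
Qed.

Lemma real_mean_value_bound (f f' : R -> R) (B : R) :
  (forall t, 0 <= t <= 1 -> is_derive t 1 f (f' t)) ->
  (forall t, 0 <= t <= 1 -> `|f' t| <= B) -> `|f 1 - f 0| <= B.
Proof.
move=> hd hb.
have [||c c01 ->] := @MVT R f f' 0 1 ltr01.
- by move=> x; rewrite in_itv/= => /andP[x0 x1]; apply: hd; rewrite !ltW.
- by apply: derivable_within_continuous => x; rewrite in_itv/= => xx;
    apply: (@ex_derive _ _ _ _ _ _ _ (hd _ xx)).
- rewrite subr0 mulr1 hb//; move: c01; rewrite in_itv/= => /andP[? ?].
  by rewrite !ltW.
Qed.

(** The mean value theorem for each component; the factor 2 is the price of the
    two components. *)
Lemma cis_derive_bound u (u' : R -> C) (B : R) :
  (forall t, 0 <= t <= 1 -> cis_derive u t (u' t)) ->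
  (forall t, 0 <= t <= 1 -> c1norm (u' t) <= B) -> c1norm (u 1 - u 0) <= 2 * B.
Proof.
move=> hd hb; rewrite /c1norm cReD cImD cReN cImN mulr_natl mulr2n; apply: lerD.
  apply: (@real_mean_value_bound (fun t => complex.Re (u t))
    (fun t => complex.Re (u' t))) => t t01; first by have [] := hd t t01.
  exact: le_trans (normRe_le _) (hb t t01).
apply: (@real_mean_value_bound (fun t => complex.Im (u t))
  (fun t => complex.Im (u' t))) => t t01; first by have [] := hd t t01.
exact: le_trans (normIm_le _) (hb t t01).
Qed.

Lemma cis_derive0_cst u : (forall t, 0 <= t <= 1 -> cis_derive u t 0) ->
  u 1 = u 0.
Proof.
move=> h; apply/eqP; rewrite -subr_eq0; apply/eqP/c1norm_eq0/le_anti.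
rewrite c1norm_ge0 andbT.
rewrite (le_trans (@cis_derive_bound u (fun=> 0) 0 h _)) ?mulr0//.
by move=> t _; rewrite c1norm0.
Qed.

End ComplexDerivative.

(** * Real integrals over the half line *)

Section RealIntegral.
Variable R : realType.
Local Notation mu := (@lebesgue_measure R).
Local Notation mR := (measurableTypeR R).
Implicit Types (A : set mR) (f g : R -> R) (t a b : R).

Lemma integrable_dominated A f g : measurable A -> measurable_fun A f ->
  mu.-integrable A (EFin \o g) -> (forall x, A x -> `|f x| <= g x) ->
  mu.-integrable A (EFin \o f).
Proof.
move=> mA mf ig fg; apply: le_integrable ig => //; first exact/measurable_EFinP.
by move=> x Ax /=; rewrite lee_fin (le_trans (fg _ Ax))// ler_norm.
Qed.

Lemma integrable_measurable A f : mu.-integrable A (EFin \o f) ->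
  measurable_fun A f.
Proof. by move=> /integrableP[/measurable_EFinP]. Qed.

Lemma integrable_norm A f : mu.-integrable A (EFin \o f) ->
  mu.-integrable A (EFin \o (fun x => `|f x|)).
Proof. exact: integrable_abse. Qed.

Lemma integrable_Rsub A B f : measurable A -> measurable B -> B `<=` A ->
  mu.-integrable A (EFin \o f) -> mu.-integrable B (EFin \o f).
Proof. exact: integrableS. Qed.

Lemma measurable_Ritv (i : interval R) : measurable ([set` i] : set mR).
Proof. exact: measurable_itv. Qed.

Lemma integrable_RD A f g : measurable A -> mu.-integrable A (EFin \o f) ->
  mu.-integrable A (EFin \o g) -> mu.-integrable A (EFin \o (fun x => f x + g x)).
Proof. by move=> mA i1 i2; exact: (integrableD mA i1 i2). Qed.

Lemma integrable_RB A f g : measurable A -> mu.-integrable A (EFin \o f) ->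
  mu.-integrable A (EFin \o g) -> mu.-integrable A (EFin \o (fun x => f x - g x)).
Proof. by move=> mA i1 i2; exact: (integrableB mA i1 i2). Qed.

Lemma integrable_RZ A f (c : R) : measurable A -> mu.-integrable A (EFin \o f) ->
  mu.-integrable A (EFin \o (fun x => c * f x)).
Proof. by move=> mA i1; exact: (integrableZl mA c i1). Qed.

Lemma integrable_fin_num A f : measurable A -> mu.-integrable A (EFin \o f) ->
  (\int[mu]_(x in A) (f x)%:E)%E \is a fin_num.
Proof. by move=> mA i1; exact: lebesgue_integrable.integrable_fin_num. Qed.

Lemma EFin_Rintegral A f : measurable A -> mu.-integrable A (EFin \o f) ->
  (\int[mu]_(x in A) f x)%:E = (\int[mu]_(x in A) (f x)%:E)%E.
Proof. by move=> mA i1; rewrite /Rintegral fineK// integrable_fin_num. Qed.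

Lemma Rintegral_dct A (f_ : nat -> R -> R) f g : measurable A ->
  (forall p, measurable_fun A (f_ p)) -> measurable_fun A f ->
  (forall x, A x -> f_ ^~ x @ \oo --> f x) ->
  mu.-integrable A (EFin \o g) ->
  (forall p x, A x -> `|f_ p x| <= g x) ->
  mu.-integrable A (EFin \o f) /\
  (\int[mu]_(x in A) f_ p x) @[p --> \oo] --> \int[mu]_(x in A) f x.
Proof.
move=> mA mf_ mf cf ig dom.
have [||||i1 _ i2] := @dominated_convergence _ _ _ mu A mA (fun p => EFin \o f_ p)
  (EFin \o f) (EFin \o g) _ _ _ ig.
- by move=> p; exact/measurable_EFinP.
- exact/measurable_EFinP.
- by apply: aeW => x Ax; apply: cvg_EFin; [exact: nearW|exact: cf].
- by apply: aeW => x p Ax; rewrite /= lee_fin dom.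
split => //.
by apply: fine_cvg; rewrite fineK// integrable_fin_num.
Qed.

Lemma Rintegral_ae A f g : measurable A -> measurable_fun A f ->
  measurable_fun A g -> {ae mu, forall x, A x -> f x = g x} ->
  \int[mu]_(x in A) f x = \int[mu]_(x in A) g x.
Proof.
move=> mA mf mg fg; rewrite /Rintegral; congr fine.
apply: ae_eq_integral => //; try exact/measurable_EFinP.
by apply: filterS fg => x fgx Ax /=; rewrite fgx.
Qed.

Lemma half_line_cover :
  `]0, +oo[%classic = \bigcup_p `[(p.+1%:R : R)^-1, p.+1%:R]%classic.
Proof.
apply/seteqP; split => [x|x [p _]] /=; rewrite !in_itv/= ?andbT; last first.
  by move=> /andP[h _]; apply: lt_le_trans h; rewrite invr_gt0 ltr0n.
move=> x0; exists (maxn (Num.truncn x) (Num.truncn x^-1)) => //=.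
rewrite in_itv/=.
have h (y : R) : (Num.truncn y <= maxn (Num.truncn x) (Num.truncn x^-1))%N ->
    y <= (maxn (Num.truncn x) (Num.truncn x^-1)).+1%:R.
  move=> le; apply: ltW; apply: lt_le_trans (truncnS_gt y) _.
  by rewrite ler_nat ltnS.
rewrite h ?leq_maxl// andbT -[leRHS]invrK lef_pV2 ?posrE ?ltr0n ?invr_gt0//.
by rewrite h// leq_maxr.
Qed.

Lemma half_line_cover_nondecreasing :
  {homo (fun p => `[(p.+1%:R : R)^-1, p.+1%:R]%classic) : i j / (i <= j)%N >-> (i <= j)%O}.
Proof.
move=> i j ij; apply/subsetPset => x /=; rewrite !in_itv/= => /andP[h1 h2].
rewrite (le_trans _ h1) ?(le_trans h2) ?ler_nat//.
by rewrite lef_pV2 ?posrE ?ltr0n// ler_nat.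
Qed.

Lemma continuous_pos_measurable f : (forall t, 0 < t -> {for t, continuous f}) ->
  measurable_fun (`]0, +oo[%classic : set mR) f.
Proof.
move=> cf; apply: open_continuous_measurable_fun; first exact: interval_open.
by move=> t; rewrite inE/= in_itv/= andbT => /cf.
Qed.

Lemma FTC2_pos (F f : R -> R) a b : 0 < a -> a < b ->
  (forall t, 0 < t -> is_derive t 1 F (f t)) ->
  (forall t, 0 < t -> {for t, continuous f}) ->
  (\int[mu]_(t in `[a, b]) (f t)%:E)%E = ((F b - F a)%:E)%E.
Proof.
move=> a0 ab dF cf; rewrite (@continuous_FTC2 _ f F)//.
- apply: continuous_in_subspaceT => x; rewrite inE/= in_itv/= => /andP[ax _].
  by apply: cf; apply: lt_le_trans ax.
- have cF t : 0 < t -> {for t, continuous F}.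
    move=> t0; apply: differentiable_continuous; apply/derivable1_diffP.
    exact: (@ex_derive _ _ _ _ _ _ _ (dF t t0)).
  split => [x||].
  + rewrite in_itv/= => /andP[ax _].
    exact: (@ex_derive _ _ _ _ _ _ _ (dF x (lt_trans a0 ax))).
  + by apply: cvg_at_right_filter; exact: cF.
  + by apply: cvg_at_left_filter; apply: cF; exact: lt_trans ab.
- move=> x; rewrite in_itv/= => /andP[ax _].
  by rewrite derive1E (@derive_val _ _ _ _ _ _ _ (dF x (lt_trans a0 ax))).
Qed.

Lemma inv_nat_lt (p : nat) : (0 < p)%N -> (p.+1%:R : R)^-1 < p.+1%:R.
Proof.
move=> p0; apply: (@lt_trans _ _ 1); last by rewrite ltr1n.
by rewrite invf_lt1 ?ltr0n// ltr1n.
Qed.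

(** A nonnegative derivative of a bounded function is integrable on the half
    line; this is how every explicit dominating function is obtained. *)
Lemma integrable_bounded_primitive (F f : R -> R) (B : R) :
  (forall t, 0 < t -> is_derive t 1 F (f t)) ->
  (forall t, 0 < t -> {for t, continuous f}) ->
  (forall t, 0 < t -> 0 <= f t) -> (forall t, 0 < t -> `|F t| <= B) ->
  mu.-integrable `]0, +oo[ (EFin \o f).
Proof.
move=> dF cf f0 FB; apply/integrableP; split.
  by apply/measurable_EFinP; exact: continuous_pos_measurable.
rewrite (eq_integral (fun x : mR => (f x)%:E)); last first.
  move=> x; rewrite inE/= in_itv/= andbT => x0.
  by rewrite ger0_norm// f0.
have H := @ge0_nondecreasing_set_cvg_integral _ mR R _ (EFin \o f) mu
  half_line_cover_nondecreasing (fun=> measurable_itv _).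
rewrite half_line_cover.
apply: (@le_lt_trans _ _ (2 * B)%:E); last by rewrite ltry.
have pos p x : x \in `[(p.+1%:R : R)^-1, p.+1%:R] -> 0 < x.
  by rewrite in_itv/= => /andP[h _]; apply: lt_le_trans h; rewrite invr_gt0 ltr0n.
have mfp p : measurable_fun (`[(p.+1%:R : R)^-1, p.+1%:R]%classic : set mR) (EFin \o f).
  apply/measurable_EFinP; apply: measurable_funS (continuous_pos_measurable cf) => //.
  by move=> x /= /pos; rewrite in_itv/= andbT.
have H0 (i : nat) (x : mR) : `[(i.+1%:R : R)^-1, i.+1%:R]%classic x ->
    (0 <= (EFin \o f) x)%E.
  by move=> /pos/f0; rewrite lee_fin.
have {}H := H mfp H0.
rewrite -(cvg_lim _ H)//; apply: lime_le; first by apply/cvg_ex; eexists; exact: H.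
near=> p; rewrite (@FTC2_pos F f)//; last first.
  by apply: inv_nat_lt; near: p; exact: nbhs_infty_gt.
rewrite lee_fin mulr_natl mulr2n (le_trans (ler_norm _))//.
by rewrite (le_trans (ler_normB _ _))// lerD// FB// ?invr_gt0 ltr0n.
Unshelve. all: by end_near. Qed.

Lemma cvg_inv_nat : (p.+1%:R : R)^-1 @[p --> \oo] --> 0^'+.
Proof.
move=> S /= [e /= e0 he].
suff : \forall p \near \oo, S (p.+1%:R^-1) by [].
near=> p; apply: he; rewrite /ball_ /=; last by rewrite invr_gt0 ltr0n.
rewrite sub0r normrN ger0_norm ?invr_ge0 ?ler0n//.
by near: p; exact: near_infty_natSinv_lt (PosNum e0).
Unshelve. all: by end_near. Qed.

Lemma cvg_natS : (p.+1%:R : R) @[p --> \oo] --> +oo.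
Proof.
by apply/cvgryPge => A; near=> p; rewrite (@le_trans _ _ p%:R) ?ler_nat//;
  near: p; exact: nbhs_infty_ger.
Unshelve. all: by end_near. Qed.

Lemma Rintegral_derivative_half_line (F f : R -> R) (a b : R) :
  (forall t, 0 < t -> is_derive t 1 F (f t)) ->
  (forall t, 0 < t -> {for t, continuous f}) ->
  mu.-integrable `]0, +oo[ (EFin \o f) ->
  F t @[t --> 0^'+] --> a -> F t @[t --> +oo] --> b ->
  \int[mu]_(t in `]0, +oo[) f t = b - a.
Proof.
move=> dF cf fi Fa Fb.
pose I p : set mR := `[(p.+1%:R : R)^-1, p.+1%:R]%classic.
have mf := continuous_pos_measurable cf.
have [|||_ H] := @Rintegral_dct `]0, +oo[%classic (fun p => f \_ (I p)) f (fun x => `|f x|)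
  (measurable_itv _) _ mf _ (integrable_norm fi) _.
- move=> p; apply/(measurable_restrict _ (measurable_itv _) (measurable_itv _)).
  by apply: measurable_funS mf => // x [].
- move=> x; rewrite half_line_cover => -[p0 _ Ip0].
  apply: cvg_near_cst; near=> p; rewrite patchE mem_set//.
  have pp : (p0 <= p)%N by near: p; exact: nbhs_infty_ge.
  by have /subsetPset := half_line_cover_nondecreasing pp; apply.
- by move=> p x _; rewrite patchE; case: ifPn => //; rewrite normr0.
have H2 : (\int[mu]_(x in `]0, +oo[) (f \_ (I p)) x) @[p --> \oo] --> b - a.
  have : F (p.+1%:R) - F (p.+1%:R^-1) @[p --> \oo] --> b - a.
    apply: cvgB; first exact: (cvg_comp _ _ cvg_natS Fb).
    exact: (cvg_comp _ _ cvg_inv_nat Fa).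
  apply: cvg_trans; apply: near_eq_cvg; near=> p.
  rewrite -Rintegral_mkcondr (_ : _ `&` _ = I p); last first.
    apply/setIidr => x /=; rewrite !in_itv/= andbT => /andP[h _].
    by rewrite bnd_simp in h; apply: lt_le_trans h; rewrite invr_gt0 ltr0n.
  rewrite /Rintegral (@FTC2_pos F f)//.
  by apply: inv_nat_lt; near: p; exact: nbhs_infty_gt.
exact: (cvg_unique _ H H2).
Unshelve. all: by end_near. Qed.

End RealIntegral.

(** * Complex integrals and dominated convergence *)

Section ComplexIntegral.
Variable R : realType.
Local Notation C := R[i].
Local Notation mu := (@lebesgue_measure R).
Local Notation mR := (measurableTypeR R).
Implicit Types (A : set mR) (u v : R -> C) (t s : R) (z : C).

Lemma ae_imply (P Q : R -> Prop) : {ae mu, forall t, P t} ->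
  (forall t, P t -> Q t) -> {ae mu, forall t, Q t}.
Proof.
by move=> h PQ; apply: (@filterS _ _ (ae_filter_ringOfSetsType mu) _ _ _ h).
Qed.

Lemma ae_and (P Q : R -> Prop) : {ae mu, forall t, P t} ->
  {ae mu, forall t, Q t} -> {ae mu, forall t, P t /\ Q t}.
Proof. exact: (@filterI _ _ (ae_filter_ringOfSetsType mu)). Qed.

Definition cmeasurable A u : Prop :=
  measurable_fun A (fun t => complex.Re (u t)) /\
  measurable_fun A (fun t => complex.Im (u t)).

Lemma cmeasurable_cst A z : cmeasurable A (fun=> z).
Proof. by split; exact: measurable_cst. Qed.

Lemma cmeasurableD A u v : cmeasurable A u -> cmeasurable A v ->
  cmeasurable A (fun t => u t + v t).
Proof.
move=> [u1 u2] [v1 v2]; split.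
  by under eq_fun do rewrite cReD; exact: measurable_funD.
by under eq_fun do rewrite cImD; exact: measurable_funD.
Qed.

Lemma cmeasurableM A u v : cmeasurable A u -> cmeasurable A v ->
  cmeasurable A (fun t => u t * v t).
Proof.
move=> [u1 u2] [v1 v2]; split.
  by under eq_fun do rewrite cReM; apply: measurable_funB; exact: measurable_funM.
by under eq_fun do rewrite cImM; apply: measurable_funD; exact: measurable_funM.
Qed.

Lemma cmeasurable_real A (f : R -> R) : measurable_fun A f ->
  cmeasurable A (fun t => (f t)%:C).
Proof. by move=> mf; split => //=; exact: measurable_cst. Qed.

Lemma cmeasurableS A B u : measurable A -> B `<=` A -> cmeasurable A u ->
  cmeasurable B u.
Proof. by move=> mA BA [h1 h2]; split; apply: measurable_funS mA BA _. Qed.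

Lemma cmeasurable_norm A u : cmeasurable A u ->
  measurable_fun A (fun t => c1norm (u t)).
Proof.
by move=> [h1 h2]; apply: measurable_funD; apply: measurableT_comp.
Qed.

Lemma cmeasurable_if A (B : set mR) u v : measurable A -> measurable B ->
  cmeasurable A u -> cmeasurable A v ->
  cmeasurable A (fun t => if t \in B then u t else v t).
Proof.
move=> mA mB [u1 u2] [v1 v2].
have h (f g : R -> R) : measurable_fun A f -> measurable_fun A g ->
    measurable_fun A (fun t : mR => if t \in B then f t else g t).
  move=> mf mg; apply: measurable_fun_if => //.
  - apply: (@measurable_fun_bool _ _ _ _ true).
    rewrite (_ : _ @^-1` _ = B); first exact: measurableI.
    by apply/seteqP; split => x /=; [move=> /set_mem|move=> /mem_set].
  - by apply: measurable_funS mf => // x [].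
  - by apply: measurable_funS mg => // x [].
split.
  rewrite (_ : (fun _ => _) = fun t : mR => if t \in B then complex.Re (u t) else complex.Re (v t)).
    exact: h.
  by apply/funext => t; case: ifP.
rewrite (_ : (fun _ => _) = fun t : mR => if t \in B then complex.Im (u t) else complex.Im (v t)).
  exact: h.
by apply/funext => t; case: ifP.
Qed.

Lemma cintegrable_cmeasurable A u : cintegrable A u -> cmeasurable A u.
Proof. by move=> [h1 h2]; split; exact: integrable_measurable. Qed.

Lemma cintegrable_dominated A u (g : R -> R) : measurable A -> cmeasurable A u ->
  mu.-integrable A (EFin \o g) -> (forall t, A t -> c1norm (u t) <= g t) ->
  cintegrable A u.
Proof.
move=> mA [m1 m2] ig ug; split; apply: integrable_dominated ig _ => // t At.
  exact: le_trans (normRe_le _) (ug _ At).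
exact: le_trans (normIm_le _) (ug _ At).
Qed.

Lemma cintegrable_norm A u : measurable A -> cintegrable A u ->
  mu.-integrable A (EFin \o (fun t => c1norm (u t))).
Proof.
by move=> mA [h1 h2]; apply: integrable_RD => //; exact: integrable_norm.
Qed.

Lemma cintegrable_le A u v : measurable A -> cmeasurable A u -> cintegrable A v ->
  (forall t, A t -> c1norm (u t) <= c1norm (v t)) -> cintegrable A u.
Proof.
by move=> mA mu_ iv uv; apply: cintegrable_dominated (cintegrable_norm mA iv) uv.
Qed.

Lemma eq_cintegrable A u v : measurable A -> (forall t, A t -> u t = v t) ->
  cintegrable A u -> cintegrable A v.
Proof.
move=> mA uv [h1 h2]; split; [apply: eq_integrable h1|apply: eq_integrable h2] => //;
  by move=> t; rewrite inE => At; rewrite uv.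
Qed.

Lemma cintegrableD A u v : measurable A -> cintegrable A u -> cintegrable A v ->
  cintegrable A (fun t => u t + v t).
Proof.
move=> mA [u1 u2] [v1 v2]; split.
  by under eq_fun do rewrite cReD; exact: integrable_RD.
by under eq_fun do rewrite cImD; exact: integrable_RD.
Qed.

Lemma cintegrableZ A u z : measurable A -> cintegrable A u ->
  cintegrable A (fun t => z * u t).
Proof.
move=> mA [u1 u2]; split.
  by under eq_fun do rewrite cReM; apply: integrable_RB => //; exact: integrable_RZ.
by under eq_fun do rewrite cImM; apply: integrable_RD => //; exact: integrable_RZ.
Qed.

Lemma cintegrableB A u v : measurable A -> cintegrable A u -> cintegrable A v ->
  cintegrable A (fun t => u t - v t).
Proof.
move=> mA iu iv; apply: (eq_cintegrable mA) (cintegrableD mA iu (cintegrableZ (-1) mA iv)).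
by move=> t _; rewrite mulN1r.
Qed.

Lemma cintegrableS A B u : measurable A -> measurable B -> B `<=` A ->
  cintegrable A u -> cintegrable B u.
Proof. by move=> mA mB BA [h1 h2]; split; apply: integrableS mA mB BA _. Qed.

Lemma cintegrableMb A u v (K : R) : measurable A -> cintegrable A u ->
  cmeasurable A v -> (forall t, A t -> c1norm (v t) <= K) ->
  cintegrable A (fun t => u t * v t).
Proof.
move=> mA iu mv vK.
apply: (cintegrable_dominated mA (cmeasurableM (cintegrable_cmeasurable iu) mv)
   (integrable_RZ K mA (cintegrable_norm mA iu))) => t At.
by rewrite (le_trans (c1normM _ _))// mulrC ler_wpM2r ?c1norm_ge0// vK.
Qed.

Lemma cintD A u v : measurable A -> cintegrable A u -> cintegrable A v ->
  cint A (fun t => u t + v t) = cint A u + cint A v.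
Proof.
move=> mA [u1 u2] [v1 v2]; rewrite /cint; apply: cplxP; rewrite ?(cReD, cImD) /=.
  by under eq_Rintegral do rewrite cReD; rewrite RintegralD.
by under eq_Rintegral do rewrite cImD; rewrite RintegralD.
Qed.

Lemma cintZ A u z : measurable A -> cintegrable A u ->
  cint A (fun t => z * u t) = z * cint A u.
Proof.
move=> mA [u1 u2]; rewrite /cint; apply: cplxP; rewrite ?(cReM, cImM) /=.
  under eq_Rintegral do rewrite cReM.
  by rewrite RintegralB ?RintegralZl//; exact: integrable_RZ.
under eq_Rintegral do rewrite cImM.
by rewrite RintegralD ?RintegralZl//; exact: integrable_RZ.
Qed.

Lemma cintB A u v : measurable A -> cintegrable A u -> cintegrable A v ->
  cint A (fun t => u t - v t) = cint A u - cint A v.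
Proof.
move=> mA iu iv; rewrite -(mulN1r (cint A v)) -cintZ// -cintD//.
  by congr cint; apply/funext => t; rewrite mulN1r.
exact: cintegrableZ.
Qed.

Lemma eq_cint A u v : (forall t, A t -> u t = v t) -> cint A u = cint A v.
Proof.
by move=> uv; rewrite /cint; congr (_ +i* _); apply: eq_Rintegral => t;
  rewrite inE => At; rewrite uv.
Qed.

Lemma cint_ae A u v : measurable A -> cmeasurable A u -> cmeasurable A v ->
  {ae mu, forall t, A t -> u t = v t} -> cint A u = cint A v.
Proof.
move=> mA [u1 u2] [v1 v2] uv; rewrite /cint; congr (_ +i* _);
  by apply: Rintegral_ae => //; apply: ae_imply uv _ => t h At; rewrite h.
Qed.

Lemma cint0 A : cint A (fun=> 0) = 0.
Proof. by rewrite /cint /= /Rintegral integral0. Qed.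

Lemma cint_mkcond A u : cint A u = cint setT (fun t => if t \in A then u t else 0).
Proof.
rewrite /cint (Rintegral_mkcond _ A) (Rintegral_mkcond _ A (fun t => complex.Im _)).
by congr (_ +i* _); apply: eq_Rintegral => t _; rewrite patchE; case: ifP.
Qed.

Lemma cintegrable_mkcond A u : measurable A ->
  cintegrable A u <-> cintegrable setT (fun t => if t \in A then u t else 0).
Proof.
move=> mA.
have e (f : C -> R) : f 0 = 0 -> (EFin \o (fun t => f (u t))) \_ A =
   EFin \o (fun t => f (if t \in A then u t else 0)).
  by move=> f0; apply/funext => t; rewrite patchE /=; case: ifP => // _; rewrite f0.
split => -[h1 h2]; split.
- by move: h1 => /(integrable_mkcond _ mA); rewrite e.
- by move: h2 => /(integrable_mkcond _ mA); rewrite e.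
- by apply/(integrable_mkcond _ mA); rewrite e.
- by apply/(integrable_mkcond _ mA); rewrite e.
Qed.

(** For the taxicab norm this is the real inequality for each component. *)
Lemma c1norm_cint A u : measurable A -> cintegrable A u ->
  c1norm (cint A u) <= \int[mu]_(t in A) c1norm (u t).
Proof.
move=> mA [h1 h2]; rewrite /c1norm /cint /= RintegralD//; try exact: integrable_norm.
by apply: lerD; exact: le_normr_Rintegral.
Qed.

Definition ccvg (w : nat -> C) z : Prop :=
  ((fun p => complex.Re (w p)) @ \oo --> complex.Re z) /\
  ((fun p => complex.Im (w p)) @ \oo --> complex.Im z).

Lemma ccvg_unique (w : nat -> C) z z' : ccvg w z -> ccvg w z' -> z = z'.
Proof.
by move=> [h1 h2] [h3 h4]; apply: cplxP; [exact: cvg_unique h1 h3|exact: cvg_unique h2 h4].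
Qed.

Lemma ccvg_cst z : ccvg (fun=> z) z.
Proof. by split; exact: cvg_cst. Qed.

Lemma ccvgD (w w' : nat -> C) z z' : ccvg w z -> ccvg w' z' ->
  ccvg (fun p => w p + w' p) (z + z').
Proof.
move=> [h1 h2] [h3 h4]; split; rewrite ?(cReD, cImD).
  by under eq_fun do rewrite cReD; exact: cvgD.
by under eq_fun do rewrite cImD; exact: cvgD.
Qed.

Lemma ccvgM (w w' : nat -> C) z z' : ccvg w z -> ccvg w' z' ->
  ccvg (fun p => w p * w' p) (z * z').
Proof.
move=> [h1 h2] [h3 h4]; split; rewrite ?(cReM, cImM).
  by under eq_fun do rewrite cReM; apply: cvgB; exact: cvgM.
by under eq_fun do rewrite cImM; apply: cvgD; exact: cvgM.
Qed.

Lemma ccvg_dist (w : nat -> C) z (e : nat -> R) : (e @ \oo --> 0) ->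
  (forall p, c1norm (w p - z) <= e p) -> ccvg w z.
Proof.
move=> e0 he; split; apply/cvgrPdist_le => d d0.
  have /cvgrPdist_le/(_ d d0) := e0; apply: filterS => p; rewrite sub0r normrN => h.
  rewrite distrC -cReN -cReD (le_trans (normRe_le _))// (le_trans (he p))//.
  exact: le_trans (ler_norm _) h.
have /cvgrPdist_le/(_ d d0) := e0; apply: filterS => p; rewrite sub0r normrN => h.
rewrite distrC -cImN -cImD (le_trans (normIm_le _))// (le_trans (he p))//.
exact: le_trans (ler_norm _) h.
Qed.

Lemma ccvg_norm (w : nat -> C) z : ccvg w z ->
  (fun p => c1norm (w p)) @ \oo --> c1norm z.
Proof. by move=> [h1 h2]; apply: cvgD; apply: cvg_norm. Qed.

Lemma cint_dct A (w : nat -> R -> C) u (g : R -> R) : measurable A ->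
  (forall p, cmeasurable A (w p)) -> cmeasurable A u ->
  (forall t, A t -> ccvg (w ^~ t) (u t)) ->
  mu.-integrable A (EFin \o g) ->
  (forall p t, A t -> c1norm (w p t) <= g t) ->
  cintegrable A u /\ ccvg (fun p => cint A (w p)) (cint A u).
Proof.
move=> mA mw [m1 m2] cw ig dom.
have [|||i1 c1] := @Rintegral_dct R A (fun p t => complex.Re (w p t))
  (fun t => complex.Re (u t)) g mA _ m1 _ ig.
- by move=> p; have [] := mw p.
- by move=> t At; have [] := cw t At.
- by move=> p t At; apply: le_trans (normRe_le _) (dom p t At).
have [|||i2 c2] := @Rintegral_dct R A (fun p t => complex.Im (w p t))
  (fun t => complex.Im (u t)) g mA _ m2 _ ig.
- by move=> p; have [] := mw p.
- by move=> t At; have [] := cw t At.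
- by move=> p t At; apply: le_trans (normIm_le _) (dom p t At).
by split; split.
Qed.

(** Only behaviour on the open half line matters for one-sided transforms. *)
Definition ccont_pos u : Prop := forall t, 0 < t ->
  {for t, continuous (fun s => complex.Re (u s))} /\
  {for t, continuous (fun s => complex.Im (u s))}.

Lemma ccont_pos_cmeasurable u : ccont_pos u ->
  cmeasurable `]0, +oo[%classic u.
Proof.
by move=> h; split; apply: continuous_pos_measurable => t /h[].
Qed.

Lemma cis_derive_ccont_pos u u' : (forall t, 0 < t -> cis_derive u t (u' t)) ->
  ccont_pos u.
Proof. by move=> h t t0; apply: cis_derive_continuous (h t t0). Qed.

Lemma ccont_posD u v : ccont_pos u -> ccont_pos v ->
  ccont_pos (fun t => u t + v t).
Proof.
move=> hu hv t t0; have [u1 u2] := hu t t0; have [v1 v2] := hv t t0; split.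
  have -> : (fun s => complex.Re (u s + v s)) =
    (fun s => complex.Re (u s) + complex.Re (v s)).
    by apply/funext => s; rewrite cReD.
  exact: (continuousD u1 v1).
have -> : (fun s => complex.Im (u s + v s)) =
  (fun s => complex.Im (u s) + complex.Im (v s)).
  by apply/funext => s; rewrite cImD.
exact: (continuousD u2 v2).
Qed.

Lemma ccont_posM u v : ccont_pos u -> ccont_pos v ->
  ccont_pos (fun t => u t * v t).
Proof.
move=> hu hv t t0; have [u1 u2] := hu t t0; have [v1 v2] := hv t t0; split.
  have -> : (fun s => complex.Re (u s * v s)) = (fun s =>
    complex.Re (u s) * complex.Re (v s) - complex.Im (u s) * complex.Im (v s)).
    by apply/funext => s; rewrite cReM.
  exact: (continuousB (continuousM u1 v1) (continuousM u2 v2)).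
have -> : (fun s => complex.Im (u s * v s)) = (fun s =>
  complex.Re (u s) * complex.Im (v s) + complex.Im (u s) * complex.Re (v s)).
  by apply/funext => s; rewrite cImM.
exact: (continuousD (continuousM u1 v2) (continuousM u2 v1)).
Qed.

Lemma ccont_pos_cst z : ccont_pos (fun=> z).
Proof. by move=> t _; split; exact: cst_continuous. Qed.

(** Integration by parts on the half line, in the form that is used: the
    derivative of a function vanishing at both ends has integral zero. *)
Lemma cint_derivative_half_line u u' :
  (forall t, 0 < t -> cis_derive u t (u' t)) -> ccont_pos u' ->
  cintegrable `]0, +oo[ u' ->
  c1norm (u t) @[t --> 0^'+] --> 0 -> c1norm (u t) @[t --> +oo] --> 0 ->
  cint `]0, +oo[ u' = 0.
Proof.
move=> du cu' [i1 i2] u0 uoo.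
have sq (f : C -> R) F (FF : Filter F) : (forall z, `|f z| <= c1norm z) ->
    c1norm (u t) @[t --> F] --> 0 -> f (u t) @[t --> F] --> 0.
  move=> fle; move/(cvgrPdist_le) => h; apply/cvgrPdist_le => e e0.
  have := h e e0; apply: filterS => t; rewrite !sub0r !normrN => ht.
  by rewrite (le_trans (fle _))// (le_trans _ ht)// ler_norm.
apply: cplxP => /=.
  have := @Rintegral_derivative_half_line _ (fun t => complex.Re (u t)) _ 0 0
    (fun t h => proj1 (du t h)) (fun t h => proj1 (cu' t h)) i1
    (sq _ _ _ (@normRe_le R) u0) (sq _ _ _ (@normRe_le R) uoo).
  by rewrite subrr; apply.
have := @Rintegral_derivative_half_line _ (fun t => complex.Im (u t)) _ 0 0
  (fun t h => proj2 (du t h)) (fun t h => proj2 (cu' t h)) i2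
  (sq _ _ _ (@normIm_le R) u0) (sq _ _ _ (@normIm_le R) uoo).
by rewrite subrr; apply.
Qed.

End ComplexIntegral.

(** * The weights of the Gamma integral *)

Section GammaKernel.
Variable R : realType.
Local Notation C := R[i].
Local Notation mu := (@lebesgue_measure R).
Local Notation mR := (measurableTypeR R).
Implicit Types (t s a c : R) (b z : C).

(** The weight $t^{a-1} e^{-ct}$, written as one exponential so that products
    and derivatives of weights are additions of exponents. *)
Definition gweight a c t : R := expR ((a - 1) * ln t - c * t).

Lemma gweight_gt0 a c t : 0 < gweight a c t.
Proof. exact: expR_gt0. Qed.

Lemma ln_linear_bound a c : 0 < a -> 0 < c ->
  exists K : R, forall t, 0 < t -> a * ln t <= c * t + K.
Proof.
move=> a0 c0; exists (a * ln (a / c)) => t t0.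
have ct : 0 < c * t / a by rewrite divr_gt0// mulr_gt0.
have -> : t = (c * t / a) * (a / c) by field; rewrite !gt_eqF.
rewrite lnM ?posrE// ?divr_gt0// mulrDr lerD2r.
apply: (@le_trans _ _ (a * (c * t / a))); first by rewrite ler_pM2l// ltW// ln_sublinear.
by rewrite le_eqVlt; apply/orP; left; apply/eqP; field; rewrite !gt_eqF.
Qed.

Lemma integrable_gweight a c : 0 < a -> 0 < c ->
  mu.-integrable `]0, +oo[ (EFin \o gweight a c).
Proof.
move=> a0 c0.
have [K HK] := ln_linear_bound a0 (divr_gt0 c0 (ltr0n R 2)).
pose q t := expR (a * ln t).
pose F t := - (1 + q t)^-1.
pose f t := a / t * q t / (1 + q t) ^+ 2.
have q0 t : 0 < 1 + q t by rewrite addr_gt0// expR_gt0.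
have dq t : 0 < t -> is_derive t 1 q (a / t * q t).
  move=> t0; have H := is_derive1_ln t0.
  have H2 : is_derive t 1 (expR \o (fun s => a * ln s)) (expR (a * ln t) * (a * t^-1)).
    exact: is_derive1_comp.
  by apply: is_derive_eq; rewrite /q; ring.
have dF t : 0 < t -> is_derive t 1 F (f t).
  move=> t0; have H := dq t t0.
  have H1 : is_derive t 1 (fun s => 1 + q s) (a / t * q t).
    have := is_deriveD (is_derive_cst (1 : R) t 1) H.
    by rewrite add0r.
  have H2 := @is_deriveV R (fun s => 1 + q s) t _ _ (lt0r_neq0 (q0 t)) H1.
  have H3 := is_deriveN H2.
  apply: is_derive_eq; rewrite /GRing.scale/= /f; field.
  by rewrite !gt_eqF.
have cq t : 0 < t -> {for t, continuous q}.
  move=> t0; apply: differentiable_continuous; apply/derivable1_diffP.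
  exact: (@ex_derive _ _ _ _ _ _ _ (dq t t0)).
have cf t : 0 < t -> {for t, continuous f}.
  move=> t0; have cqt := cq t t0; rewrite /f.
  apply: (@continuousM _ _ (fun t => a / t * q t) (fun t => ((1 + q t) ^+ 2)^-1)).
    apply: (@continuousM _ _ (fun t => a / t) q) => //.
    apply: (@continuousM _ _ (fun=> a) (fun t => t^-1)); first exact: cst_continuous.
    by apply: inv_continuous; rewrite gt_eqF.
  apply: (@continuousV _ _ (fun t => (1 + q t) ^+ 2)); first by rewrite gt_eqF// exprn_gt0.
  have c1 : {for t, continuous (fun t => 1 + q t)}.
    have c0' : {for t, continuous (fun _ : R => (1 : R))} by exact: cst_continuous.
    exact: (continuousD c0' cqt).
  exact: (continuousM c1 c1).
have intf : mu.-integrable `]0, +oo[ (EFin \o f).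
  apply: (@integrable_bounded_primitive R F f 1 dF cf).
  - move=> t t0; rewrite /f !mulr_ge0// ?invr_ge0 ?ltW ?exprn_gt0//; exact: expR_gt0.
  - move=> t t0; rewrite /F normrN normfV gtr0_norm// invf_le1//.
    by rewrite lerDl ltW// expR_gt0.
have mg : measurable_fun (`]0, +oo[%classic : set mR) (gweight a c).
  apply: continuous_pos_measurable => t t0.
  apply: continuous_comp; last exact: continuous_expR.
  have k1 : {for t, continuous (fun _ : R => a - 1)} by exact: cst_continuous.
  have k2 : {for t, continuous (fun _ : R => c)} by exact: cst_continuous.
  have k3 : {for t, continuous (fun s : R => s)} by exact: cvg_id.
  exact: (continuousB (continuousM k1 (continuous_ln t0)) (continuousM k2 k3)).
pose L := a^-1 * (1 + expR K) ^+ 2.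
apply: (integrable_dominated (measurable_itv _) mg (integrable_RZ L (measurable_itv _) intf)).
move=> t; rewrite /= in_itv/= andbT => t0.
rewrite gtr0_norm ?gweight_gt0//.
have -> : gweight a c t = t^-1 * q t * (expR (- (c / 2 * t))) ^+ 2.
  have -> : t^-1 = expR (- ln t) by rewrite expRN lnK.
  by rewrite /gweight /q expr2 -!expRD; congr expR; field.
have qb : q t * expR (- (c / 2 * t)) <= expR K.
  by rewrite -expRD ler_expR; have := HK t t0; rewrite /q; lra.
have eb : expR (- (c / 2 * t)) <= 1.
  by rewrite -expR0 ler_expR oppr_le0 ltW// !mulr_gt0.
have -> : L * f t = t^-1 * q t * ((1 + expR K) / (1 + q t)) ^+ 2.
  by rewrite /L /f; field; rewrite !gt_eqF.
rewrite ler_pM2l ?mulr_gt0 ?invr_gt0 ?expR_gt0//.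
rewrite ler_sqr; last 2 first.
- exact: expR_ge0.
- by rewrite nnegrE divr_ge0 ?addr_ge0 ?expR_ge0.
by rewrite ler_pdivlMr// mulrDr mulr1 lerD// mulrC.
Qed.

(** The complex weight $t^{b-1} e^{-zt}$. *)
Definition gkernel b z t : C := cexp ((b - 1) * (ln t)%:C - z * t%:C).

Lemma cnorm_gkernel b z t :
  cnorm (gkernel b z t) = gweight (complex.Re b) (complex.Re z) t.
Proof.
by rewrite cnorm_cexp cReD cReN !cReM cReD /= !mulr0 !subr0.
Qed.

Lemma c1norm_gkernel b z t :
  c1norm (gkernel b z t) <= 2 * gweight (complex.Re b) (complex.Re z) t.
Proof. by rewrite -cnorm_gkernel c1norm_le_cnorm. Qed.

Lemma gkernelS b z t : 0 < t -> gkernel (b + 1) z t = t%:C * gkernel b z t.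
Proof.
move=> t0; rewrite /gkernel -{3}(lnK t0) -cexp_real -cexpD.
by congr cexp; ring.
Qed.

Lemma cis_derive_gkernel b z t : 0 < t ->
  cis_derive (gkernel b z) t (((b - 1) / t%:C - z) * gkernel b z t).
Proof.
move=> t0; apply: cis_derive_cexp.
have H1 := cis_deriveZ (b - 1) (cis_derive_real (is_derive1_ln t0)).
have H2 : cis_derive (fun s : R => - (z * s%:C)) t (- z).
  have -> : (fun s : R => - (z * s%:C)) = (fun s => 0 + (- z) * s%:C).
    by apply/funext => s; rewrite add0r mulNr.
  exact: cis_derive_affine.
apply: cis_derive_eq (cis_deriveD H1 H2) _.
congr (_ * _ - _); apply: (mulfI (x := t%:C)).
  by apply/eqP => -[] /eqP; rewrite gt_eqF.
rewrite divff; last by apply/eqP => -[] /eqP; rewrite gt_eqF.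
by apply: cplxP; rewrite ?(cReM, cImM) /=; field; rewrite gt_eqF.
Qed.

Lemma ccont_pos_gkernel b z : ccont_pos (gkernel b z).
Proof. exact: cis_derive_ccont_pos (@cis_derive_gkernel b z). Qed.

Lemma cintegrable_gkernel b z : 0 < complex.Re b -> 0 < complex.Re z ->
  cintegrable `]0, +oo[ (gkernel b z).
Proof.
move=> b0 z0; apply: (cintegrable_dominated (measurable_itv _)
  (ccont_pos_cmeasurable (ccont_pos_gkernel b z))
  (integrable_RZ 2 (measurable_itv _) (integrable_gweight b0 z0))) => t _.
exact: c1norm_gkernel.
Qed.

Lemma gweightS_cvg0 a c : 0 < a -> 0 < c ->
  gweight (a + 1) c t @[t --> 0^'+] --> 0 /\ gweight (a + 1) c t @[t --> +oo] --> 0.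
Proof.
move=> a0 c0; have [K HK] := ln_linear_bound a0 (divr_gt0 c0 (ltr0n R 2)).
split; apply/cvgrPdist_le => e e0; near=> t; rewrite sub0r normrN
  gtr0_norm ?gweight_gt0// /gweight addrK -(lnK e0) ler_expR.
- have t0 : 0 < t by near: t; exact: nbhs_right_gt.
  have te : t <= expR (ln e / a) by near: t; apply: nbhs_right_le; exact: expR_gt0.
  have : ln t <= ln e / a by rewrite -(expRK (ln e / a)) ler_ln ?posrE// expR_gt0.
  rewrite ler_pdivlMr// mulrC => h.
  by rewrite (le_trans _ h)// lerBlDr lerDl ltW// mulr_gt0.
- have t0 : 0 < t by near: t; exact: nbhs_pinfty_gt.
  have := HK t t0.
  have : (K - ln e) / (c / 2) <= t by near: t; apply: nbhs_pinfty_ge; exact: num_real.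
  rewrite ler_pdivrMr ?divr_gt0//; lra.
Unshelve. all: by end_near. Qed.

Definition cgamma_integral b z : C := cint `]0, +oo[ (gkernel b z).

(** Integrating $(t^b e^{-zt})'$ gives the functional equation of the Gamma
    function (for z = 1) and, for general z, the differential equation in z
    that identifies the Laplace transform of a power. *)
Lemma cgamma_integralS b z : 0 < complex.Re b -> 0 < complex.Re z ->
  z * cgamma_integral (b + 1) z = b * cgamma_integral b z.
Proof.
move=> b0 z0; have b1 : 0 < complex.Re (b + 1) by rewrite cReD addr_gt0.
have i0 := cintegrable_gkernel b0 z0; have i1 := cintegrable_gkernel b1 z0.
pose u' t := b * gkernel b z t - z * gkernel (b + 1) z t.
have iu' : cintegrable `]0, +oo[ u'.
  by apply: cintegrableB => //; exact: cintegrableZ.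
apply/esym/eqP; rewrite -subr_eq0 /cgamma_integral; apply/eqP.
rewrite -!cintZ// -cintB//; try exact: cintegrableZ.
have dom (F : set_system R) : Filter F ->
    gweight (complex.Re b + 1) (complex.Re z) t @[t --> F] --> 0 ->
    c1norm (gkernel (b + 1) z t) @[t --> F] --> 0.
  move=> FF h; apply: (@squeeze_cvgr _ _ _ _ (cst 0)
    (fun t => 2 * gweight (complex.Re b + 1) (complex.Re z) t)).
  - apply: nearW => t; rewrite c1norm_ge0/= (le_trans (c1norm_gkernel _ _ _))//.
    by rewrite cReD.
  - exact: cvg_cst.
  - by rewrite -[0](mulr0 (2 : R)); apply: cvgM => //; exact: cvg_cst.
have [w0 woo] := gweightS_cvg0 b0 z0.
apply: (cint_derivative_half_line (u := gkernel (b + 1) z)) => //.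
- move=> t t0; apply: cis_derive_eq (cis_derive_gkernel (b + 1) z t0) _.
  rewrite addrK mulrBl; congr (_ - _); rewrite gkernelS// mulrA divfK//.
  by apply/eqP => -[] /eqP; rewrite gt_eqF.
- apply: ccont_posD; first by apply: ccont_posM;
    [exact: ccont_pos_cst|exact: ccont_pos_gkernel].
  have -> : (fun t => - (z * gkernel (b + 1) z t)) = (fun t => (- z) * gkernel (b + 1) z t).
    by apply/funext => t; rewrite mulNr.
  by apply: ccont_posM; [exact: ccont_pos_cst|exact: ccont_pos_gkernel].
- exact: dom w0.
- exact: dom woo.
Qed.

End GammaKernel.

(** * The Laplace transform of a power *)

Section LaplacePower.
Variable R : realType.
Local Notation C := R[i].
Local Notation mu := (@lebesgue_measure R).
Local Notation mR := (measurableTypeR R).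
Implicit Types (t s a c : R) (b z : C).

Lemma is_derive_under_integral (A : set mR) (f f' : R -> R -> R) (G : R -> R)
    (u v a : R) : measurable A -> u < a < v ->
  (forall s, u < s < v -> mu.-integrable A (EFin \o f s)) ->
  (forall s t, u < s < v -> A t -> is_derive s 1 (f ^~ t) (f' s t)) ->
  (forall t, 0 <= G t) -> mu.-integrable A (EFin \o G) ->
  (forall s t, u < s < v -> A t -> `|f' s t| <= G t) ->
  is_derive a 1 (fun s => \int[mu]_(t in A) f s t) (\int[mu]_(t in A) f' a t).
Proof.
move=> mA ha fi df G0 Gi dG.
have ha' : `]u, v[%classic a by rewrite /= in_itv.
have hi (s : R) : `]u, v[%classic s -> mu.-integrable A (EFin \o f s).
  by rewrite /= in_itv/= => /fi.
have hd (s : R) (t : mR) : `]u, v[%classic s -> A t -> derivable (f ^~ t) s 1.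
  by rewrite /= in_itv/= => hs At; apply: (@ex_derive _ _ _ _ _ _ _ (df s t hs At)).
have d1 (s : R) (t : mR) : `]u, v[%classic s -> A t -> partial1of2 f s t = f' s t.
  rewrite /= in_itv/= => hs At; rewrite partial1of2E.
  exact: (@derive_val _ _ _ _ _ _ _ (df s t hs At)).
have hG (s : R) (t : mR) : `]u, v[%classic s -> A t -> `|partial1of2 f s t| <= G t.
  by move=> hs At; rewrite d1//; apply: dG => //; move: hs; rewrite /= in_itv.
apply: DeriveDef.
  exact: (derivable_under_integral mA ha' hi hd G0 Gi hG).
rewrite -derive1E (differentiation_under_integral mA ha' hi hd G0 Gi hG).
by apply: eq_Rintegral => t; rewrite inE => At; rewrite d1.
Qed.

Lemma cis_derive_under_integral (A : set mR) (w w' : R -> R -> C) (G : R -> R)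
    (u v a : R) : measurable A -> u < a < v ->
  (forall s, u < s < v -> cintegrable A (w s)) ->
  (forall s t, u < s < v -> A t -> cis_derive (w ^~ t) s (w' s t)) ->
  (forall t, 0 <= G t) -> mu.-integrable A (EFin \o G) ->
  (forall s t, u < s < v -> A t -> c1norm (w' s t) <= G t) ->
  cis_derive (fun s => cint A (w s)) a (cint A (w' a)).
Proof.
move=> mA ha wi dw G0 Gi dG; split => /=.
  apply: (@is_derive_under_integral A (fun s t => complex.Re (w s t))
    (fun s t => complex.Re (w' s t)) G u v a) => //.
  - by move=> s /wi[].
  - by move=> s t hs At; have [] := dw s t hs At.
  - by move=> s t hs At; apply: le_trans (normRe_le _) (dG s t hs At).
apply: (@is_derive_under_integral A (fun s t => complex.Im (w s t))
  (fun s t => complex.Im (w' s t)) G u v a) => //.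
- by move=> s /wi[].
- by move=> s t hs At; have [] := dw s t hs At.
- by move=> s t hs At; apply: le_trans (normIm_le _) (dG s t hs At).
Qed.

(** The value at z is transported from the value at 1 along the segment
    joining them: there, the integral and the principal power $z^{-b}$ satisfy
    the same linear differential equation. *)
Lemma cgamma_integral_cpow b z : 0 < complex.Re b -> 0 < complex.Re z ->
  cgamma_integral b z = cgamma_integral b 1 * cpow z (- b).
Proof.
move=> b0 z0.
pose x := complex.Re z; pose ze s : C := 1 + (z - 1) * s%:C.
have zeRe s : complex.Re (ze s) = 1 + (x - 1) * s.
  by rewrite /ze cReD cReM cReD cReN /= mulr0 subr0.
(* On a neighbourhood of the segment the real part of ze stays above m, which
   gives one dominating function for all parameters. *)
pose m := Num.min 1 x / 2.
have m0 : 0 < m by rewrite divr_gt0// lt_min ltr01.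
pose e := m / (1 + `|x - 1|).
have d0 : 0 < 1 + `|x - 1| by rewrite ltr_pwDl.
have e0 : 0 < e by rewrite divr_gt0.
have exm : e * `|x - 1| <= m.
  by rewrite /e mulrAC ler_pdivrMr// ler_pM2l// lerDr.
have hm1 : 2 * m <= 1 by rewrite /m mulrC divfK// ge_min lexx.
have hmx : 2 * m <= x by rewrite /m mulrC divfK// ge_min lexx orbT.
have zem s : - e < s < 1 + e -> m <= complex.Re (ze s).
  move=> /andP[s1 s2]; rewrite zeRe.
  have xm : - m <= e * (x - 1) <= m.
    by rewrite -ler_norml normrM (ger0_norm (ltW e0)).
  move: xm => /andP[h1 h2].
  have [hx|hx] := leP 1 x.
    have : 0 <= (s + e) * (x - 1) by apply: mulr_ge0; lra.
    by rewrite mulrDl; lra.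
  have : 0 <= (1 + e - s) * (1 - x) by apply: mulr_ge0; lra.
  rewrite !mulrBl !mulrBr !mulr1 !mul1r mulrDl mul1r; rewrite mulrBr mulr1 in h1 h2; lra.
pose w s t := gkernel b (ze s) t.
pose w' s t := - (z - 1) * gkernel (b + 1) (ze s) t.
pose K := c1norm (z - 1) * 2.
have gm s t : - e < s < 1 + e -> 0 < t ->
    gweight (complex.Re (b + 1)) (complex.Re (ze s)) t <=
    gweight (complex.Re b + 1) m t.
  move=> /zem h t0; rewrite /gweight ler_expR cReD /= lerD2l lerN2 ler_wpM2r//.
  exact: ltW.
have b1 : 0 < complex.Re b + 1 by rewrite addr_gt0.
have dPhi s : 0 <= s <= 1 ->
    cis_derive (fun s => cgamma_integral b (ze s)) s
      (- (z - 1) * cgamma_integral (b + 1) (ze s)).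
  move=> /andP[s0 s1].
  have hs : - e < s < 1 + e by apply/andP; split; lra.
  have hb1 : 0 < complex.Re (b + 1) by rewrite cReD.
  rewrite /cgamma_integral -cintZ//; last first.
    by apply: cintegrable_gkernel => //; exact: lt_le_trans m0 (zem _ hs).
  apply: (@cis_derive_under_integral _ w w'
    (fun t => K * gweight (complex.Re b + 1) m t) (- e) (1 + e)) => //.
  - by move=> r /zem h; apply: cintegrable_gkernel => //; exact: lt_le_trans m0 h.
  - move=> r t hr; rewrite /= in_itv/= andbT => t0.
    apply: cis_derive_eq.
      apply: cis_derive_cexp.
      rewrite (_ : (fun r => _) = fun r =>
        ((b - 1) * (ln t)%:C - t%:C) + (- (z - 1) * t%:C) * r%:C); last first.
        by apply/funext => q; rewrite /ze; ring.
      exact: cis_derive_affine.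
    by rewrite /w' gkernelS// [RHS]mulrA.
  - by move=> t; rewrite mulr_ge0// ?mulr_ge0 ?c1norm_ge0// ltW// gweight_gt0.
  - by apply: integrable_RZ => //; apply: integrable_gweight.
  - move=> r t hr; rewrite /= in_itv/= andbT => t0.
    rewrite (le_trans (c1normM _ _))// c1normN /K -mulrA ler_wpM2l ?c1norm_ge0//.
    by rewrite (le_trans (c1norm_gkernel _ _ _))// ler_pM2l// gm.
have zen0 s : 0 <= s <= 1 -> 0 < complex.Re (ze s).
  move=> /andP[s0 s1].
  have hs : - e < s < 1 + e by apply/andP; split; lra.
  exact: lt_le_trans m0 (zem _ hs).
have := @cis_derive0_cst R (fun s => cgamma_integral b (ze s) * cexp (b * clog (ze s))) _.
have H s : 0 <= s <= 1 -> cis_derive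
    (fun s => cgamma_integral b (ze s) * cexp (b * clog (ze s))) s 0.
  move=> hs; have p := zen0 s hs.
  apply: cis_derive_eq (cis_deriveM (dPhi s hs) (cis_derive_cpow_line b p)) _.
  have zn : ze s != 0 by apply/eqP => h; move: p; rewrite h ltxx.
  have E : cgamma_integral (b + 1) (ze s) = b * cgamma_integral b (ze s) / ze s.
    by rewrite -cgamma_integralS// mulrC mulKf.
  by rewrite E /ze; field.
move=> /(_ H); rewrite /ze mulr1 mulr0 addr0 addrC subrK.
have one0 : (1 : C) != 0 by rewrite oner_eq0.
have zn : z != 0 by apply/eqP => h; move: z0; rewrite h ltxx.
rewrite -!cpowE// => h; rewrite cpowN//.
have -> : cgamma_integral b 1 = cgamma_integral b 1 * cpow 1 b.
  rewrite (_ : cpow 1 b = 1) ?mulr1//.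
  by rewrite (@cpow_real R 1 b ltr01) ln1 mulr0 cexp0.
by rewrite -h mulfK// cpow_neq0.
Qed.

Lemma cgammaE z : 0 < complex.Re z -> cgamma z = cgamma_integral z 1.
Proof.
move=> z0; rewrite /cgamma z0 big_ord0 divr1 /cgamma_integral.
apply: eq_cint => t; rewrite /= in_itv/= andbT => t0.
rewrite addr0 cpow_real// -cexp_real -cexpD /gkernel mul1r.
by congr (cexp (_ + _)); apply: cplxP => //=; rewrite oppr0.
Qed.

Lemma cgammaS z : 0 < complex.Re z -> cgamma (z + 1) = z * cgamma z.
Proof.
move=> z0; rewrite !cgammaE//; last by rewrite cReD addr_gt0.
by rewrite -cgamma_integralS//= ?ltr01// mul1r.
Qed.

Lemma cint_gkernel b z : 0 < complex.Re b -> 0 < complex.Re z ->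
  cint `]0, +oo[ (gkernel b z) = cgamma b * cpow z (- b).
Proof. by move=> b0 z0; rewrite cgammaE// -cgamma_integral_cpow. Qed.

End LaplacePower.

(** * Lower bounds for the Gamma function in a sector *)

Section GammaBounds.
Variable R : realType.
Local Notation C := R[i].
Local Notation mu := (@lebesgue_measure R).
Local Notation mR := (measurableTypeR R).
Implicit Types (t s a c x y : R) (b z : C).

Lemma lebesgue_measure_cc (a b : R) : a < b ->
  mu (`[a, b]%classic : set mR) = (b - a)%:E.
Proof.
move=> ab; have := @lebesgue_measure_itv R `[a, b].
by rewrite /= lte_fin ab.
Qed.

Lemma integrable_cst_itv (a b k : R) : a < b ->
  mu.-integrable `[a, b] (EFin \o (fun=> k)).
Proof.
move=> ab; apply/integrableP; split; first exact: measurable_cst.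
rewrite (@integral_cst _ mR R mu _ (measurable_Ritv _)).
by rewrite [X in (_ * X)%E](lebesgue_measure_cc ab) -EFinM ltry.
Qed.

Lemma Rintegral_cst_itv (a b k : R) : a < b ->
  \int[mu]_(_ in `[a, b]) k = k * (b - a).
Proof.
move=> ab; rewrite (@Rintegral_cst _ mR R mu _ (measurable_Ritv _)).
by congr (_ * _); have /(congr1 fine) := lebesgue_measure_cc ab.
Qed.
(** The Gamma function on the positive axis; it dominates |Gamma(a + iy)|. *)
Definition rgamma a : R := \int[mu]_(t in `]0, +oo[) gweight a 1 t.

Lemma cgamma_real a : 0 < a -> cgamma a%:C = (rgamma a)%:C.
Proof.
move=> a0; rewrite cgammaE//= /cgamma_integral /cint /rgamma.
have -> : gkernel a%:C 1 = fun t => (gweight a 1 t)%:C.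
  apply/funext => t; rewrite /gkernel /gweight -cexp_real; congr cexp.
  by apply: cplxP; rewrite !(cReD, cReN, cReM, cImD, cImN, cImM)/=; ring.
by apply: cplxP => //=; rewrite /Rintegral integral0.
Qed.

Lemma rgammaS a : 0 < a -> rgamma (a + 1) = a * rgamma a.
Proof.
move=> a0; have := @cgammaS R a%:C a0.
have -> : a%:C + 1 = (a + 1)%:C by apply: cplxP; rewrite ?(cReD, cImD)//= addr0.
by rewrite !cgamma_real ?addr_gt0// => -[]; rewrite mul0r subr0.
Qed.

(** The Gamma integral restricted to the unit interval that starts at t + 1
    already dominates a power of t. *)
Lemma power_le_rgamma a y t : 0 < a -> 0 <= y -> 0 < t ->
  expR (y * ln t - 2 * t) <= expR 4 * rgamma (y + a).
Proof.
move=> a0 y0 t0.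
have ya : 0 < y + a by rewrite ltr_wpDl.
have ig := integrable_gweight ya (ltr01 : 0 < (1 : R)).
have sub : `[t + 1, t + 2] `<=` `]0, +oo[%classic.
  by move=> s /=; rewrite !in_itv/= andbT => /andP[h _]; lra.
have iJ := integrable_Rsub (measurable_Ritv _) (measurable_Ritv _) sub ig.
pose k := expR (y * ln t - 2 * t - 4).
have kle : k <= rgamma (y + a).
  apply: (@le_trans _ _ (\int[mu]_(s in `[t + 1, t + 2]) gweight (y + a) 1 s)).
    rewrite -[leLHS](_ : \int[mu]_(s in `[t + 1, t + 2]) k = k); last first.
      rewrite Rintegral_cst_itv ?ltrD2l ?ltr1n//.
      by rewrite (_ : t + 2 - (t + 1) = 1) ?mulr1//; ring.
    apply: le_Rintegral => //.
      by apply: integrable_cst_itv; rewrite ltrD2l ltr1n.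
    move=> s /=; rewrite in_itv/= => /andP[s1 s2].
    rewrite /k /gweight ler_expR mul1r.
    have s0 : 0 < s by lra.
    have h1 : ln t <= ln s by rewrite ler_ln ?posrE//; lra.
    have h2 : 0 <= ln s by rewrite ln_ge0//; lra.
    have h3 : ln s <= s by rewrite ltW// ln_sublinear.
    have h4 : y * ln t <= y * ln s by rewrite ler_wpM2l.
    have h5 : 0 <= a * ln s by rewrite mulr_ge0// ltW.
    rewrite !mulrDl mulN1r; lra.
  rewrite -lee_fin /rgamma !EFin_Rintegral//.
  apply: ge0_subset_integral => //; first exact: measurable_int ig.
  by move=> s _; rewrite lee_fin ltW// gweight_gt0.
apply: le_trans (_ : expR 4 * k <= _); last by rewrite ler_pM2l ?expR_gt0.
by rewrite /k -expRD ler_expR; lra.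
Qed.

Lemma rgamma_gt0 a : 0 < a -> 0 < rgamma a.
Proof.
move=> a0; have := @power_le_rgamma a 0 1 a0 (lexx _) ltr01.
rewrite add0r => h; rewrite -(pmulr_rgt0 _ (expR_gt0 4)).
by apply: lt_le_trans h; exact: expR_gt0.
Qed.

Lemma norm_sin_le x : `|sin x| <= `|x|.
Proof.
have := @real_mean_value_bound R (sin \o (fun s => x * s)) (fun s => cos (x * s) * x) `|x|.
rewrite /= mulr1 mulr0 sin0 subr0; apply.
- move=> s _; apply: is_derive1_comp.
  have h : is_derive s 1 (fun s : R => s) (1 : R) by exact: is_derive_id.
  by have := is_deriveZ x h; rewrite /GRing.scale/= mulr1.
- by move=> s _; rewrite normrM ler_piMl// cos_max.
Qed.

Lemma cos_quadratic x : 1 - x ^+ 2 / 2 <= cos x.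
Proof.
have -> : x = (x / 2) *+ 2 by rewrite -(mulr_natr (x / 2)) divfK.
rewrite cos_mulr2n -(mulr_natr (cos _ ^+ 2)) cos2sin2.
have : sin (x / 2) ^+ 2 <= (x / 2) ^+ 2.
  by rewrite -(real_normK (num_real (sin _))) -(real_normK (num_real (x / 2)))
    ler_sqr ?nnegrE// norm_sin_le.
set u := _ ^+ 2 => h; rewrite -(mulr_natr (x / 2)) divfK//.
have -> : x ^+ 2 / 2 = 2 * (x / 2) ^+ 2 by field.
lra.
Qed.

Lemma sinh_ge s : 0 <= s -> 2 * s <= expR s - expR (- s).
Proof.
rewrite le_eqVlt => /predU1P[<-|s0]; first by rewrite oppr0 subrr mulr0.
pose f (t : R) := expR t - expR (- t) - 2 * t.
have df t : is_derive t 1 f (expR t + expR (- t) - 2).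
  have h1 := is_derive_expR t.
  have hi : is_derive t 1 (fun s : R => s) (1 : R) by exact: is_derive_id.
  have h2 : is_derive t 1 (expR \o (fun s : R => - s)) (expR (- t) * (- 1)).
    by apply: is_derive1_comp; exact: is_deriveN.
  have h3 := is_deriveB (is_deriveB h1 h2) (is_deriveZ 2 hi).
  by apply: is_derive_eq; rewrite /GRing.scale/=; ring.
have [|c _ h] := @MVT R f (fun t => expR t + expR (- t) - 2) 0 s s0 (fun t _ => df t).
- by apply: derivable_within_continuous => t _; apply: (@ex_derive _ _ _ _ _ _ _ (df t)).
- have : 0 <= f s - f 0.
    rewrite h subr0 mulr_ge0 ?(ltW s0)//.
    by have := expR_ge1Dx c; have := expR_ge1Dx (- c); lra.
  by rewrite /f oppr0 subrr mulr0 !subr0 subr_ge0.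
Qed.

Lemma sqr_le_cosh x : x ^+ 2 <= expR x + expR (- x) - 2.
Proof.
have E s : expR s + expR (- s) - 2 = (expR (s / 2) - expR (- (s / 2))) ^+ 2.
  have h1 : expR s = expR (s / 2) ^+ 2 by rewrite expr2 -expRD; congr expR; field.
  have h2 : expR (- s) = expR (- (s / 2)) ^+ 2 by rewrite expr2 -expRD; congr expR; field.
  have h3 : expR (s / 2) * expR (- (s / 2)) = 1 by rewrite -expRD subrr expR0.
  by rewrite sqrrB h3 -h1 -h2; ring.
wlog x0 : x / 0 <= x => [hw|].
  have [|h] := leP 0 x; first exact: hw.
  by have := hw (- x); rewrite oppr_ge0 sqrrN opprK => /(_ (ltW h)); lra.
rewrite E; have h : x <= expR (x / 2) - expR (- (x / 2)).
  by have := @sinh_ge (x / 2); lra.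
by rewrite ler_sqr// nnegrE// (le_trans x0).
Qed.

(** On the vertical line of abscissa x, the Gamma density is concentrated near
    x, where the oscillating factor $(t/x)^{iy}$ is close to 1. *)
Lemma cgamma_ge x y : 1 < x ->
  rgamma x * (1 - y ^+ 2 / (2 * (x - 1))) <= cnorm (cgamma (x +i* y)).
Proof.
move=> x1; have x0 : 0 < x by lra.
have xm : 0 < x - 1 by lra.
have i0 := integrable_gweight x0 (ltr01 : 0 < (1 : R)).
have ip := integrable_gweight (addr_gt0 x0 ltr01) (ltr01 : 0 < (1 : R)).
have im := integrable_gweight xm (ltr01 : 0 < (1 : R)).
(* The phase x^-iy centres the oscillation of t^iy at t = x. *)
pose ph : C := cexp (- (y * ln x)%:C * 'i).
have nph : cnorm ph = 1 by rewrite cnorm_cexp cReM cReN /= mulr0 oppr0 mul0r subr0 expR0.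
have -> : cnorm (cgamma (x +i* y)) = cnorm (ph * cgamma (x +i* y)).
  by rewrite cnormM nph mul1r.
apply: le_trans (normRe_le_cnorm _); apply: le_trans (ler_norm _).
rewrite cgammaE; last by [].
rewrite /cgamma_integral -cintZ; last 2 first.
- exact: measurable_Ritv.
- by apply: cintegrable_gkernel; rewrite /= ?ltr01.
rewrite /cint; set rhs := (X in _ <= X).
have -> : rhs = \int[mu]_(t in `]0, +oo[) complex.Re (ph * gkernel (x +i* y) 1 t) by [].
rewrite {}/rhs.
have -> : (fun t => complex.Re (ph * gkernel (x +i* y) 1 t)) =
    fun t => gweight x 1 t * cos (y * (ln t - ln x)).
  apply/funext => t; rewrite /ph /gkernel -cexpD /cexp cReM /= /gweight.
  by rewrite (mul0r (sin _)) [LHS]subr0; congr (_ * _); [congr expR|congr cos]; ring.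
pose D t := gweight x 1 t - y ^+ 2 / 2 *
   ((x^-1 * gweight (x + 1) 1 t + x * gweight (x - 1) 1 t) - 2 * gweight x 1 t).
have mI := @measurable_Ritv R `]0, +oo[.
have iA := integrable_RD mI (integrable_RZ x^-1 mI ip) (integrable_RZ x mI im).
have iB := integrable_RB mI iA (integrable_RZ 2 mI i0).
have iD : mu.-integrable `]0, +oo[ (EFin \o D).
  by apply: integrable_RB => //; apply: integrable_RZ.
have <- : \int[mu]_(t in `]0, +oo[) D t = rgamma x * (1 - y ^+ 2 / (2 * (x - 1))).
  rewrite /D RintegralB//; last by apply: integrable_RZ.
  rewrite RintegralZl// RintegralB//; last by apply: integrable_RZ.
  rewrite RintegralD//; [|exact: integrable_RZ|exact: integrable_RZ].
  rewrite !RintegralZl// -!/(rgamma _) rgammaS//.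
  have := rgammaS xm; rewrite subrK => ->.
  by field; rewrite !gt_eqF.
apply: le_Rintegral => //.
  apply: (integrable_dominated mI _ i0).
    apply: measurable_funM; first exact: integrable_measurable i0.
    apply: measurableT_comp; first by apply: continuous_measurable_fun; exact: continuous_cos.
    apply: measurable_funM; first exact: measurable_cst.
    apply: measurable_funB; last exact: measurable_cst.
    by apply: continuous_pos_measurable => t; exact: continuous_ln.
  move=> t _; rewrite normrM gtr0_norm ?gweight_gt0//.
  by rewrite ler_piMr ?cos_max// ltW// gweight_gt0.
move=> t; rewrite /= in_itv/= andbT => t0.
have tE : expR (ln t) = t by exact: lnK.
have Ep : gweight (x + 1) 1 t = gweight x 1 t * t.
  by rewrite /gweight -[X in _ = _ * X]tE -expRD; congr expR; ring.
have Em : gweight (x - 1) 1 t = gweight x 1 t / t.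
  by rewrite /gweight -[X in _ = _ / X]tE -expRN -expRD; congr expR; ring.
set L := ln t - ln x.
have eL : expR L = t / x by rewrite /L expRD expRN !lnK.
have eNL : expR (- L) = x / t by rewrite /L opprB expRD expRN !lnK.
have -> : D t = gweight x 1 t * (1 - y ^+ 2 / 2 * (expR L + expR (- L) - 2)).
  by rewrite /D Ep Em eL eNL; field; rewrite !gt_eqF.
rewrite ler_pM2l ?gweight_gt0//.
apply: le_trans (cos_quadratic _).
rewrite lerD2l lerN2 exprMn mulrAC ler_wpM2l ?divr_ge0 ?sqr_ge0//.
exact: sqr_le_cosh.
Qed.

(** Away from the positive axis Gamma decays, but inside a sector at most
    exponentially. The functional equation carries the estimate from abscissa
    x + 1 to x, and the exponent 1/x + 1/x^2 absorbs the factor |x + iy| / x. *)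
Lemma rgamma_le_cgamma x y : 0 < x ->
  rgamma x <= 2 * expR (y ^+ 2 * (x^-1 + x^-2)) * cnorm (cgamma (x +i* y)).
Proof.
move=> x0.
(* For x >= 2 + y^2 the bound of [cgamma_ge] is at least 1/2; J counts the steps
   that are needed to get there. *)
have [J HJ] : exists J : nat, 2 + y ^+ 2 <= x + J%:R.
  exists (Num.truncn (2 + y ^+ 2)).+1.
  by rewrite (le_trans (ltW (truncnS_gt _)))// lerDr ltW.
elim: J x x0 HJ => [|J IH] x x0 HJ.
  rewrite addr0 in HJ; have y2 : 0 <= y ^+ 2 by exact: sqr_ge0.
  have x1 : 1 < x by lra.
  have xm : 0 < x - 1 by lra.
  have h : 2^-1 <= 1 - y ^+ 2 / (2 * (x - 1)).
    have -> : y ^+ 2 / (2 * (x - 1)) = (y ^+ 2 / (x - 1)) * 2^-1 by field; rewrite gt_eqF.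
    have : y ^+ 2 / (x - 1) <= 1 by rewrite ler_pdivrMr// mul1r; lra.
    by lra.
  have g0 := rgamma_gt0 x0.
  have h2 := @cgamma_ge x y x1.
  have h3 : rgamma x <= 2 * cnorm (cgamma (x +i* y)).
    rewrite -ler_pdivrMl//; apply: le_trans h2; rewrite mulrC.
    by rewrite ler_pM2l.
  apply: le_trans h3 _; rewrite -mulrA ler_pM2l// ler_peMl ?cnorm_ge0//.
  rewrite -expR0 ler_expR mulr_ge0// addr_ge0// invr_ge0 ?exprn_ge0// ltW//.
have x10 : 0 < x + 1 by lra.
have HJ' : 2 + y ^+ 2 <= x + 1 + J%:R by rewrite -(addrA x) nat1r.
have := IH (x + 1) x10 HJ'.
have -> : (x + 1) +i* y = (x +i* y) + 1 :> C by apply: cplxP => //=; rewrite addr0.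
rewrite (rgammaS x0) (@cgammaS R (x +i* y) x0) cnormM.
set u := y ^+ 2 / x ^+ 2.
have u0 : 0 <= u by rewrite divr_ge0 ?sqr_ge0.
have nle : cnorm (x +i* y) <= x * expR u.
  apply: (@le_trans _ _ (x * (1 + u))); last by rewrite ler_pM2l// expR_ge1Dx.
  have p0 : 0 <= x * (1 + u) by rewrite mulr_ge0 ?addr_ge0 ?(ltW x0).
  rewrite cnormE /= -[leRHS](ger0_norm p0) -sqrtr_sqr.
  rewrite ler_sqrt ?sqr_ge0// exprMn sqrrD expr1n mul1r.
  have -> : x ^+ 2 + y ^+ 2 = x ^+ 2 * (1 + u) by rewrite /u; field; rewrite gt_eqF.
  rewrite ler_pM2l ?exprn_gt0// -addrA lerD2l -(mulr_natr u).
  by have := sqr_ge0 u; lra.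
set G := cnorm (cgamma _); have G0 : 0 <= G by exact: cnorm_ge0.
move=> h.
have h2 : x * rgamma x <= x * (2 * expR (y ^+ 2 * ((x + 1)^-1 + (x + 1) ^- 2)) * expR u * G).
  apply: le_trans h _.
  set E := expR (y ^+ 2 * _).
  have -> : x * (2 * E * expR u * G) = 2 * E * ((x * expR u) * G) by ring.
  by rewrite ler_wpM2l ?mulr_ge0 ?expR_ge0// ler_wpM2r.
move: h2; rewrite ler_pM2l// => h2; apply: le_trans h2 _.
rewrite ler_wpM2r// -mulrA ler_pM2l// -expRD ler_expR /u -mulrDr ler_wpM2l ?sqr_ge0//.
have h3 : (x + 1) ^- 2 <= x^-1 - (x + 1)^-1.
  rewrite (_ : x^-1 - (x + 1)^-1 = (x * (x + 1))^-1); last by field; rewrite !gt_eqF.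
  by rewrite lef_pV2 ?posrE ?mulr_gt0 ?exprn_gt0// expr2 ler_pM2r//; lra.
lra.
Qed.

Lemma cgamma_neq0 z : 0 < complex.Re z -> cgamma z != 0.
Proof.
case: z => x y /= x0; apply/eqP => h.
have := rgamma_le_cgamma y x0; rewrite h cnormE /= expr0n addr0 sqrtr0 mulr0.
by rewrite leNgt rgamma_gt0.
Qed.

End GammaBounds.

(** * Fubini and convolution *)

Section Convolution.
Variable R : realType.
Local Notation C := R[i].
Local Notation mu := (@lebesgue_measure R).
Local Notation mR := (measurableTypeR R).
Implicit Types (u v : R -> C) (t s : R).

Lemma measurable_reflect (t : R) : measurable_fun [set: mR] (fun s : mR => (t - s : mR)).
Proof. by apply: measurable_funB; [exact: measurable_cst|exact: measurable_id]. Qed.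

Lemma lebesgue_measure_reflect (t : R) (A : set mR) : measurable A ->
  mu A = pushforward mu (fun s : mR => (t - s : mR)) A.
Proof.
pose m := @pushforward _ _ mR mR R mu (fun s : mR => (t - s : mR)).
have H := @lebesgue_measure_unique R
  (measure_function_pushforward__canonical__measure_function_Measure mu (measurable_reflect t)).
apply: H => X [[a b] _ <-] /=; rewrite /pushforward.
have -> : (fun s : mR => (t - s : mR)) @^-1` `]a, b] = `[t - b, t - a[%classic.
  apply/seteqP; split => s /=; rewrite !in_itv/= => /andP[h1 h2]; apply/andP; split; lra.
have e1 := @lebesgue_measure_itv R `]a, b].
have e2 := @lebesgue_measure_itv R `[t - b, t - a[.
rewrite /= in e1 e2; rewrite [LHS]e1 [RHS]e2 !lte_fin ltrD2l ltrN2.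
by case: ifP => // _; rewrite -!EFinB; congr EFin; ring.
Qed.

Lemma ge0_integral_reflect (t : R) (f : mR -> \bar R) :
  measurable_fun [set: mR] f -> (forall s, (0 <= f s)%E) ->
  (\int[mu]_s f (t - s)%R = \int[mu]_s f s)%E.
Proof.
move=> mf f0.
have := @ge0_integral_pushforward _ _ mR mR R _ (measurable_reflect t) mu setT f
  measurableT mf (fun s _ => f0 s).
rewrite preimage_setT => <-; apply: eq_measure_integral.
  exact: measurable_reflect.
by move=> ? A mA _; apply/esym; exact: (lebesgue_measure_reflect t mA).
Qed.

Lemma integrable_reflect (t : R) (f : R -> R) :
  mu.-integrable setT (EFin \o f) ->
  mu.-integrable setT (EFin \o (fun s => f (t - s))).
Proof.
move=> fi; have mf := integrable_measurable fi.
have mf' : measurable_fun [set: mR] (fun s => f (t - s)).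
  exact: (measurableT_comp mf (measurable_reflect t)).
apply/integrableP; split; first exact/measurable_EFinP.
have := @ge0_integral_reflect t (fun s => `|f s|%:E) _ (fun s => _).
move=> -> //; first by have /integrableP[] := fi.
by apply/measurable_EFinP; apply: measurableT_comp.
Qed.

Lemma Rintegral_reflect (t : R) (f : R -> R) :
  mu.-integrable setT (EFin \o f) ->
  \int[mu]_s f (t - s) = \int[mu]_s f s.
Proof.
move=> fi; have mf := integrable_measurable fi.
have := @integral_pushforward _ _ mR mR R _ (measurable_reflect t) mu setT (EFin \o f).
rewrite preimage_setT => /(_ _ (integrable_reflect t fi) measurableT) H.
rewrite /Rintegral; congr fine; rewrite -[LHS]H; last exact/measurable_EFinP.
apply: eq_measure_integral; first exact: measurable_reflect.
by move=> ? A mA _; apply/esym; exact: (lebesgue_measure_reflect t mA).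
Qed.

Lemma integrable_ae_eq (f g : mR -> \bar R) : measurable_fun setT f ->
  mu.-integrable setT g -> {ae mu, forall t, f t = g t} -> mu.-integrable setT f.
Proof.
move=> mf /integrableP[mg gfin] fg; apply/integrableP; split => //.
rewrite (@ae_eq_integral _ mR R mu setT (fun t : mR => `|g t|)%E)//; try exact: measurableT_comp.
by apply: ae_imply fg _ => t h _; rewrite /= h.
Qed.

Lemma RintegralZ_gt0 (f : R -> R) (k : R) : 0 < k -> measurable_fun [set: mR] f ->
  \int[mu]_s (k * f s) = k * \int[mu]_s f s.
Proof.
move=> k0 mf; rewrite /Rintegral integralE [in RHS]integralE.
have mfE : measurable_fun [set: mR] (EFin \o f) by exact/measurable_EFinP.
have -> : (\int[mu]_x (fun s => (k * f s)%:E)^\+ x = k%:E * \int[mu]_x (EFin \o f)^\+ x)%E.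
  rewrite -ge0_integralZl_EFin//; last 2 first.
  - exact: measurable_funepos.
  - exact: ltW.
  by rewrite -(@ge0_funeposM mR R k (EFin \o f) (ltW k0)).
have -> : (\int[mu]_x (fun s => (k * f s)%:E)^\- x = k%:E * \int[mu]_x (EFin \o f)^\- x)%E.
  rewrite -ge0_integralZl_EFin//; last 2 first.
  - exact: measurable_funeneg.
  - exact: ltW.
  by rewrite -(@ge0_funenegM mR R k (EFin \o f) (ltW k0)).
rewrite -[X in fine X = _](_ : k%:E * (\int[mu]_x (EFin \o f)^\+ x - \int[mu]_x (EFin \o f)^\- x) = _)%E.
  case: (_ - _)%E => [r| |] //=; first by rewrite ?gt0_muley ?gt0_muleNy ?lte_fin //= mulr0.
  by rewrite gt0_muleNy ?lte_fin //= mulr0.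
have : (0 <= \int[mu]_x (EFin \o f)^\+ x)%E by apply: integral_ge0.
have : (0 <= \int[mu]_x (EFin \o f)^\- x)%E by apply: integral_ge0.
case: (\int[mu]_x _)%E => [b| |] //; case: (\int[mu]_x _)%E => [a| |] //= _ _.
- by rewrite -EFinB -!EFinM -EFinB mulrBr.
- by rewrite gt0_muley ?lte_fin.
- by rewrite gt0_muley ?gt0_muleNy ?lte_fin.
- by rewrite gt0_muley ?gt0_muleNy ?lte_fin.
Qed.

Lemma cintZ_gt0 u (k : R) : 0 < k -> cmeasurable [set: mR] u ->
  cint setT (fun s => u s * k%:C) = cint setT u * k%:C.
Proof.
move=> k0 [m1 m2]; apply: cplxP => /=.
  rewrite mulr0 subr0 mulrC -RintegralZ_gt0//.
  by apply: eq_Rintegral => s _; rewrite cReM /= mulr0 subr0 mulrC.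
rewrite mulr0 add0r mulrC -RintegralZ_gt0//.
by apply: eq_Rintegral => s _; rewrite cImM /= mulr0 add0r mulrC.
Qed.

Lemma cintegrable_reflect (t : R) u : cintegrable setT u ->
  cintegrable setT (fun s => u (t - s)).
Proof.
by move=> [h1 h2]; split; [exact: (integrable_reflect t h1)|exact: (integrable_reflect t h2)].
Qed.

Lemma cint_reflect (t : R) u : cintegrable setT u ->
  cint setT (fun s => u (t - s)) = cint setT u.
Proof.
move=> [h1 h2]; rewrite /cint.
by rewrite (Rintegral_reflect t h1) (Rintegral_reflect t h2).
Qed.

Lemma cmeasurable_reflect (t : R) u : cmeasurable [set: mR] u ->
  cmeasurable [set: mR] (fun s => u (t - s)).
Proof.
by move=> [h1 h2]; split; [exact: (measurableT_comp h1 (measurable_reflect t))|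
  exact: (measurableT_comp h2 (measurable_reflect t))].
Qed.

Lemma cint_translate (s : R) u : cintegrable setT u ->
  cint setT (fun t => u (t - s)) = cint setT u.
Proof.
move=> ui; have := cint_reflect s (cintegrable_reflect 0 ui).
rewrite cint_reflect// => <-; apply: eq_cint => t _.
by congr u; ring.
Qed.

Lemma cintegrable_translate (s : R) u : cintegrable setT u ->
  cintegrable setT (fun t => u (t - s)).
Proof.
move=> ui; have := cintegrable_reflect s (cintegrable_reflect 0 ui).
by apply: eq_cintegrable => // t _; congr u; ring.
Qed.

Lemma ge0_integral_translate (s : R) (f : mR -> \bar R) :
  measurable_fun [set: mR] f -> (forall s, (0 <= f s)%E) ->
  (\int[mu]_t f (t - s)%R = \int[mu]_t f t)%E.
Proof.
move=> mf f0.
have mg : measurable_fun [set: mR] (fun t : mR => f (0 - t)).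
  exact: (measurableT_comp mf (measurable_reflect 0)).
have := @ge0_integral_reflect s (fun t : mR => f (0 - t)) mg (fun _ => f0 _).
rewrite ge0_integral_reflect// => <-; apply: eq_integral => t _.
by congr f; ring.
Qed.

(** ** Fubini for complex functions of two real variables *)

Definition jmeasurable (w : R -> R -> C) : Prop :=
  measurable_fun [set: (mR * mR)%type] (fun p => complex.Re (w p.1 p.2)) /\
  measurable_fun [set: (mR * mR)%type] (fun p => complex.Im (w p.1 p.2)).

(** Tonelli's criterion, in the order of integration in which it is verified for
    convolutions. *)
Definition jnorm_finite (w : R -> R -> C) : Prop :=
  (\int[mu]_s \int[mu]_t (c1norm (w t s))%:E < +oo)%E.

Lemma jintegrable_part (f : R -> R -> R) (g : R -> R -> R) :
  measurable_fun [set: (mR * mR)%type] (fun p => f p.1 p.2) ->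
  measurable_fun [set: (mR * mR)%type] (fun p => g p.1 p.2) ->
  (forall t s, `|f t s| <= g t s) ->
  (\int[mu]_s \int[mu]_t (g t s)%:E < +oo)%E ->
  (mu \x mu)%E.-integrable [set: (mR * mR)%type] (fun p => (f p.1 p.2)%:E).
Proof.
move=> mf mg fg gfin.
have g0 t s : 0 <= g t s by apply: le_trans (fg t s).
have gi : (mu \x mu)%E.-integrable [set: (mR * mR)%type] (fun p => (g p.1 p.2)%:E).
  apply/integrable21ltyP; first exact/measurable_EFinP.
  apply: le_lt_trans gfin; rewrite le_eqVlt; apply/orP; left; apply/eqP.
  by apply: eq_integral => s _; apply: eq_integral => t _ /=; rewrite ger0_norm.
apply: (le_integrable _ _ _ gi) => //; first exact/measurable_EFinP.
by move=> [t s] _ /=; rewrite lee_fin (ger0_norm (g0 _ _)).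
Qed.

Lemma RFubini (f : R -> R -> R) :
  (mu \x mu)%E.-integrable [set: (mR * mR)%type] (fun p => (f p.1 p.2)%:E) ->
  [/\ {ae mu, forall t, mu.-integrable setT (EFin \o f t)},
      mu.-integrable setT (EFin \o (fun t => \int[mu]_s f t s)) &
      \int[mu]_t \int[mu]_s f t s = \int[mu]_s \int[mu]_t f t s].
Proof.
move=> fi.
have A1 := ae_integrable1 fi; have A2 := ae_integrable2 fi.
have iF := integrable_fubini_F fi; have mG := measurable_fubini_G fi.
have E1 : {ae mu, forall t, (\int[mu]_s f t s)%:E = fubini_F mu (fun p => (f p.1 p.2)%:E) t}.
  by apply: ae_imply A1 _ => t it; rewrite EFin_Rintegral.
have E2 : {ae mu, forall s, (\int[mu]_t f t s)%:E = fubini_G mu (fun p => (f p.1 p.2)%:E) s}.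
  by apply: ae_imply A2 _ => s it; rewrite EFin_Rintegral.
have M1 : measurable_fun [set: mR] (EFin \o (fun t => \int[mu]_s f t s)).
  by apply/measurable_EFinP/measurableT_comp => //; have /integrableP[] := iF.
have M2 : measurable_fun [set: mR] (EFin \o (fun s => \int[mu]_t f t s)).
  by apply/measurable_EFinP/measurableT_comp.
have I1 : mu.-integrable setT (EFin \o (fun t => \int[mu]_s f t s)).
  exact: integrable_ae_eq M1 iF E1.
split; [exact: A1|exact: I1|].
have G1 : Rintegral mu setT (fun t => \int[mu]_s f t s) =
    fine (\int[mu]_t fubini_F mu (fun p => (f p.1 p.2)%:E) t)%E.
  rewrite {1}/Rintegral; congr fine.
  apply: ae_eq_integral; [exact: measurableT|exact: M1|by have /integrableP[] := iF|].
  by apply: ae_imply E1 _ => t h _; rewrite /= h.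
have G2 : Rintegral mu setT (fun s => \int[mu]_t f t s) =
    fine (\int[mu]_s fubini_G mu (fun p => (f p.1 p.2)%:E) s)%E.
  rewrite {1}/Rintegral; congr fine.
  apply: ae_eq_integral; [exact: measurableT|exact: M2|exact: mG|].
  by apply: ae_imply E2 _ => t h _; rewrite /= h.
by rewrite G1 G2 (integral12_prod_meas1 fi) (integral21_prod_meas1 fi).
Qed.

Theorem cFubini (w : R -> R -> C) : jmeasurable w -> jnorm_finite w ->
  [/\ {ae mu, forall t, cintegrable setT (w t)},
      cintegrable setT (fun t => cint setT (w t)) &
      cint setT (fun t => cint setT (w t)) =
      cint setT (fun s => cint setT (fun t => w t s))].
Proof.
move=> [m1 m2] fin.
have mn : measurable_fun [set: (mR * mR)%type] (fun p => c1norm (w p.1 p.2)).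
  by apply: measurable_funD; apply: measurableT_comp.
have [a1 b1 c1] := RFubini (@jintegrable_part (fun t s => complex.Re (w t s))
  (fun t s => c1norm (w t s)) m1 mn (fun t s => normRe_le _) fin).
have [a2 b2 c2] := RFubini (@jintegrable_part (fun t s => complex.Im (w t s))
  (fun t s => c1norm (w t s)) m2 mn (fun t s => normIm_le _) fin).
split.
- by apply: ae_imply (ae_and a1 a2) _ => t [].
- by split.
- by rewrite {1 3}/cint /= /cint c1 c2.
Qed.

Lemma jmeasurableM (w w' : R -> R -> C) : jmeasurable w -> jmeasurable w' ->
  jmeasurable (fun t s => w t s * w' t s).
Proof.
move=> [u1 u2] [v1 v2]; split.
  by under eq_fun do rewrite cReM; apply: measurable_funB; exact: measurable_funM.
by under eq_fun do rewrite cImM; apply: measurable_funD; exact: measurable_funM.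
Qed.

Lemma jmeasurable_sub u : cmeasurable [set: mR] u ->
  jmeasurable (fun t s => u (t - s)).
Proof.
move=> [h1 h2].
have mS : measurable_fun [set: (mR * mR)%type] (fun p : mR * mR => (p.1 - p.2 : mR)).
  by apply: measurable_funB; [exact: measurable_fst|exact: measurable_snd].
by split; [exact: (measurableT_comp h1 mS)|exact: (measurableT_comp h2 mS)].
Qed.

Lemma jmeasurable_snd u : cmeasurable [set: mR] u -> jmeasurable (fun t s => u s).
Proof.
move=> [h1 h2].
by split; [exact: (measurableT_comp h1 measurable_snd)|exact: (measurableT_comp h2 measurable_snd)].
Qed.

Lemma integrable_lty (f : R -> R) : mu.-integrable setT (EFin \o f) ->
  (forall t, 0 <= f t) -> (\int[mu]_t (f t)%:E < +oo)%E.
Proof.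
move=> /integrableP[_]; under eq_integral => t _ do rewrite /= -/(EFin `|f t|).
move=> h f0; apply: le_lt_trans h; rewrite le_eqVlt; apply/orP; left; apply/eqP.
by apply: eq_integral => t _; rewrite /= ger0_norm.
Qed.

(** Integration over the whole line avoids a moving domain; for causal factors
    the integrand vanishes outside ]0, t[. *)
Definition cconv u v t : C := cint setT (fun s => u (t - s) * v s).

Lemma cconv_L1 u v : cintegrable setT u -> cintegrable setT v ->
  [/\ cintegrable setT (cconv u v),
      cint setT (cconv u v) = cint setT u * cint setT v &
      {ae mu, forall t, cintegrable setT (fun s => u (t - s) * v s)}].
Proof.
move=> ui vi.
have mu_ := cintegrable_cmeasurable ui; have mv := cintegrable_cmeasurable vi.
pose w t s := u (t - s) * v s.
have jm : jmeasurable w := jmeasurableM (jmeasurable_sub mu_) (jmeasurable_snd mv).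
have mnu : measurable_fun [set: mR] (fun t => (c1norm (u t))%:E).
  by apply/measurable_EFinP; exact: cmeasurable_norm.
have mnv : measurable_fun [set: mR] (fun t => (c1norm (v t))%:E).
  by apply/measurable_EFinP; exact: cmeasurable_norm.
have Nu := integrable_lty (cintegrable_norm measurableT ui) (fun t => c1norm_ge0 _).
have Nv := integrable_lty (cintegrable_norm measurableT vi) (fun t => c1norm_ge0 _).
set nu := (\int[mu]_t (c1norm (u t))%:E)%E in Nu.
have nu0 : (0 <= nu)%E by apply: integral_ge0 => t _; rewrite lee_fin c1norm_ge0.
have fin : jnorm_finite w.
  apply: (@le_lt_trans _ _ (\int[mu]_s (nu * (c1norm (v s))%:E))%E); last first.
    rewrite ge0_integralZl//; last by move=> s _; rewrite lee_fin c1norm_ge0.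
    by rewrite lte_mul_pinfty// ge0_fin_numE.
  apply: ge0_le_integral => //.
  - by move=> s _; apply: integral_ge0 => t _; rewrite lee_fin c1norm_ge0.
  - have mt : measurable_fun [set: (mR * mR)%type] (fun p => (c1norm (w p.1 p.2))%:E).
      by apply/measurable_EFinP; apply: measurable_funD; apply: measurableT_comp => //; have [] := jm.
    have p0 (p : mR * mR) : (0 <= (c1norm (w p.1 p.2))%:E)%E by rewrite lee_fin c1norm_ge0.
    exact: (@measurable_fun_fubini_tonelli_G _ _ mR mR R mu _ mt p0).
  - by apply: emeasurable_funM => //; exact: measurable_cst.
  - move=> s _.
    apply: (@le_trans _ _ (\int[mu]_t ((c1norm (u (t - s)%R))%:E * (c1norm (v s))%:E))%E).
      apply: ge0_le_integral => //.
      + by move=> t _; rewrite lee_fin c1norm_ge0.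
      + apply/measurable_EFinP; apply: cmeasurable_norm; apply: cmeasurableM; last exact: cmeasurable_cst.
        rewrite /cmeasurable.
        by split; [apply: (measurableT_comp (proj1 mu_)) | apply: (measurableT_comp (proj2 mu_))];
          apply: measurable_funB => //; exact: measurable_cst.
      + apply: emeasurable_funM; last exact: measurable_cst.
        apply: (measurableT_comp mnu).
        by apply: measurable_funB => //; exact: measurable_cst.
      + by move=> t _; rewrite -EFinM lee_fin c1normM.
    rewrite ge0_integralZr//.
    + rewrite (@ge0_integral_translate s (fun t => (c1norm (u t))%:E))// => t.
      by rewrite lee_fin c1norm_ge0.
    + apply: (measurableT_comp mnu).
      by apply: measurable_funB => //; exact: measurable_cst.
    + by move=> t _; rewrite lee_fin c1norm_ge0.
    + by rewrite lee_fin c1norm_ge0.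
have [a b c] := cFubini jm fin; split; [exact: b| |exact: a].
have E s : cint setT (fun t => w t s) = cint setT u * v s.
  have -> : (fun t => w t s) = (fun t => v s * u (t - s)).
    by apply/funext => t; rewrite /w mulrC.
  by rewrite (cintZ (v s) measurableT (cintegrable_translate s ui))
    (cint_translate s ui) mulrC.
rewrite [LHS]c -(cintZ (cint setT u) measurableT vi).
by congr (cint setT _); apply/funext => s; exact: E.
Qed.

End Convolution.

(** * Injectivity of the Laplace transform *)

Section Lerch.
Variable R : realType.
Local Notation C := R[i].
Local Notation mu := (@lebesgue_measure R).
Local Notation mR := (measurableTypeR R).
Implicit Types (u v : R -> C) (t s : R).

Definition causal u : Prop := forall t, t <= 0 -> u t = 0.

(** Damping by an exponential turns functions of exponential growth into
    integrable ones and commutes with convolution. *)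
Definition wexp (s : R) u t : C := u t * (expR (- (s * t)))%:C.

Definition Lexp (s : R) u : Prop := cintegrable setT (wexp s u).

(** Laplace transform at a real point; real points already determine the
    original. *)
Definition rlap u (s : R) : C := cint setT (wexp s u).

Lemma wexp_gt0 (s t : R) : 0 < expR (- (s * t)).
Proof. exact: expR_gt0. Qed.

Lemma measurable_expNM (s : R) : measurable_fun [set: mR] (fun t : mR => expR (- (s * t))).
Proof.
apply: (measurableT_comp (f := @expR R)); first exact: measurable_expR.
apply: (measurableT_comp (f := fun x : R => - x)); first exact: oppr_measurable.
by apply: measurable_funM; [exact: measurable_cst|exact: measurable_id].
Qed.

Lemma cmeasurable_wexp (s : R) u : cmeasurable [set: mR] u ->
  cmeasurable [set: mR] (wexp s u).
Proof.
move=> mu_; apply: (cmeasurableM mu_); apply: cmeasurable_real.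
exact: measurable_expNM.
Qed.

Lemma wexpD (s s' : R) u : wexp s (wexp s' u) = wexp (s + s') u.
Proof.
apply/funext => t; rewrite /wexp -mulrA; congr (_ * _).
rewrite -(rmorphM (real_complex R)) -expRD; congr (real_complex R (expR _)); ring.
Qed.

Lemma wexp0 u : wexp 0 u = u.
Proof. by apply/funext => t; rewrite /wexp mul0r oppr0 expR0 mulr1. Qed.

Lemma Lexp_cmeasurable (s : R) u : Lexp s u -> cmeasurable [set: mR] u.
Proof.
move=> /cintegrable_cmeasurable/(cmeasurable_wexp (- s)).
by rewrite wexpD addNr wexp0.
Qed.

Lemma LexpW (s s' : R) u : causal u -> s <= s' -> Lexp s u -> Lexp s' u.
Proof.
move=> cu ss' Lu.
apply: (cintegrable_le measurableT (cmeasurable_wexp _ (Lexp_cmeasurable Lu)) Lu).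
move=> t _; rewrite /wexp.
have [t0|t0] := leP t 0; first by rewrite cu// !mul0r lexx.
rewrite !c1normMr ler_wpM2l ?c1norm_ge0// !gtr0_norm ?expR_gt0//.
by rewrite ler_expR lerN2 ler_wpM2r// ltW.
Qed.

Lemma LexpD (s : R) u v : Lexp s u -> Lexp s v -> Lexp s (fun t => u t + v t).
Proof.
move=> Lu Lv; apply: (eq_cintegrable measurableT) (cintegrableD measurableT Lu Lv).
by move=> t _; rewrite /wexp mulrDl.
Qed.

Lemma LexpZ (s : R) u (z : C) : Lexp s u -> Lexp s (fun t => z * u t).
Proof.
move=> Lu; apply: (eq_cintegrable measurableT) (cintegrableZ z measurableT Lu).
by move=> t _; rewrite /wexp mulrA.
Qed.

Lemma rlapD (s : R) u v : Lexp s u -> Lexp s v ->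
  rlap (fun t => u t + v t) s = rlap u s + rlap v s.
Proof.
move=> Lu Lv; rewrite /rlap -(cintD measurableT Lu Lv).
by congr (cint setT _); apply/funext => t; rewrite /wexp mulrDl.
Qed.

Lemma rlapZ (s : R) u (z : C) : Lexp s u ->
  rlap (fun t => z * u t) s = z * rlap u s.
Proof.
move=> Lu; rewrite /rlap -(cintZ z measurableT Lu).
by congr (cint setT _); apply/funext => t; rewrite /wexp mulrA.
Qed.

Lemma wexp_cconv (s : R) u v : cmeasurable [set: mR] u -> cmeasurable [set: mR] v ->
  wexp s (cconv u v) = cconv (wexp s u) (wexp s v).
Proof.
move=> mu_ mv; apply/funext => t; rewrite {1}/wexp /cconv.
have mw : cmeasurable [set: mR] (fun r => u (t - r) * v r).
  exact: cmeasurableM (cmeasurable_reflect t mu_) mv.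
rewrite -(cintZ_gt0 (wexp_gt0 s t) mw); congr (cint setT _); apply/funext => r.
rewrite /wexp -!mulrA; congr (_ * _); rewrite [RHS]mulrCA; congr (_ * _).
rewrite -(rmorphM (real_complex R)) -expRD; congr (real_complex R (expR _)); ring.
Qed.

Lemma cconv_Lexp (s : R) u v : Lexp s u -> Lexp s v ->
  Lexp s (cconv u v) /\ rlap (cconv u v) s = rlap u s * rlap v s.
Proof.
move=> Lu Lv.
have [a b _] := cconv_L1 Lu Lv.
by rewrite /Lexp /rlap (wexp_cconv s (Lexp_cmeasurable Lu) (Lexp_cmeasurable Lv)).
Qed.

Lemma cconv_causal u v : causal u -> causal v -> causal (cconv u v).
Proof.
move=> cu cv t t0; rewrite /cconv (_ : (fun s => _) = fun=> 0) ?cint0//.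
apply/funext => s; have [s0|s0] := leP s 0; first by rewrite cv// mulr0.
by rewrite cu ?mul0r//; lra.
Qed.

(** A polynomial in e^-at integrates against f to zero. The induction on the
    degree carries an additional factor e^-st. *)
Lemma Rintegral_decay_factor (f : R -> R) (n : nat) (a : R) :
  (forall t, t <= 0 -> f t = 0) -> mu.-integrable setT (EFin \o f) -> 0 <= a ->
  (forall s, 0 <= s -> \int[mu]_t (f t * expR (- (s * t))) = 0) ->
  \int[mu]_t (f t * (1 - expR (- (a * t))) ^+ n) = 0.
Proof.
move=> f0 fi a0 h; have mf := integrable_measurable fi.
suff : forall s, 0 <= s -> \int[mu]_t (f t * (1 - expR (- (a * t))) ^+ n * expR (- (s * t))) = 0.
  move=> /(_ 0 (lexx _)) <-; apply: eq_Rintegral => t _.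
  by rewrite mul0r oppr0 expR0 mulr1.
have bnd (s t : R) : 0 <= s -> 0 < t -> 0 <= expR (- (s * t)) <= 1.
  move=> s0 t0; rewrite expR_ge0/= -expR0 ler_expR oppr_le0.
  by rewrite mulr_ge0// ltW.
have int k s : 0 <= s -> mu.-integrable setT
    (EFin \o (fun t => f t * (1 - expR (- (a * t))) ^+ k * expR (- (s * t)))).
  move=> s0; apply: (integrable_dominated measurableT _ (integrable_norm fi)).
    apply: measurable_funM; last exact: measurable_expNM.
    apply: measurable_funM => //; apply: measurable_funX.
    by apply: measurable_funB; [exact: measurable_cst|exact: measurable_expNM].
  move=> t _; have [t0|t0] := leP t 0; first by rewrite f0// !mul0r normr0.
  have /andP[h1 h2] := bnd a t a0 t0; have /andP[h3 h4] := bnd s t s0 t0.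
  rewrite !normrM -mulrA ler_piMr// mulr_ile1//.
    by rewrite normrX exprn_ile1// ger0_norm; lra.
  by rewrite ger0_norm.
elim: n => [|n IH] s s0.
  rewrite -[RHS](h s s0); apply: eq_Rintegral => t _.
  by rewrite expr0 mulr1.
transitivity (\int[mu]_t (f t * (1 - expR (- (a * t))) ^+ n * expR (- (s * t)) -
    f t * (1 - expR (- (a * t))) ^+ n * expR (- ((s + a) * t)))).
  apply: eq_Rintegral => t _; rewrite mulrDl opprD expRD exprSr; ring.
rewrite (RintegralB measurableT (int n s s0) (int n (s + a) (addr_ge0 s0 a0))).
by rewrite !IH ?addr_ge0// subrr.
Qed.

Lemma bernoulli (x : R) (n : nat) : 0 <= x <= 1 -> 1 - n%:R * x <= (1 - x) ^+ n.
Proof.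
move=> /andP[x0 x1]; elim: n => [|n IH]; first by rewrite mul0r subr0 expr0.
rewrite exprSr -natr1.
have h : (1 - n%:R * x) * (1 - x) <= (1 - x) ^+ n * (1 - x) by rewrite ler_wpM2r// subr_ge0.
apply: le_trans h; have : 0 <= n%:R * x ^+ 2 by rewrite mulr_ge0 ?sqr_ge0.
rewrite expr2; nra.
Qed.

Lemma bernoulli_inv (x : R) (n : nat) : 0 <= x <= 1 ->
  (1 - x) ^+ n * (1 + n%:R * x) <= 1.
Proof.
move=> /andP[x0 x1].
have h : 1 + n%:R * x <= (1 + x) ^+ n.
  elim: n => [|n IH]; first by rewrite mul0r addr0 expr0.
  rewrite exprSr -natr1.
  have h : (1 + n%:R * x) * (1 + x) <= (1 + x) ^+ n * (1 + x) by rewrite ler_wpM2r// addr_ge0.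
  apply: le_trans h; have : 0 <= n%:R * x ^+ 2 by rewrite mulr_ge0 ?sqr_ge0.
  rewrite expr2; nra.
apply: (@le_trans _ _ ((1 - x) ^+ n * (1 + x) ^+ n)).
  by rewrite ler_wpM2l// exprn_ge0// subr_ge0.
rewrite -exprMn exprn_ile1//; nra.
Qed.

(** Double exponentials of this kind are a boundedly convergent approximation
    of an indicator function by polynomials in $e^{-at}$. *)
Lemma decay_factor_cvg (x : R) : 0 <= x <= 1 -> x != 2^-1 ->
  (fun q => (1 - x ^+ q) ^+ (2 ^ q)) @ \oo --> ((x < 2^-1)%R%:R : R).
Proof.
move=> /andP[x0 x1] xh.
have xq (q : nat) : 0 <= x ^+ q <= 1 by rewrite exprn_ge0// exprn_ile1.
have e2 (q : nat) : ((2 ^ q)%:R * x ^+ q) = (2 * x) ^+ q by rewrite natrX exprMn.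
have [xl|xg] := ltP x 2^-1.
  have h : (fun q : nat => (2 * x) ^+ q) @ \oo --> (0 : R).
    by apply: cvg_expr; rewrite ger0_norm; lra.
  have h' : (fun q : nat => 1 - (2 * x) ^+ q) @ \oo --> (1%:R : R).
    by rewrite -[X in _ --> X]subr0; apply: cvgB => //; exact: cvg_cst.
  apply: (@squeeze_cvgr _ _ _ _ (fun q : nat => 1 - (2 * x) ^+ q) (fun=> 1)) => //.
    apply: nearW => q; rewrite -e2 bernoulli//=.
    by rewrite exprn_ile1//; have /andP[] := xq q; lra.
  exact: cvg_cst.
have x2 : 1 < 2 * x.
  have h : 2^-1 < x by rewrite lt_neqAle eq_sym xh.
  lra.
have x2' : 0 < 2 * x by lra.
have h : (fun q : nat => ((2 * x)^-1) ^+ q) @ \oo --> (0 : R).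
  by apply: cvg_expr; rewrite ger0_norm ?invr_ge0 ?(ltW x2')// invf_lt1.
apply: (@squeeze_cvgr _ _ _ _ (fun=> 0) (fun q : nat => ((2 * x)^-1) ^+ q)) => //;
  last exact: cvg_cst.
apply: nearW => q.
have /andP[q0 q1] := xq q.
rewrite exprn_ge0 ?subr_ge0//= exprVn -[leLHS](mulfK (x := (2 * x) ^+ q)); last first.
  by rewrite gt_eqF// exprn_gt0.
rewrite ler_piMl ?invr_ge0 ?exprn_ge0 ?(ltW x2')//.
have := @bernoulli_inv (x ^+ q) (2 ^ q) (xq q); rewrite e2 => hb.
apply: le_trans hb; rewrite ler_wpM2l ?exprn_ge0 ?subr_ge0// ?exprn_ge0 ?lerDr//.
Qed.

(** With the rate c such that e^-ct = 1/2 at t = a, the approximations of the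
    indicator show that f has integral zero over every ]a, +oo[; hence its
    primitive vanishes, and so does f by Lebesgue differentiation. *)
Lemma real_lerch (f : R -> R) :
  (forall t, t <= 0 -> f t = 0) -> mu.-integrable setT (EFin \o f) ->
  (forall s, 0 <= s -> \int[mu]_t (f t * expR (- (s * t))) = 0) ->
  {ae mu, forall t, f t = 0}.
Proof.
move=> f0 fi h; have mf := integrable_measurable fi.
have tail (a : R) : 0 < a -> \int[mu]_t (f t * (a < t)%R%:R) = 0.
  move=> a0; pose et := ln 2 / a.
  have ln20 : 0 < ln (2 : R) by rewrite ln_gt0// ltr1n.
  have et0 : 0 < et by rewrite divr_gt0.
  pose x t := expR (- (et * t)).
  have xa t : 0 < t -> (x t < 2^-1) = (a < t).
    have e2 : expR (ln 2) = 2 :> R by apply: lnK; rewrite posrE.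
    move=> t0; rewrite /x expRN ltf_pV2 ?posrE ?expR_gt0// -[X in (X < _)]e2.
    by rewrite ltr_expR /et mulrAC ltr_pdivlMr// ltr_pM2l.
  have xn t : t != a -> x t != 2^-1.
    apply: contra => /eqP; rewrite /x expRN => /invr_inj/(congr1 (@ln R)).
    rewrite expRK => e; apply/eqP/(mulfI (lt0r_neq0 et0)).
    by rewrite e /et divfK// gt_eqF.
  have xb t : 0 < t -> 0 <= x t <= 1.
    move=> t0; rewrite expR_ge0/= -expR0 ler_expR oppr_le0.
    by rewrite mulr_ge0// ltW.
  have mx : measurable_fun [set: mR] x by exact: measurable_expNM.
  pose f_ q t := f t * (t != a)%:R * (1 - x t ^+ q) ^+ (2 ^ q).
  pose g t := f t * (t != a)%:R * (a < t)%R%:R.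
  have mna : measurable_fun [set: mR] (fun t => ((t != a)%:R : R)).
    have -> : (fun t : R => ((t != a)%:R : R)) = \1_(~` [set a]).
      apply/funext => t; rewrite indicE; congr (nat_of_bool _)%:R.
      by apply/idP/idP => [/eqP ta|]; [rewrite inE|rewrite inE => /eqP].
    by apply: measurable_indic; apply: measurableC; exact: measurable_set1.
  have mgt : measurable_fun [set: mR] (fun t => ((a < t)%R%:R : R)).
    have -> : (fun t : R => ((a < t)%R%:R : R)) = \1_(`]a, +oo[%classic).
      apply/funext => t; rewrite indicE; congr (nat_of_bool _)%:R.
      by apply/idP/idP => [ta|]; rewrite ?inE/= ?in_itv/= ?andbT.
    by apply: measurable_indic; exact: measurable_Ritv.
  have mf_ q : measurable_fun [set: mR] (f_ q).
    apply: measurable_funM; first exact: measurable_funM.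
    apply: measurable_funX; apply: measurable_funB; first exact: measurable_cst.
    exact: measurable_funX.
  have [|t _|q t _|_ H] := @Rintegral_dct R setT f_ g (fun t => `|f t|) measurableT
    mf_ _ _ (integrable_norm fi).
  - by apply: measurable_funM => //; exact: measurable_funM.
  - have [t0|t0] := leP t 0.
      have -> : g t = 0 by rewrite /g f0// !mul0r.
      have -> : f_ ^~ t = fun=> 0 by apply/funext => q; rewrite /f_ f0// !mul0r.
      exact: cvg_cst.
    have [->|ta] := eqVneq t a.
      have -> : g a = 0 by rewrite /g eqxx mulr0 mul0r.
      have -> : f_ ^~ a = fun=> 0 by apply/funext => q; rewrite /f_ eqxx mulr0 mul0r.
      exact: cvg_cst.
    rewrite /g /f_ -(xa t t0); apply: cvgM; first exact: cvg_cst.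
    by apply: decay_factor_cvg; [exact: xb|exact: xn].
  - have [t0|t0] := leP t 0; first by rewrite /f_ f0// !mul0r normr0.
    have /andP[h1 h2] := xb t t0.
    rewrite /f_ !normrM -mulrA ler_piMr// mulr_ile1//; first by case: (t != a); rewrite ?normr1 ?normr0.
    rewrite normrX exprn_ile1// ger0_norm ?subr_ge0 ?exprn_ile1//.
    by rewrite lerBlDr lerDl exprn_ge0.
  have Z q : \int[mu]_t f_ q t = 0.
    have := @Rintegral_decay_factor f (2 ^ q) (et * q%:R) f0 fi (mulr_ge0 (ltW et0) (ler0n _ _)) h.
    move=> <-; apply: Rintegral_ae => //.
      apply: measurable_funM => //; apply: measurable_funX.
      by apply: measurable_funB; [exact: measurable_cst|exact: measurable_expNM].
    have na : {ae mu, forall t, t != a}.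
      exists [set a]; split; [exact: measurable_set1|exact: lebesgue_measure_set1|].
      by move=> t /= /negP; rewrite negbK => /eqP.
    apply: ae_imply na _ => t ta _; rewrite /f_ ta mulr1; congr (_ * (1 - _) ^+ _).
    by rewrite /x -expRM_natl; congr expR; ring.
  have -> : \int[mu]_t (f t * (a < t)%R%:R) = \int[mu]_t g t.
    apply: eq_Rintegral => t _; rewrite /g.
    by have [->|_] := eqVneq t a; rewrite ?ltxx ?mulr0// mulr1.
  have ZE : (fun q => \int[mu]_t f_ q t) = fun=> 0 by apply/funext => q; exact: Z.
  by move: H; rewrite ZE => H; exact: (cvg_unique _ H (cvg_cst (0 : R))).
have F0 (y : R) : \int[mu]_(t in `]-oo, y]) f t = 0.
  rewrite Rintegral_mkcond.
  have [y0|y0] := leP y 0.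
    rewrite (_ : f \_ _ = fun=> 0); first by rewrite /Rintegral integral0.
    apply/funext => t; rewrite patchE; case: ifPn => //; rewrite inE/= in_itv/= => ty.
    by rewrite f0// (le_trans ty).
  have i1 : mu.-integrable setT (EFin \o (fun t => f t * (y < t)%R%:R)).
    apply: (integrable_dominated measurableT _ (integrable_norm fi)).
      apply: measurable_funM => //.
      have -> : (fun t : R => ((y < t)%R%:R : R)) = \1_(`]y, +oo[%classic).
        apply/funext => t; rewrite indicE; congr (nat_of_bool _)%:R.
        by apply/idP/idP => [ta|]; rewrite ?inE/= ?in_itv/= ?andbT.
      by apply: measurable_indic; exact: measurable_Ritv.
    by move=> t _; rewrite normrM ler_piMr//; case: (y < t); rewrite ?normr1 ?normr0.
  have hh := h 0 (lexx _).
  transitivity (\int[mu]_t (f t - f t * (y < t)%R%:R)).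
    apply: eq_Rintegral => t _; rewrite patchE; case: ifPn; rewrite ?inE/= ?in_itv/= ?notin_setE/= ?in_itv/=.
      by move=> ty; rewrite ltNge ty mulr0 subr0.
    by move=> /negP; rewrite -ltNge => ->; rewrite mulr1 subrr.
  rewrite (RintegralB measurableT fi i1) tail// subr0 -[RHS]hh.
  by apply: eq_Rintegral => t _; rewrite mul0r oppr0 expR0 mulr1.
have li : locally_integrable [set: R] f.
  by apply: open_integrable_locally => //; exact: openT.
have fiy (y : R) : mu.-integrable `]-oo, y] (EFin \o f).
  exact: (integrable_Rsub measurableT (measurable_Ritv `]-oo, y]) (@subsetT _ _) fi).
have := @FTC1Ny R f fiy li.
have -> : (fun x : R => \int[mu]_(t in `]-oo, x]) f t) = fun=> 0.
  by apply/funext => y; exact: F0.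
move=> H; apply: ae_imply H _ => t [_ <-].
by rewrite derive1_cst.
Qed.

(** After damping by e^(-s0 t) each component satisfies the real statement. *)
Theorem lerch u (s0 : R) : causal u -> Lexp s0 u ->
  (forall s, s0 <= s -> rlap u s = 0) -> {ae mu, forall t, u t = 0}.
Proof.
move=> cu Lu hu; have [i1 i2] := Lu.
have E (s t : R) : wexp s0 u t * (expR (- (s * t)))%:C = wexp (s0 + s) u t.
  by rewrite -/(wexp s (wexp s0 u) t) wexpD addrC.
have rl : {ae mu, forall t, complex.Re (wexp s0 u t) = 0}.
  apply: real_lerch => // [t t0|s sp]; first by rewrite /wexp cu// mul0r.
  have hs : s0 <= s0 + s by rewrite lerDl.
  have /(congr1 (@complex.Re R)) /= <- := hu _ hs.
  rewrite /rlap /cint /=; apply: eq_Rintegral => t _.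
  by rewrite -E [RHS]cReM /= mulr0 subr0.
have im : {ae mu, forall t, complex.Im (wexp s0 u t) = 0}.
  apply: real_lerch => // [t t0|s sp]; first by rewrite /wexp cu// mul0r.
  have hs : s0 <= s0 + s by rewrite lerDl.
  have /(congr1 (@complex.Im R)) /= <- := hu _ hs.
  rewrite /rlap /cint /=; apply: eq_Rintegral => t _.
  by rewrite -E [RHS]cImM /= mulr0 add0r.
apply: ae_imply (ae_and rl im) _ => t [h1 h2].
have : wexp s0 u t = 0 by apply: cplxP.
rewrite /wexp => /eqP; rewrite mulf_eq0 => /orP[/eqP//|/eqP[] /eqP].
by rewrite gt_eqF// expR_gt0.
Qed.

End Lerch.

(** * Dominated series and the binomial series *)

Section ComplexSeries.
Variable R : realType.
Local Notation C := R[i].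
Local Notation mu := (@lebesgue_measure R).
Local Notation mR := (measurableTypeR R).
Implicit Types (t s : R) (z w l : C).

Definition psum (a : nat -> C) (p : nat) : C := \sum_(0 <= j < p) a j.

(** Majorants of complex series are kept together with their sums, which then
    serve as explicit bounds. *)
Definition has_sum (c : nat -> R) (S : R) : Prop :=
  (forall j, 0 <= c j) /\ (fun p => \sum_(0 <= j < p) c j) @ \oo --> S.

Lemma has_sum_le c S p : has_sum c S -> \sum_(0 <= j < p) c j <= S.
Proof.
move=> [c0 cS]; apply: (cvgr_to_ge cS).
near=> q; have pq : (p <= q)%N by near: q; exact: nbhs_infty_ge.
rewrite (big_cat_nat (leq0n p) pq)//= lerDl sumr_ge0//.
Unshelve. all: by end_near. Qed.

Lemma has_sum_geometric (x : R) : 0 <= x < 1 -> has_sum (fun j => x ^+ j) (1 - x)^-1.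
Proof.
move=> /andP[x0 x1]; split=> [j|]; first exact: exprn_ge0.
have := @cvg_geometric_series R 1 x; rewrite ger0_norm// div1r => /(_ x1).
by apply: cvg_trans; apply: near_eq_cvg; near=> p; apply: eq_bigr => j _; rewrite /= mul1r.
Unshelve. all: by end_near. Qed.

Lemma has_sumZ c S (k : R) : 0 <= k -> has_sum c S -> has_sum (fun j => k * c j) (k * S).
Proof.
move=> k0 [c0 cS]; split=> [j|]; first exact: mulr_ge0.
under eq_fun do rewrite -mulr_sumr.
by apply: cvgM => //; exact: cvg_cst.
Qed.

Lemma c1norm_psum_sub a c (p q : nat) : (forall j, c1norm (a j) <= c j) -> (p <= q)%N ->
  c1norm (psum a q - psum a p) <= \sum_(0 <= j < q) c j - \sum_(0 <= j < p) c j.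
Proof.
move=> ac pq; rewrite /psum (big_cat_nat (leq0n p) pq)//= addrAC subrr add0r.
rewrite (big_cat_nat (leq0n p) pq (F := c))//= addrAC subrr add0r.
by apply: le_trans (c1norm_sum _ _ _) _; apply: ler_sum.
Qed.

Lemma real_series_cvg (a c : nat -> R) S : has_sum c S -> (forall j, `|a j| <= c j) ->
  cvg ((fun p => \sum_(0 <= j < p) a j) @ \oo).
Proof.
move=> [c0 cS] ac; apply: (@normed_cvg _ _ a).
apply: (@series_le_cvg _ _ c) => //; last by apply/cvg_ex; exists S.
by move=> j; exact: normr_ge0.
Qed.

Lemma csum_cvg a c S : has_sum c S -> (forall j, c1norm (a j) <= c j) ->
  ccvg (psum a) (csum a).
Proof.
move=> cS ac; split.
  have := @real_series_cvg (fun j => complex.Re (a j)) c S cS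
    (fun j => le_trans (normRe_le _) (ac j)).
  by rewrite /csum /= /psum; under eq_fun do rewrite -cRe_sum.
have := @real_series_cvg (fun j => complex.Im (a j)) c S cS
  (fun j => le_trans (normIm_le _) (ac j)).
by rewrite /csum /= /psum; under eq_fun do rewrite -cIm_sum.
Qed.

Lemma ccvg_csum a z : ccvg (psum a) z -> csum a = z.
Proof.
by move=> [h1 h2]; apply: cplxP; rewrite /csum /=; apply/cvg_lim => //; exact: Rhausdorff.
Qed.


Lemma csum_tail a c S p : has_sum c S -> (forall j, c1norm (a j) <= c j) ->
  c1norm (csum a - psum a p) <= S - \sum_(0 <= j < p) c j.
Proof.
move=> cS ac; have h := csum_cvg cS ac.
have h2 := ccvg_norm (ccvgD h (ccvg_cst (- psum a p))).
apply: (cvgr_to_le h2); near=> q.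
have pq : (p <= q)%N by near: q; exact: nbhs_infty_ge.
apply: le_trans (c1norm_psum_sub ac pq) _.
by rewrite lerD2r has_sum_le.
Unshelve. all: by end_near. Qed.

Lemma csum_bound a c S : has_sum c S -> (forall j, c1norm (a j) <= c j) ->
  c1norm (csum a) <= S.
Proof.
move=> cS ac; have := csum_tail 0 cS ac.
by rewrite /psum !big_nil !subr0.
Qed.

Lemma psumZ z a p : psum (fun j => z * a j) p = z * psum a p.
Proof. by rewrite /psum mulr_sumr. Qed.


Lemma ccont_pos_psum (F : nat -> R -> C) p : (forall j, ccont_pos (F j)) ->
  ccont_pos (fun t => psum (F ^~ t) p).
Proof.
move=> cF; elim: p => [|p IH].
  rewrite (_ : (fun t => _) = fun=> 0); first exact: ccont_pos_cst.
  by apply/funext => t; rewrite /psum big_nil.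
rewrite (_ : (fun t => _) = fun t => psum (F ^~ t) p + F p t).
  exact: ccont_posD.
by apply/funext => t; rewrite /psum big_nat_recr.
Qed.

Section DominatedSeries.
Variables (F : nat -> R -> C) (c : nat -> R) (S : R) (W : R -> R).
Hypothesis cS : has_sum c S.
Hypothesis W0 : forall t, 0 < t -> 0 <= W t.
Hypothesis cW : forall t, 0 < t -> {for t, continuous W}.
Hypothesis FW : forall j t, 0 < t -> c1norm (F j t) <= c j * W t.
Hypothesis cF : forall j, ccont_pos (F j).

Definition csumf t : C := csum (F ^~ t).

Let has_sumW t : 0 < t -> has_sum (fun j => c j * W t) (S * W t).
Proof.
move=> t0; have := has_sumZ (W0 t0) cS.
by rewrite mulrC; under eq_fun do rewrite mulrC.
Qed.

Lemma csumf_bound t : 0 < t -> c1norm (csumf t) <= S * W t.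
Proof. by move=> t0; apply: (csum_bound (has_sumW t0)) => j; exact: FW. Qed.

Lemma csumf_cvg t : 0 < t -> ccvg (psum (F ^~ t)) (csumf t).
Proof. by move=> t0; apply: (csum_cvg (has_sumW t0)) => j; exact: FW. Qed.

Lemma csumf_tail t p : 0 < t ->
  c1norm (csumf t - psum (F ^~ t) p) <= (S - \sum_(0 <= j < p) c j) * W t.
Proof.
move=> t0; have := @csum_tail (F ^~ t) _ _ p (has_sumW t0) (fun j => FW j t0).
by rewrite mulrBl mulr_suml.
Qed.

Lemma real_uniform_tail (f : R -> R) (g : nat -> R -> R) t :
  (forall s p, 0 < s -> `|f s - g p s| <= (S - \sum_(0 <= j < p) c j) * W s) ->
  (forall p, {for t, continuous (g p)}) -> 0 < t -> {for t, continuous f}.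
Proof.
move=> fg cg t0.
have [B B0 HB] : exists2 B : R, 0 < B & \forall s \near t, 0 < s /\ W s <= B.
  exists (W t + 1); first by rewrite ltr_wpDl// W0.
  near=> s; split; first by near: s; exact: lt_nbhsr.
  apply: ltW; near: s; have := cW t0 => /cvgr_lt; apply; by rewrite ltrDl.
apply/cvgrPdist_le => e e0.
have e3 : 0 < e / 3 / B by rewrite !divr_gt0.
have [p Hp] : exists p : nat, S - \sum_(0 <= j < p) c j <= e / 3 / B.
  have /cvgrPdist_le/(_ _ e3)[p _ Hp] := proj2 cS.
  by exists p; apply: le_trans (ler_norm _) (Hp p _) => /=.
have tail s : 0 < s -> W s <= B -> `|f s - g p s| <= e / 3.
  move=> s0 sB; apply: le_trans (fg s p s0) _.
  apply: (@le_trans _ _ (e / 3 / B * B)); last by rewrite divfK// gt_eqF.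
  apply: ler_pM => //; [by rewrite subr_ge0 has_sum_le|exact: W0].
have Bt : W t <= B by have [] := nbhs_singleton HB.
near=> s.
have [s0 sB] : 0 < s /\ W s <= B by near: s.
have h1 := tail s s0 sB; have h2 := tail t t0 Bt.
have h3 : `|g p t - g p s| <= e / 3.
  by near: s; have /cvgrPdist_le := cg p; apply; rewrite divr_gt0.
have -> : f t - f s = (f t - g p t) + (g p t - g p s) - (f s - g p s) by ring.
apply: le_trans (ler_normB _ _) _.
have h4 := ler_normD (f t - g p t) (g p t - g p s).
lra.
Unshelve. all: by end_near. Qed.

Lemma csumf_ccont_pos : ccont_pos csumf.
Proof.
move=> t t0; split.
  apply: (@real_uniform_tail _ (fun p s => complex.Re (psum (F ^~ s) p))) => //.
  - move=> s p s0; rewrite -cReN -cReD.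
    exact: le_trans (normRe_le _) (csumf_tail p s0).
  - by move=> p; have [] := ccont_pos_psum p cF t0.
apply: (@real_uniform_tail _ (fun p s => complex.Im (psum (F ^~ s) p))) => //.
- move=> s p s0; rewrite -cImN -cImD.
  exact: le_trans (normIm_le _) (csumf_tail p s0).
- by move=> p; have [] := ccont_pos_psum p cF t0.
Qed.

(** The partial sums are dominated by S W |e|, which gives termwise integration. *)
Lemma cint_csumf (e : R -> C) : ccont_pos e ->
  mu.-integrable `]0, +oo[ (EFin \o (fun t => W t * c1norm (e t))) ->
  ccvg (psum (fun j => cint `]0, +oo[ (fun t => F j t * e t)))
    (cint `]0, +oo[ (fun t => csumf t * e t)).
Proof.
move=> ce We.
have mI := @measurable_Ritv R `]0, +oo[.
have S0 : 0 <= S by have := has_sum_le 0 cS; rewrite big_nil.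
have iF j : cintegrable `]0, +oo[ (fun t => F j t * e t).
  apply: (cintegrable_dominated mI _ (integrable_RZ (c j) mI We)).
    exact: ccont_pos_cmeasurable (ccont_posM (cF j) ce).
  move=> t; rewrite /= in_itv/= andbT => t0.
  apply: le_trans (c1normM _ _) _; rewrite mulrA ler_wpM2r ?c1norm_ge0//.
  exact: FW.
have E p : cint `]0, +oo[ (fun t => psum (F ^~ t) p * e t) =
    psum (fun j => cint `]0, +oo[ (fun t => F j t * e t)) p /\
    cintegrable `]0, +oo[ (fun t => psum (F ^~ t) p * e t).
  elim: p => [|p [IH1 IH2]].
    have -> : (fun t => psum (F ^~ t) 0 * e t) = fun=> 0.
      by apply/funext => t; rewrite /psum big_nil mul0r.
    rewrite /psum big_nil; split; first exact: cint0.
    by split; exact: integrable0.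
  have -> : (fun t => psum (F ^~ t) p.+1 * e t) =
      (fun t => psum (F ^~ t) p * e t + F p t * e t).
    by apply/funext => t; rewrite /psum big_nat_recr//= mulrDl.
  split; last exact: cintegrableD.
  by rewrite cintD// IH1 /psum big_nat_recr.
have [_ H] : cintegrable `]0, +oo[ (fun t => csumf t * e t) /\
    ccvg (fun p => cint `]0, +oo[ (fun t => psum (F ^~ t) p * e t))
      (cint `]0, +oo[ (fun t => csumf t * e t)).
  apply: (cint_dct mI _ _ _ (integrable_RZ S mI We)).
  - by move=> p; apply: ccont_pos_cmeasurable; apply: ccont_posM => //; exact: ccont_pos_psum.
  - by apply: ccont_pos_cmeasurable; apply: ccont_posM => //; exact: csumf_ccont_pos.
  - move=> t; rewrite /= in_itv/= andbT => t0.
    by apply: ccvgM (ccvg_cst _); exact: csumf_cvg.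
  - move=> p t; rewrite /= in_itv/= andbT => t0.
    apply: le_trans (c1normM _ _) _; rewrite mulrA ler_wpM2r ?c1norm_ge0//.
    apply: le_trans (c1norm_sum _ _ _) _.
    apply: (@le_trans _ _ (\sum_(0 <= j < p) c j * W t)).
      by apply: ler_sum => j _; exact: FW.
    by rewrite -mulr_suml ler_wpM2r ?W0// has_sum_le.
move: H; rewrite (_ : (fun p => cint _ _) = psum (fun j => cint `]0, +oo[ (fun t => F j t * e t))) //.
by apply/funext => p; have [] := E p.
Qed.

End DominatedSeries.

(** ** The binomial series *)

(** The coefficients of (1 - w)^-l. *)
Definition bcoef l (u : nat) : C := cpoch l u / u`!%:R.

Lemma natC_neq0 (n : nat) : (n.+1%:R : C) != 0.
Proof. by rewrite pnatr_eq0. Qed.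

Lemma bcoef0 l : bcoef l 0 = 1.
Proof. by rewrite /bcoef /cpoch big_ord0 fact0 divr1. Qed.

Lemma bcoefS l u : u.+1%:R * bcoef l u.+1 = (l + u%:R) * bcoef l u.
Proof.
rewrite /bcoef /cpoch big_ord_recr /= factS natrM.
have f0 : (u`!%:R : C) != 0 by rewrite pnatr_eq0 -lt0n fact_gt0.
by field; rewrite f0 addrC natr1 natC_neq0.
Qed.

(** Divided by u!, the product is a binomial coefficient, at most a power of 2. *)
Lemma rising_le (J u : nat) : (\prod_(i < u) (J + i) <= u`! * 2 ^ (J + u))%N.
Proof.
elim: J u => [|J IHJ] u.
  case: u => [|u]; first by rewrite big_ord0.
  by rewrite big_ord_recl /= mul0n.
elim: u => [|u IHu]; first by rewrite big_ord0 fact0 mul1n expn_gt0.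
have E : (\prod_(i < u.+1) (J.+1 + i) =
    u.+1 * \prod_(i < u) (J.+1 + i) + \prod_(i < u.+1) (J + i))%N.
  rewrite big_ord_recr [X in (_ = _ + X)%N]big_ord_recl /= addn0.
  have -> : (\prod_(i < u) (J + bump 0 i) = \prod_(i < u) (J.+1 + i))%N.
    by apply: eq_bigr => i _; rewrite /bump /= add1n addnS addSn.
  by rewrite mulnC -mulnDl addSnnS addnC.
rewrite E (leq_trans (leq_add (leq_mul (leqnn u.+1) IHu) (IHJ u.+1)))//.
rewrite mulnA -factS addSnnS -mulnDr addnn -mul2n -expnS.
by rewrite !addSn.
Qed.

Lemma cnorm_nat (n : nat) : cnorm (n%:R : C) = n%:R.
Proof. by rewrite -(rmorph_nat (real_complex R)) cnorm_real ger0_norm. Qed.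

Lemma cnorm_prod (I : Type) (r : seq I) (P : pred I) (G : I -> C) :
  cnorm (\prod_(i <- r | P i) G i) = \prod_(i <- r | P i) cnorm (G i).
Proof. by elim/big_rec2: _ => [|i x y _ <-]; rewrite ?cnorm1// cnormM. Qed.

Lemma cnorm_bcoef l (J u : nat) : cnorm l <= J%:R ->
  cnorm (bcoef l u) <= 2 ^+ (J + u).
Proof.
move=> lJ; rewrite /bcoef cnormM cnormV cnorm_nat /cpoch cnorm_prod.
have f0 : (0 : R) < u`!%:R by rewrite ltr0n fact_gt0.
rewrite ler_pdivrMr// -natrX -natrM mulnC.
apply: le_trans (_ : (\prod_(i < u) (J + i))%N%:R <= _); last by rewrite ler_nat rising_le.
rewrite natr_prod; apply: ler_prod => i _; rewrite cnorm_ge0/= natrD.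
by apply: le_trans (cnormD _ _) _; rewrite cnorm_nat lerD2r.
Qed.

(** The recurrence of the coefficients makes the sum telescope; only its last
    term remains. *)
Lemma binomial_partial_ode l w (s : R) (p : nat) :
  (1 - w * s%:C) * psum (fun u => bcoef l u * w ^+ u * (u%:R * s%:C ^+ u.-1)) p -
  l * w * psum (fun u => bcoef l u * (w * s%:C) ^+ u) p =
  - (p%:R * bcoef l p * w ^+ p * s%:C ^+ p.-1).
Proof.
elim: p => [|p IH]; first by rewrite /psum !big_nil !mul0r !mulr0 subr0 oppr0.
have e : p.+1%:R * bcoef l p.+1 * w ^+ p.+1 * s%:C ^+ p.+1.-1 =
    (l + p%:R) * bcoef l p * w ^+ p.+1 * s%:C ^+ p by rewrite bcoefS.
rewrite e /psum !big_nat_recr//= -!/(psum _ p) !mulrDr opprD addrACA IH exprMn.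
case: p {IH e} => [|p] /=; first by rewrite !mul0r !mulr0 expr0 expr1; ring.
rewrite (exprS s%:C p) (exprS w p.+1); ring.
Qed.

Lemma clog_small w (s : R) : cnorm w <= 8^-1 -> 0 <= s <= 1 ->
  [/\ 2^-1 <= complex.Re (1 - w * s%:C), 2^-1 <= cnorm (1 - w * s%:C) &
      cnorm (clog (1 - w * s%:C)) <= 1 + pi].
Proof.
move=> w8 /andP[s0 s1].
have ws : cnorm (w * s%:C) <= 8^-1.
  by rewrite cnormM cnorm_real ger0_norm// (le_trans _ w8)// ler_piMr ?cnorm_ge0.
have re : 2^-1 <= complex.Re (1 - w * s%:C).
  rewrite cReD cReN /=; have := le_trans (ler_norm _) (le_trans (normRe_le_cnorm (w * s%:C)) ws).
  by rewrite [complex.Re (w * _)]cReM /= mulr0 subr0; lra.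
have n1 : 2^-1 <= cnorm (1 - w * s%:C).
  exact: le_trans re (le_trans (ler_norm _) (normRe_le_cnorm _)).
have n2 : cnorm (1 - w * s%:C) <= 2.
  apply: le_trans (cnormD _ _) _; rewrite -(mulN1r (w * _)) cnormM cnorm1.
  rewrite (_ : cnorm (-1) = 1); last by rewrite cnormE /= sqrrN expr1n oppr0 expr0n addr0 sqrtr1.
  by rewrite mul1r; lra.
split => //.
have z0 : 1 - w * s%:C != 0.
  by apply/eqP => z; move: re; rewrite z /= leNgt invr_gt0 ltr0n.
apply: le_trans (cnorm_le_c1norm _) _; rewrite /c1norm /clog /=.
apply: lerD; last exact: norm_carg.
have n0 : 0 < cnorm (1 - w * s%:C) by apply: lt_le_trans n1; rewrite invr_gt0.
have l2 : ln (2 : R) <= 1 by have := @ln_sublinear R 1 ltr01; have := @le_ln1Dx R 1; rewrite ln1; lra.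
rewrite ler_norml; apply/andP; split.
  rewrite (le_trans (_ : -1 <= - ln 2))// ?lerN2//.
  by rewrite -lnV ?posrE// ler_ln ?posrE ?invr_gt0.
by rewrite (le_trans _ l2)// ler_ln ?posrE.
Qed.

(** The product of the p-th partial sum at ws with $(1 - ws)^l$ has a
    derivative in s that contains only the last term of the sum, which tends to
    zero; hence it is nearly constant, with value 1 at s = 0. *)
Theorem binomial_series l w : cnorm w <= 8^-1 ->
  ccvg (psum (fun u => bcoef l u * w ^+ u)) (cpow (1 - w) (- l)).
Proof.
move=> w8.
pose v (s : R) := cexp (l * clog (1 + (- w) * s%:C)).
pose Sp p (s : R) := psum (fun u => bcoef l u * (w * s%:C) ^+ u) p.
pose dS p (s : R) := psum (fun u => bcoef l u * w ^+ u * (u%:R * s%:C ^+ u.-1)) p.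
have zE (s : R) : 1 + (- w) * s%:C = 1 - w * s%:C by rewrite mulNr.
have dSp p (s : R) : cis_derive (Sp p) s (dS p s).
  apply: cis_derive_sum => u; apply: cis_derive_eq.
    rewrite (_ : (fun s => _) = fun s : R => bcoef l u * w ^+ u * (s%:C ^+ u)); last first.
      by apply/funext => r; rewrite exprMn mulrA.
    apply: cis_deriveZ; apply: cis_derive_exprn; apply: cis_derive_real.
  by rewrite (_ : 1%:C = 1)// mulr1.
pose J := (Num.truncn (cnorm l)).+1.
have lJ : cnorm l <= J%:R by rewrite ltW// truncnS_gt.
pose V := expR (cnorm l * (1 + pi)) : R.
have vb (s : R) : 0 <= s <= 1 -> cnorm (v s) <= V.
  move=> hs; rewrite /v cnorm_cexp ler_expR zE.
  have [_ _ h] := clog_small w8 hs.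
  apply: le_trans (le_trans (ler_norm _) (normRe_le_cnorm _)) _.
  by rewrite cnormM ler_wpM2l ?cnorm_ge0.
pose P p s := Sp p s * v s.
pose dP p s := - (p%:R * bcoef l p * w ^+ p * s%:C ^+ p.-1) * (v s / (1 - w * s%:C)).
have dPp p (s : R) : 0 <= s <= 1 -> cis_derive (P p) s (dP p s).
  move=> hs; have [h _ _] := clog_small w8 hs.
  have re : 0 < complex.Re (1 + (- w) * s%:C).
    by rewrite zE; apply: lt_le_trans h; rewrite invr_gt0.
  apply: cis_derive_eq (cis_deriveM (dSp p s) (cis_derive_cpow_line l re)) _.
  rewrite /dP -binomial_partial_ode -/(Sp p s) -/(dS p s) -/(v s) zE.
  field; apply/eqP => z; move: re; rewrite zE z /= ltxx.
  by [].
have bound p : c1norm (P p.+1 1 - P p.+1 0) <= (8 * V * 2 ^+ J * 4^-1) * 2^-1 ^+ p.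
  apply: le_trans (_ : 2 * (4 * V * 2 ^+ J * 4^-1 * 2^-1 ^+ p) <= _); last first.
    by rewrite le_eqVlt; apply/orP; left; apply/eqP; ring.
  apply: (@cis_derive_bound R (P p.+1) (dP p.+1)); first by move=> s; exact: dPp.
  move=> s hs; have /andP[s0 s1] := hs; apply: le_trans (c1norm_le_cnorm _) _.
  have [_ h _] := clog_small w8 hs.
  rewrite /dP mulNr -mulN1r cnormM (_ : cnorm (-1) = 1); last first.
    by rewrite cnormE /= sqrrN expr1n oppr0 expr0n addr0 sqrtr1.
  rewrite mul1r (cnormM (_ * s%:C ^+ p)) (cnormM (v s)) (cnormM _ (s%:C ^+ p)).
  rewrite (cnormM _ (w ^+ _)) (cnormM p.+1%:R) cnormV cnorm_nat.
  have -> : cnorm (w ^+ p.+1) = cnorm w ^+ p.+1.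
    by elim: p.+1 => [|q IH]; rewrite ?expr0 ?cnorm1// !exprS cnormM IH.
  have sle : cnorm (s%:C ^+ p) <= 1.
    rewrite -rmorphXn cnorm_real ger0_norm ?exprn_ge0// exprn_ile1//.
  have wle : cnorm w ^+ p.+1 <= 8^-1 ^+ p.+1.
    by rewrite lerXn2r ?nnegrE ?cnorm_ge0.
  have ple : (p.+1%:R : R) <= 2 ^+ p by rewrite -natrX ler_nat ltn_expl.
  have ile : (cnorm (1 - w * s%:C))^-1 <= 2.
    by rewrite -[leRHS]invrK lef_pV2 ?posrE ?invr_gt0//; apply: lt_le_trans h; rewrite invr_gt0.
  have bl := cnorm_bcoef p.+1 lJ.
  have step : p.+1%:R * cnorm (bcoef l p.+1) * cnorm w ^+ p.+1 * cnorm (s%:C ^+ p) *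
      (cnorm (v s) / cnorm (1 - w * s%:C)) <=
      2 ^+ p * 2 ^+ (J + p.+1) * 8^-1 ^+ p.+1 * 1 * (V * 2).
    have p1 := ler_pM (ler0n _ _) (cnorm_ge0 _) ple bl.
    have q1 := mulr_ge0 (ler0n R p.+1) (cnorm_ge0 (bcoef l p.+1)).
    have p2 := ler_pM q1 (exprn_ge0 _ (cnorm_ge0 w)) p1 wle.
    have q2 := mulr_ge0 q1 (exprn_ge0 p.+1 (cnorm_ge0 w)).
    have p3 := ler_pM q2 (cnorm_ge0 _) p2 sle.
    have q3 := mulr_ge0 q2 (cnorm_ge0 (s%:C ^+ p)).
    have i0 : 0 <= (cnorm (1 - w * s%:C))^-1 by rewrite invr_ge0 cnorm_ge0.
    have p4 := ler_pM (cnorm_ge0 (v s)) i0 (vb s hs) ile.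
    exact: (ler_pM q3 (mulr_ge0 (cnorm_ge0 (v s)) i0) p3 p4).
  apply: le_trans (_ : 2 * (2 ^+ p * 2 ^+ (J + p.+1) * 8^-1 ^+ p.+1 * 1 * (V * 2)) <= _).
    by rewrite ler_pM2l.
  rewrite le_eqVlt; apply/orP; left; apply/eqP.
  rewrite exprD !exprS.
  have -> : (2^-1 : R) ^+ p = 2 ^+ p * 2 ^+ p * 8^-1 ^+ p.
    by rewrite -!exprMn; congr (_ ^+ _); field.
  by field.
have v0 : v 0 = 1.
  by rewrite /v mulr0 addr0 (@clog_real R 1 ltr01) ln1 mulr0 cexp0.
have P0 p : P p.+1 0 = 1.
  rewrite /P v0 mulr1 /Sp /psum big_nat_recl//= big1 ?addr0 ?bcoef0 ?mul1r//.
  by move=> i _; rewrite mulr0 exprS mul0r mulr0.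
have z0 : 1 - w != 0.
  have [h _ _] := @clog_small w 1 w8 (introT andP (conj ler01 (lexx _))).
  by rewrite mulr1 in h; apply/eqP => z; move: h; rewrite z /= leNgt invr_gt0 ltr0n.
have v1 : v 1 = cpow (1 - w) l by rewrite cpowE// /v mulr1.
have cvP : ccvg (fun p => P p.+1 1) 1.
  apply: (ccvg_dist (e := fun p => (8 * V * 2 ^+ J * 4^-1) * 2^-1 ^+ p)).
    rewrite -[X in _ --> X](mulr0 (8 * V * 2 ^+ J * 4^-1)); apply: cvgM; first exact: cvg_cst.
    by apply: cvg_expr; rewrite ger0_norm ?invr_ge0// invf_lt1 ?ltr1n.
  by move=> p; have := bound p; rewrite P0.
have := ccvgM cvP (ccvg_cst (cpow (1 - w) (- l))); rewrite mul1r => -[h1 h2].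
have E p : P p.+1 1 * cpow (1 - w) (- l) = psum (fun u => bcoef l u * w ^+ u) p.+1.
  rewrite /P /Sp v1 cpowN// mulfK ?cpow_neq0//.
  by apply: eq_bigr => u _; rewrite mulr1.
split.
  rewrite -(cvg_shiftS (fun p => complex.Re (psum (fun u => bcoef l u * w ^+ u) p))).
  by move: h1; under eq_fun do rewrite E.
rewrite -(cvg_shiftS (fun p => complex.Im (psum (fun u => bcoef l u * w ^+ u) p))).
by move: h2; under eq_fun do rewrite E.
Qed.

End ComplexSeries.

(** * Series of powers and their transforms *)

Section PowerSeriesOriginals.
Variable R : realType.
Local Notation C := R[i].
Local Notation mu := (@lebesgue_measure R).
Local Notation mR := (measurableTypeR R).
Implicit Types (t s a c : R) (b z w : C).

Definition claplace (e : R -> C) z : C :=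
  cint `]0, +oo[ (fun t => e t * cexp (- (z * t%:C))).

(** The function t^(b-1) / Gamma(b), the original of z^-b. *)
Definition pbase b t : C := (cgamma b)^-1 * gkernel b 0 t.

Lemma ccont_pos_pbase b : ccont_pos (pbase b).
Proof. exact: ccont_posM (ccont_pos_cst _) (ccont_pos_gkernel _ _). Qed.

Lemma gkernel_shift b z t : gkernel b 0 t * cexp (- (z * t%:C)) = gkernel b z t.
Proof. by rewrite /gkernel -cexpD mul0r subr0. Qed.

Lemma claplace_pbase b z : 0 < complex.Re b -> 0 < complex.Re z ->
  claplace (pbase b) z = cpow z (- b).
Proof.
move=> b0 z0; have mI := @measurable_Ritv R `]0, +oo[.
rewrite /claplace (eq_cint (v := fun t => (cgamma b)^-1 * gkernel b z t)); last first.
  by move=> t _; rewrite /pbase -mulrA gkernel_shift.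
rewrite (cintZ _ mI (cintegrable_gkernel b0 z0)) cint_gkernel//.
by rewrite mulKf// cgamma_neq0.
Qed.

(** The constant M enters through $t^y = M^{-y} (Mt)^y$: the growth of the Gamma
    function absorbs $(Mt)^y e^{-2Mt}$ and leaves the decay $M^{-y}$, which is
    what makes all the series below geometric. *)
Lemma cnorm_pbase_le a kap L b t : 0 < a -> 0 < t -> a <= complex.Re b ->
  `|complex.Im b| <= kap * complex.Re b ->
  cnorm (pbase b t) <= 2 * expR 4 * expR (kap ^+ 2 * (a + 1)) *
    expR (- ((complex.Re b - a) * L)) * gweight a (- (2 * expR (L + kap ^+ 2))) t.
Proof.
move=> a0 t0 ab imb; have b0 : 0 < complex.Re b := lt_le_trans a0 ab.
set y := complex.Re b - a; have y0 : 0 <= y by rewrite subr_ge0.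
(* The summand kap^2 of the exponent pays for the growth of rgamma / |cgamma|. *)
set M := expR (L + kap ^+ 2); have M0 : 0 < M by exact: expR_gt0.
have g1 := @power_le_rgamma R a y (M * t) a0 y0 (mulr_gt0 M0 t0).
have lnM : ln (M * t) = L + kap ^+ 2 + ln t by rewrite lnM ?posrE// expRK.
have bE : b = (complex.Re b) +i* (complex.Im b) by case: (b).
have g2 := rgamma_le_cgamma (complex.Im b) b0; rewrite -bE in g2.
have g0 : 0 < cnorm (cgamma b) by apply: cnorm_gt0; exact: cgamma_neq0.
have yab : y + a = complex.Re b by rewrite /y subrK.
rewrite yab in g1.
have im2 : complex.Im b ^+ 2 <= kap ^+ 2 * complex.Re b ^+ 2.
  rewrite -exprMn -(real_normK (num_real (complex.Im b))) lerXn2r ?nnegrE//.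
  exact: le_trans (normr_ge0 _) imb.
have e2 : complex.Im b ^+ 2 * ((complex.Re b)^-1 + (complex.Re b)^-2) <= kap ^+ 2 * (a + y + 1).
  apply: (@le_trans _ _ (kap ^+ 2 * complex.Re b ^+ 2 * ((complex.Re b)^-1 + (complex.Re b)^-2))).
    by rewrite ler_wpM2r// addr_ge0// ?invr_ge0// ?exprn_ge0// ltW.
  rewrite (addrC a) yab le_eqVlt; apply/orP; left; apply/eqP; field.
  by rewrite gt_eqF.
rewrite /pbase cnormM cnormV cnorm_gkernel /= ler_pdivrMl//.
have -> : gweight (complex.Re b) 0 t =
    expR (y * ln (M * t) - 2 * (M * t)) * expR (- (y * (L + kap ^+ 2))) * gweight a (- (2 * M)) t.
  by rewrite /gweight -!expRD lnM -{1}yab; congr expR; ring.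
have g3 : expR (y * ln (M * t) - 2 * (M * t)) <=
    expR 4 * (2 * expR (kap ^+ 2 * (a + y + 1)) * cnorm (cgamma b)).
  apply: le_trans g1 _; rewrite ler_pM2l ?expR_gt0//; apply: le_trans g2 _.
  by rewrite ler_pM2r// ler_pM2l// ler_expR.
have w0 := gweight_gt0 a (- (2 * M)) t.
have p0 := expR_gt0 (- (y * (L + kap ^+ 2))).
apply: le_trans (_ : _ <= expR 4 * (2 * expR (kap ^+ 2 * (a + y + 1)) * cnorm (cgamma b)) * expR (- (y * (L + kap ^+ 2))) * gweight a (- (2 * M)) t) _.
  by rewrite ler_pM2r// ler_pM2r.
have -> : expR (- (y * (L + kap ^+ 2))) = expR (- (y * L)) * expR (- (kap ^+ 2 * y)).
  by rewrite -expRD; congr expR; ring.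
have -> : expR (kap ^+ 2 * (a + y + 1)) = expR (kap ^+ 2 * (a + 1)) * expR (kap ^+ 2 * y).
  by rewrite -expRD; congr expR; ring.
rewrite [expR (- (kap ^+ 2 * y))]expRN le_eqVlt; apply/orP; left; apply/eqP; field.
by rewrite gt_eqF ?expR_gt0.
Qed.

Lemma has_sum_half (k : R) : 0 <= k -> has_sum (fun u => k * 2^-1 ^+ u) (k * 2).
Proof.
move=> k0; apply: has_sumZ => //.
have E : (1 - 2^-1)^-1 = 2 :> R by field.
have h : 0 <= (2^-1 : R) < 1 by apply/andP; split; lra.
by have := has_sum_geometric h; rewrite E.
Qed.

Section LaplaceSeries.
Variables (e : nat -> R -> C) (G : nat -> C -> C) (c : nat -> R) (S a M : R).
Hypothesis a0 : 0 < a.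
Hypothesis cS : has_sum c S.
Hypothesis ce : forall j, ccont_pos (e j).
Hypothesis ew : forall j t, 0 < t -> c1norm (e j t) <= c j * gweight a (- M) t.
Hypothesis eG : forall j z, M < complex.Re z -> claplace (e j) z = G j z.

Let W0 t : 0 < t -> 0 <= gweight a (- M) t.
Proof. by move=> _; exact/ltW/gweight_gt0. Qed.

Let cW t : 0 < t -> {for t, continuous (gweight a (- M))}.
Proof.
move=> t0.
have h : is_derive t 1 (fun s => (a - 1) * ln s - (- M) * s) ((a - 1) * t^-1 - (- M) * 1).
  apply: is_deriveB; first exact: is_deriveZ (is_derive1_ln t0).
apply: (@continuous_comp _ _ _ (fun s => (a - 1) * ln s - (- M) * s) (@expR R)).
  exact: differentiable_continuous (proj1 (derivable1_diffP _ _) (@ex_derive _ _ _ _ _ _ _ h)).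
exact: continuous_expR.
Qed.

Lemma ccont_pos_csumf_gweight : ccont_pos (csumf e).
Proof. exact: csumf_ccont_pos cS W0 cW ew ce. Qed.

Lemma csumf_gweight t : 0 < t -> c1norm (csumf e t) <= S * gweight a (- M) t.
Proof. exact: csumf_bound cS W0 ew t. Qed.

Lemma ccont_pos_cexp z : ccont_pos (fun t => cexp (- (z * t%:C))).
Proof.
apply: cis_derive_ccont_pos => t t0; apply: cis_derive_cexp.
rewrite (_ : (fun s => _) = fun s : R => 0 + (- z) * s%:C); first exact: cis_derive_affine.
by apply/funext => s; rewrite add0r mulNr.
Qed.

Lemma gweight_cexp_integrable z : M < complex.Re z ->
  mu.-integrable `]0, +oo[ (EFin \o (fun t => gweight a (- M) t * c1norm (cexp (- (z * t%:C))))).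
Proof.
move=> Mz; have mI := @measurable_Ritv R `]0, +oo[.
have zM : 0 < complex.Re z - M by rewrite subr_gt0.
have h := integrable_RZ 2 mI (integrable_gweight a0 zM).
have mW : measurable_fun (`]0, +oo[%classic : set mR) (gweight a (- M)).
  exact: continuous_pos_measurable.
apply: (integrable_dominated mI _ h).
  apply: measurable_funM => //.
  exact: cmeasurable_norm (ccont_pos_cmeasurable (ccont_pos_cexp z)).
move=> t _; rewrite ger0_norm; last by rewrite mulr_ge0 ?c1norm_ge0// ltW// gweight_gt0.
have -> : 2 * gweight a (complex.Re z - M) t = gweight a (- M) t * (2 * cnorm (cexp (- (z * t%:C)))).
  rewrite cnorm_cexp cReN [complex.Re (z * _)]cReM /= mulr0 subr0 mulrCA /gweight -expRD.
  by congr (2 * expR _); ring.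
by rewrite ler_pM2l ?gweight_gt0// c1norm_le_cnorm.
Qed.

Lemma claplace_csumf z : M < complex.Re z ->
  ccvg (psum (G ^~ z)) (claplace (csumf e) z).
Proof.
move=> Mz.
have := cint_csumf cS W0 cW ew ce (ccont_pos_cexp z) (gweight_cexp_integrable Mz).
rewrite (_ : psum _ = psum (G ^~ z))//.
by apply/funext => p; apply: eq_bigr => j _; exact: eG.
Qed.

End LaplaceSeries.

Lemma claplaceZ x e z : cintegrable `]0, +oo[ (fun t => e t * cexp (- (z * t%:C))) ->
  claplace (fun t => x * e t) z = x * claplace e z.
Proof.
move=> h; rewrite /claplace -(cintZ x (@measurable_Ritv R `]0, +oo[) h).
by apply: eq_cint => t _; rewrite mulrA.
Qed.

Lemma cintegrable_gweight_bound (e : R -> C) a K M z : 0 < a -> ccont_pos e ->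
  (forall t, 0 < t -> c1norm (e t) <= K * gweight a (- M) t) -> M < complex.Re z ->
  cintegrable `]0, +oo[ (fun t => e t * cexp (- (z * t%:C))).
Proof.
move=> a0 ce eK Mz; have mI := @measurable_Ritv R `]0, +oo[.
apply: (cintegrable_dominated mI _ (integrable_RZ K mI (gweight_cexp_integrable a0 Mz))).
  exact: ccont_pos_cmeasurable (ccont_posM ce (ccont_pos_cexp z)).
move=> t; rewrite /= in_itv/= andbT => t0.
apply: le_trans (c1normM _ _) _; rewrite mulrA ler_wpM2r ?c1norm_ge0//.
exact: eK.
Qed.

(** The constant of [cnorm_pbase_le], doubled because the modulus is replaced by
    the taxicab norm. *)
Definition kap_const (kap a : R) : R := 4 * expR 4 * expR (kap ^+ 2 * (a + 1)).

(** ** Power series in $z^{-m}$ *)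
Section Layer.
Variables (a kap L q D : R) (b m : C) (d : nat -> C).
Hypotheses (a0 : 0 < a) (ab : a <= complex.Re b) (m0 : 0 <= complex.Re m).
Hypothesis imb : `|complex.Im b| <= kap * complex.Re b.
Hypothesis imm : `|complex.Im m| <= kap * complex.Re m.
Hypothesis D0 : 0 <= D.
Hypothesis dq : forall u, cnorm (d u) <= D * q ^+ u.
Hypothesis q0 : 0 <= q.
Hypothesis qL : q * expR (- (complex.Re m * L)) <= 2^-1.

Local Notation M := (2 * expR (L + kap ^+ 2)).
Local Notation Db := (D * kap_const kap a * expR (- ((complex.Re b - a) * L))).

(** The original of sum_u d_u z^-(b + m u). *)
Definition layer : R -> C := csumf (fun u t => d u * pbase (b + m * u%:R) t).

Let Rebu u : complex.Re (b + m * u%:R) = complex.Re b + complex.Re m * u%:R.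
Proof. by rewrite cReD cReM cRe_nat cIm_nat mulr0 subr0. Qed.

Let Imbu u : complex.Im (b + m * u%:R) = complex.Im b + complex.Im m * u%:R.
Proof. by rewrite cImD cImM cRe_nat cIm_nat mulr0 add0r. Qed.

Let abu u : a <= complex.Re (b + m * u%:R).
Proof. by rewrite Rebu (le_trans ab)// lerDl mulr_ge0. Qed.

Let term_bound u t : 0 < t ->
  c1norm (d u * pbase (b + m * u%:R) t) <= Db * 2^-1 ^+ u * gweight a (- M) t.
Proof.
move=> t0.
have ib : `|complex.Im (b + m * u%:R)| <= kap * complex.Re (b + m * u%:R).
  rewrite Imbu Rebu mulrDr; apply: le_trans (ler_normD _ _) _; apply: lerD => //.
  by rewrite normrM normr_nat mulrA ler_wpM2r.
have h := cnorm_pbase_le L a0 t0 (abu u) ib.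
apply: le_trans (c1norm_le_cnorm _) _; rewrite cnormM.
have h2 := ler_pM (cnorm_ge0 _) (cnorm_ge0 _) (dq u) h.
apply: (@le_trans _ _ (2 * (D * q ^+ u * (2 * expR 4 * expR (kap ^+ 2 * (a + 1)) *
    expR (- ((complex.Re (b + m * u%:R) - a) * L)) * gweight a (- M) t)))).
  by rewrite ler_pM2l.
have -> : expR (- ((complex.Re (b + m * u%:R) - a) * L)) =
    expR (- ((complex.Re b - a) * L)) * expR (- (complex.Re m * L)) ^+ u.
  by rewrite -expRM_natr -expRD Rebu; congr expR; ring.
have w0 := gweight_gt0 a (- M) t.
have -> : 2 * (D * q ^+ u * (2 * expR 4 * expR (kap ^+ 2 * (a + 1)) *
    (expR (- ((complex.Re b - a) * L)) * expR (- (complex.Re m * L)) ^+ u) * gweight a (- M) t)) =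
    Db * (q * expR (- (complex.Re m * L))) ^+ u * gweight a (- M) t.
  by rewrite exprMn /kap_const; ring.
rewrite ler_pM2r//; apply: ler_wpM2l; first by rewrite !mulr_ge0 ?expR_ge0.
by rewrite lerXn2r ?nnegrE// mulr_ge0 ?expR_ge0.
Qed.

Let half_sum : has_sum (fun u => Db * 2^-1 ^+ u) (Db * 2).
Proof. by apply: has_sum_half; rewrite !mulr_ge0 ?expR_ge0. Qed.

Let ccont_term u : ccont_pos (fun t => d u * pbase (b + m * u%:R) t).
Proof. exact: ccont_posM (ccont_pos_cst _) (ccont_pos_pbase _). Qed.

Lemma ccont_pos_layer : ccont_pos layer.
Proof. exact: ccont_pos_csumf_gweight half_sum ccont_term term_bound. Qed.

Lemma layer_bound t : 0 < t -> c1norm (layer t) <= Db * 2 * gweight a (- M) t.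
Proof. exact: csumf_gweight half_sum term_bound t. Qed.

Lemma layer_ccvg t : 0 < t ->
  ccvg (psum (fun u => d u * pbase (b + m * u%:R) t)) (layer t).
Proof.
move=> t0; have w0 := gweight_gt0 a (- M) t.
apply: (@csumf_cvg _ _ _ _ _ half_sum _ term_bound) => // s _.
exact/ltW/gweight_gt0.
Qed.

Lemma claplace_layer z : M < complex.Re z ->
  ccvg (psum (fun u => d u * cpow z (- (b + m * u%:R)))) (claplace layer z).
Proof.
move=> Mz; apply: (claplace_csumf (G := fun u z => d u * cpow z (- (b + m * u%:R)))
  a0 half_sum ccont_term term_bound) => // u {Mz}z Mz.
have z0 : 0 < complex.Re z by apply: lt_trans Mz; rewrite mulr_gt0 ?expR_gt0.
have bu0 := lt_le_trans a0 (abu u).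
rewrite claplaceZ ?claplace_pbase//.
apply: eq_cintegrable (cintegrableZ (cgamma (b + m * u%:R))^-1 (@measurable_Ritv R `]0, +oo[)
  (cintegrable_gkernel bu0 z0)); first exact: measurable_Ritv.
by move=> t _; rewrite /pbase -mulrA gkernel_shift.
Qed.

End Layer.

End PowerSeriesOriginals.

(** * Originals of the resolvent and of the Prabhakar kernel *)

Section ResolventOriginals.
Variable R : realType.
Local Notation C := R[i].
Local Notation mu := (@lebesgue_measure R).
Local Notation mR := (measurableTypeR R).
Implicit Types (t s a c : R) (b z w : C).

Lemma exp_decay_small (x q e : R) : 0 < x -> 0 < e -> 0 <= q ->
  exists2 L0 : R, 0 <= L0 & forall L, L0 <= L -> q * expR (- (x * L)) <= e.
Proof.
move=> x0 e0 q0; exists (q / e / x); first by rewrite !divr_ge0// ltW.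
move=> L; rewrite ler_pdivrMr// ler_pdivrMr// => hL.
rewrite expRN ler_pdivrMr ?expR_gt0//.
apply: le_trans hL _; rewrite mulrC ler_pM2l// mulrC.
by apply: le_trans (expR_ge1Dx _); rewrite lerDr.
Qed.

Lemma cnorm_powz_small (r m z : C) (L : R) : 0 < complex.Re m -> 0 < complex.Re z ->
  expR L <= complex.Re z ->
  cnorm (r * cpow z (- m)) <=
    cnorm r * expR (`|complex.Im m| * pi) * expR (- (complex.Re m * L)).
Proof.
move=> m0 z0 Lz; have zn : z != 0 by apply/eqP => z1; move: z0; rewrite z1 /= ltxx.
rewrite cnormM -mulrA ler_wpM2l ?cnorm_ge0//.
apply: le_trans (cnorm_cpow_le _ zn) _.
rewrite cReN cImN normrN mulrC ler_pM2l ?expR_gt0//.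
have nz : expR L <= cnorm z by rewrite (le_trans Lz)// (le_trans (ler_norm _))// normRe_le_cnorm.
have n0 : 0 < cnorm z by apply: lt_le_trans nz; exact: expR_gt0.
rewrite /powR gt_eqF// ler_expR mulNr lerN2 ler_pM2l//.
by rewrite -(expRK L) ler_ln ?posrE ?expR_gt0.
Qed.

Lemma one_sub_neq0 w : cnorm w <= 8^-1 -> 1 - w != 0.
Proof.
move=> w8; have := @clog_small R w 1 w8; rewrite mulr1 => -[|h _ _]; first by rewrite ler01 lexx.
by apply/eqP => z; move: h; rewrite z /= leNgt invr_gt0 ltr0n.
Qed.

Definition cratio b : R := `|complex.Im b| / complex.Re b.

Lemma cratio_le b (kap : R) : 0 < complex.Re b -> cratio b <= kap ->
  `|complex.Im b| <= kap * complex.Re b.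
Proof. by move=> b0; rewrite ler_pdivrMr. Qed.

Lemma cnormXn z (p : nat) : cnorm (z ^+ p) = cnorm z ^+ p.
Proof. by elim: p => [|p IH]; rewrite ?expr0 ?cnorm1// !exprS cnormM IH. Qed.

Lemma c1normXn z (p : nat) : c1norm (z ^+ p) <= c1norm z ^+ p.
Proof.
elim: p => [|p IH]; first by rewrite !expr0 c1norm1.
rewrite !exprS; apply: le_trans (c1normM _ _) _.
by rewrite ler_wpM2l ?c1norm_ge0.
Qed.

Lemma psum_geometric_rec (g : nat -> C) (c0 X : C) (p : nat) :
  (forall j, g j = c0 * X ^+ j) -> psum g p.+1 = c0 + X * psum g p.
Proof.
move=> gE; rewrite /psum big_nat_recl// gE expr0 mulr1 mulr_sumr; congr (_ + _).
by apply: eq_bigr => j _; rewrite !gE exprS mulrCA.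
Qed.

(** $A(\xi) = \xi^n (1 - r\xi^{-m})^l$ is the symbol of the derivative. *)
Definition csymbol (l : R) (m n r z : C) : C :=
  cpow z n * cpow (1 - r * cpow z (- m)) l%:C.

Section Resolvent.
Variables (l : R) (m n r k : C).
Hypotheses (l0 : 0 <= l) (l1 : l <= 1) (m0 : 0 < complex.Re m) (n0 : 0 < complex.Re n).

(** An original e of the transform z^-b0 (1 - w)^(- l j0) / (1 + k / A), where
    w = r z^-m and A is the symbol. The identity is multiplied out, so that it
    also shows that 1 + k / A vanishes nowhere in the half-plane. *)
Definition resolvent_spec (b0 : C) (j0 : nat) (e : R -> C) (K M : R) : Prop :=
  [/\ 0 <= M, ccont_pos e,
    forall t, 0 < t -> c1norm (e t) <= K * gweight (complex.Re b0) (- M) t &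
    forall z, M < complex.Re z -> 1 - r * cpow z (- m) != 0 /\
      claplace e z * (1 + k / csymbol l m n r z) =
      cpow z (- b0) * cpow (1 - r * cpow z (- m)) (- l%:C) ^+ j0].

(** Expanding $z^{-b_0}(1-w)^{-l j_0}/(1+k/A)$ first as a geometric series in
    $-k/A$, then each power of $1-w$ as a binomial series in w, gives a double
    series of powers of z whose originals sum up. *)
Theorem resolvent_original b0 (j0 : nat) : 0 < complex.Re b0 ->
  exists (e : R -> C) (K M : R), resolvent_spec b0 j0 e K M.
Proof.
move=> b00; set a := complex.Re b0.
pose kap := Num.max (cratio b0) (Num.max (cratio n) (cratio m)).
have kb : `|complex.Im b0| <= kap * complex.Re b0.
  by apply: cratio_le => //; rewrite le_max lexx.
have kn : `|complex.Im n| <= kap * complex.Re n.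
  by apply: cratio_le => //; rewrite !le_max lexx orbT.
have km : `|complex.Im m| <= kap * complex.Re m.
  by apply: cratio_le => //; rewrite !le_max lexx !orbT.
have h2 : (0 : R) < 2^-1 by rewrite invr_gt0.
have h8 : (0 : R) < 8^-1 by rewrite invr_gt0.
have q0 : 0 <= 2 * cnorm r by rewrite mulr_ge0 ?cnorm_ge0.
have k0 : 0 <= 2 * c1norm k by rewrite mulr_ge0 ?c1norm_ge0.
have r0 : 0 <= cnorm r * expR (`|complex.Im m| * pi) by rewrite mulr_ge0 ?cnorm_ge0 ?expR_ge0.
have [L1 _ HL1] := exp_decay_small m0 h2 q0.
have [L2 _ HL2] := exp_decay_small n0 h2 k0.
have [L3 _ HL3] := exp_decay_small m0 h8 r0.
(* With this L the terms of the inner binomial series and of the outer geometric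
   series are halved at each step, and |w| <= 1/8. *)
pose L := Num.max L1 (Num.max L2 L3).
have qL : 2 * cnorm r * expR (- (complex.Re m * L)) <= 2^-1.
  by apply: HL1; rewrite le_max lexx.
have kL : 2 * c1norm k * expR (- (complex.Re n * L)) <= 2^-1.
  by apply: HL2; rewrite !le_max lexx orbT.
have wL : cnorm r * expR (`|complex.Im m| * pi) * expR (- (complex.Re m * L)) <= 8^-1.
  by apply: HL3; rewrite !le_max lexx !orbT.
pose M := 2 * expR (L + kap ^+ 2).
pose lam (j : nat) : C := (l * (j + j0)%:R)%:C.
pose d j (u : nat) := bcoef (lam j) u * r ^+ u.
pose b j := b0 + n * j%:R.
have Reb j : complex.Re (b j) = a + complex.Re n * j%:R.
  by rewrite /b cReD cReM cRe_nat cIm_nat mulr0 subr0.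
have ab j : a <= complex.Re (b j) by rewrite Reb lerDl mulr_ge0// ltW.
have Imb j : `|complex.Im (b j)| <= kap * complex.Re (b j).
  rewrite Reb /b cImD cImM cRe_nat cIm_nat mulr0 add0r mulrDr.
  apply: le_trans (ler_normD _ _) _; apply: lerD => //.
  by rewrite normrM normr_nat mulrA ler_wpM2r.
have D0 j : 0 <= (2 : R) ^+ (j + j0) by rewrite exprn_ge0.
have dq j u : cnorm (d j u) <= 2 ^+ (j + j0) * (2 * cnorm r) ^+ u.
  have lj : cnorm (lam j) <= (j + j0)%:R.
    by rewrite cnorm_real ger0_norm ?mulr_ge0// ler_piMl.
  rewrite /d cnormM cnormXn exprMn mulrA -exprD ler_wpM2r ?exprn_ge0 ?cnorm_ge0//.
  exact: cnorm_bcoef.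
have m0' := ltW m0.
pose e_ j t := (- k) ^+ j * layer (b j) m (d j) t.
pose cc := 2 ^+ j0 * kap_const kap a * 2.
have ce j : ccont_pos (e_ j).
  apply: ccont_posM (ccont_pos_cst _) _.
  exact: (ccont_pos_layer b00 (ab j) m0' (Imb j) km (D0 j) (dq j) q0 qL).
have cc0 : 0 <= cc by rewrite !mulr_ge0 ?expR_ge0 ?exprn_ge0.
have be j t : 0 < t -> c1norm (e_ j t) <= cc * 2^-1 ^+ j * gweight a (- M) t.
  move=> t0; have h := layer_bound b00 (ab j) m0' (Imb j) km (D0 j) (dq j) q0 qL t0.
  apply: le_trans (c1normM _ _) _.
  have h' : c1norm ((- k) ^+ j) <= c1norm k ^+ j.
    by rewrite -(c1normN k); exact: c1normXn.
  apply: le_trans (ler_pM (c1norm_ge0 _) (c1norm_ge0 _) h' h) _.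
  rewrite Reb.
  have -> : expR (- ((a + complex.Re n * j%:R - a) * L)) = expR (- (complex.Re n * L)) ^+ j.
    by rewrite -expRM_natr; congr expR; ring.
  have w0 := gweight_gt0 a (- M) t.
  have -> : c1norm k ^+ j * (2 ^+ (j + j0) * kap_const kap a * expR (- (complex.Re n * L)) ^+ j * 2
      * gweight a (- M) t) =
      cc * (2 * c1norm k * expR (- (complex.Re n * L))) ^+ j * gweight a (- M) t.
    by rewrite /cc !exprMn exprD; ring.
  rewrite ler_pM2r// ler_wpM2l// lerXn2r ?nnegrE//.
  by rewrite mulr_ge0 ?expR_ge0.
pose G j z := (- k) ^+ j * claplace (layer (b j) m (d j)) z.
have eG j z : M < complex.Re z -> claplace (e_ j) z = G j z.
  move=> Mz; rewrite /e_ claplaceZ//.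
  apply: (cintegrable_gweight_bound b00 _ _ Mz).
    exact: (ccont_pos_layer b00 (ab j) m0' (Imb j) km (D0 j) (dq j) q0 qL).
  by move=> t t0; exact: (layer_bound b00 (ab j) m0' (Imb j) km (D0 j) (dq j) q0 qL t0).
exists (csumf e_), (cc * 2), M; split.
- by rewrite mulr_ge0 ?expR_ge0.
- exact: (ccont_pos_csumf_gweight (has_sum_half cc0) ce be).
- by move=> t t0; exact: (csumf_gweight (has_sum_half cc0) be t0).
move=> z Mz.
have z0 : 0 < complex.Re z by apply: lt_trans Mz; rewrite mulr_gt0 ?expR_gt0.
have zn : z != 0 by apply/eqP => z1; move: z0; rewrite z1 /= ltxx.
have Lz : expR L <= complex.Re z.
  apply: le_trans (ltW Mz); rewrite /M expRD.
  have e1 : 1 <= expR (kap ^+ 2) by rewrite -expR0 ler_expR sqr_ge0.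
  have eL := expR_gt0 L; nra.
have w8 := le_trans (cnorm_powz_small r m0 z0 Lz) wL.
set w := r * cpow z (- m) in w8 *.
have w1 := one_sub_neq0 w8; split => //.
set X := - k / csymbol l m n r z.
have GE j : G j z = cpow z (- b0) * cpow (1 - w) (- l%:C) ^+ j0 * X ^+ j.
  rewrite /G; have h := claplace_layer b00 (ab j) m0' (Imb j) km (D0 j) (dq j) q0 qL Mz.
  have hb := ccvgM (ccvg_cst (cpow z (- b j))) (binomial_series (lam j) w8).
  have -> : claplace (layer (b j) m (d j)) z = cpow z (- b j) * cpow (1 - w) (- lam j).
    apply: ccvg_unique h _.
    rewrite (_ : psum _ = (fun p => cpow z (- b j) * psum (fun u => bcoef (lam j) u * w ^+ u) p))//.
    apply/funext => p; rewrite -psumZ; apply: eq_bigr => u _.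
    rewrite opprD cpowD// -mulNr cpowMn// /d /w exprMn; ring.
  have lamE : - lam j = (- l%:C) * (j + j0)%:R.
    by rewrite /lam rmorphM /= rmorph_nat mulNr.
  rewrite lamE cpowMn// /b opprD cpowD// -mulNr cpowMn// exprD.
  rewrite /X /csymbol -/w exprMn exprVn exprMn !cpowN// !exprVn.
  set x1 := cpow z n; set x2 := cpow (1 - w) l%:C.
  have x10 : x1 != 0 by exact: cpow_neq0.
  have x20 : x2 != 0 by exact: cpow_neq0.
  have x30 : cpow z b0 != 0 by exact: cpow_neq0.
  have h1 : x1 ^+ j != 0 by rewrite expf_neq0.
  have h3 : x2 ^+ j != 0 by rewrite expf_neq0.
  have h4 : x2 ^+ j0 != 0 by rewrite expf_neq0.
  by field; rewrite x30 h1 h3 h4.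
have hT := claplace_csumf b00 (has_sum_half cc0) ce be eG Mz.
set T := claplace (csumf e_) z in hT *.
set c0 := cpow z (- b0) * cpow (1 - w) (- l%:C) ^+ j0 in GE *.
(* The transforms form a geometric progression, so that the sum T is determined
   by T = c0 + X T. *)
have rec p : psum (G ^~ z) p.+1 = c0 + X * psum (G ^~ z) p.
  exact: (@psum_geometric_rec (G ^~ z)) GE.
have TE : T = c0 + X * T.
  have hr := ccvgD (ccvg_cst c0) (ccvgM (ccvg_cst X) hT).
  apply: ccvg_unique hr; case: hT => hT1 hT2; split.
    by rewrite -(cvg_shiftS (fun p => complex.Re (psum (G ^~ z) p))) in hT1;
      move: hT1; under eq_fun do rewrite rec.
  by rewrite -(cvg_shiftS (fun p => complex.Im (psum (G ^~ z) p))) in hT2;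
    move: hT2; under eq_fun do rewrite rec.
by rewrite mulrDr mulr1 {1}TE /X; ring.
Qed.

End Resolvent.

(** ** The kernel of the Prabhakar integral *)
Section Kernel.
Variables (l : R) (m nu r : C).
Hypotheses (l0 : 0 <= l) (l1 : l <= 1) (m0 : 0 < complex.Re m) (nu0 : 0 <= complex.Re nu).

Definition prabhakar_kernel t : C :=
  cpow t%:C (nu - 1) * cprabhakar (- l%:C) m nu (r * cpow t%:C m).

(** The first term of the kernel, t^(nu-1) / Gamma(nu), is kept apart because it
    is not integrable at 0 when Re nu = 0; in the remaining terms the exponents
    have real part at least Re m > 0. *)
Theorem prabhakar_kernel_original :
  exists (e : R -> C) (K M : R), [/\ 0 <= M, ccont_pos e,
    forall t, 0 < t -> c1norm (e t) <= K * gweight (complex.Re nu + complex.Re m) (- M) t,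
    forall t, 0 < t -> prabhakar_kernel t = pbase nu t + e t &
    forall z, M < complex.Re z -> 1 - r * cpow z (- m) != 0 /\
      claplace e z = cpow z (- nu) * (cpow (1 - r * cpow z (- m)) l%:C - 1)].
Proof.
set a := complex.Re nu + complex.Re m.
have aE : complex.Re (nu + m) = a by rewrite cReD.
have a0 : 0 < a by rewrite ltr_wpDl.
have a0' : 0 < complex.Re (nu + m) by rewrite aE.
pose kap := Num.max (cratio (nu + m)) (cratio m).
have kb : `|complex.Im (nu + m)| <= kap * complex.Re (nu + m).
  by apply: cratio_le => //; rewrite le_max lexx.
have km : `|complex.Im m| <= kap * complex.Re m.
  by apply: cratio_le => //; rewrite !le_max lexx !orbT.
have h2 : (0 : R) < 2^-1 by rewrite invr_gt0.
have h8 : (0 : R) < 8^-1 by rewrite invr_gt0.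
have q0 : 0 <= 2 * cnorm r by rewrite mulr_ge0 ?cnorm_ge0.
have r0 : 0 <= cnorm r * expR (`|complex.Im m| * pi) by rewrite mulr_ge0 ?cnorm_ge0 ?expR_ge0.
have [L1 _ HL1] := exp_decay_small m0 h2 q0.
have [L3 _ HL3] := exp_decay_small m0 h8 r0.
pose L := Num.max L1 L3.
have qL : 2 * cnorm r * expR (- (complex.Re m * L)) <= 2^-1.
  by apply: HL1; rewrite le_max lexx.
have wL : cnorm r * expR (`|complex.Im m| * pi) * expR (- (complex.Re m * L)) <= 8^-1.
  by apply: HL3; rewrite !le_max lexx !orbT.
pose M := 2 * expR (L + kap ^+ 2).
(* The index is shifted by one: the term u = 0 is the summand pbase nu. *)
pose d (u : nat) := bcoef (- l%:C) u.+1 * r ^+ u.+1.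
have D0 : 0 <= (2 : R) ^+ 2 * cnorm r by rewrite mulr_ge0 ?cnorm_ge0// exprn_ge0.
have dq u : cnorm (d u) <= 2 ^+ 2 * cnorm r * (2 * cnorm r) ^+ u.
  have lj : cnorm (- l%:C) <= 1%:R.
    by rewrite -rmorphN cnorm_real normrN ger0_norm.
  rewrite /d cnormM cnormXn exprMn.
  have -> : 2 ^+ 2 * cnorm r * (2 ^+ u * cnorm r ^+ u) = 2 ^+ (1 + u.+1) * cnorm r ^+ u.+1.
    by rewrite !exprS expr0; ring.
  rewrite ler_wpM2r ?exprn_ge0 ?cnorm_ge0//; exact: cnorm_bcoef.
have m0' := ltW m0.
have ab : a <= complex.Re (nu + m) by rewrite aE.
exists (layer (nu + m) m d), (2 ^+ 2 * cnorm r * kap_const kap a *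
  expR (- ((complex.Re (nu + m) - a) * L)) * 2), M; split.
- by rewrite mulr_ge0 ?expR_ge0.
- exact: (ccont_pos_layer a0 ab m0' kb km D0 dq q0 qL).
- by move=> t t0; exact: (layer_bound a0 ab m0' kb km D0 dq q0 qL t0).
- move=> t t0; have h := layer_ccvg a0 ab m0' kb km D0 dq q0 qL t0.
  have t0C : (t%:C : C) != 0 by apply/eqP => -[] /eqP; rewrite gt_eqF.
  have tE b : cpow t%:C (b - 1) = gkernel b 0 t by rewrite cpow_real// /gkernel mul0r subr0.
  have termE u : cpow t%:C (nu - 1) * (cpoch (- l%:C) u / (u`!%:R * cgamma (m * u%:R + nu)) *
      (r * cpow t%:C m) ^+ u) = bcoef (- l%:C) u * r ^+ u * pbase (nu + m * u%:R) t.
    rewrite /pbase -tE exprMn -cpowMn// (_ : nu + m * u%:R - 1 = (nu - 1) + m * u%:R); last by ring.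
    rewrite (cpowD (nu - 1))// (addrC nu (m * u%:R)) /bcoef invfM; ring.
  suff hs : ccvg (psum (fun u => cpow t%:C (nu - 1) * (cpoch (- l%:C) u / (u`!%:R * cgamma (m * u%:R + nu)) *
      (r * cpow t%:C m) ^+ u))) (pbase nu t + layer (nu + m) m d t).
    have c0 : cpow t%:C (nu - 1) != 0 by exact: cpow_neq0.
    have := ccvgM (ccvg_cst (cpow t%:C (nu - 1))^-1) hs.
    rewrite /prabhakar_kernel /cprabhakar => h'.
    rewrite (@ccvg_csum _ _ ((cpow t%:C (nu - 1))^-1 * (pbase nu t + layer (nu + m) m d t))).
      by rewrite mulVKf.
    rewrite (_ : psum _ = (fun p => (cpow t%:C (nu - 1))^-1 * psum (fun u => cpow t%:C (nu - 1) * (cpoch (- l%:C) u / (u`!%:R * cgamma (m * u%:R + nu)) *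
      (r * cpow t%:C m) ^+ u)) p))//.
    by apply/funext => p; rewrite -psumZ; apply: eq_bigr => u _; rewrite mulKf.
  have hr := ccvgD (ccvg_cst (pbase nu t)) h.
  have rec p : psum (fun u => cpow t%:C (nu - 1) * (cpoch (- l%:C) u / (u`!%:R * cgamma (m * u%:R + nu)) *
      (r * cpow t%:C m) ^+ u)) p.+1 =
      pbase nu t + psum (fun u => d u * pbase (nu + m + m * u%:R) t) p.
    rewrite /psum big_nat_recl// termE bcoef0 expr0 !mul1r mulr0 addr0; congr (_ + _).
    apply: eq_bigr => u _; rewrite termE /d; congr (_ * pbase _ _).
    by rewrite -natr1; ring.
  case: hr => hr1 hr2; split.
    rewrite -(cvg_shiftS (fun p => complex.Re (psum _ p))).
    by under eq_fun do rewrite rec.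
  rewrite -(cvg_shiftS (fun p => complex.Im (psum _ p))).
  by under eq_fun do rewrite rec.
move=> z Mz.
have z0 : 0 < complex.Re z by apply: lt_trans Mz; rewrite mulr_gt0 ?expR_gt0.
have zn : z != 0 by apply/eqP => z1; move: z0; rewrite z1 /= ltxx.
have Lz : expR L <= complex.Re z.
  apply: le_trans (ltW Mz); rewrite /M expRD.
  have e1 : 1 <= expR (kap ^+ 2) by rewrite -expR0 ler_expR sqr_ge0.
  have eL := expR_gt0 L; nra.
have w8 := le_trans (cnorm_powz_small r m0 z0 Lz) wL.
set w := r * cpow z (- m) in w8 *.
have w1 := one_sub_neq0 w8; split => //.
have h := claplace_layer a0 ab m0' kb km D0 dq q0 qL Mz.
apply: ccvg_unique h _.
have hb := ccvgM (ccvg_cst (cpow z (- nu))) (ccvgD (binomial_series (- l%:C) w8) (ccvg_cst (-1))).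
rewrite opprK in hb.
have rec p : psum (fun u => d u * cpow z (- (nu + m + m * u%:R))) p =
    cpow z (- nu) * (psum (fun u => bcoef (- l%:C) u * w ^+ u) p.+1 + -1).
  rewrite /psum big_nat_recl// bcoef0 expr0 mul1r addrAC subrr add0r mulr_sumr.
  apply: eq_bigr => u _; rewrite /d /w exprMn.
  rewrite (_ : nu + m + m * u%:R = nu + m * u.+1%:R); last by rewrite -natr1; ring.
  rewrite opprD cpowD// -mulNr cpowMn//; ring.
case: hb => hb1 hb2; split.
  rewrite -(cvg_shiftS (fun p => complex.Re _)) in hb1.
  by under eq_fun do rewrite rec.
rewrite -(cvg_shiftS (fun p => complex.Im _)) in hb2.
by under eq_fun do rewrite rec.
Qed.

End Kernel.

End ResolventOriginals.

(** * Absolutely continuous functions are integrals *)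

Section AbsoluteContinuity.
Variable R : realType.
Local Notation mu := (@lebesgue_measure R).
Local Notation mR := (measurableTypeR R).
Implicit Types (v w G f : R -> R) (t s a b x y : R).

(** Absolute continuity on the whole line, over families indexed by an
    arbitrary finite type, so that families can be refined. *)
Definition ac_bound w (d e : R) : Prop :=
  forall (I : finType) (x y : I -> R), (forall i, x i <= y i) ->
  (forall i j z, x i < z < y i -> x j < z < y j -> i = j) ->
  \sum_i (y i - x i) < d -> \sum_i `|w (y i) - w (x i)| <= e.

Definition acR w : Prop := forall e : R, 0 < e -> exists2 d : R, 0 < d & ac_bound w d e.

(** The continuation of v by constants: its limit l0 to the left of 0, and its value
    at b to the right of b. *)
Definition extend0 v l0 b t : R := if t <= 0 then l0 else v (Num.min t b).

Lemma sum_enum_val (I : finType) (F : I -> R) :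
  \sum_(i < #|I|) F (enum_val i) = \sum_i F i.
Proof. by rewrite -(big_enum_val (A := I)); apply: eq_bigl. Qed.

(** The bound holds for v at the end points clamped to [h, b], which lie in ]0, b],
    and passes to the limit h -> 0. *)
Lemma acR_extend0 v (l0 : R) b : 0 < b -> abs_continuous_on `]0, b] v ->
  v t @[t --> 0^'+] --> l0 -> acR (extend0 v l0 b).
Proof.
move=> b0 acv cl0 e e0; have [d d0 H] := acv e e0; exists d => // I x y xy dis sd.
pose c (h s : R) := Num.min (Num.max s h) b.
have cvc (s : R) : v (c h s) @[h --> 0^'+] --> extend0 v l0 b s.
  rewrite /extend0; case: leP => s0.
    apply: cvg_trans cl0; apply: near_eq_cvg; near=> h.
    have h0 : 0 < h by near: h; exact: nbhs_right_gt.
    have hb : h < b by near: h; exact: nbhs_right_lt.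
    by rewrite /c (max_idPr (le_trans s0 (ltW h0))) (min_idPl (ltW hb)).
  apply: cvg_near_cst; near=> h.
  have hs : h < s by near: h; exact: nbhs_right_lt.
  by rewrite /c (max_idPl (ltW hs)).
have lim : \sum_i `|v (c h (y i)) - v (c h (x i))| @[h --> 0^'+] -->
    \sum_i `|extend0 v l0 b (y i) - extend0 v l0 b (x i)|.
  apply: cvg_big => [|i _]; first exact: add_continuous.
  by apply: cvg_norm; apply: cvgB; exact: cvc.
apply: (cvgr_to_le lim); near=> h.
have h0 : 0 < h by near: h; exact: nbhs_right_gt.
have hb : h < b by near: h; exact: nbhs_right_lt.
have mono (s t : R) : s <= t -> c h s <= c h t.
  by move=> st; rewrite /c; case: (leP s h); case: (leP t h); move=> th sh;
    rewrite ?(min_idPl (ltW hb)) //; rewrite ?le_min ?ge_min; lra.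
have cin (s : R) : 0 < c h s <= b.
  rewrite /c; apply/andP; split; last by rewrite ge_min lexx orbT.
  by rewrite lt_min b0 andbT lt_max h0 orbT.
have inner (s t z : R) : c h s < z < c h t -> s < z < t.
  rewrite /c => /andP[]; rewrite lt_min gt_min gt_max => /orP[/andP[sz hz]|bz].
    rewrite lt_max => /andP[/orP[zt|zh] zb]; rewrite ?sz//; lra.
  move=> /andP[_ zb]; lra.
have len (s t : R) : s <= t -> c h t - c h s <= t - s.
  move=> st; rewrite /c; case: (leP s h) => sh; case: (leP t h) => th;
    rewrite ?(min_idPl (ltW hb)); [lra| | |].
  - by have := ge_min t t b; case: (leP t b); lra.
  - lra.
  - by case: (leP t b); case: (leP s b); lra.
rewrite -(sum_enum_val (fun i => `|v (c h (y i)) - v (c h (x i))|)) ltW//.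
apply: (H #|I| (fun i => c h (x (enum_val i))) (fun i => c h (y (enum_val i)))).
- move=> i; split; first exact: mono.
  move=> z /=; rewrite !in_itv/= => /andP[cz zc].
  have /andP[h1 _] := cin (x (enum_val i)); have /andP[_ h2] := cin (y (enum_val i)).
  by rewrite (lt_le_trans h1 cz) (le_trans zc h2).
- apply/trivIsetP => i j _ _ ij; rewrite -subset0 => z [] /=.
  rewrite !in_itv/= => h1 h2; have := dis _ _ z (inner _ _ _ h1) (inner _ _ _ h2).
  by move/enum_val_inj => /eqP; rewrite (negbTE ij).
- rewrite (sum_enum_val (fun i => c h (y i) - c h (x i))); apply: le_lt_trans sd.
  by apply: ler_sum => i _; exact: len.
Unshelve. all: by end_near. Qed.

Lemma acR_sub v w : acR v -> acR w -> acR (fun t => v t - w t).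
Proof.
move=> av aw e e0; have e2 : 0 < e / 2 by rewrite divr_gt0.
have [d1 d10 H1] := av _ e2; have [d2 d20 H2] := aw _ e2.
exists (Num.min d1 d2); first by rewrite lt_min d10.
move=> I x y xy dis; rewrite lt_min => /andP[s1 s2].
have h1 := H1 I x y xy dis s1; have h2 := H2 I x y xy dis s2.
apply: le_trans (_ : \sum_i (`|v (y i) - v (x i)| + `|w (y i) - w (x i)|) <= _).
  apply: ler_sum => i _; rewrite (_ : _ - _ = (v (y i) - v (x i)) - (w (y i) - w (x i))).
    exact: ler_normB.
  by ring.
by rewrite big_split /=; lra.
Qed.

Lemma acR_continuous w : acR w -> continuous w.
Proof.
move=> aw t; apply/cvgrPdist_le => e e0; have [d d0 H] := aw e e0.
near=> s.
have ts : `|t - s| < d by near: s; exact: cvgr_dist_lt.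
have one (x y : R) : x <= y -> y - x < d -> `|w y - w x| <= e.
  move=> xy dxy; have := H 'I_1 (fun=> x) (fun=> y) (fun=> xy).
  rewrite !big_ord1; apply => // i j z _ _; by rewrite !ord1.
have [st|st] := leP s t; first by apply: one => //; move: ts; rewrite ger0_norm ?subr_ge0.
rewrite distrC; apply: one (ltW st) _.
by move: ts; rewrite distrC ger0_norm// subr_ge0 ltW.
Unshelve. all: by end_near. Qed.

(** Partitions of the intervals of a family form a single family of the same total
    length. *)
Lemma ac_variation w (d e : R) (I : finType) (x y : I -> R) (s : I -> seq R) :
  ac_bound w d e -> (forall i, itv_partition (x i) (y i) (s i)) ->
  (forall i j z, x i < z < y i -> x j < z < y j -> i = j) ->
  \sum_i (y i - x i) < d -> \sum_i variation (x i) (y i) w (s i) <= e.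
Proof.
move=> H ps dis sd.
pose J : finType := {i : I & 'I_(size (s i))}.
pose P i n := nth (y i) (x i :: s i) n.
have Pmono i n n' : (n < n')%N -> (n' <= size (s i))%N -> P i n < P i n'.
  move=> nn' n's; have [ip _] := ps i.
  apply: (sorted_ltn_nth lt_trans (y i) (s := x i :: s i)) => //.
    by rewrite inE /= ltnS (leq_trans (ltnW nn')).
have Pge i n : (n <= size (s i))%N -> x i <= P i n.
  by move=> ns; apply: itv_partition_nth_ge (ps i).
have Ple i n : (n <= size (s i))%N -> P i n <= y i.
  by move=> ns; apply: itv_partition_nth_le (ps i).
have h := H J (fun u => P (tag u) (tagged u)) (fun u => P (tag u) (tagged u).+1).
have -> : \sum_i variation (x i) (y i) w (s i) =
    \sum_(u : J) `|w (P (tag u) (tagged u).+1) - w (P (tag u) (tagged u))|.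
  under eq_bigr do rewrite /variation big_mkord.
  by rewrite sig_big_dep.
apply: h.
- by move=> [i n]; rewrite ltW//; apply: Pmono.
- move=> [i n] [j n'] z /= /andP[h1 h2] /andP[h3 h4].
  have ij : i = j.
    apply: (dis _ _ z); apply/andP; split.
    + exact: le_lt_trans (Pge _ _ (ltnW (ltn_ord n))) h1.
    + exact: lt_le_trans h2 (Ple _ _ (ltn_ord n)).
    + exact: le_lt_trans (Pge _ _ (ltnW (ltn_ord n'))) h3.
    + exact: lt_le_trans h4 (Ple _ _ (ltn_ord n')).
  subst j; congr existT; apply/val_inj/eqP; rewrite /=.
  case: (ltngtP n n') => // nn.
    have : P i n.+1 <= P i n'.
      by move: nn; rewrite leq_eqVlt => /orP[/eqP ->//|nn]; rewrite ltW// Pmono// ltnW.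
    by move=> h5; have := lt_trans h2 (le_lt_trans h5 h3); rewrite ltxx.
  have : P i n'.+1 <= P i n.
    by move: nn; rewrite leq_eqVlt => /orP[/eqP ->//|nn]; rewrite ltW// Pmono// ltnW.
  by move=> h5; have := lt_trans h4 (le_lt_trans h5 h1); rewrite ltxx.
- rewrite (_ : \sum_u _ = \sum_i (y i - x i))//.
  transitivity (\sum_i \sum_(n < size (s i)) (P i n.+1 - P i n)); first by rewrite sig_big_dep.
  apply: eq_bigr => i _; rewrite -(big_mkord xpredT (fun n => P i n.+1 - P i n)).
  by rewrite telescope_sumr// /P (itv_partition_nth_size _ (ps i)).
Qed.

Notation TV := (@total_variation R).

Lemma ac_total_variation1 w (d e x y : R) : ac_bound w d e -> x <= y ->
  y - x < d -> (TV x y w <= e%:E)%E.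
Proof.
move=> H xy dxy; apply: ub_ereal_sup => _ [r [s ps <-] <-].
rewrite lee_fin; have := @ac_variation w d e 'I_1 (fun=> x) (fun=> y) (fun=> s) H (fun=> ps).
by rewrite !big_ord1; apply => // i j z _ _; rewrite !ord1.
Qed.

Lemma ac_total_variation w (d e : R) (I : finType) (x y : I -> R) :
  ac_bound w d e -> (forall i, x i <= y i) ->
  (forall i j z, x i < z < y i -> x j < z < y j -> i = j) ->
  \sum_i (y i - x i) < d -> \sum_i fine (TV (x i) (y i) w) <= e.
Proof.
move=> H xy dis sd; apply/ler_addgt0Pr => eta eta0.
pose h := eta / #|I|.+1%:R; have h0 : 0 < h by rewrite divr_gt0.
have fin i : TV (x i) (y i) w \is a fin_num.
  have le1 : y i - x i < d.
    apply: le_lt_trans sd; rewrite (bigD1 i)//= lerDl sumr_ge0// => j _.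
    by rewrite subr_ge0.
  rewrite ge0_fin_numE; last exact: total_variation_ge0.
  by rewrite (le_lt_trans (ac_total_variation1 H (xy i) le1))// ltry.
have exs i : exists s : seq R, itv_partition (x i) (y i) s /\
    fine (TV (x i) (y i) w) - h <= variation (x i) (y i) w s.
  have : ((fine (TV (x i) (y i) w) - h)%:E < TV (x i) (y i) w)%E.
    by rewrite -{2}(fineK (fin i)) lte_fin ltrBlDr ltrDl.
  move=> /ereal_sup_gt[_ [r [s ps <-] <-]]; rewrite lte_fin => /ltW hs.
  by exists s.
have [s hs] := choice exs.
have h1 := ac_variation H (fun i => proj1 (hs i)) dis sd.
apply: le_trans (_ : \sum_i (variation (x i) (y i) w (s i) + h) <= _).
  by apply: ler_sum => i _; rewrite -lerBlDr; exact: proj2 (hs i).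
rewrite big_split /= sumr_const lerD// -mulr_natr /h -mulrA ler_piMr ?(ltW eta0)//.
by rewrite mulrC ler_pdivrMr ?mul1r ?ler_nat.
Qed.

Lemma acR_total_variation_fin w a b : acR w -> a <= b -> TV a b w \is a fin_num.
Proof.
move=> aw ab; have [d d0 H] := aw 1 ltr01.
have d2 : 0 < d / 2 by rewrite divr_gt0.
have step (n : nat) : TV a (a + n%:R * (d / 2)) w \is a fin_num.
  elim: n => [|n IH]; first by rewrite mul0r addr0 total_variationxx.
  have ge : 0 <= n%:R * (d / 2) by rewrite mulr_ge0// ltW.
  have e : a + n.+1%:R * (d / 2) = a + n%:R * (d / 2) + d / 2 by rewrite -natr1; ring.
  rewrite (@total_variationD _ _ _ (a + n%:R * (d / 2))) ?lerDl//; last by rewrite e lerDl ltW.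
  rewrite fin_numD IH/= ge0_fin_numE; last by apply: total_variation_ge0; rewrite e lerDl ltW.
  apply: le_lt_trans (ltry 1); apply: (ac_total_variation1 H); rewrite e; first by rewrite lerDl ltW.
  by rewrite addrAC subrr add0r; lra.
pose n := (Num.truncn ((b - a) / (d / 2))).+1.
have bn : b <= a + n%:R * (d / 2).
  by rewrite -lerBlDl -ler_pdivrMr// ltW// truncnS_gt.
apply/bounded_variationP => //.
by apply: (bounded_variationl ab bn); apply/bounded_variationP => //; exact: le_trans bn.
Qed.

(** ** Monotone absolutely continuous functions have a density *)
Section Monotone.
Variables (G : R -> R) (g0 g1 : R).
Hypothesis ndG : {homo G : x y / x <= y}.
Hypothesis acG : acR G.
Hypothesis Gb : forall t, g0 <= G t <= g1.

Let rcG : right_continuous G.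
Proof. by apply: right_continuousW; exact: acR_continuous. Qed.

Let Gc : cumulative R R := HB.pack G (isCumulative.Build R _ R G ndG rcG).
Let nu := lebesgue_stieltjes_measure Gc.

Let nu_itv x y : x <= y -> nu (`]x, y]%classic : set mR) = (G y - G x)%:E.
Proof.
move=> xy; transitivity (wlength Gc `]x, y]%classic).
  exact: (measurable_mu_extE _ (is_ocitv x y)).
exact: (wlength_itv_bnd Gc false false xy).
Qed.

Let nuT : (nu [set: mR] <= (g1 - g0)%:E)%E.
Proof.
have -> : [set: mR] = \bigcup_k (`](- k%:R), k%:R]%classic : set mR).
  apply/esym; rewrite -subTset => /= x _ /=.
  exists (Num.truncn `|x : R|).+1 => //=; have := truncnS_gt `|x : R|.
  by rewrite ltr_norml in_itv/= => /andP[h1 h2]; rewrite h1 ltW.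
have nd : {homo (fun k => (`](- k%:R), k%:R]%classic : set mR)) : n m / (n <= m)%N >-> (n <= m)%O}.
  move=> n m nm; apply/subsetPset => t /=; rewrite !in_itv/= => /andP[h1 h2].
  have nmR : (n%:R : R) <= m%:R by rewrite ler_nat.
  by apply/andP; split; lra.
have mI k : measurable (`](- k%:R), k%:R]%classic : set mR) by exact: measurable_Ritv.
have := nondecreasing_cvg_mu (mu := nu) mI (bigcup_measurable (fun k _ => mI k)) nd.
move=> h; apply: (cvge_to_le h); near=> k.
have kk : - (k%:R : R) <= k%:R by have := ler0n R k; lra.
apply: (@le_trans _ _ (G k%:R - G (- k%:R))%:E); first by rewrite -(nu_itv kk).
by rewrite lee_fin; have := Gb k%:R; have := Gb (- k%:R); lra.
Unshelve. all: by end_near. Qed.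

Let nuF : {finite_measure set mR -> \bar R} :=
  @mfrestr _ mR R setT nu measurableT (le_lt_trans nuT (ltry _)).

Let nuFE (A : set mR) : nuF A = nu A.
Proof. by rewrite /nuF /= /mfrestr /mrestr setIT. Qed.

Let open_left (U : set R) z : open U -> U z -> exists2 h : R, 0 < h & U (z - h).
Proof.
move=> oU Uz; have /nbhs_ballP[e /= e0 H] : nbhs z U by exact: open_nbhs_nbhs.
exists (e / 2); first by rewrite divr_gt0.
apply: H; rewrite /ball/= opprB addrC subrK ger0_norm; first lra.
by rewrite divr_ge0// ltW.
Qed.

(** The Stieltjes measure is known on intervals ]x, y], and Lebesgue measure does
    not see the end points. *)
Let component_ends (i : interval R) : open [set` i] -> (mu [set` i] < +oo)%E ->
  exists xy : R * R, [/\ xy.1 <= xy.2, [set` i] `<=` `]xy.1, xy.2],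
    `]xy.1, xy.2[ `<=` [set` i] & mu [set` i] = (xy.2 - xy.1)%:E].
Proof.
move=> oi fi; case: (pselect ([set` i] = set0)) => [i0|/eqP/set0P[z zi]].
  exists (0, 0); rewrite i0 /= subrr measure0; split => //.
  by move=> t; rewrite /= in_itv/=; lra.
have [h h0 zh] := open_left oi zi.
move: oi fi zi zh; case: i => -[b1 x|b1] [b2 y|b2] oi fi zi zh.
- have xz : x < z.
    move: zh; rewrite /= in_itv/= => /andP[xzh _]; have := lteifW xzh; lra.
  have zy : z <= y by move: zi; rewrite /= in_itv/= => /andP[_ /lteifW].
  have xy := lt_le_trans xz zy.
  exists (x, y); split => /=; first exact: ltW.
  + move=> t ti; move: (ti); rewrite /= !in_itv/= => /andP[t1 /lteifW ->]; rewrite andbT.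
    have [h' h'0 th] := open_left oi ti.
    by move: th; rewrite /= in_itv/= => /andP[t2 _]; have := lteifW t2; lra.
  + move=> t; rewrite /= !in_itv/= => /andP[t1 t2].
    by case: (b1); case: (b2); rewrite /= ?t1 ?t2 ?(ltW t1) ?(ltW t2).
  + by rewrite lebesgue_measure_itv/= lte_fin xy.
- by move: fi zi {oi zh}; rewrite lebesgue_measure_itv/=; case: b2;
    rewrite /= ?ltxx ?ltry// => _; rewrite /= in_itv/= ?andbF.
- by move: fi zi {oi zh}; rewrite lebesgue_measure_itv/=; case: b1;
    rewrite /= ?ltxx ?ltNyr// => _; rewrite /= in_itv/= ?andbF.
- by move: fi zi {oi zh}; rewrite lebesgue_measure_itv/=; case: b1; case: b2;
    rewrite /= ?ltxx// => _; rewrite /= in_itv/= ?andbF.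
Qed.

Let measure_diff_null (m : {measure set mR -> \bar R}) (U B : set mR) :
  measurable U -> measurable B -> B `<=` U -> m B = 0 -> (m U <= m (U `\` B))%E.
Proof.
move=> mU mB BU B0; apply: (@le_trans _ _ (m (U `\` B) + m B)%E); last by rewrite B0 adde0.
have := measureU2 m (measurableD mU mB) mB; by rewrite setUC (setDUK BU).
Qed.

(** A null set is covered by an open set of small measure, whose components
    form a disjoint family of small total length. *)
Let nu_open (d e : R) (U : set mR) : ac_bound G d e -> open (U : set R) ->
  (mu U < d%:E)%E -> (nu U <= e%:E)%E.
Proof.
move=> H oU Ud.
pose I := open_disjoint_itv oU.
have iI q : I q = [set` Rhull (I q)] by apply/is_intervalP; exact: open_disjoint_itv_is_interval.
have mI q : measurable (I q : set mR) by rewrite iI; exact: measurable_Ritv.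
have UE : U = \bigcup_q I q := open_disjoint_itv_bigcup oU.
have tI : trivIset setT I by exact: open_disjoint_itv_trivIset.
have mU : measurable U by rewrite UE; apply: bigcup_measurable.
have Iq q : (mu (I q) < +oo)%E.
  apply: le_lt_trans (ltry d); apply/ltW; apply: le_lt_trans Ud.
  by apply: le_measure; rewrite ?inE// => z zI; rewrite UE; exists q.
have ends q : exists xy : R * R, [/\ xy.1 <= xy.2, I q `<=` `]xy.1, xy.2],
    `]xy.1, xy.2[ `<=` I q & mu (I q) = (xy.2 - xy.1)%:E].
  have oI : open (I q) by exact: open_disjoint_itv_open.
  by move: (Iq q) oI; rewrite iI => fq oI; exact: component_ends.
have [xy hxy] := choice ends.
have sumE (m : {measure set mR -> \bar R}) : m U = (\sum_(0 <= q <oo) m (I q))%E.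
  have := @measure_bigcup _ R mR m setT I (fun i _ => mI i) tI; rewrite -UE => ->.
  by apply: eq_eseriesl => q; rewrite in_setT.
have nuE : nu U = (\sum_(0 <= q <oo) nu (I q))%E := sumE nu.
have muE : mu U = (\sum_(0 <= q <oo) mu (I q))%E := sumE mu.
rewrite nuE; apply: lime_le; first by apply: is_cvg_nneseries => n _ _; exact: measure_ge0.
near=> n; rewrite big_mkord.
apply: (@le_trans _ _ (\sum_(i < n) (G (xy i).2 - G (xy i).1)%:E)%E).
  apply: lee_sum => i _; have [h1 h2 _ _] := hxy i.
  by rewrite -nu_itv//; apply: le_measure; rewrite ?inE//; exact: measurable_Ritv.
rewrite sumEFin lee_fin.
apply: le_trans (_ : \sum_(i < n) `|G (xy i).2 - G (xy i).1| <= _).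
  by apply: ler_sum => i _; exact: ler_norm.
apply: (H 'I_n (fun i => (xy i).1) (fun i => (xy i).2)).
- by move=> i; have [] := hxy i.
- move=> i j z iz jz; apply/val_inj => /=.
  apply: (tI i j) => //; exists z; split.
    by have [_ _ h _] := hxy i; apply: h; rewrite /= in_itv.
  by have [_ _ h _] := hxy j; apply: h; rewrite /= in_itv.
rewrite -lte_fin -sumEFin; apply: le_lt_trans Ud; rewrite muE.
apply: le_trans (_ : (\sum_(0 <= i < n) mu (I i) <= _)%E).
  rewrite big_mkord; apply: lee_sum => i _; by have [_ _ _ ->] := hxy i.
exact: nneseries_lim_ge.
Unshelve. all: by end_near. Qed.

(** Outer regularity reduces null sets to open sets of small measure. *)
Let nu_dominated : nuF `<< mu.
Proof.
move=> A A0 B mB BA; rewrite nuFE; have B0 : mu B = 0 := A0 B mB BA.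
apply/eqP; rewrite eq_le measure_ge0 andbT; apply/lee_addgt0Pr => e e0; rewrite add0e.
have [d d0 H] := acG e0.
have fB : (mu B < +oo)%E by apply: le_lt_trans (ltry 0); rewrite le_eqVlt; apply/orP; left; apply/eqP; exact: B0.
have [U [oU BU UB]] := lebesgue_regularity_outer mB fB d0.
have mU : measurable (U : set mR) := open_measurable oU.
have UE : (mu U <= mu (U `\` B))%E by exact: measure_diff_null.
apply: le_trans (nu_open H oU _); last exact: le_lt_trans UE UB.
by apply: le_measure; rewrite ?inE.
Qed.

(** The Stieltjes measure of G is absolutely continuous, so that the
    Radon-Nikodym theorem applies. *)
Lemma monotone_ac_density : exists phi : R -> R,
  mu.-integrable setT (EFin \o phi) /\
  forall x y, x <= y -> G y - G x = \int[mu]_(t in `]x, y]) phi t.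
Proof.
have [f [f0 ff fi fE]] := radon_nikodym_sigma_finite nu_dominated.
have fK : EFin \o (fun t => fine (f t)) = f by apply/funext => t /=; rewrite fineK.
exists (fun t => fine (f t)); rewrite fK; split => // x y xy.
have := fE _ (@measurable_Ritv R `]x, y]); rewrite nuFE (nu_itv xy) /Rintegral.
rewrite (_ : (fun t => (fine (f t))%:E) = f)//.
by move=> <-.
Qed.

End Monotone.

Lemma derive_add_cst (F H : R -> R) (k x : R) : (forall z, H z = F z + k) ->
  derivable F x 1 -> derivable H x 1 /\ H^`()%classic x = F^`()%classic x.
Proof.
move=> HF dF; have -> : H = F \+ cst k by apply/funext => z; exact: HF.
have dc : derivable (cst k : R -> R) x 1 by exact: derivable_cst.
split; first exact: derivableD.
by rewrite !derive1E (deriveD dF dc) derive_cst addr0.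
Qed.

Lemma Rintegral_Ny_split (phi : R -> R) x y : mu.-integrable setT (EFin \o phi) -> x <= y ->
  \int[mu]_(t in `]-oo, y]) phi t =
  \int[mu]_(t in `]-oo, x]) phi t + \int[mu]_(t in `]x, y]) phi t.
Proof.
move=> iphi xy; have U : `]-oo, y]%classic = `]-oo, x] `|` `]x, y].
  apply/seteqP; split => t /=; rewrite !in_itv/=; last by move=> [|/andP[]]; lra.
  by move=> ty; case: (leP t x) => tx; [left|right].
rewrite {1}U; apply: Rintegral_setU; [exact: measurable_Ritv|exact: measurable_Ritv|..].
  by rewrite -U; exact: integrable_Rsub measurableT (measurable_Ritv _) _ iphi.
apply/disj_setPS => t [] /=; rewrite !in_itv/=; lra.
Qed.

(** Lebesgue differentiation of the indefinite integral of phi. *)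
Lemma density_derive G (phi : R -> R) : mu.-integrable setT (EFin \o phi) ->
  (forall x y, x <= y -> G y - G x = \int[mu]_(t in `]x, y]) phi t) ->
  {ae mu, forall x, derivable G x 1 /\ G^`()%classic x = phi x}.
Proof.
move=> iphi Gphi.
have iy (y : R) : mu.-integrable `]-oo, y] (EFin \o phi).
  exact: integrable_Rsub measurableT (measurable_Ritv _) _ iphi.
have loc : locally_integrable setT phi.
  by have := @integrable_locally R phi setT measurableT iphi; rewrite patch_setT.
pose F x := \int[mu]_(t in `]-oo, x]) phi t.
have FE x y : x <= y -> F y = F x + \int[mu]_(t in `]x, y]) phi t.
  exact: Rintegral_Ny_split.
have GE x : G x = F x + (G 0 - F 0).
  have [x0|x0] := leP 0 x.
    by rewrite (FE 0 x x0) -Gphi//; lra.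
  by rewrite (FE x 0 (ltW x0)) -Gphi 1?ltW//; lra.
apply: ae_imply (FTC1Ny iy loc) _ => x [dF dE].
by have [dG ->] := derive_add_cst GE dF.
Qed.

(** Jordan decomposition: the variation V of w and V - w are monotone and
    inherit absolute continuity. *)
Lemma acR_density w b : 0 < b -> acR w -> (forall t, t <= 0 -> w t = w 0) ->
  (forall t, b <= t -> w t = w b) ->
  exists phi : R -> R, [/\ mu.-integrable setT (EFin \o phi),
    forall x y, x <= y -> w y - w x = \int[mu]_(t in `]x, y]) phi t &
    {ae mu, forall x, derivable w x 1 /\ w^`()%classic x = phi x}].
Proof.
move=> b0 acw w0 wb.
pose c (t : R) := Num.max 0 (Num.min t b).
have wc t : w (c t) = w t.
  rewrite /c; case: (leP t b) => tb; first by case: (leP 0 t) => t0 //; rewrite (w0 t) ?ltW.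
  by rewrite (max_idPr (ltW b0)) (wb t)// ltW.
have c0 t : 0 <= c t by rewrite /c le_max lexx.
have cb t : c t <= b by rewrite /c ge_max (ltW b0) ge_min lexx orbT.
have cmono x y : x <= y -> c x <= c y.
  by move=> xy; rewrite /c; case: (leP x b); case: (leP y b); move=> h1 h2;
    rewrite ?ge_max ?le_max ?lexx ?(ltW b0) ?orbT //=; try lra;
    case: (leP 0 x); case: (leP 0 y); lra.
have clen x y : x <= y -> c y - c x <= y - x.
  by move=> xy; rewrite /c; case: (leP x b); case: (leP y b); move=> h1 h2;
    rewrite ?(max_idPr (ltW b0)); case: (leP 0 x); try case: (leP 0 y); lra.
have cin x y z : c x < z < c y -> x < z < y.
  rewrite /c => /andP[]; rewrite gt_max gt_min => /andP[z0 /orP[xz|bz]];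
    rewrite lt_max lt_min => /orP[|/andP[zy zb]]; lra.
(* The variation is taken up to the clamped point c t, since w is constant outside
   [0, b]. *)
pose V t := fine (TV 0 (c t) w).
have Vd x y : x <= y -> V y - V x = fine (TV (c x) (c y) w).
  move=> xy; rewrite /V (total_variationD w (c0 x) (cmono _ _ xy)) fineD.
  - by rewrite addrAC subrr add0r.
  - exact: acR_total_variation_fin.
  - by apply: acR_total_variation_fin => //; exact: cmono.
have ndV : {homo V : x y / x <= y}.
  by move=> x y xy; rewrite -subr_ge0 Vd// fine_ge0// total_variation_ge0// cmono.
have acV : acR V.
  move=> e e0; have [d d0 H] := acw e e0; exists d => // I x y xy dis sd.
  have := @ac_total_variation w d e I (fun i => c (x i)) (fun i => c (y i)) H
    (fun i => cmono _ _ (xy i)).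
  move=> h; apply: le_trans (h _ _).
  - by apply: ler_sum => i _; rewrite ger0_norm ?Vd// fine_ge0// total_variation_ge0// cmono.
  - by move=> i j z /cin iz /cin jz; exact: dis iz jz.
  - by apply: le_lt_trans sd; apply: ler_sum => i _; exact: clen.
have ndU : {homo (fun t => V t - w t) : x y / x <= y}.
  move=> x y xy; rewrite -subr_ge0.
  have -> : V y - w y - (V x - w x) = (V y - V x) - (w y - w x) by ring.
  rewrite subr_ge0 Vd// -(wc y) -(wc x); apply: le_trans (ler_norm _) _.
  rewrite -lee_fin fineK; first exact: total_variation_ge (cmono _ _ xy).
  by apply: acR_total_variation_fin => //; exact: cmono.
have cE t : V t = V (c t) by rewrite /V /c; congr (fine (TV _ _ _)); case: (leP t b) => h;
  [case: (leP 0 t) => h2; rewrite ?(min_idPl h) ?(min_idPl (ltW b0)) ?(max_idPr h2) ?maxxx//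
  |rewrite (max_idPr (ltW b0)) minxx (max_idPr (ltW b0))].
have bound (f : R -> R) : {homo f : x y / x <= y} -> (forall t, f t = f (c t)) ->
    forall t, f 0 <= f t <= f b.
  by move=> ndf fc t; rewrite (fc t) !ndf.
have [p1 [i1 E1]] := monotone_ac_density ndV acV (bound _ ndV cE).
have cE2 t : V t - w t = V (c t) - w (c t) by rewrite wc -cE.
have [p2 [i2 E2]] := monotone_ac_density ndU (acR_sub acV acw) (bound _ ndU cE2).
have i12 := integrable_RB measurableT i1 i2.
have E12 x y : x <= y -> w y - w x = \int[mu]_(t in `]x, y]) (p1 t - p2 t).
  move=> xy; have mI := @measurable_Ritv R `]x, y].
  have j1 := integrable_Rsub measurableT mI (@subsetT _ _) i1.
  have j2 := integrable_Rsub measurableT mI (@subsetT _ _) i2.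
  by rewrite (RintegralB mI j1 j2) -E1// -E2//; ring.
exists (fun t => p1 t - p2 t); split => //.
exact: density_derive.
Qed.

(** Continued by constants to both sides, v becomes absolutely continuous on the
    whole line, where it is a difference of monotone functions with densities. *)
Theorem abs_continuous_density v (l0 : R) b : 0 < b -> abs_continuous_on `]0, b] v ->
  v t @[t --> 0^'+] --> l0 -> exists phi : R -> R,
  [/\ mu.-integrable setT (EFin \o phi),
    forall t, 0 < t <= b -> v t = l0 + \int[mu]_(s in `]0, t]) phi s &
    {ae mu, forall t, 0 < t < b -> v^`()%classic t = phi t}].
Proof.
move=> b0 acv cv.
have acw := acR_extend0 b0 acv cv; set w := extend0 v l0 b in acw.
have w0 t : t <= 0 -> w t = l0 by move=> t0; rewrite /w /extend0 t0.
have wv t : 0 < t <= b -> w t = v t.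
  by move=> /andP[t0 tb]; rewrite /w /extend0 leNgt t0/= (min_idPl tb).
have [phi [ip E aeE]] : exists phi : R -> R, [/\ mu.-integrable setT (EFin \o phi),
    forall x y, x <= y -> w y - w x = \int[mu]_(t in `]x, y]) phi t &
    {ae mu, forall x, derivable w x 1 /\ w^`()%classic x = phi x}].
  apply: (acR_density b0 acw) => t; first by move=> t0; rewrite !w0.
  move=> bt; rewrite /w /extend0 leNgt (lt_le_trans b0 bt) leNgt b0/=.
  by rewrite (min_idPr bt) minxx.
exists phi; split => //.
  by move=> t /andP[t0 tb]; rewrite -(E 0 t (ltW t0)) (w0 0 (lexx _)) wv ?t0 ?tb// addrC subrK//.
apply: ae_imply aeE _ => t [_ dw] /andP[t0 tb]; rewrite -dw !derive1E.
apply: near_eq_derive; near=> s; rewrite wv//; apply/andP; split; last apply: ltW.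
  by near: s; exact: lt_nbhsr.
by near: s; exact: lt_nbhsl.
Unshelve. all: by end_near. Qed.

End AbsoluteContinuity.

(** * Convolution of causal functions *)

Section CausalCalculus.
Variable R : realType.
Local Notation C := R[i].
Local Notation mu := (@lebesgue_measure R).
Local Notation mR := (measurableTypeR R).
Implicit Types (u v : R -> C) (t s a b : R) (z : C).

Lemma ae_reflect (P : R -> Prop) t : {ae mu, forall s, P s} -> {ae mu, forall s, P (t - s)}.
Proof.
move=> [N [mN N0 PN]]; exists ((fun s : mR => (t - s : mR)) @^-1` N); split.
- by rewrite -[X in measurable X]setTI; exact: (measurable_reflect t measurableT mN).
- by have := lebesgue_measure_reflect t mN; rewrite /pushforward N0 => <-.
- by move=> s /= nP; exact: PN.
Qed.

Lemma ae_neq_point (a : R) : {ae mu, forall s, s != a}.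
Proof.
exists [set a]; split; first exact: measurable_set1.
  exact: lebesgue_measure_set1.
by move=> s /= /negP; rewrite negbK => /eqP.
Qed.

(** Transforms and convolutions only see t > 0; cutting makes a function causal
    whatever its values at t <= 0. *)
Definition cut u t : C := if 0 < t then u t else 0.

Lemma causal_cut u : causal (cut u).
Proof. by move=> t t0; rewrite /cut ltNge t0. Qed.

Lemma cut_mem u : cut u = (fun t => if t \in `]0, +oo[%classic then u t else 0).
Proof. by apply/funext => t; rewrite /cut mem_setE in_itv/= andbT. Qed.

Lemma ccont_pos_cut u : ccont_pos u -> ccont_pos (cut u).
Proof.
move=> cu t t0; have [h1 h2] := cu t t0.
have e : \forall s \near t, u s = cut u s.
  by near=> s; rewrite /cut ifT//; near: s; exact: lt_nbhsr.
split.
  rewrite /prop_for /continuous_at {2}/cut t0; apply: cvg_trans h1; apply: near_eq_cvg.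
  by near=> s; congr complex.Re; near: s.
rewrite /prop_for /continuous_at {2}/cut t0; apply: cvg_trans h2; apply: near_eq_cvg.
by near=> s; congr complex.Im; near: s.
Unshelve. all: by end_near. Qed.

Lemma cmeasurable_mkcond (A : set mR) u : measurable A -> cmeasurable A u ->
  cmeasurable [set: mR] (fun t => if t \in A then u t else 0).
Proof.
move=> mA [h1 h2]; split.
  rewrite (_ : (fun t => _) = (fun t => complex.Re (u t)) \_ A); last first.
    by apply/funext => t; rewrite patchE; case: ifP.
  exact: (proj1 (measurable_restrictT (fun t : mR => complex.Re (u t)) mA) h1).
rewrite (_ : (fun t => _) = (fun t => complex.Im (u t)) \_ A); last first.
  by apply/funext => t; rewrite patchE; case: ifP.
exact: (proj1 (measurable_restrictT (fun t : mR => complex.Im (u t)) mA) h2).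
Qed.

Lemma cmeasurable_causal u : causal u -> ccont_pos u -> cmeasurable [set: mR] u.
Proof.
move=> cu /ccont_pos_cmeasurable h.
have := cmeasurable_mkcond (@measurable_Ritv R `]0, +oo[) h.
rewrite (_ : (fun t => _) = u)//; apply/funext => t.
rewrite mem_setE in_itv/= andbT; case: ltP => // t0; by rewrite cu.
Qed.

Lemma null_subset_itv (a b : R) (N : set R) : a < b -> `]a, b[%classic `<=` N ->
  mu.-negligible N -> False.
Proof.
move=> ab sub [B [mB B0 NB]].
have : (mu (`]a, b[%classic : set mR) <= mu B)%E.
  by apply: le_measure; rewrite ?inE//; exact: subset_trans sub NB.
by rewrite B0 lebesgue_measure_itv/= lte_fin ab -EFinD lee_fin; lra.
Qed.

(** A null set contains no interval, so that continuity removes the exceptional set. *)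
Lemma ae_ccont_eq u v : ccont_pos u -> ccont_pos v ->
  {ae mu, forall t, 0 < t -> u t = v t} -> forall t, 0 < t -> u t = v t.
Proof.
move=> cu cv ae t t0.
have key (f g : R -> R) : {for t, continuous f} -> {for t, continuous g} ->
    (forall s, u s = v s -> f s = g s) -> f t = g t.
  move=> cf cg fg; apply/eqP/negP => /negP ne.
  have cd : {for t, continuous (fun s => `|f s - g s|)}.
    by apply: cvg_norm; apply: cvgB.
  have pos : 0 < `|f t - g t| by rewrite normr_gt0 subr_eq0.
  have n1 : \forall s \near t, 0 < `|f s - g s| by exact: (cvgr_gt _ cd).
  have n2 : \forall s \near t, 0 < s by exact: lt_nbhsr.
  have /nbhs_ballP[e /= e0 H] : \forall s \near t, 0 < s /\ 0 < `|f s - g s|.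
    by near=> s; split; near: s.
  apply: (@null_subset_itv t (t + e) _ _ _ ae); first by rewrite ltrDl.
  move=> s; rewrite /= in_itv/= => /andP[ts se] H'.
  have [s0 ds] : 0 < s /\ 0 < `|f s - g s|.
    by apply: H; rewrite /ball/= ltr0_norm; [lra|rewrite subr_lt0].
  by move: ds; rewrite (fg s (H' s0)) subrr normr0 ltxx.
have [c1 c2] := cu t t0; have [d1 d2] := cv t t0.
apply: cplxP; first by apply: (key _ _ c1 d1) => s ->.
by apply: (key _ _ c2 d2) => s ->.
Unshelve. all: by end_near. Qed.

Definition locint v : Prop := forall b, cintegrable (`]0, b]%classic : set mR) v.

Definition locbounded u : Prop := forall b, exists K : R, forall t, t <= b -> c1norm (u t) <= K.

Lemma Lexp_locint (s : R) v : Lexp s v -> locint v.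
Proof.
move=> hv b; have mI := @measurable_Ritv R `]0, b].
have h1 := cintegrableS measurableT mI (@subsetT _ _) hv.
have mE : cmeasurable (`]0, b]%classic : set mR) (fun t => (expR (- (- s * t)))%:C).
  apply: cmeasurable_real; apply: measurable_funS (measurable_expNM (- s)) => //.
have h2 := cintegrableMb (K := expR (`|s| * b)) mI h1 mE.
apply: eq_cintegrable (h2 _) => //.
  move=> t _; rewrite /wexp -mulrA -rmorphM -expRD.
  by rewrite (_ : _ + _ = 0) ?expR0 ?mulr1//; ring.
move=> t; rewrite /= in_itv/= => /andP[t0 tb].
rewrite c1norm_real ger0_norm ?expR_ge0// ler_expR mulNr opprK.
apply: le_trans (ler_norm _) _; rewrite normrM (gtr0_norm t0).
by rewrite ler_wpM2l.
Qed.

(** Near 0 local integrability suffices, far away the growth bound. *)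
Lemma locint_Lexp (s : R) v : causal v -> ccont_pos v -> locint v ->
  (exists K : R, exists b : R, forall t, b <= t -> c1norm (v t) <= K * expR (s * t)) ->
  forall s', s < s' -> Lexp s' v.
Proof.
move=> cv ccv lv [K [b0 hK]] s' ss'; pose b := Num.max b0 0.
have bb : b0 <= b by rewrite /b le_max lexx.
have b00 : 0 <= b by rewrite /b le_max lexx orbT.
have mv := cmeasurable_causal cv ccv.
have mw := cmeasurable_wexp s' mv.
have m1 := @measurable_Ritv R `]0, b]; have m2 := @measurable_Ritv R `]b, +oo[.
have i1 : cintegrable (`]0, b]%classic : set mR) (wexp s' v).
  have mE : cmeasurable (`]0, b]%classic : set mR) (fun t => (expR (- (s' * t)))%:C).
    apply: cmeasurable_real; apply: measurable_funS (measurable_expNM s') => //.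
  apply: (cintegrableMb (K := expR (`|s'| * b)) m1 (lv b) mE) => t.
  rewrite /= in_itv/= => /andP[t0 tb].
  rewrite c1norm_real ger0_norm ?expR_ge0// ler_expR.
  apply: le_trans (ler_norm _) _; rewrite normrN normrM (gtr0_norm t0).
  by rewrite ler_wpM2l.
have i2 : cintegrable (`]b, +oo[%classic : set mR) (wexp s' v).
  have ig : mu.-integrable `]b, +oo[ (EFin \o gweight 1 (s' - s)).
    apply: integrable_Rsub (measurable_Ritv `]0, +oo[) m2 _ _.
      by move=> t; rewrite /= !in_itv/= !andbT; exact: le_lt_trans.
    by apply: integrable_gweight => //; rewrite subr_gt0.
  apply: (cintegrable_dominated m2 _ (integrable_RZ K m2 ig)).
    by apply: cmeasurableS mw.
  move=> t; rewrite /= in_itv/= andbT => bt.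
  rewrite /wexp c1normMr (ger0_norm (expR_ge0 _)).
  apply: (@le_trans _ _ (K * expR (s * t) * expR (- (s' * t)))).
    by rewrite ler_pM2r ?expR_gt0// hK// (le_trans bb)// ltW.
  by rewrite -mulrA -expRD /gweight subrr mul0r le_eqVlt; apply/orP; left; apply/eqP;
    congr (_ * expR _); ring.
have j1 := proj1 (cintegrable_mkcond _ m1) i1; have j2 := proj1 (cintegrable_mkcond _ m2) i2.
have := cintegrableD measurableT j1 j2.
apply: eq_cintegrable => // t _; rewrite !mem_setE !in_itv/= andbT.
case: (leP t b) => tb; rewrite ?andbT ?andbF ?addr0 ?add0r//.
case: ltP => // t0; by rewrite /wexp cv// mul0r.
Qed.

Lemma cconv_itv u v t b : causal u -> causal v -> t <= b ->
  cconv u v t = cint (`]0, b]%classic : set mR) (fun s => u (t - s) * v s).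
Proof.
move=> cu cv tb; rewrite cint_mkcond; apply: eq_cint => s _.
rewrite mem_setE in_itv/=; case: ltP => s0; last by rewrite (cv s s0) mulr0.
case: leP => //= bs; by rewrite cu ?mul0r// subr_le0 ltW// (le_lt_trans tb).
Qed.

Lemma cmeasurable_conv u v t : cmeasurable [set: mR] u -> cmeasurable [set: mR] v ->
  cmeasurable [set: mR] (fun s => u (t - s) * v s).
Proof. by move=> mu' mv; apply: cmeasurableM => //; exact: cmeasurable_reflect. Qed.

Lemma cconv_aer u v v' t : cmeasurable [set: mR] u -> cmeasurable [set: mR] v ->
  cmeasurable [set: mR] v' -> {ae mu, forall s, v s = v' s} ->
  cconv u v t = cconv u v' t.
Proof.
move=> mu' mv mv' ae; apply: cint_ae => //; try exact: cmeasurable_conv.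
by apply: ae_imply ae _ => s -> _.
Qed.

Lemma cconv_ael u u' v t : cmeasurable [set: mR] u -> cmeasurable [set: mR] u' ->
  cmeasurable [set: mR] v -> {ae mu, forall s, u s = u' s} ->
  cconv u v t = cconv u' v t.
Proof.
move=> mu' mu'' mv ae; apply: cint_ae => //; try exact: cmeasurable_conv.
by apply: ae_imply (ae_reflect t ae) _ => s -> _.
Qed.

Lemma cconv_integrable u v t b : causal u -> causal v -> cmeasurable [set: mR] u ->
  locbounded u -> locint v -> t <= b ->
  cintegrable setT (fun s => u (t - s) * v s).
Proof.
move=> cu cv mu' bu iv tb; have mI := @measurable_Ritv R `]0, b].
have [K hK] := bu b.
have h : cintegrable (`]0, b]%classic : set mR) (fun s => u (t - s) * v s).
  have h0 := @cintegrableMb R `]0, b] v (fun s => u (t - s)) K mI (iv b).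
  apply: eq_cintegrable (h0 _ _) => //.
  - by move=> s _; rewrite mulrC.
  - by apply: cmeasurableS (cmeasurable_reflect t mu').
  - move=> s; rewrite /= in_itv/= => /andP[s0 _]; apply: hK; lra.
have := proj1 (cintegrable_mkcond _ mI) h.
apply: eq_cintegrable => // s _; rewrite mem_setE in_itv/=.
case: ltP => s0; last by rewrite (cv s s0) mulr0.
case: leP => //= bs; by rewrite cu ?mul0r// subr_le0 ltW// (le_lt_trans tb).
Qed.

Lemma cconvC u v t : causal u -> causal v -> cmeasurable [set: mR] u ->
  locbounded u -> locint v -> cconv u v t = cconv v u t.
Proof.
move=> cu cv mu' bu iv.
have := cint_reflect t (cconv_integrable (t := t) cu cv mu' bu iv (lexx t)).
rewrite /cconv => <-; apply: eq_cint => s _.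
by rewrite subKr mulrC.
Qed.

Lemma locint_measurable v : causal v -> locint v -> cmeasurable [set: mR] v.
Proof.
move=> cv lv.
have mk (k : nat) : cmeasurable [set: mR] (fun t => if t \in `]0, (k%:R : R)]%classic then v t else 0).
  by apply: cmeasurable_mkcond (measurable_Ritv _) (cintegrable_cmeasurable (lv _)).
have ev t : ccvg (fun k : nat => if t \in `]0, (k%:R : R)]%classic then v t else 0) (v t).
  have e : \forall k \near \oo, (if t \in `]0, (k%:R : R)]%classic then v t else 0) = v t.
    near=> k; rewrite mem_setE in_itv/=; case: ltP => t0; last by rewrite (cv t t0).
    rewrite ifT//=; apply: (@le_trans _ _ (Num.truncn t).+1%:R); first exact/ltW/truncnS_gt.
    by rewrite ler_nat; near: k; exact: nbhs_infty_ge.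
  split; apply: cvg_near_cst; near=> k.
    by congr complex.Re; near: k.
  by congr complex.Im; near: k.
split.
  apply: (measurable_fun_cvg (fun k => proj1 (mk k))) => t _; exact: proj1 (ev t).
apply: (measurable_fun_cvg (fun k => proj2 (mk k))) => t _; exact: proj2 (ev t).
Unshelve. all: by end_near. Qed.

Lemma cconv_locbounded u v : causal u -> causal v -> cmeasurable [set: mR] u ->
  locbounded u -> locint v -> locbounded (cconv u v).
Proof.
move=> cu cv mu' bu iv b; have mI := @measurable_Ritv R `]0, b].
have [K hK] := bu b.
exists (K * \int[mu]_(s in `]0, b]) c1norm (v s)) => t tb.
rewrite (cconv_itv cu cv tb).
have h0 := cconv_integrable cu cv mu' bu iv tb.
have h := cintegrableS measurableT mI (@subsetT _ _) h0.
apply: le_trans (c1norm_cint mI h) _.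
have iv' := cintegrable_norm mI (iv b).
rewrite -RintegralZl//.
apply: le_Rintegral => //; first exact: cintegrable_norm mI h.
  exact: integrable_RZ.
move=> s; rewrite /= in_itv/= => /andP[s0 _].
apply: le_trans (c1normM _ _) _; rewrite ler_wpM2r ?c1norm_ge0//.
by apply: hK; lra.
Qed.

Lemma seq_continuous (f : R -> R) t :
  (forall x_ : nat -> R, x_ n @[n --> \oo] --> t -> f (x_ n) @[n --> \oo] --> f t) ->
  {for t, continuous f}.
Proof. by move=> H; apply/continuous_withinNx/cvgr_dnbhsP => x_ [_]; exact: H. Qed.

(** The jump of u at 0 meets the point s = t only, where v may be changed. *)
Lemma cconv_ccont_pos u v : causal u -> causal v -> ccont_pos u ->
  locbounded u -> locint v -> ccont_pos (cconv u v).
Proof.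
move=> cu cv ccu bu iv t t0.
have mu' := cmeasurable_causal cu ccu.
have mv := locint_measurable cv iv.
pose v' s := if s == t then 0 else v s.
have aev : {ae mu, forall s, v s = v' s}.
  by apply: ae_imply (ae_neq_point t) _ => s /negbTE st; rewrite /v' st.
have mv' : cmeasurable [set: mR] v'.
  have := cmeasurable_if (B := [set t]) measurableT (measurable_set1 t) (cmeasurable_cst _ 0) mv.
  rewrite (_ : (fun s => _) = v')//; apply/funext => s.
  by rewrite /v' in_set1.
have cv' : causal v' by move=> s s0; rewrite /v'; case: eqP => // _; exact: cv.
have E s : cconv u v s = cconv u v' s by exact: cconv_aer.
pose b := t + 1; have mI := @measurable_Ritv R `]0, b].
have [K hK] := bu b.
have main (x_ : nat -> R) : x_ n @[n --> \oo] --> t -> (forall n, x_ n <= b) ->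
    ccvg (fun n => cconv u v (x_ n)) (cconv u v t).
  move=> xt xb.
  have tb : t <= b by rewrite /b lerDl.
  rewrite E (cconv_itv cu cv' tb).
  rewrite (_ : (fun n => _) = fun n => cint (`]0, b]%classic : set mR) (fun s => u (x_ n - s) * v' s)); last first.
    by apply/funext => n; rewrite E (cconv_itv cu cv' (xb n)).
  have iW := integrable_RZ K mI (cintegrable_norm mI (iv b)).
  apply: (proj2 (cint_dct mI _ _ _ iW _)).
  - by move=> n; apply: cmeasurableS (cmeasurable_conv _ mu' mv').
  - by apply: cmeasurableS (cmeasurable_conv _ mu' mv').
  - move=> s; rewrite /= in_itv/= => /andP[s0 sb].
    have [st|st] := eqVneq s t.
      have v0 : v' s = 0 by rewrite /v' st eqxx.
      rewrite v0 mulr0 (_ : (fun x => _) = fun=> 0); first exact: ccvg_cst.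
      by apply/funext => n; rewrite mulr0.
    apply: ccvgM (ccvg_cst _).
    have [ts|ts] := leP t s.
      have ts' : t < s by rewrite lt_neqAle ts andbT eq_sym.
      have e : \forall n \near \oo, u (x_ n - s) = u (t - s).
        near=> n; rewrite !cu//; first lra.
        have : x_ n < s by near: n; exact: (cvgr_lt _ xt).
        lra.
      by split; apply: cvg_near_cst; near=> n; [congr complex.Re|congr complex.Im]; near: n.
    have ts0 : 0 < t - s by lra.
    have [c1 c2] := ccu _ ts0.
    have xs : x_ n - s @[n --> \oo] --> t - s by apply: cvgB => //; exact: cvg_cst.
    by split; [exact: (cvg_comp _ _ xs c1)|exact: (cvg_comp _ _ xs c2)].
  - move=> n s; rewrite /= in_itv/= => /andP[s0 sb].
    apply: le_trans (c1normM _ _) _; apply: ler_pM; rewrite ?c1norm_ge0//.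
      by apply: hK; have := xb n; lra.
    by rewrite /v'; case: ifP => // _; rewrite c1norm0 c1norm_ge0.
have gen (x_ : nat -> R) : x_ n @[n --> \oo] --> t ->
    ccvg (fun n => cconv u v (x_ n)) (cconv u v t).
  move=> xt; pose y_ n := Num.min (x_ n) b.
  have e : \forall n \near \oo, y_ n = x_ n.
    near=> n; rewrite /y_ (min_idPl _)// ltW//; near: n.
    by apply: (cvgr_lt _ xt); rewrite /b ltrDl.
  have yt : y_ n @[n --> \oo] --> t.
    apply: cvg_trans xt; apply: near_eq_cvg; near=> n; apply/esym; by near: n.
  have yb n : y_ n <= b by rewrite /y_ ge_min lexx orbT.
  have [h1 h2] := main _ yt yb; split.
    apply: cvg_trans h1; apply: near_eq_cvg; near=> n; congr (complex.Re (cconv u v _)).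
    by near: n.
  apply: cvg_trans h2; apply: near_eq_cvg; near=> n; congr (complex.Im (cconv u v _)).
  by near: n.
split; apply: seq_continuous => x_ xt; first exact: proj1 (gen x_ xt).
exact: proj2 (gen x_ xt).
Unshelve. all: by end_near. Qed.

End CausalCalculus.

(** * Iterated primitives and the Taylor formula *)

Section TruncatedSolution.
Variable R : realType.
Local Notation C := R[i].
Local Notation mu := (@lebesgue_measure R).
Local Notation mR := (measurableTypeR R).
Implicit Types (u : R -> C) (t s a b : R) (z : C).

Lemma integrable_cut (e : R -> C) (s : R) :
  cintegrable `]0, +oo[ (fun t => e t * cexp (- (s%:C * t%:C))) ->
  Lexp s (cut e) /\ rlap (cut e) s = claplace e s%:C.
Proof.
move=> ie; have mI := @measurable_Ritv R `]0, +oo[.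
have E : wexp s (cut e) = (fun t => if t \in `]0, +oo[%classic then e t * cexp (- (s%:C * t%:C)) else 0).
  apply/funext => t; rewrite /wexp cut_mem; case: ifP => _; last by rewrite mul0r.
  by rewrite -rmorphM -rmorphN cexp_real.
rewrite /Lexp /rlap E; split; first exact: (proj1 (cintegrable_mkcond _ mI) ie).
by rewrite -cint_mkcond.
Qed.

Lemma cut_gweight (e : R -> C) a (K M s : R) : 0 < a -> ccont_pos e ->
  (forall t, 0 < t -> c1norm (e t) <= K * gweight a (- M) t) -> M < s ->
  Lexp s (cut e) /\ rlap (cut e) s = claplace e s%:C.
Proof. by move=> a0 ce eK Ms; apply: integrable_cut; exact: (cintegrable_gweight_bound (z := s%:C) a0 ce eK Ms). Qed.

Lemma gweight_locbounded (e : R -> C) a (K M : R) : 1 <= a -> 0 <= M ->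
  (forall t, 0 < t -> c1norm (e t) <= K * gweight a (- M) t) -> locbounded (cut e).
Proof.
move=> a1 M0 eK b; exists (Num.max 0 (K * expR ((a - 1) * b + M * b))) => t tb.
rewrite /cut; case: ltP => t0; last by rewrite c1norm0 le_max lexx.
have K0 : 0 <= K.
  have := le_trans (c1norm_ge0 (e t)) (eK t t0).
  by rewrite pmulr_lge0 ?gweight_gt0.
rewrite le_max; apply/orP; right; apply: le_trans (eK t t0) _.
rewrite ler_wpM2l// ler_expR mulNr opprK; apply: lerD; last by rewrite ler_wpM2l.
have lt' : ln t <= b by rewrite (le_trans _ tb)//; have := @ln_sublinear R t t0; lra.
by rewrite ler_wpM2l ?subr_ge0.
Qed.

Lemma rgamma1 : rgamma 1 = 1 :> R.
Proof.
rewrite /rgamma; have E t : gweight 1 1 t = expR (- t) by rewrite /gweight subrr mul0r add0r mul1r.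
rewrite (_ : gweight 1 1 = fun t => expR (- t)); last by apply/funext => t; rewrite E.
have d (t : R) : 0 < t -> is_derive t 1 (fun t => - expR (- t)) (expR (- t)).
  move=> _; rewrite -[X in is_derive _ _ _ X]opprK; apply: is_deriveN.
  have h : is_derive t 1 (fun s : R => - s) (-1) by exact: is_deriveN.
  have := @is_derive1_comp R (@expR R) (fun s => - s) t _ _ (is_derive_expR _) h.
  by rewrite mulrN1.
have ce : continuous (fun t : R => expR (- t)).
  move=> t; apply: (@continuous_comp _ _ _ (fun t : R => - t) (@expR R)); first exact: continuousN.
  exact: continuous_expR.
rewrite (@Rintegral_derivative_half_line R (fun t => - expR (- t)) _ (-1) 0); first ring.
- by move=> t _; exact: ce.
- have := @integrable_gweight R 1 1 ltr01 ltr01; apply: eq_integrable; first exact: measurable_Ritv.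
  by move=> t _ /=; rewrite E.
- apply: cvg_at_right_filter; apply: cvgN.
  by have := ce 0; rewrite /continuous_at oppr0 expR0.
- rewrite -[X in _ --> X]oppr0; apply: cvgN.
  exact: (@cvgr_expR R).
Qed.

(** The Heaviside function: convolution with it is integration from 0. *)
Definition heav : R -> C := cut (fun=> 1).

Lemma heav_laplace (s : R) : 0 < s -> Lexp s heav /\ rlap heav s = s%:C^-1.
Proof.
move=> s0; have g1 : cgamma (1 : C) = 1.
  by have := @cgamma_real R 1 ltr01; rewrite rgamma1.
have E : heav = cut (pbase 1).
  apply/funext => t; rewrite /heav /cut /pbase g1 invr1 mul1r /gkernel subrr !mul0r subr0.
  by rewrite cexp0.
have bnd t : 0 < t -> c1norm (pbase 1 t) <= 2 * gweight 1 (- 0) t.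
  move=> t0; rewrite /pbase g1 invr1 mul1r; apply: le_trans (c1norm_gkernel _ _ _) _.
  by rewrite /= oppr0.
have [h1 h2] := cut_gweight ltr01 (ccont_pos_pbase _) bnd s0.
rewrite E; split => //; rewrite h2 claplace_pbase ?ltr01//.
have sn : s%:C != 0 :> C by apply/eqP => -[] /eqP; rewrite gt_eqF.
by rewrite cpowN// cpow1.
Qed.

Lemma ccont_pos_heav : ccont_pos heav.
Proof. exact: ccont_pos_cut (ccont_pos_cst _). Qed.

Lemma locbounded_heav : locbounded heav.
Proof.
move=> b; exists 1 => t _; rewrite /heav /cut; case: ifP => _; rewrite ?c1norm1// c1norm0.
exact: ler01.
Qed.

Local Notation heavC := (causal_cut (fun=> 1)).

(** The p-fold primitive, vanishing at the origin. *)
Definition cprim (p : nat) u : R -> C := iter p (cconv heav) u.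

Lemma cprim_laplace p u (s : R) : 0 < s -> Lexp s u ->
  Lexp s (cprim p u) /\ rlap (cprim p u) s = s%:C^-1 ^+ p * rlap u s.
Proof.
move=> s0 hu; have [h1 h2] := heav_laplace s0.
elim: p => [|p [IH1 IH2]]; first by rewrite expr0 mul1r.
have [k1 k2] := cconv_Lexp h1 IH1; split; first exact: k1.
by rewrite /cprim iterS -/(cprim p u) k2 h2 IH2 exprS mulrA.
Qed.

Lemma causal_cprim p u : causal u -> causal (cprim p u).
Proof. by move=> cu; elim: p => [//|p IH]; apply: cconv_causal => //; exact: heavC. Qed.

Lemma cprimS_regular p u : causal u -> (forall s, 0 < s -> Lexp s u) ->
  ccont_pos (cprim p.+1 u) /\ locbounded (cprim p.+1 u).
Proof.
move=> cu hu; have lu : locint (cprim p u).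
  exact: Lexp_locint (proj1 (cprim_laplace p ltr01 (hu 1 ltr01))).
have cp := causal_cprim p cu.
split; first exact: cconv_ccont_pos heavC cp ccont_pos_heav locbounded_heav lu.
apply: cconv_locbounded heavC cp _ locbounded_heav lu.
exact: cmeasurable_causal heavC ccont_pos_heav.
Qed.

Lemma cconv_heav u t : causal u -> cconv heav u t = cint (`]0, t[%classic : set mR) u.
Proof.
move=> cu; rewrite /cconv [RHS]cint_mkcond; apply: eq_cint => s _.
rewrite mem_setE in_itv/= /heav /cut subr_gt0.
case: (ltP 0 s) => s0; last by rewrite (cu s s0) mulr0.
by case: ifP => _; rewrite ?mul1r ?mul0r.
Qed.

Definition rprim (f : R -> R) t : R := \int[mu]_(s in `]0, t[) f s.

Lemma cprim_parts (f g : R -> R) u (T : R) : causal u ->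
  (forall t, 0 < t <= T -> u t = f t +i* g t) -> forall p t, 0 < t <= T ->
  cprim p u t = (iter p rprim f t) +i* (iter p rprim g t).
Proof.
move=> cu ufg; elim=> [|p IH] t tT; first exact: ufg.
rewrite /cprim iterS cconv_heav; last exact: causal_cprim.
have /andP[t0 tT'] := tT.
rewrite (eq_cint (v := fun s => (iter p rprim f s) +i* (iter p rprim g s))); last first.
  move=> s; rewrite /= in_itv/= => /andP[s0 st]; apply: IH.
  by rewrite s0 (le_trans (ltW st)).
by [].
Qed.

Lemma abs_continuous_cont (v : R -> R) : (forall b, 0 < b -> abs_continuous_on `]0, b] v) ->
  forall t, 0 < t -> {for t, continuous v}.
Proof.
move=> acv t t0; apply/cvgrPdist_lt => e e0.
have t1 : 0 < t + 1 by rewrite addr_gt0.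
have [d d0 H] := acv _ t1 e e0.
have one (x y : R) : 0 < x -> x <= y -> y <= t + 1 -> y - x < d -> `|v y - v x| < e.
  move=> x0 xy yt dxy; have := H 1%N (fun=> x) (fun=> y); rewrite !big_ord1; apply => //.
    move=> _; split => // z; rewrite /= !in_itv/= => /andP[xz zy].
    by rewrite (lt_le_trans x0 xz) (le_trans zy yt).
  by move=> i j _ _ _; rewrite !ord1.
near=> s.
have s0 : 0 < s by near: s; exact: lt_nbhsr.
have s1 : s <= t + 1 by apply: ltW; near: s; apply: lt_nbhsl; rewrite ltrDl.
have ts : `|t - s| < d by near: s; exact: cvgr_dist_lt.
have [st|st] := leP s t; first by apply: one => //; [rewrite lerDl|move: ts; rewrite ger0_norm ?subr_ge0].
rewrite distrC; apply: one => //; first exact: ltW.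
by move: ts; rewrite distrC ger0_norm// subr_ge0 ltW.
Unshelve. all: by end_near. Qed.

(** The limits at 0 extend v and v' continuously to the closed half line. *)
Lemma FTC_from0 (v v' : R -> R) (c d : R) :
  (forall t, 0 < t -> is_derive t 1 v (v' t)) -> (forall t, 0 < t -> {for t, continuous v'}) ->
  v t @[t --> 0^'+] --> c -> v' t @[t --> 0^'+] --> d ->
  forall t, 0 < t -> v t = c + rprim v' t.
Proof.
move=> dv cv' vc vd t t0.
pose w : R -> R := fun x => if x <= 0 then c else v x.
pose w' : R -> R := fun x => if x <= 0 then d else v' x.
have near_pos (f : R -> R) (k x : R) : 0 < x -> \forall y \near x, f y = if y <= 0 then k else f y.
  by move=> x0; near=> y; rewrite leNgt ifF//; apply/negbF; near: y; exact: lt_nbhsr.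
have right0 (f : R -> R) (k : R) : f x @[x --> 0^'+] --> k ->
    (if x <= 0 then k else f x) @[x --> 0^'+] --> k.
  move=> h; apply: cvg_trans h; apply: near_eq_cvg; near=> y; rewrite leNgt ifF//.
  by apply/negbF; near: y; exact: nbhs_right_gt.
have cw' (x : R) : 0 < x -> {for x, continuous w'}.
  move=> x0; rewrite /prop_for /continuous_at {2}/w' leNgt x0 /=.
  by apply: cvg_trans (cv' x x0); apply: near_eq_cvg; exact: near_pos.
have dw (x : R) : 0 < x -> is_derive x 1 w (v' x).
  move=> x0; have h := dv x x0.
  by apply: near_eq_is_derive h; exact: near_pos.
have cont : {within `[0, t], continuous w'}.
  apply/(continuous_within_itvP _ t0); split.
  - by move=> x; rewrite in_itv/= => /andP[x0 _]; exact: cw'.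
  - by rewrite /w' lexx; exact: right0.
  - by apply: cvg_at_left_filter; exact: cw'.
have dob : derivable_oo_LRcontinuous w 0 t.
  split.
  - by move=> x; rewrite in_itv/= => /andP[x0 _]; exact: (@ex_derive _ _ _ _ _ _ _ (dw x x0)).
  - by rewrite /w lexx; exact: right0.
  - apply: cvg_at_left_filter.
    exact: differentiable_continuous (proj1 (derivable1_diffP _ _) (@ex_derive _ _ _ _ _ _ _ (dw t t0))).
have ww' : {in `]0, t[, w^`()%classic =1 w'}.
  move=> x; rewrite in_itv/= => /andP[x0 _].
  by rewrite derive1E (@derive_val _ _ _ _ _ _ _ (dw x x0)) /w' leNgt x0.
have := continuous_FTC2 t0 cont dob ww'.
have E : rprim v' t = \int[mu]_(x in `[0, t]) w' x.
  have iw : mu.-integrable `[0, t] (EFin \o w').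
    exact: continuous_compact_integrable (@segment_compact _ _ _) cont.
  have iw1 : mu.-integrable `]0, t] (EFin \o w').
    apply: integrable_Rsub (measurable_Ritv _) (measurable_Ritv _) _ iw => x.
    by rewrite /= !in_itv/= => /andP[/ltW -> ->].
  have iw2 : mu.-integrable `]0, t[ (EFin \o w').
    apply: integrable_Rsub (measurable_Ritv _) (measurable_Ritv _) _ iw => x.
    by rewrite /= !in_itv/= => /andP[/ltW -> /ltW ->].
  rewrite -(Rintegral_itv_obnd_cbnd iw1) -(Rintegral_itv_bndo_bndc iw2) /rprim.
  by apply: eq_Rintegral => x; rewrite inE/= in_itv/= => /andP[x0 _]; rewrite /w' leNgt x0.
rewrite E /Rintegral => ->; rewrite /w lexx leNgt t0 /=; ring.
Unshelve. all: by end_near. Qed.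

(** Taylor's formula with integral remainder, for functions whose intermediate
    derivatives vanish at the origin. *)
Lemma AC_order_primitive (N : nat) (v : R -> R) (c T : R) : 0 < T -> AC_order N.+1 v ->
  v t @[t --> 0^'+] --> c ->
  (forall p, (0 < p < N.+1)%N -> derive1n p v t @[t --> 0^'+] --> 0) ->
  exists phi : R -> R, [/\ mu.-integrable setT (EFin \o phi),
    {ae mu, forall t, 0 < t < T -> derive1n N.+1 v t = phi t} &
    forall t, 0 < t <= T -> v t = c + iter N.+1 rprim phi t].
Proof.
move=> T0; elim: N v c => [|N IH] v c [dv acv] vc v0.
  have [phi [ip E ae]] := abs_continuous_density T0 (acv T T0) vc.
  exists phi; split => //.
  move=> t tT; have /= -> := E t tT; congr (_ + _).
  rewrite /rprim -Rintegral_itv_bndo_bndc//.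
  exact: integrable_Rsub measurableT (measurable_Ritv _) _ ip.
pose v1 := v^`()%classic.
have v1E p : derive1n p.+1 v = derive1n p v1 by rewrite derive1Sn.
have ac1 : AC_order N.+1 v1.
  split=> [p pN t t0|b b0]; first by rewrite -v1E; apply: dv => //; rewrite ltnS.
  by rewrite -v1E; exact: acv.
have v1c : v1 t @[t --> 0^'+] --> 0.
  by have := v0 1%N isT; rewrite v1E derive1n0.
have [phi [ip ae E]] := IH v1 0 ac1 v1c (fun p pN => ltac:(by rewrite -v1E; apply: v0; move: pN; rewrite !ltnS => /andP[_ ->])).
exists phi; split => //; first by apply: ae_imply ae _ => t h tT; rewrite v1E h.
have dv' t : 0 < t -> is_derive t 1 v (v1 t).
  by move=> t0; apply: DeriveDef; [exact: (dv 0%N isT t t0)|rewrite /v1 derive1E].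
have cv1 t : 0 < t -> {for t, continuous v1}.
  move=> t0; case: N {IH acv v0 v1c E ae} dv ac1 => [|N] dv ac1.
    by apply: (@abs_continuous_cont v1) t0 => b b0; have := proj2 ac1 b b0; rewrite derive1n0.
  have := dv 1%N isT t t0; rewrite v1E derive1n0 => h.
  exact: differentiable_continuous (proj1 (derivable1_diffP _ _) h).
move=> t /andP[t0 tT]; rewrite (FTC_from0 dv' cv1 vc v1c t0); congr (_ + _).
rewrite iterS /rprim; apply: eq_Rintegral => s; rewrite inE/= in_itv/= => /andP[s0 st].
by rewrite E ?add0r// s0 (le_trans (ltW st)).
Qed.

End TruncatedSolution.

(** * The identity satisfied by a truncated solution *)

Arguments heav {R} _.

Section ConvolutionIdentities.
Variable R : realType.
Local Notation C := R[i].
Local Notation mu := (@lebesgue_measure R).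
Local Notation mR := (measurableTypeR R).
Implicit Types (u v : R -> C) (t s a b : R) (z : C).

Lemma realC_neq0 s : 0 < s -> (s%:C : C) != 0.
Proof. by move=> s0; apply/eqP => -[] /eqP; rewrite gt_eqF. Qed.

Section Resolvent.
Variables (l : R) (m n r k : C).
Hypotheses (l0 : 0 <= l) (l1 : l <= 1) (m0 : 0 < complex.Re m) (n0 : 0 < complex.Re n).


Lemma resolvent_rlap (b0 : C) (j0 : nat) (e : R -> C) (K M s : R) : 0 < complex.Re b0 ->
  resolvent_spec l m n r k b0 j0 e K M -> M < s ->
  [/\ Lexp s (cut e), csymbol l m n r s%:C != 0, 1 + k / csymbol l m n r s%:C != 0 &
      rlap (cut e) s = cpow s%:C (- b0) * cpow (1 - r * cpow s%:C (- m)) (- l%:C) ^+ j0 /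
        (1 + k / csymbol l m n r s%:C)].
Proof.
move=> b00 [M0 ce eK eL] Ms; have sn := realC_neq0 (le_lt_trans M0 Ms).
have [h1 h2] := cut_gweight b00 ce eK Ms.
have [w1 E] := eL s%:C Ms.
have D0 : 1 + k / csymbol l m n r s%:C != 0.
  apply/eqP => D0; move: E; rewrite D0 mulr0 => /esym/eqP.
  by apply/negP; rewrite mulf_neq0 ?expf_neq0 ?cpow_neq0.
split => //; first by rewrite /csymbol mulf_neq0 ?cpow_neq0.
by rewrite h2 -E mulfK.
Qed.

Lemma resolvent_locint (b0 : C) (j0 : nat) (e : R -> C) (K M : R) : 0 < complex.Re b0 ->
  resolvent_spec l m n r k b0 j0 e K M -> locint (cut e).
Proof.
move=> b00 spec; have M1 : M < M + 1 by rewrite ltrDl.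
by have [h _ _ _] := resolvent_rlap b00 spec M1; exact: Lexp_locint h.
Qed.

Section Solution.
Variables (N : nat) (tau : C) (phi eh eq eB : R -> C) (Kh Mh Kq Mq KB MB : R).
Hypothesis N0 : (0 < N)%N.
Hypothesis sh : resolvent_spec l m n r k n 1 eh Kh Mh.
Hypothesis sq : resolvent_spec l m n r k 1 0 eq Kq Mq.
Hypothesis sB : resolvent_spec l m n r k N%:R 0 eB KB MB.
Hypotheses (cphi : causal phi) (Lphi : forall s, 0 <= s -> Lexp s phi).

Local Notation h := (cut eh).
Local Notation q := (cut eq).
Local Notation B := (cut eB).

(** The function tau + J^N phi, where J is integration from 0. *)
Definition solution t : C := tau * heav t + cprim N phi t.

Let ReN : complex.Re (N%:R : C) = N%:R := cRe_nat _ N.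
Let N0' : 0 < complex.Re (N%:R : C).
Proof. by rewrite ReN ltr0n. Qed.
Let N1 : 1 <= complex.Re (N%:R : C).
Proof. by rewrite ReN ler1n. Qed.
Let one0 : 0 < complex.Re (1 : C).
Proof. exact: ltr01. Qed.

Let cheav : causal heav := @causal_cut R (fun=> 1).

Lemma causal_solution : causal solution.
Proof. by move=> t t0; rewrite /solution cheav// mulr0 add0r causal_cprim. Qed.

Lemma solution_regular : ccont_pos solution /\ locbounded solution.
Proof.
have L1 s : 0 < s -> Lexp s phi by move=> /ltW; exact: Lphi.
move: N0; rewrite /solution; case: N => // N' _.
have [c1 b1] := cprimS_regular N' cphi L1; split.
  exact: ccont_posD (ccont_posM (ccont_pos_cst _) (@ccont_pos_heav R)) c1.
move=> b; have [K1 hK1] := @locbounded_heav R b; have [K2 hK2] := b1 b.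
exists (c1norm tau * K1 + K2) => t tb; apply: le_trans (c1normD _ _) _.
apply: lerD; last exact: hK2.
by apply: le_trans (c1normM _ _) _; rewrite ler_wpM2l ?c1norm_ge0// hK1.
Qed.

Lemma solution_rlap s : 0 < s -> Lexp s solution /\
  rlap solution s = tau * s%:C^-1 + s%:C^-1 ^+ N * rlap phi s.
Proof.
move=> s0; have [h1 h2] := @heav_laplace R s s0.
have [p1 p2] := cprim_laplace N s0 (Lphi (ltW s0)).
have t1 := LexpZ tau h1; split; first exact: LexpD t1 p1.
by rewrite /solution (rlapD t1 p1) (rlapZ _ h1) h2 p2.
Qed.

Let lbB : locbounded B.
Proof. by have [M0 _ hb _] := sB; exact: gweight_locbounded N1 M0 hb. Qed.

Let lphi : locint phi := Lexp_locint (Lphi (lexx 0)).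

(** The Laplace transforms of both sides agree, and both are continuous. *)
Lemma solution_identity t : 0 < t ->
  solution t = cconv B phi t + k * cconv h solution t + tau * q t.
Proof.
move: t; have [cS bS] := solution_regular; have aS := causal_solution.
have lh : locint h := resolvent_locint n0 sh.
have ch := @causal_cut R eh; have cB := @causal_cut R eB; have cq := @causal_cut R eq.
have [_ ccB _ _] := sB; have [_ cch _ _] := sh; have [_ ccq _ _] := sq.
have mS := cmeasurable_causal aS cS.
have cc1 : ccont_pos (cconv B phi) by exact: cconv_ccont_pos (ccont_pos_cut ccB) lbB lphi.
have cc2 : ccont_pos (cconv h solution).
  rewrite (_ : cconv h solution = cconv solution h); first exact: cconv_ccont_pos.
  by apply/funext => t; rewrite (cconvC t aS ch mS bS lh).
apply: ae_ccont_eq => //.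
  apply: ccont_posD; last exact: ccont_posM (ccont_pos_cst _) (ccont_pos_cut ccq).
  exact: ccont_posD cc1 (ccont_posM (ccont_pos_cst _) cc2).
pose rhs t := cconv B phi t + (k * cconv h solution t + tau * q t).
suff : {ae mu, forall t, solution t + (-1) * rhs t = 0}.
  move=> ae; apply: ae_imply ae _ => t /eqP; rewrite mulN1r subr_eq0 => /eqP -> _.
  by rewrite /rhs addrA.
pose s0 := Num.max (Num.max Mh Mq) (Num.max MB 0) + 1.
have big s : s0 <= s -> [/\ Mh < s, Mq < s, MB < s & 0 < s].
  move=> ss; have: Num.max (Num.max Mh Mq) (Num.max MB 0) < s by apply: lt_le_trans ss; rewrite ltrDl.
  by rewrite !gt_max => /andP[/andP[-> ->] /andP[-> ->]].
have main s : s0 <= s -> Lexp s (fun t => solution t + (-1) * rhs t) /\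
    rlap (fun t => solution t + (-1) * rhs t) s = 0.
  move=> /big[h1 h2 h3 s1].
  have sn := realC_neq0 s1.
  have [Lh A0 D0 Eh] := resolvent_rlap n0 sh h1.
  have [Lq _ _ Eq] := resolvent_rlap one0 sq h2.
  have [LB _ _ EB] := resolvent_rlap N0' sB h3.
  have [LS ES] := solution_rlap s1.
  have Lp := Lphi (ltW s1).
  have [L1 E1] := cconv_Lexp LB Lp.
  have [L2 E2] := cconv_Lexp Lh LS.
  have L3 := LexpZ k L2; have L4 := LexpZ tau Lq.
  have L34 := LexpD L3 L4; have Lr := LexpD L1 L34.
  have Ln := LexpZ (-1) Lr; split; first exact: LexpD LS Ln.
  rewrite (rlapD LS Ln) (rlapZ _ Lr) (rlapD L1 L34) (rlapD L3 L4) (rlapZ _ L2) (rlapZ _ Lq).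
  rewrite E1 E2 Eh Eq EB !expr0 expr1 !mulr1.
  have -> : cpow s%:C (- n) * cpow (1 - r * cpow s%:C (- m)) (- l%:C) = (csymbol l m n r s%:C)^-1.
    have w1 : 1 - r * cpow s%:C (- m) != 0 by have [_ _ _ H] := sh; have [] := H s%:C h1.
    by rewrite /csymbol invfM (cpowN n sn) (cpowN l%:C w1).
  have -> : cpow s%:C (- N%:R) = s%:C^-1 ^+ N by rewrite cpowN// cpow_nat// exprVn.
  have -> : cpow s%:C (- 1) = s%:C^-1 by rewrite cpowN// cpow1.
  set A := csymbol l m n r s%:C in A0 D0 *; set D := 1 + k / A in D0 *.
  (* B and q have the transforms s^-N / D and s^-1 / D, and h has A^-1 / D. *)
  rewrite ES; set i := s%:C^-1; set I := i ^+ N; set p := rlap phi s.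
  have -> : tau * i + I * p + -1 * (I / D * p + (k * (A^-1 / D * (tau * i + I * p)) + tau * (i / D))) =
     (tau * i + I * p) - (tau * i + I * p) * (1 + k / A) / D by ring.
  by rewrite -/D mulfK// subrr.
apply: (@lerch R _ s0).
- move=> t t0; rewrite /rhs (aS t t0) (cconv_causal cB cphi t0) (cconv_causal ch aS t0) (cq t t0).
  by rewrite !mulr0 !addr0 !mulr0 ?addr0.
- exact: proj1 (main s0 (lexx _)).
- by move=> s ss; exact: proj2 (main s ss).
Qed.

End Solution.
End Resolvent.

(** ** Convolution of weights, and Fubini at a single point *)

Lemma Lexp_conv_integrable u v (s : R) : Lexp s u -> Lexp s v ->
  {ae mu, forall t, cintegrable setT (fun y => u (t - y) * v y)}.
Proof.
move=> hu hv; have [_ _ ae] := cconv_L1 hu hv; apply: ae_imply ae _ => t h.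
have := cintegrableZ (expR (s * t))%:C measurableT h.
apply: eq_cintegrable => // y _; rewrite /wexp.
have E : expR (s * t) * expR (- (s * (t - y))) * expR (- (s * y)) = 1.
  by rewrite -!expRD -[RHS]expR0; congr expR; ring.
rewrite -[RHS]mulr1 -[1]/(1%:C) -E !rmorphM; ring.
Qed.

Definition wgt a (M : R) : R -> C := cut (fun t => (gweight a (- M) t)%:C).

Lemma wgt_rlap a (M s : R) : 0 < a -> M < s ->
  Lexp s (wgt a M) /\ rlap (wgt a M) s = cgamma a%:C * cpow (s - M)%:C (- a%:C).
Proof.
move=> a0 Ms; have sM : 0 < s - M by rewrite subr_gt0.
have E : (fun t => (gweight a (- M) t)%:C * cexp (- (s%:C * t%:C))) = gkernel a%:C (s - M)%:C.
  apply/funext => t; rewrite /gkernel.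
  have -> : - (s%:C * t%:C) = (- (s * t))%:C :> C by rewrite rmorphN rmorphM.
  have -> : (a%:C - 1) * (ln t)%:C - (s - M)%:C * t%:C = ((a - 1) * ln t - (s - M) * t)%:C.
    by apply: cplxP; rewrite ?(cReD, cReN, cReM, cImD, cImN, cImM) /=; ring.
  rewrite !cexp_real -rmorphM /gweight -expRD; congr (expR _)%:C; ring.
have ig := @cintegrable_gkernel R a%:C (s - M)%:C a0 sM.
have [h1 h2] := @integrable_cut R (fun t => (gweight a (- M) t)%:C) s (ltac:(by rewrite E)).
split; first exact: h1.
by rewrite /wgt h2 /claplace E cint_gkernel.
Qed.

(** By comparison of transforms the convolution is almost everywhere a multiple of
    the weight with parameter a + b, which is bounded near 0 because a + b >= 1. *)
Lemma wgt_conv a b (M T : R) : 0 < a -> 0 < b -> 1 <= a + b -> 0 <= M ->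
  exists K : R, {ae mu, forall x, x <= T ->
    cintegrable setT (fun s => wgt a M (x - s) * wgt b M s) /\
    c1norm (cconv (wgt a M) (wgt b M) x) <= K}.
Proof.
move=> a0 b0 ab M0; have ab0 : 0 < a + b by rewrite addr_gt0.
have ca c : causal (wgt c M) by exact: causal_cut.
have gab : cgamma (a + b)%:C != 0 :> C by apply: cgamma_neq0.
pose c : C := cgamma a%:C * cgamma b%:C / cgamma (a + b)%:C.
have main s : M + 1 <= s -> Lexp s (fun t => cconv (wgt a M) (wgt b M) t + (- c) * wgt (a + b) M t) /\
    rlap (fun t => cconv (wgt a M) (wgt b M) t + (- c) * wgt (a + b) M t) s = 0.
  move=> Ms; have {}Ms : M < s by apply: lt_le_trans Ms; rewrite ltrDl.
  have [La Ea] := wgt_rlap a0 Ms; have [Lb Eb] := wgt_rlap b0 Ms.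
  have [Lab Eab] := wgt_rlap ab0 Ms.
  have [Lc Ec] := cconv_Lexp La Lb; have Ln := LexpZ (- c) Lab.
  split; first exact: LexpD Lc Ln.
  have sM := realC_neq0 (_ : 0 < s - M); rewrite subr_gt0 in sM; have {}sM := sM Ms.
  rewrite (rlapD Lc Ln) (rlapZ _ Lab) Ec Ea Eb Eab.
  have -> : - (a + b)%:C = - a%:C + - b%:C :> C.
    by apply: cplxP; rewrite ?(cReD, cReN, cImD, cImN) /=; ring.
  have cancel (x y w p q : C) : w != 0 ->
      x * p * (y * q) + - (x * y / w) * (w * (p * q)) = 0 by move=> w0; field.
  by rewrite (cpowD _ _ sM); exact: cancel.
have ae : {ae mu, forall t, cconv (wgt a M) (wgt b M) t + (- c) * wgt (a + b) M t = 0}.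
  apply: (@lerch R _ (M + 1)).
  - by move=> t t0; rewrite cconv_causal// (ca (a + b))// mulr0 addr0.
  - exact: proj1 (main _ (lexx _)).
  - by move=> s ss; exact: proj2 (main s ss).
have M1 : M < M + 1 by rewrite ltrDl.
have ae2 := Lexp_conv_integrable (proj1 (wgt_rlap a0 M1)) (proj1 (wgt_rlap b0 M1)).
have lb : locbounded (wgt (a + b) M).
  apply: (@gweight_locbounded R _ (a + b) 1 M ab M0) => t t0.
  by rewrite c1norm_real gtr0_norm ?gweight_gt0// mul1r.
have [K hK] := lb T.
exists (c1norm c * K); apply: ae_imply (ae_and ae ae2) _ => x [h1 h2] xT; split => //.
have -> : cconv (wgt a M) (wgt b M) x = c * wgt (a + b) M x.
  by move/eqP: h1; rewrite mulNr subr_eq0 => /eqP.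
by apply: le_trans (c1normM _ _) _; rewrite ler_wpM2l ?c1norm_ge0// hK.
Qed.

End ConvolutionIdentities.

(** * Associativity of convolution at a point *)

Section ScalarSolution.
Variable R : realType.
Local Notation C := R[i].
Local Notation mu := (@lebesgue_measure R).
Local Notation mR := (measurableTypeR R).
Implicit Types (u v : R -> C) (t s a b : R) (z : C).

Lemma jmeasurable_fst u : cmeasurable [set: mR] u -> jmeasurable (fun t s => u t).
Proof.
move=> [h1 h2].
by split; [exact: (measurableT_comp h1 measurable_fst)|exact: (measurableT_comp h2 measurable_fst)].
Qed.

Lemma cmeasurable_cint_snd (w : R -> R -> C) : jmeasurable w -> jnorm_finite w ->
  cmeasurable [set: mR] (fun s => cint setT (fun t => w t s)).
Proof.
move=> [m1 m2] fin.
have mn : measurable_fun [set: (mR * mR)%type] (fun p => c1norm (w p.1 p.2)).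
  by apply: measurable_funD; apply: measurableT_comp.
have i1 := @jintegrable_part R (fun t s => complex.Re (w t s))
  (fun t s => c1norm (w t s)) m1 mn (fun t s => normRe_le _) fin.
have i2 := @jintegrable_part R (fun t s => complex.Im (w t s))
  (fun t s => c1norm (w t s)) m2 mn (fun t s => normIm_le _) fin.
have g1 := measurable_fubini_G i1; have g2 := measurable_fubini_G i2.
by split; apply: measurableT_comp.
Qed.

Lemma c1norm_nonneg_real (x : R) : 0 <= x -> c1norm (x%:C : C) = x.
Proof. by move=> x0; rewrite c1norm_real ger0_norm. Qed.

(** Associativity of convolution at a given point t, where the integrand is
    controlled by two nonnegative majorants U, V with bounded convolution. *)
Lemma cconv_assoc_at u v phi (U V : R -> R) (K s0 t : R) :
  causal phi -> cintegrable setT phi -> Lexp s0 u -> Lexp s0 v -> Lexp s0 phi ->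
  (forall x, 0 <= U x) -> (forall x, 0 <= V x) ->
  (forall x, c1norm (u x) <= U x) -> (forall x, c1norm (v x) <= V x) ->
  {ae mu, forall x, x <= t -> cintegrable setT (fun s => (U (x - s))%:C * (V s)%:C) /\
    c1norm (cconv (fun x => (U x)%:C) (fun x => (V x)%:C) x) <= K} ->
  cintegrable setT (fun a => u (t - a) * cconv v phi a) /\
  cconv u (cconv v phi) t = cconv (cconv u v) phi t.
Proof.
move=> cphi iphi Lu Lv Lp U0 V0 uU vV H.
have mu' := Lexp_cmeasurable Lu; have mv := Lexp_cmeasurable Lv.
have mp := cintegrable_cmeasurable iphi.
pose w a y := u (t - a) * v (a - y) * phi y.
have jm : jmeasurable w.
  apply: jmeasurableM (jmeasurable_snd mp); apply: jmeasurableM (jmeasurable_sub mv).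
  by have := @jmeasurable_fst (fun a => u (t - a)) (cmeasurable_reflect t mu').
have H' := ae_reflect t H.
have K' : {ae mu, forall y, (\int[mu]_a (c1norm (w a y))%:E <= (`|K| * c1norm (phi y))%:E)%E}.
  apply: ae_imply H' _ => y hy.
  have [y0|y0] := leP y 0.
    rewrite (_ : (fun a => (c1norm (w a y))%:E) = cst 0%E); last first.
      by apply/funext => a; rewrite /w (cphi y y0) mulr0 c1norm0.
    by rewrite integral0 lee_fin mulr_ge0 ?c1norm_ge0.
  have ty : t - y <= t by lra.
  have [iW bW] := hy ty.
  pose W a := U (t - a) * V (a - y).
  have iW' : cintegrable setT (fun a => (W a)%:C).
    have := cintegrable_translate y iW; apply: eq_cintegrable => // a _.
    by rewrite /W rmorphM; congr ((U _)%:C * _); ring.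
  have EW : cint setT (fun a => (W a)%:C) = cconv (fun x => (U x)%:C) (fun x => (V x)%:C) (t - y).
    rewrite /cconv -(cint_translate y iW); apply: eq_cint => a _.
    by rewrite /W rmorphM; congr ((U _)%:C * _); ring.
  have iWr : mu.-integrable setT (EFin \o W) := proj1 iW'.
  have bWr : \int[mu]_a W a <= `|K|.
    apply: le_trans (ler_norm _) _; apply: le_trans (ler_norm K).
    by apply: le_trans bW; rewrite -EW; exact: normRe_le (cint setT (fun a => (W a)%:C)).
  have W0 a : 0 <= W a by rewrite mulr_ge0.
  have mw : cmeasurable [set: mR] (fun a => w a y).
    apply: cmeasurableM (cmeasurable_cst _ _); apply: cmeasurableM (cmeasurable_reflect t mu') _.
    by have := cmeasurable_reflect 0 (cmeasurable_reflect (- y) mv);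
      rewrite (_ : (fun s => _) = (fun a => v (a - y)))//; apply/funext => a; congr v; ring.
  apply: (@le_trans _ _ (\int[mu]_a (W a * c1norm (phi y))%:E)%E).
    apply: ge0_le_integral => //.
    - by move=> a _; rewrite lee_fin c1norm_ge0.
    - by apply/measurable_EFinP; exact: cmeasurable_norm mw.
    - apply/measurable_EFinP; apply: measurable_funM (measurable_cst _).
      exact: integrable_measurable iWr.
    - move=> a _; rewrite lee_fin /w; apply: le_trans (c1normM _ _) _.
      rewrite ler_wpM2r ?c1norm_ge0//; apply: le_trans (c1normM _ _) _.
      by apply: ler_pM; rewrite ?c1norm_ge0.
  have iWp := integrable_RZ (c1norm (phi y)) measurableT iWr.
  rewrite (_ : (fun a => (W a * c1norm (phi y))%:E) = EFin \o (fun a => c1norm (phi y) * W a)); last first.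
    by apply/funext => a; rewrite /= mulrC.
  rewrite -(EFin_Rintegral measurableT iWp) lee_fin RintegralZl// mulrC.
  by rewrite ler_wpM2r ?c1norm_ge0.
have fin : jnorm_finite w.
  have iK := integrable_RZ `|K| measurableT (cintegrable_norm measurableT iphi).
  have ltK := integrable_lty iK (fun y => mulr_ge0 (normr_ge0 K) (c1norm_ge0 (phi y))).
  apply: le_lt_trans ltK.
  apply: ae_ge0_le_integral => //.
  - by move=> y _; apply: integral_ge0 => a _; rewrite lee_fin c1norm_ge0.
  - have mt : measurable_fun [set: (mR * mR)%type] (fun p => (c1norm (w p.1 p.2))%:E).
      by apply/measurable_EFinP; apply: measurable_funD; apply: measurableT_comp => //; have [] := jm.
    have p0 (p : mR * mR) : (0 <= (c1norm (w p.1 p.2))%:E)%E by rewrite lee_fin c1norm_ge0.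
    exact: (@measurable_fun_fubini_tonelli_G _ _ mR mR R mu _ mt p0).
  - by move=> y _; rewrite lee_fin mulr_ge0 ?c1norm_ge0.
  - by apply/measurable_EFinP; exact: integrable_measurable iK.
  - by apply: ae_imply K' _ => y h _.
have [_ F2 F3] := cFubini jm fin.
have [Lvp _] := cconv_Lexp Lv Lp.
have mvp := Lexp_cmeasurable Lvp.
have E1 : {ae mu, forall a, cint setT (w a) = u (t - a) * cconv v phi a}.
  apply: ae_imply (Lexp_conv_integrable Lv Lp) _ => a ha.
  rewrite /cconv -(cintZ _ measurableT ha); apply: eq_cint => y _.
  by rewrite /w mulrA.
have ml := cmeasurable_conv t mu' mvp.
have iL : cintegrable setT (fun a => u (t - a) * cconv v phi a).
  have [j1 j2] := F2; split.
    apply: (integrable_ae_eq _ j1); first by apply/measurable_EFinP; exact: proj1 ml.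
    by apply: ae_imply E1 _ => a ->.
  apply: (integrable_ae_eq _ j2); first by apply/measurable_EFinP; exact: proj2 ml.
  by apply: ae_imply E1 _ => a ->.
split; first exact: iL.
have [Luv _] := cconv_Lexp Lu Lv.
have muv := Lexp_cmeasurable Luv.
transitivity (cint setT (fun a => cint setT (w a))).
  have E1' : {ae mu, forall a, setT a -> u (t - a) * cconv v phi a = cint setT (w a)}.
    by apply: ae_imply E1 _ => a -> _.
  exact: (cint_ae measurableT ml (cintegrable_cmeasurable F2) E1').
rewrite F3.
have E2 : {ae mu, forall y, cint setT (fun a => w a y) = cconv u v (t - y) * phi y}.
  apply: ae_imply (ae_reflect t (Lexp_conv_integrable Lu Lv)) _ => y hy.
  have hy' := cintegrable_translate y hy.
  rewrite /cconv -(cint_translate y hy) [RHS]mulrC -(cintZ _ measurableT hy').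
  apply: eq_cint => a _; rewrite /w mulrC; congr (_ * (u _ * _)); ring.
have E2' : {ae mu, forall y, setT y -> cint setT (fun a => w a y) = cconv u v (t - y) * phi y}.
  by apply: ae_imply E2 _ => y -> _.
exact: (cint_ae measurableT (cmeasurable_cint_snd jm fin) (cmeasurable_conv t muv mp) E2').
Qed.

End ScalarSolution.

(** * The Prabhakar kernel at the origin *)

Section KernelEquation.
Variable R : realType.
Local Notation C := R[i].
Local Notation mu := (@lebesgue_measure R).
Local Notation mR := (measurableTypeR R).
Implicit Types (u v : R -> C) (t s a b : R) (z : C).

Lemma deriv_order_bounds z : 0 < complex.Re z ->
  (0 < deriv_order z)%N /\ complex.Re z <= (deriv_order z)%:R.
Proof.
move=> z0; have c0 : 0 < Num.ceil (complex.Re z) by rewrite ceil_gt0.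
split; first by rewrite /deriv_order absz_gt0 gt_eqF.
by rewrite /deriv_order natr_absz gtr0_norm// ceil_ge.
Qed.

(** A power of t is absorbed by an increase of the exponential rate. *)
Lemma gweight_shift a d (M : R) : 0 < d -> exists K : R, 0 < K /\ forall t, 0 < t ->
  gweight (a + d) (- M) t <= K * gweight a (- (M + 1)) t.
Proof.
move=> d0; have [K hK] := @ln_linear_bound R d 1 d0 ltr01.
exists (expR K); split=> [|t t0]; first exact: expR_gt0.
by rewrite /gweight -expRD ler_expR; have := hK t t0; lra.
Qed.

(** The value at the pole is a division by zero. *)
Lemma cgamma0 : cgamma (0 : C) = 0.
Proof.
rewrite /cgamma ltxx /= oppr0 truncn0 big_ord_recl big_ord0 /= addr0 mul0r invr0 mulr0.
by [].
Qed.

Lemma pbase0 t : pbase (0 : C) t = 0.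
Proof. by rewrite /pbase cgamma0 invr0 mul0r. Qed.

(** There Gamma(z) = Gamma(z + 1) / z. *)
Lemma cgamma_imaginary_neq0 z : complex.Re z = 0 -> z != 0 -> cgamma z != 0.
Proof.
move=> z0 zn; have z1 : 0 < complex.Re (z + 1) by rewrite cReD z0 add0r ltr01.
have g1 := cgamma_neq0 z1.
suff -> : cgamma z = cgamma (z + 1) / z by rewrite mulf_neq0 ?invr_neq0.
rewrite [in RHS]/cgamma z1 big_ord0 divr1 /cgamma z0 ltxx oppr0 truncn0.
by rewrite big_ord_recl big_ord0 mulr1 /= !addr0.
Qed.

Section Kernel.
Variables (l : R) (m nu r : C).
Hypotheses (l0 : 0 <= l) (l1 : l <= 1) (m0 : 0 < complex.Re m).

Local Notation ker := (prabhakar_kernel l m nu r).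

Lemma cut_kernel (e : R -> C) : (forall t, 0 < t -> ker t = pbase nu t + e t) ->
  cut ker = (fun t => cut (pbase nu) t + cut e t).
Proof.
move=> kE; apply/funext => t; rewrite /cut; case: ltP => t0; last by rewrite addr0.
exact: kE.
Qed.

Lemma cmeasurable_kernel : 0 <= complex.Re nu -> cmeasurable [set: mR] (cut ker).
Proof.
move=> nu0; have [e [K [M [_ ce _ kE _]]]] := prabhakar_kernel_original r l0 l1 m0 nu0.
rewrite (cut_kernel kE); apply: cmeasurableD.
  exact: cmeasurable_causal (@causal_cut _ _) (ccont_pos_cut (ccont_pos_pbase nu)).
exact: cmeasurable_causal (@causal_cut _ _) (ccont_pos_cut ce).
Qed.

(** The term t^(nu-1) / Gamma(nu) of the kernel has the transform z^-nu when
    Re nu > 0, and vanishes when nu = 0; then the unit of convolution stands for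
    it and contributes the summand 1. *)
Lemma kernel_rlap : 0 < complex.Re nu \/ nu = 0 -> exists b K M : R,
  [/\ 0 <= M, 0 < b, complex.Re nu <= b,
    forall t, c1norm (cut ker t) <= c1norm (cut (fun t => (K * gweight b (- M) t)%:C) t) &
    forall s, M < s -> Lexp s (cut ker) /\
      (if nu == 0 then 1 else 0) + rlap (cut ker) s =
        cpow s%:C (- nu) * cpow (1 - r * cpow s%:C (- m)) l%:C].
Proof.
move=> nuP; have nu0 : 0 <= complex.Re nu by case: nuP => [/ltW|->].
have [e [K [M [M0 ce eK kE eL]]]] := prabhakar_kernel_original r l0 l1 m0 nu0.
have kcut := cut_kernel kE.
have b0 : 0 < complex.Re nu + complex.Re m by rewrite ltr_wpDl.
have K0 : 0 <= K.
  have := le_trans (c1norm_ge0 (e 1)) (eK 1 ltr01).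
  by rewrite pmulr_lge0 ?gweight_gt0.
have realC (x : R) : 0 <= x -> c1norm (x%:C : C) = x by exact: c1norm_nonneg_real.
case: nuP => [nup|nuE].
  have [K' [K'0 hK']] := gweight_shift (complex.Re nu) M m0.
  pose c := 2 * cnorm (cgamma nu)^-1.
  have c0 : 0 <= c by rewrite mulr_ge0 ?cnorm_ge0.
  have pb t : 0 < t -> c1norm (pbase nu t) <= c * gweight (complex.Re nu) (- 0) t.
    move=> t0; apply: le_trans (c1norm_le_cnorm _) _.
    by rewrite /pbase cnormM cnorm_gkernel /= /c oppr0 mulrA.
  exists (complex.Re nu), (c + K * K'), (M + 1); split.
  - by rewrite addr_ge0.
  - exact: nup.
  - exact: lexx.
  - move=> t; rewrite kcut /cut; case: ltP => t0; last by rewrite addr0.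
    have g0 := gweight_gt0 (complex.Re nu) (- (M + 1)) t.
    rewrite realC; last by rewrite mulr_ge0 ?(ltW g0)// addr_ge0// mulr_ge0// ltW.
    apply: le_trans (c1normD _ _) _; rewrite mulrDl; apply: lerD.
      apply: le_trans (pb t t0) _; rewrite ler_wpM2l//.
      rewrite /gweight ler_expR oppr0 mul0r subr0 mulNr opprK lerDl mulr_ge0 ?(ltW t0)//.
      by rewrite addr_ge0.
    apply: le_trans (eK t t0) _; rewrite -mulrA ler_wpM2l//; exact: hK'.
  move=> s sM; have {}sM : M < s by apply: lt_trans sM; rewrite ltrDl.
  have s0 := le_lt_trans M0 sM; have sn := realC_neq0 s0.
  have [h1 h2] := cut_gweight nup (ccont_pos_pbase nu) pb s0.
  have [h3 h4] := cut_gweight b0 ce eK sM.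
  rewrite kcut; split; first exact: LexpD h1 h3.
  have [w1 eE] := eL s%:C sM.
  have nun : (nu == 0) = false by apply/eqP => nuz; move: nup; rewrite nuz /= ltxx.
  rewrite nun add0r (rlapD h1 h3) h2 h4 eE claplace_pbase//; ring.
have Rnu : complex.Re nu = 0 by rewrite nuE.
have kE0 : cut ker = cut e.
  rewrite kcut; apply/funext => t; rewrite /cut; case: ifP => _; rewrite ?addr0//.
  by rewrite nuE pbase0 add0r.
exists (complex.Re nu + complex.Re m), K, M; split => //.
- by rewrite lerDl ltW.
- move=> t; rewrite kE0 /cut; case: ltP => t0 //.
  by rewrite realC ?mulr_ge0// ?(ltW (gweight_gt0 _ _ _))// eK.
move=> s sM; have sn := realC_neq0 (le_lt_trans M0 sM).
have [h3 h4] := cut_gweight b0 ce eK sM.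
rewrite kE0; split; first exact: h3.
have [w1 eE] := eL s%:C sM.
by rewrite h4 eE nuE eqxx oppr0 cpow0//; ring.
Qed.

(** For Re nu = 0 with nu nonzero, the leading term of the kernel is not
    integrable at the origin. *)
Lemma kernel_singular : complex.Re nu = 0 -> nu != 0 ->
  exists c d : R, [/\ 0 < c, 0 < d & forall t, 0 < t <= d -> c / t <= cnorm (ker t)].
Proof.
move=> nu0 nun; have nu0' : 0 <= complex.Re nu by rewrite nu0.
have [e [K [M [M0 ce eK kE _]]]] := prabhakar_kernel_original r l0 l1 m0 nu0'.
have g0 : 0 < cnorm (cgamma nu)^-1.
  by apply: cnorm_gt0; rewrite invr_neq0// cgamma_imaginary_neq0.
set c := cnorm (cgamma nu)^-1 in g0.
have K0 : 0 <= K.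
  have := le_trans (c1norm_ge0 (e 1)) (eK 1 ltr01).
  by rewrite pmulr_lge0 ?gweight_gt0.
have K1 : 0 < K + 1 by rewrite ltr_wpDl.
have c2 : 0 < c / 2 / (K + 1) by rewrite !divr_gt0.
pose d1 := expR ((ln (c / 2 / (K + 1)) - M) / complex.Re m).
exists (c / 2), (Num.min 1 d1); split; first by rewrite divr_gt0.
  by rewrite lt_min ltr01 expR_gt0.
move=> t /andP[t0]; rewrite le_min => /andP[t1 td].
have pE : cnorm (pbase nu t) = c / t.
  rewrite /pbase cnormM cnorm_gkernel /= /gweight nu0 mul0r subr0 sub0r mulN1r expRN lnK//.
have eE : cnorm (e t) <= c / 2 / t.
  apply: le_trans (cnorm_le_c1norm _) _; apply: le_trans (eK t t0) _.
  have lt1 : complex.Re m * ln t <= ln (c / 2 / (K + 1)) - M.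
    by rewrite mulrC -ler_pdivlMr// -(expRK (_ / _)) ler_ln ?posrE ?expR_gt0.
  apply: (@le_trans _ _ ((K + 1) * (c / 2 / (K + 1) / t))); last first.
    rewrite le_eqVlt; apply/orP; left; apply/eqP; field.
    by rewrite !gt_eqF.
  have h : gweight (complex.Re nu + complex.Re m) (- M) t <= c / 2 / (K + 1) / t.
    rewrite -[X in _ <= X / t](lnK c2) -[X in _ / X](lnK t0) -expRN -expRD /gweight ler_expR.
    rewrite nu0 add0r mulNr opprK mulrBl mul1r.
    have Mt : M * t <= M by rewrite -[leRHS]mulr1 ler_wpM2l.
    lra.
  by apply: ler_pM => //; [exact/ltW/gweight_gt0|rewrite lerDl].
rewrite kE//; have h := cnormD (pbase nu t + e t) (- e t).
rewrite addrK in h; have hN : cnorm (- e t) = cnorm (e t).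
  by rewrite !cnormE cReN cImN !sqrrN.
rewrite hN pE in h.
have hc : c / 2 / t = c / t / 2 by rewrite mulrAC.
rewrite hc in eE *; lra.
Qed.

End Kernel.

(** If f(y)/(t-y) is integrable near t then the averages of f over ]t-s, t[ tend
    to zero, whereas they tend to f(t) for almost every t. *)
Lemma singular_average_zero (f : R -> R) : (forall y, 0 <= f y) ->
  mu.-integrable setT (EFin \o f) ->
  {ae mu, forall t, (exists2 d : R, 0 < d &
     mu.-integrable `]t - d, t[ (EFin \o (fun y => f y / (t - y)))) -> f t = 0}.
Proof.
move=> f0 fi.
pose G x := \int[mu]_(y in `]-oo, x]) f y.
have GE x y : x <= y -> G y - G x = \int[mu]_(z in `]x, y]) f z.
  by move=> xy; rewrite /G (Rintegral_Ny_split fi xy) addrAC subrr add0r.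
apply: ae_imply (density_derive fi GE) _ => t [dG GE'] [d d0 id].
have mI := @measurable_Ritv R `]t - d, t[.
pose s_ (p : nat) : R := p.+1%:R^-1.
have s0 p : 0 < s_ p by rewrite invr_gt0.
have sc : s_ p @[p --> \oo] --> 0 by exact: cvg_harmonic.
pose A p : set mR := `]t - s_ p, t[%classic.
have mA p : measurable (A p) by exact: measurable_Ritv.
pose F p y := f y / (t - y) * \1_(A p) y.
have ind (B : set mR) (y : mR) : \1_B y = (y \in B)%:R :> R by rewrite indicE.
have [_ dct] : mu.-integrable `]t - d, t[ (EFin \o (fun=> 0 : R)) /\
    (\int[mu]_(y in `]t - d, t[) F p y) @[p --> \oo] --> \int[mu]_(y in `]t - d, t[) (0 : R).
  apply: (Rintegral_dct mI _ _ _ (integrable_norm id)).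
  - move=> p; apply: measurable_funM; first exact: integrable_measurable id.
    exact: measurable_indic.
  - exact: measurable_cst.
  - move=> y; rewrite /= in_itv/= => /andP[_ yt]; apply: cvg_near_cst; near=> p.
    have sp : s_ p < t - y by near: p; apply: (cvgr_lt _ sc); rewrite subr_gt0.
    have yp : y <= t - s_ p by lra.
    by rewrite /F ind mem_setE in_itv/= ltNge yp mulr0.
  - move=> p y _; rewrite /F ind normrM ler_piMr//.
    by case: (_ \in _); rewrite ?normr1 ?normr0.
have z0 : \int[mu]_(y in `]t - d, t[) (0 : R) = 0 by rewrite /Rintegral integral0.
rewrite z0 in dct.
have quot : (G t - G (t - s_ p)) / s_ p @[p --> \oo] --> f t.
  have := dG; rewrite /derivable => /cvg_ex[/= L hL].
  have LE : L = f t.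
    by rewrite -GE' derive1E /derive; apply/esym/cvg_lim => //; exact: hL.
  rewrite LE in hL; move/cvgr_dnbhsP: hL => /(_ (fun p => - s_ p)) hL.
  have h : - s_ p @[p --> \oo] --> 0 by rewrite -oppr0; exact: cvgN.
  have := hL (conj (fun p => _) h).
  move=> /(_ (fun p => ltac:(by rewrite oppr_eq0 gt_eqF))).
  apply: cvg_trans; apply: near_eq_cvg; near=> p.
  rewrite (_ : (- s_ p)%:A = - s_ p); last by rewrite /GRing.scale/= mulr1.
  by rewrite invrN /GRing.scale/= (addrC (- s_ p)) mulNr -mulrN opprB mulrC.
have le : \forall p \near \oo, (G t - G (t - s_ p)) / s_ p <= \int[mu]_(y in `]t - d, t[) F p y.
  near=> p.
  have sd : s_ p < d by near: p; apply: (cvgr_lt _ sc).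
  rewrite GE; last by rewrite gerBl ltW.
  have iA := integrable_Rsub measurableT (mA p) (@subsetT _ _) fi.
  rewrite -(Rintegral_itv_bndo_bndc iA) mulrC -RintegralZl//.
  have iZ := integrable_RZ (s_ p)^-1 (mA p) iA.
  have iF : mu.-integrable `]t - d, t[ (EFin \o F p).
    apply: (integrable_dominated mI _ (integrable_norm id)).
      apply: measurable_funM; first exact: integrable_measurable id.
      exact: measurable_indic.
    move=> y _; rewrite /F ind normrM ler_piMr//.
    by case: (_ \in _); rewrite ?normr1 ?normr0.
  have iFA : mu.-integrable (A p) (EFin \o F p).
    apply: integrable_Rsub mI (mA p) _ iF => y; rewrite /A /= !in_itv/= => /andP[h1 ->].
    by rewrite andbT; lra.
  have -> : \int[mu]_(y in `]t - d, t[) F p y = \int[mu]_(y in A p) F p y.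
    rewrite Rintegral_mkcond [RHS]Rintegral_mkcond; congr (Rintegral _ _ _).
    apply/funext => y; rewrite !patchE /F ind.
    case: (boolP (y \in A p)) => yA; last by rewrite mulr0 if_same.
    rewrite mulr1 ifT//; move: yA; rewrite /A !mem_setE !in_itv/= => /andP[h1 ->].
    by rewrite andbT; lra.
  apply: le_Rintegral => // y yA; rewrite /F ind mem_set// mulr1 mulrC ler_wpM2l//.
  move: yA; rewrite /A /= in_itv/= => /andP[h1 h2].
  have ty : 0 < t - y by rewrite subr_gt0.
  by rewrite lef_pV2 ?posrE//; lra.
apply/eqP; rewrite eq_le f0 andbT.
exact: (ler_cvg_to quot dct le).
Unshelve. all: by end_near. Qed.

End KernelEquation.

(** * The scalar equation *)

Section ScalarTheorem.
Variable R : realType.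
Local Notation C := R[i].
Local Notation mu := (@lebesgue_measure R).
Local Notation mR := (measurableTypeR R).
Implicit Types (u v : R -> C) (t s a b : R) (z : C).

Lemma gweight_leM a (M M' t : R) : 0 < t -> M <= M' -> gweight a (- M) t <= gweight a (- M') t.
Proof.
by move=> t0 MM; rewrite /gweight ler_expR lerD2l lerN2 ler_wpM2r ?lerN2// ltW.
Qed.

(** Two weights whose parameters satisfy a + b >= 1 have a locally bounded
    convolution, and can serve as the majorants of u and v. *)
Lemma cconv_assoc_weight u v phi a b (Ku Mu Kv Mv s0 t : R) :
  causal u -> causal v -> causal phi -> cintegrable setT phi ->
  Lexp s0 u -> Lexp s0 v -> Lexp s0 phi ->
  0 < a -> 0 < b -> 1 <= a + b -> 0 <= Mu -> 0 <= Mv ->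
  (forall x, 0 < x -> c1norm (u x) <= Ku * gweight a (- Mu) x) ->
  (forall x, 0 < x -> c1norm (v x) <= Kv * gweight b (- Mv) x) ->
  cintegrable setT (fun a => u (t - a) * cconv v phi a) /\
  cconv u (cconv v phi) t = cconv (cconv u v) phi t.
Proof.
move=> cu cv cp ip Lu Lv Lp a0 b0 ab Mu0 Mv0 uK vK.
pose M := Num.max Mu Mv; have M0 : 0 <= M by rewrite le_max Mu0.
have uM : Mu <= M by rewrite le_max lexx.
have vM : Mv <= M by rewrite le_max lexx orbT.
pose W c x := if 0 < x then gweight c (- M) x else 0.
have W0 c x : 0 <= W c x by rewrite /W; case: ifP => // _; exact/ltW/gweight_gt0.
have WE c : (fun x => (W c x)%:C) = wgt c M.
  by apply/funext => x; rewrite /W /wgt /cut; case: ifP.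
have nonneg (w : R -> C) (K c Mw : R) :
    (forall x, 0 < x -> c1norm (w x) <= K * gweight c (- Mw) x) -> 0 <= K.
  by move=> h; have := le_trans (c1norm_ge0 (w 1)) (h 1 ltr01); rewrite pmulr_lge0 ?gweight_gt0.
have Ku0 := nonneg _ _ _ _ uK; have Kv0 := nonneg _ _ _ _ vK.
have bound (w : R -> C) (K c Mw : R) : causal w -> 0 <= K -> Mw <= M ->
    (forall x, 0 < x -> c1norm (w x) <= K * gweight c (- Mw) x) ->
    forall x, c1norm (w x) <= K * W c x.
  move=> cw K0 MM h x; rewrite /W; case: ltP => x0; last by rewrite cw// c1norm0 mulr0.
  by apply: le_trans (h x x0) _; rewrite ler_wpM2l// gweight_leM.
have [K hK] := wgt_conv t a0 b0 ab M0.
apply: (cconv_assoc_at (U := fun x => Ku * W a x) (V := fun x => Kv * W b x)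
  (K := c1norm (Ku * Kv)%:C * K) cp ip Lu Lv Lp).
- by move=> x; rewrite mulr_ge0.
- by move=> x; rewrite mulr_ge0.
- exact: (bound u Ku a Mu cu Ku0 uM uK).
- exact: (bound v Kv b Mv cv Kv0 vM vK).
apply: ae_imply hK _ => x h xt; have [i1 b1] := h xt.
have E s : (Ku * W a (x - s))%:C * (Kv * W b s)%:C =
    (Ku * Kv)%:C * (wgt a M (x - s) * wgt b M s).
  rewrite -(WE a) -(WE b) !rmorphM /=; ring.
have EE : (fun s => (Ku * W a (x - s))%:C * (Kv * W b s)%:C) =
    (fun s => (Ku * Kv)%:C * (wgt a M (x - s) * wgt b M s)) by apply/funext.
split; first by rewrite EE; exact: cintegrableZ.
rewrite /cconv EE (cintZ _ measurableT i1); apply: le_trans (c1normM _ _) _.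
by rewrite ler_wpM2l ?c1norm_ge0.
Qed.

Lemma cint_cc_oo (w : R -> C) t : cmeasurable (`]0, t[%classic : set mR) w ->
  cint `[0, t] w = cint `]0, t[ w.
Proof.
move=> [m1 m2].
have key (f : mR -> R) : measurable_fun (`]0, t[%classic : set mR) f ->
    \int[mu]_(s in `[0, t]) f s = \int[mu]_(s in `]0, t[) f s.
  move=> mf; rewrite /Rintegral; congr fine.
  have mfE : measurable_fun (`]0, t[%classic : set mR) (EFin \o f) by apply/measurable_EFinP.
  have [t0|t0] := leP t 0.
    rewrite [RHS](_ : _ = 0%E); last by rewrite set_itv_ge ?integral_set0// bnd_simp -leNgt.
    have [tn|tn] := ltP t 0; first by rewrite set_itv_ge ?integral_set0// bnd_simp -ltNge.
    have -> : t = 0 by lra.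
    by rewrite set_itv1 integral_set1.
  rewrite -(integral_itv_obnd_cbnd (b := BRight t)); last first.
    have E : `]0, t]%classic = `]0, t[%classic `|` [set t] :> set mR.
      by rewrite setUitv1.
    rewrite E; apply/measurable_funU => //.
    by split => //; exact: measurable_fun_set1.
  by rewrite (integral_itv_bndo_bndc (a := BRight 0)).
by apply: cplxP; rewrite /cint /=; [exact: key|exact: key].
Qed.

Lemma cconv_aer_pos u v v' t : causal u -> causal v -> causal v' ->
  cmeasurable [set: mR] u -> cmeasurable [set: mR] v -> cmeasurable [set: mR] v' ->
  {ae mu, forall s, 0 < s < t -> v s = v' s} -> cconv u v t = cconv u v' t.
Proof.
move=> cu cv cv' mu' mv mv' ae.
have ae' : {ae mu, forall s, setT s -> u (t - s) * v s = u (t - s) * v' s}.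
  apply: ae_imply ae _ => s h _; have [s0|s0] := leP s 0; first by rewrite cv// cv'.
  have [ts|st] := leP t s; first by rewrite cu ?mul0r// subr_le0.
  by rewrite h// s0.
exact: cint_ae measurableT (cmeasurable_conv t mu' mv) (cmeasurable_conv t mu' mv') ae'.
Qed.

Lemma cconv_open u v t : causal u -> causal v ->
  cconv u v t = cint (`]0, t[%classic : set mR) (fun s => u (t - s) * v s).
Proof.
move=> cu cv; rewrite [RHS]cint_mkcond; apply: eq_cint => s _.
rewrite mem_setE in_itv/=; case: (ltP 0 s) => s0 /=; last by rewrite cv// mulr0.
by case: ltP => // ts; rewrite cu ?mul0r// subr_le0.
Qed.

Variables (l : R) (m n r k tau : C) (f g : R -> C).
Hypotheses (l0 : 0 < l) (l1 : l < 1) (m0 : 0 < complex.Re m) (n0 : 0 < complex.Re n).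
Local Notation N := (deriv_order n).
Local Notation nu := (N%:R - n).
Local Notation ker := (prabhakar_kernel l m nu r).
Hypothesis gL : forall b, 0 < b -> cintegrable `[0, b] g.
Hypothesis freg : cAC_order N f.
Hypothesis f0 : has_lim0 f tau.
Hypothesis f0' : forall p, (0 < p < N)%N -> has_lim0 (cderiv p f) 0.
Hypothesis heq : {ae mu, forall t, 0 < t ->
  cintegrable `[0, t] (fun y => ker (t - y) * cderiv N f y) /\
  (if nu == 0 then cderiv N f t else 0) +
  cint `[0, t] (fun y => ker (t - y) * cderiv N f y) + k * f t = g t}.

Variables (eh eq eB : R -> C) (Kh Mh Kq Mq KB MB : R).
Hypothesis sh : resolvent_spec l m n r k n 1 eh Kh Mh.
Hypothesis sq : resolvent_spec l m n r k 1 0 eq Kq Mq.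
Hypothesis sB : resolvent_spec l m n r k N%:R 0 eB KB MB.

Local Notation h := (cut eh).
Local Notation q := (cut eq).
Local Notation B := (cut eB).
Let l0' : 0 <= l := ltW l0.
Let l1' : l <= 1 := ltW l1.
Let N0 : (0 < N)%N := proj1 (deriv_order_bounds n0).
Let nu0 : 0 <= complex.Re nu.
Proof. by rewrite cReD cReN cRe_nat subr_ge0; exact: proj2 (deriv_order_bounds n0). Qed.
Let N1 : 1 <= complex.Re (N%:R : C).
Proof. by rewrite cRe_nat ler1n. Qed.
Let lbB : locbounded B.
Proof. by have [M0 _ hb _] := sB; exact: gweight_locbounded N1 M0 hb. Qed.
Let ch : causal h := @causal_cut R eh.
Let cB : causal B := @causal_cut R eB.
Let cK : causal (cut ker) := @causal_cut R ker.
Let ccB : ccont_pos B.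
Proof. by have [_ cc _ _] := sB; exact: ccont_pos_cut. Qed.
Let cch : ccont_pos h.
Proof. by have [_ cc _ _] := sh; exact: ccont_pos_cut. Qed.
Let mB := cmeasurable_causal cB ccB.
Let mh := cmeasurable_causal ch cch.
Let mK : cmeasurable [set: mR] (cut ker) := cmeasurable_kernel r l0' l1' m0 nu0.
Let lh : locint h := resolvent_locint n0 sh.

Section Truncation.
Variable phi : R -> C.
Hypotheses (cphi : causal phi) (iphi : cintegrable setT phi).

Let Lphi0 : Lexp 0 phi.
Proof. by rewrite /Lexp wexp0. Qed.
Let Lphi s : 0 <= s -> Lexp s phi.
Proof. by move=> s0; exact: LexpW Lphi0. Qed.
Let mphi := cintegrable_cmeasurable iphi.
Let lphi : locint phi := Lexp_locint Lphi0.

(** With A the symbol, h has the transform 1 / (A + k), the kernel (together with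
    the unit of convolution when nu = 0) has the transform A s^-N, and their
    product s^-N A / (A + k) is the transform of B. *)
Lemma conv_kernel_ae : 0 < complex.Re nu \/ nu = 0 ->
  {ae mu, forall t, (if nu == 0 then 1 else 0) * h t + cconv h (cut ker) t = B t}.
Proof.
move=> nuP; have [b [Kv [Mv [Mv0 b0 nub _ HK]]]] := kernel_rlap r l0' l1' m0 nuP.
set kappa := (if nu == 0 then 1 else 0) in HK *.
pose s0 := Num.max (Num.max Mh Mv) (Num.max MB 0) + 1.
have big s : s0 <= s -> [/\ Mh < s, Mv < s, MB < s & 0 < s].
  move=> ss; have: Num.max (Num.max Mh Mv) (Num.max MB 0) < s by apply: lt_le_trans ss; rewrite ltrDl.
  by rewrite !gt_max => /andP[/andP[-> ->] /andP[-> ->]].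
pose D t := kappa * h t + (cconv h (cut ker) t + (-1) * B t).
have main s : s0 <= s -> Lexp s D /\ rlap D s = 0.
  move=> /big[h1 h2 h3 s1]; have sn := realC_neq0 s1.
  have [Lh A0 D0 Eh] := resolvent_rlap n0 sh h1.
  have N0' : 0 < complex.Re (N%:R : C) by exact: lt_le_trans ltr01 N1.
  have [LB _ _ EB] := resolvent_rlap N0' sB h3.
  have [LK EK] := HK s h2.
  have [Lc Ec] := cconv_Lexp Lh LK.
  have L1 := LexpZ kappa Lh; have L2 := LexpZ (-1) LB; have L3 := LexpD Lc L2.
  split; first exact: LexpD L1 L3.
  have w1 : 1 - r * cpow s%:C (- m) != 0 by have [_ _ _ H] := sh; have [] := H s%:C h1.
  rewrite /D (rlapD L1 L3) (rlapD Lc L2) (rlapZ _ Lh) (rlapZ _ LB) Ec.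
  have -> : kappa * rlap h s + (rlap h s * rlap (cut ker) s + -1 * rlap B s) =
    rlap h s * (kappa + rlap (cut ker) s) - rlap B s by ring.
  rewrite EK Eh EB expr1 expr0 mulr1 (cpowN n sn) (cpowN l%:C w1).
  have -> : - nu = n + - N%:R by rewrite opprB.
  rewrite (cpowD _ _ sn).
  have x1 := cpow_neq0 n sn; have x2 := cpow_neq0 l%:C w1.
  have cancel (x y w d : C) : x != 0 -> y != 0 -> d != 0 ->
    x^-1 * y^-1 / d * (x * w * y) - w / d = 0 by move=> p1 p2 p3; field; rewrite p1 p2 p3.
  exact: cancel.
have : {ae mu, forall t, D t = 0}.
  apply: (@lerch R _ s0).
  - by move=> t t0; rewrite /D ch// cB// (cconv_causal ch cK t0) !mulr0 !addr0.
  - exact: proj1 (main s0 (lexx _)).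
  - by move=> s ss; exact: proj2 (main s ss).
move=> ae; apply: ae_imply ae _ => t /eqP; rewrite /D addrA mulN1r subr_eq0 => /eqP.
by [].
Qed.

(** The identity of convolutions h, ker and B is convolved with phi; pointwise
    associativity is needed because the claim concerns every t. *)
Lemma conv_kernel_at t : 0 < complex.Re nu \/ nu = 0 ->
  [/\ cintegrable setT (fun s => (if nu == 0 then 1 else 0) * (h (t - s) * phi s)),
      cintegrable setT (fun s => h (t - s) * cconv (cut ker) phi s) &
      (if nu == 0 then 1 else 0) * cconv h phi t + cconv h (cconv (cut ker) phi) t =
      cconv B phi t].
Proof.
move=> nuP; have [b [Kv [Mv [Mv0 b0 nub kb HK]]]] := kernel_rlap r l0' l1' m0 nuP.
pose s0 := Num.max Mh Mv + 1.
have [sh0 sv0] : Mh < s0 /\ Mv < s0.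
  have : Num.max Mh Mv < s0 by rewrite ltrDl.
  by rewrite gt_max => /andP[].
have [Mh0 _ hb _] := sh.
have s00 : 0 <= s0 by rewrite ltW// (le_lt_trans Mh0).
have [Lh _ _ _] := resolvent_rlap n0 sh sh0.
have [LK _] := HK s0 sv0.
have hb' x : 0 < x -> c1norm (h x) <= Kh * gweight (complex.Re n) (- Mh) x.
  by move=> x0; rewrite /cut x0 hb.
have kb' x : 0 < x -> c1norm (cut ker x) <= `|Kv| * gweight b (- Mv) x.
  move=> x0; apply: le_trans (kb x) _; rewrite /cut x0 c1norm_real normrM.
  by rewrite (gtr0_norm (gweight_gt0 _ _ _)).
have ab : 1 <= complex.Re n + b.
  have : complex.Re n + complex.Re nu = complex.Re (N%:R : C) by rewrite cReD cReN; ring.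
  have := N1; lra.
have [i1 E1] := cconv_assoc_weight t ch cK cphi iphi Lh LK (Lphi s00) n0 b0 ab Mh0 Mv0 hb' kb'.
have aeB := conv_kernel_ae nuP.
have [Lc _] := cconv_Lexp Lh LK; have mc := Lexp_cmeasurable Lc.
rewrite E1; split => //.
  case: eqP => [nuE|_].
    have lbh : locbounded h.
      have n1 : 1 <= complex.Re n.
        have -> : n = N%:R by apply/eqP; rewrite eq_sym -subr_eq0 nuE.
        exact: N1.
      exact: gweight_locbounded n1 Mh0 hb.
    have := cconv_integrable ch cphi mh lbh lphi (lexx t).
    by apply: eq_cintegrable => // s _; rewrite mul1r.
  have : cintegrable setT (fun=> 0 : C) by split; exact: integrable0.
  by apply: eq_cintegrable => // s _; rewrite mul0r.
move: aeB; case: eqP => [nuE|_] aeB.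
  have lbh : locbounded h.
    have n1 : 1 <= complex.Re n.
      have -> : n = N%:R by apply/eqP; rewrite eq_sym -subr_eq0 nuE.
      exact: N1.
    exact: gweight_locbounded n1 Mh0 hb.
  have i2 := cconv_integrable ch cphi mh lbh lphi (lexx t).
  have i3 := cconv_integrable cB cphi mB lbB lphi (lexx t).
  have aeB' : {ae mu, forall s, cconv h (cut ker) s = B s + (-1) * h s}.
    by apply: ae_imply aeB _ => s <-; ring.
  have mBh : cmeasurable [set: mR] (fun s => B s + (-1) * h s).
    by apply: cmeasurableD => //; apply: cmeasurableM => //; exact: cmeasurable_cst.
  rewrite (cconv_ael t mc mBh mphi aeB') mul1r.
  have -> : cconv (fun s => B s + (-1) * h s) phi t = cconv B phi t + (-1) * cconv h phi t.
    have i4 := cintegrableZ (-1) measurableT i2.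
    rewrite /cconv -(cintZ _ measurableT i2) -(cintD measurableT i3 i4).
    by apply: eq_cint => s _; ring.
  ring.
have aeB' : {ae mu, forall s, cconv h (cut ker) s = B s}.
  by apply: ae_imply aeB _ => s <-; rewrite mul0r add0r.
by rewrite mul0r add0r; exact: cconv_ael mc mB mphi aeB'.
Qed.

End Truncation.

Lemma cintegrable_Lexp phi s : causal phi -> cintegrable setT phi -> 0 <= s -> Lexp s phi.
Proof.
move=> cphi iphi s0; have L0 : Lexp 0 phi by rewrite /Lexp wexp0.
exact: LexpW L0.
Qed.

Lemma cintegrable_ae (A : set mR) u v : measurable A -> cmeasurable A u ->
  cintegrable A v -> {ae mu, forall x, A x -> u x = v x} -> cintegrable A u.
Proof.
move=> mA mu' iv ae; apply: (proj2 (cintegrable_mkcond _ mA)).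
have [m1 m2] := cmeasurable_mkcond mA mu'.
have [i1 i2] := proj1 (cintegrable_mkcond _ mA) iv.
have ae' : {ae mu, forall x, (if x \in A then u x else 0) = (if x \in A then v x else 0)}.
  by apply: ae_imply ae _ => x E; case: ifP => // xA; apply: E; exact: set_mem.
split.
  apply: integrable_ae_eq i1 _; first exact/measurable_EFinP.
  by apply: ae_imply ae' _ => x /= ->.
apply: integrable_ae_eq i2 _; first exact/measurable_EFinP.
by apply: ae_imply ae' _ => x /= ->.
Qed.

(** The truncation to ]0, T] yields a density that is integrable over the whole
    line without any growth condition on the highest derivative of f. *)
Lemma truncated_density (T : R) : 0 < T -> exists phi : R -> C,
  [/\ causal phi, cintegrable setT phi,
      {ae mu, forall y, 0 < y < T -> cderiv N f y = phi y} &
      forall y, 0 < y <= T -> f y = solution N tau phi y].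
Proof.
move=> T0; have [a1 a2] := freg; have [b1 b2] := f0.
have NE : N = N.-1.+1 by rewrite prednK.
rewrite NE in a1 a2.
have [p1 [i1 e1 s1]] := AC_order_primitive T0 a1 b1
  (fun p pN => proj1 (f0' (ltac:(by rewrite NE) : (0 < p < N)%N))).
have [p2 [i2 e2 s2]] := AC_order_primitive T0 a2 b2
  (fun p pN => proj2 (f0' (ltac:(by rewrite NE) : (0 < p < N)%N))).
rewrite -NE in e1 e2 s1 s2.
have mI := @measurable_Ritv R `]0, T].
pose phi : R -> C := fun y => if y \in (`]0, T]%classic : set mR) then p1 y +i* p2 y else 0.
have phiE (y : R) : 0 < y <= T -> phi y = p1 y +i* p2 y.
  by move=> yT; rewrite /phi mem_setE in_itv/= yT.
have cphi : causal phi.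
  by move=> y y0; rewrite /phi mem_setE in_itv/= ltNge y0.
exists phi; split => //.
- apply: (proj1 (cintegrable_mkcond _ mI)).
  by apply: (@cintegrableS R setT) => //; split.
- apply: ae_imply (ae_and e1 e2) _ => y [E1 E2] /andP[y0 yT].
  by rewrite phiE ?y0 ?ltW// /cderiv E1 ?E2// y0.
- move=> y yT; rewrite /solution (cprim_parts cphi phiE N yT) /heav /cut.
  have /andP[-> _] := yT; rewrite mulr1.
  apply: cplxP; rewrite ?cReD ?cImD /=; [exact: s1|exact: s2].
Qed.

Section Equation.
Variables (T : R) (phi : R -> C).
Hypotheses (cphi : causal phi) (iphi : cintegrable setT phi).
Hypothesis phiE : {ae mu, forall y, 0 < y < T -> cderiv N f y = phi y}.
Hypothesis fE : forall y, 0 < y <= T -> f y = solution N tau phi y.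
Let mphi := cintegrable_cmeasurable iphi.

Lemma equation_ae : {ae mu, forall s, 0 < s < T ->
  cintegrable (`]0, s[%classic : set mR) (fun y => cut ker (s - y) * phi y) /\
  g s = (if nu == 0 then 1 else 0) * phi s + cconv (cut ker) phi s + k * solution N tau phi s}.
Proof.
apply: ae_imply (ae_and heq phiE) _ => s [H pE] /andP[s0 sT].
have [ik <-] := H s0.
have mI := @measurable_Ritv R `]0, s[.
have sub : `]0, s[%classic `<=` (`[0, s]%classic : set mR).
  by move=> y; rewrite /= !in_itv/= => /andP[/ltW-> /ltW->].
have io := cintegrableS (@measurable_Ritv R `[0, s]) mI sub ik.
have mo := cmeasurableS measurableT (@subsetT _ `]0, s[%classic) (cmeasurable_conv s mK mphi).
have ae : {ae mu, forall y, (`]0, s[%classic : set mR) y ->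
    cut ker (s - y) * phi y = ker (s - y) * cderiv N f y}.
  apply: ae_imply phiE _ => y E; rewrite /= in_itv/= => /andP[y0 ys].
  by rewrite /cut subr_gt0 ys E// y0 (lt_trans ys).
split; first exact: cintegrable_ae mI mo io ae.
rewrite (cconv_open s cK cphi) (cint_cc_oo (cintegrable_cmeasurable io)).
rewrite (cint_ae mI mo (cintegrable_cmeasurable io) ae) fE ?s0 ?(ltW sT)//.
congr (_ + _ + _); case: eqP => _; last by rewrite mul0r.
by rewrite mul1r pE// s0.
Qed.

(** Here the kernel is at least c / (s - y), so that the existence of the
    derivative makes |phi(y)| / (s - y) integrable near s. *)
Lemma density_singular : complex.Re nu = 0 -> nu != 0 ->
  {ae mu, forall s, s < T -> phi s = 0}.
Proof.
move=> nu0' nun; have [c [d [c0 d0 kb]]] := kernel_singular r l0' l1' m0 nu0' nun.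
have ip : mu.-integrable setT (EFin \o (fun y => c1norm (phi y))).
  exact: cintegrable_norm measurableT iphi.
have av := singular_average_zero (fun y => c1norm_ge0 (phi y)) ip.
apply: ae_imply (ae_and av equation_ae) _ => s [A E] sT.
have [s0|s0] := leP s 0; first exact: cphi.
have [iK _] := E ltac:(by rewrite s0 sT).
apply: c1norm_eq0; apply: A; exists (Num.min d s); first by rewrite lt_min d0.
set e := Num.min d s.
have ed : e <= d by rewrite /e ge_min lexx.
have es : e <= s by rewrite /e ge_min lexx orbT.
have mI := @measurable_Ritv R `]s - e, s[.
have sub : `]s - e, s[%classic `<=` (`]0, s[%classic : set mR).
  by move=> y; rewrite /= !in_itv/= => /andP[h ->]; rewrite andbT; lra.
have iN := cintegrable_norm mI (cintegrableS (@measurable_Ritv R `]0, s[) mI sub iK).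
apply: (integrable_dominated mI _ (integrable_RZ (2 / c) mI iN)).
  apply: measurable_funM.
    apply: measurable_funS (@subsetT _ _) _ => //.
    exact: integrable_measurable ip.
  apply: open_continuous_measurable_fun; first exact: interval_open.
  move=> y /set_mem; rewrite /= in_itv/= => /andP[_ ys].
  apply: cvgV; first by rewrite gt_eqF ?subr_gt0.
  by apply: cvgB; [exact: cvg_cst|exact: cvg_id].
move=> y; rewrite /= in_itv/= => /andP[y1 y2].
have sy : 0 < s - y by rewrite subr_gt0.
rewrite ger0_norm; last by rewrite divr_ge0 ?c1norm_ge0 ?ltW.
have kb' : c / (s - y) <= cnorm (ker (s - y)) by apply: kb; rewrite sy/=; lra.
have h1 := c1norm_le_cnorm (phi y).
have h2 := cnorm_le_c1norm (ker (s - y) * phi y); rewrite cnormM in h2.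
rewrite /cut sy -(ler_pM2l c0).
have -> : c * (2 / c * c1norm (ker (s - y) * phi y)) = 2 * c1norm (ker (s - y) * phi y).
  by field; rewrite gt_eqF.
apply: (@le_trans _ _ (2 * (cnorm (ker (s - y)) * cnorm (phi y)))); last by rewrite ler_wpM2l.
have -> : c * (c1norm (phi y) / (s - y)) = c / (s - y) * c1norm (phi y).
  by field; rewrite gt_eqF.
rewrite [leRHS]mulrCA; apply: ler_pM => //; last exact: c1norm_ge0.
by rewrite divr_ge0// ltW.
Qed.

(** The function w agrees with h away from 0; at s = t the integrand may take any
    value. *)
Lemma conv_rhs (w : R -> C) t : (forall x, 0 < x -> w x = eh x) -> 0 < t < T ->
  cint `[0, t] (fun s => w (t - s) * g s) = cconv B phi t + k * cconv h (solution N tau phi) t.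
Proof.
move=> wE /andP[t0 tT]; set F := solution N tau phi.
have Lp s : 0 <= s -> Lexp s phi by exact: cintegrable_Lexp cphi iphi.
have [ccF lbF] := solution_regular tau N0 cphi Lp.
have cF : causal F := causal_solution N tau cphi.
have mF := cmeasurable_causal cF ccF.
have iF : cintegrable setT (fun s => h (t - s) * F s).
  have := cintegrable_reflect t (cconv_integrable cF ch mF lbF lh (lexx t)).
  by apply: eq_cintegrable => // s _; rewrite subKr mulrC.
have mI := @measurable_Ritv R `]0, t[.
have iF' := cintegrableS measurableT mI (@subsetT _ _) iF.
pose W s := (if nu == 0 then 1 else 0) * phi s + cconv (cut ker) phi s.
have ae : {ae mu, forall s, 0 < s < T -> g s = W s + k * F s}.
  by apply: ae_imply equation_ae _ => s E sT; have [] := E sT.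
have mg : cmeasurable (`]0, t[%classic : set mR) g.
  apply: (@cmeasurableS R `[0, t]) (cintegrable_cmeasurable (gL t0)) => //.
  by move=> y; rewrite /= !in_itv/= => /andP[/ltW-> /ltW->].
have mhr : cmeasurable (`]0, t[%classic : set mR) (fun s => h (t - s)).
  by apply: (@cmeasurableS R setT) => //; exact: cmeasurable_reflect.
have E1 s : (`]0, t[%classic : set mR) s -> h (t - s) = w (t - s).
  by rewrite /= in_itv/= => /andP[_ st]; rewrite /cut subr_gt0 st wE// subr_gt0.
have mhg := cmeasurableM mhr mg.
rewrite cint_cc_oo; last first.
  split; [move: (proj1 mhg)|move: (proj2 mhg)]; apply: eq_measurable_fun => s /set_mem sI;
    by rewrite E1.
have -> : cint (`]0, t[%classic : set mR) (fun s => w (t - s) * g s) =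
    cint (`]0, t[%classic : set mR) (fun s => h (t - s) * g s).
  by apply: eq_cint => s sI; rewrite E1.
(* In every case W has a well-behaved convolution with h, equal to B * phi. *)
have [iW EW] : cintegrable (`]0, t[%classic : set mR) (fun s => h (t - s) * W s) /\
    cint (`]0, t[%classic : set mR) (fun s => h (t - s) * W s) = cconv B phi t.
  have [nuP|[nu0' nun]] : (0 < complex.Re nu \/ nu = 0) \/ complex.Re nu = 0 /\ nu != 0.
    have := nu0; rewrite le_eqVlt => /orP[/eqP nuE|]; last by left; left.
    by case: (eqVneq nu 0) => h; [left; right|right].
  - have [j1 j2 <-] := conv_kernel_at cphi iphi t nuP.
    have j1' := cintegrableS measurableT mI (@subsetT _ _) j1.
    have j2' := cintegrableS measurableT mI (@subsetT _ _) j2.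
    have EE s : h (t - s) * W s = (if nu == 0 then 1 else 0) * (h (t - s) * phi s) +
       h (t - s) * cconv (cut ker) phi s by rewrite /W; ring.
    have EF : (fun s => h (t - s) * W s) = (fun s =>
       (if nu == 0 then 1 else 0) * (h (t - s) * phi s) +
       h (t - s) * cconv (cut ker) phi s) by apply/funext.
    rewrite EF; split; first exact: cintegrableD.
    rewrite (cintD mI j1' j2') (cconv_open t ch (cconv_causal cK cphi)); congr (_ + _).
    rewrite (cconv_open t ch cphi).
    case: eqP => _; last by rewrite mul0r -[RHS](cint0 `]0, t[); apply: eq_cint => s _; rewrite mul0r.
    by rewrite mul1r; apply: eq_cint => s _; rewrite mul1r.
  have pz := density_singular nu0' nun.
  have zc : causal (fun=> 0 : C) by [].
  have z0 (u : R -> C) s : cconv u (fun=> 0) s = 0.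
    by rewrite /cconv -[RHS](cint0 setT); apply: eq_cint => y _; rewrite mulr0.
  have cz s (u : R -> C) : causal u -> cmeasurable [set: mR] u -> s < T -> cconv u phi s = 0.
    move=> cu mu' sT; rewrite -(z0 u s); apply: cconv_aer_pos => //.
    by apply: ae_imply pz _ => y E /andP[_ ys]; apply: E; exact: lt_trans ys sT.
  have aez : {ae mu, forall s, (`]0, t[%classic : set mR) s -> h (t - s) * W s = 0}.
    apply: ae_imply pz _ => s E; rewrite /= in_itv/= => /andP[s0 st].
    rewrite /W (negPf nun) mul0r add0r (cz s _ cK mK) ?mulr0//.
    exact: lt_trans st tT.
  have mW : cmeasurable (`]0, t[%classic : set mR) (fun s => h (t - s) * W s).
    have E s : (`]0, t[%classic : set mR) s -> h (t - s) * W s = 0.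
      rewrite /= in_itv/= => /andP[s0 st].
      by rewrite /W (negPf nun) mul0r add0r (cz s _ cK mK) ?mulr0// (lt_trans st).
    have [z1 z2] := @cmeasurable_cst R (`]0, t[%classic) 0.
    by split; [move: z1|move: z2]; apply: eq_measurable_fun => s /set_mem sI; rewrite E.
  have mz := @cmeasurable_cst R (`]0, t[%classic) 0.
  have iz : cintegrable (`]0, t[%classic : set mR) (fun=> 0 : C) by split; exact: integrable0.
  split; first exact: cintegrable_ae mI mW iz aez.
  by rewrite (cint_ae mI mW mz aez) cint0 (cz t _ cB mB tT).
have iFk := cintegrableZ k mI iF'.
have aeg : {ae mu, forall s, (`]0, t[%classic : set mR) s ->
    h (t - s) * g s = h (t - s) * W s + k * (h (t - s) * F s)}.
  apply: ae_imply ae _ => s E; rewrite /= in_itv/= => /andP[s0 st].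
  by rewrite E ?s0 ?(lt_trans st)//; ring.
have iS := cintegrableD mI iW iFk.
rewrite (cint_ae mI mhg (cintegrable_cmeasurable iS) aeg) (cintD mI iW iFk) (cintZ k mI iF').
by rewrite EW -(cconv_open t ch cF).
Qed.
End Equation.

(** The identity of [solution_identity] for the truncated function, in which
    [conv_rhs] recognizes B * phi + k (h * f) as h * g. *)
Theorem scalar_solution (w : R -> C) t : (forall x, 0 < x -> w x = eh x) -> 0 < t ->
  f t = cint `[0, t] (fun s => w (t - s) * g s) + tau * eq t.
Proof.
move=> wE t0; have T0 : 0 < t + 1 by rewrite ltr_wpDr.
have tT : t < t + 1 by rewrite ltrDl.
have [phi [cphi iphi phiE fE]] := truncated_density T0.
have Lp s : 0 <= s -> Lexp s phi by exact: cintegrable_Lexp cphi iphi.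
rewrite (conv_rhs cphi iphi phiE fE wE) ?t0// fE ?t0 ?ltW//.
by rewrite (solution_identity n0 tau N0 sh sq sB cphi Lp t0) /cut t0.
Qed.

End ScalarTheorem.

(** * Idempotent components and inversion of bicomplex transforms *)

Section Components.
Variable R : realType.
Local Notation C := R[i].
Local Notation T := (bicomplex R).
Local Notation mu := (@lebesgue_measure R).
Local Notation mR := (measurableTypeR R).
Implicit Types (c : bool) (x y : T) (f g h : R -> T) (A : set R).

(** Indexing the two idempotent components by a boolean lets every componentwise
    argument be carried out once. *)
Definition comp c x : C := if c then bc1 x else bc2 x.

Definition of_comp (a : bool -> C) : T := idem (a true) (a false).

Lemma comp_idem c (a b : C) : comp c (idem a b) = if c then a else b.
Proof. by case: c; rewrite /comp ?bc1_idem ?bc2_idem. Qed.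

Lemma comp_of_comp c (a : bool -> C) : comp c (of_comp a) = a c.
Proof. by rewrite /of_comp comp_idem; case: c. Qed.

Lemma comp_inj x y : (forall c, comp c x = comp c y) -> x = y.
Proof. by move=> E; rewrite -(bc_idemP x) -(bc_idemP y); have /= -> := E true; have /= -> := E false. Qed.

Lemma compM c x y : comp c (x * y) = comp c x * comp c y.
Proof. by case: c; rewrite /comp ?bc1_mul ?bc2_mul. Qed.

Lemma compD c x y : comp c (x + y) = comp c x + comp c y.
Proof. by case: c; rewrite /comp /bc1 /bc2 /=; ring. Qed.

Lemma compN c x : comp c (- x) = - comp c x.
Proof. by case: c; rewrite /comp /bc1 /bc2 /=; ring. Qed.

Lemma comp1 c : comp c (1 : T) = 1.
Proof. by case: c; rewrite /comp ?bc1_one ?bc2_one. Qed.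

Lemma comp_ofR c (t : R) : comp c (bc_ofR t) = t%:C.
Proof. by case: c; rewrite /comp /bc1 /bc2 /= mulr0 ?subr0 ?addr0. Qed.

Lemma compV c x : (forall c, comp c x != 0) -> comp c x^-1 = (comp c x)^-1.
Proof.
move=> u; have ux : bc_unit x by apply/andP; split; [exact: (u true)|exact: (u false)].
by rewrite [x^-1]/(bc_inv x) /bc_inv ux comp_idem; case: c.
Qed.

Lemma comp_pow c x y : comp c (bc_pow x y) = cpow (comp c x) (comp c y).
Proof. by rewrite comp_idem; case: c. Qed.

Lemma comp_exp c x : comp c (bc_exp x) = cexp (comp c x).
Proof. by rewrite comp_idem; case: c. Qed.

Lemma comp_int c A f : comp c (bc_int A f) = cint A (fun t => comp c (f t)).
Proof. by rewrite comp_idem; case: c. Qed.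

Lemma comp_deriv c n f t :
  comp c (bc_deriv_N n f t) = cderiv (deriv_order (comp c n)) (fun s => comp c (f s)) t.
Proof. by rewrite comp_idem; case: c. Qed.

Lemma comp_deriv_order c n : comp c (bc_deriv_order n) = (deriv_order (comp c n))%:R :> C.
Proof. by rewrite comp_idem; case: c. Qed.

Lemma comp_prabhakar c (l m n z : T) : comp c (bc_prabhakar l m n z) =
  cprabhakar (comp c l) (comp c m) (comp c n) (comp c z).
Proof. by rewrite comp_idem; case: c. Qed.

Lemma comp_integrable c A f : bc_integrable A f -> cintegrable A (fun t => comp c (f t)).
Proof. by case: c => -[]. Qed.

(** The half-planes of convergence of the two components meet exactly in the
    region Re xi > M + |Im_j xi|, since Re xi_i = Re xi +- Im_j xi. *)
Lemma comp_half_plane (M : R) x : M + `|bc_Imj x| < bc_Re x <->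
  forall c, M < complex.Re (comp c x).
Proof.
have E c : complex.Re (comp c x) = bc_Re x + (if c then 1 else -1) * bc_Imj x.
  case: c; rewrite /comp /bc1 /bc2 /bc_Re /bc_Imj; case: (bc_z1 x) => a b;
    case: (bc_z2 x) => a' b' /=; ring.
split=> [H c|H].
  rewrite E; have := ler_norm (bc_Imj x); have := ler_norm (- bc_Imj x).
  by rewrite normrN; case: c => /=; lra.
have := H true; have := H false; rewrite !E /=.
by case: (ger0P (bc_Imj x)) => _; lra.
Qed.

Lemma comp_Re_gt0 c x : `|bc_Imj x| < bc_Re x -> 0 < complex.Re (comp c x).
Proof. by move=> h; apply: (proj1 (comp_half_plane 0 x)); rewrite add0r. Qed.

Lemma comp_laplace c f x : comp c (laplace f x) =
  cint `[0, +oo[ (fun t => comp c (f t) * cexp (- (comp c x * t%:C))).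
Proof.
rewrite /laplace comp_int; apply: eq_cint => t _.
by rewrite compM comp_exp compN compM comp_ofR.
Qed.

Lemma comp_continuous h : (forall t, 0 < t -> bc_continuous_at h t) ->
  forall c, ccont_pos (fun t => comp c (h t)).
Proof. by move=> H c t t0; have [] := H t t0; case: c. Qed.

Lemma growth_comp (M : R) h c : exp_order M h ->
  exists K : R, exists b : R, forall t, b <= t -> c1norm (comp c (h t)) <= K * expR (M * t).
Proof.
move=> [K [b [br H]]]; exists (2 * K), (b + 1) => t bt.
have [H1 H2] := H t ltac:(by apply: lt_le_trans bt; rewrite ltrDl).
apply: le_trans (c1norm_le_cnorm _) _; rewrite -mulrA ler_wpM2l//.
by case: c.
Qed.

End Components.

Section Inversion.
Variable R : realType.
Local Notation C := R[i].
Local Notation T := (bicomplex R).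
Local Notation mu := (@lebesgue_measure R).
Local Notation mR := (measurableTypeR R).
Implicit Types (c : bool) (x y : T) (f g h : R -> T) (u v : R -> C).

Lemma cint_half_line u : cmeasurable (`]0, +oo[%classic : set mR) u ->
  cint `[0, +oo[ u = cint `]0, +oo[ u.
Proof.
move=> [m1 m2]; apply: cplxP; rewrite /cint /= /Rintegral; congr fine; apply/esym;
  apply: integral_itv_obnd_cbnd; exact/measurable_EFinP.
Qed.

Lemma locint_cut u : ccont_pos u -> (forall b, 0 < b -> cintegrable `[0, b] u) ->
  locint (cut u).
Proof.
move=> cu iu b; have [b0|b0] := leP b 0.
  have -> : (`]0, b]%classic : set mR) = set0 by rewrite set_itv_ge// bnd_simp -leNgt.
  by split; exact: integrable_set0.
have h : cintegrable (`]0, b]%classic : set mR) u.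
  apply: cintegrableS (@measurable_Ritv R `[0, b]) (@measurable_Ritv R `]0, b]) _ (iu b b0).
  by move=> t; rewrite /= !in_itv/= => /andP[/ltW-> ->].
apply: (eq_cintegrable (@measurable_Ritv R `]0, b]) _ h) => t; rewrite /= in_itv/= => /andP[t0 _].
by rewrite /cut t0.
Qed.

Lemma cut_growth u (M : R) :
  (exists K : R, exists b : R, forall t, b <= t -> c1norm (u t) <= K * expR (M * t)) ->
  exists K : R, exists b : R, forall t, b <= t -> c1norm (cut u t) <= K * expR (M * t).
Proof.
move=> [K [b H]]; exists K, (Num.max b 1) => t; rewrite ge_max => /andP[bt t1].
by rewrite /cut (lt_le_trans ltr01 t1) H.
Qed.

Lemma rlap_cut u (s : R) : rlap (cut u) s = claplace u s%:C.
Proof.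
rewrite /rlap /claplace [RHS]cint_mkcond; apply: eq_cint => t _.
rewrite /wexp /cut mem_setE in_itv/= andbT; case: ifP => _; last by rewrite mul0r.
by rewrite -rmorphM -rmorphN /= cexp_real.
Qed.

Lemma claplace_closed u z : ccont_pos u ->
  cint `[0, +oo[ (fun t => u t * cexp (- (z * t%:C))) = claplace u z.
Proof.
move=> cu; apply: cint_half_line; apply: cmeasurableM; first exact: ccont_pos_cmeasurable.
have -> : (fun t : R => cexp (- (z * t%:C))) = (fun t : R => gkernel 1 z t).
  by apply/funext => t; rewrite /gkernel subrr mul0r sub0r.
exact/ccont_pos_cmeasurable/ccont_pos_gkernel.
Qed.

(** A continuous original is determined at every t > 0 by the values of its
    transform at large real points. *)
Lemma original_unique u v (M M' : R) : ccont_pos u -> ccont_pos v ->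
  (forall b, 0 < b -> cintegrable `[0, b] u) -> (forall b, 0 < b -> cintegrable `[0, b] v) ->
  (exists K : R, exists b : R, forall t, b <= t -> c1norm (u t) <= K * expR (M * t)) ->
  (exists K : R, exists b : R, forall t, b <= t -> c1norm (v t) <= K * expR (M' * t)) ->
  (forall s : R, M < s -> M' < s -> claplace u s%:C = claplace v s%:C) ->
  forall t, 0 < t -> u t = v t.
Proof.
move=> cu cv iu iv gu gv E t t0.
have cut_c w : causal (cut w) := @causal_cut R w.
have LL w (N : R) : ccont_pos w -> (forall b, 0 < b -> cintegrable `[0, b] w) ->
   (exists K : R, exists b : R, forall t, b <= t -> c1norm (w t) <= K * expR (N * t)) ->
   forall s', N < s' -> Lexp s' (cut w).
  move=> cw iw gw; apply: locint_Lexp (cut_c w) (ccont_pos_cut cw) _ (cut_growth gw).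
  exact: locint_cut cw iw.
have Lu := LL u M cu iu gu; have Lv := LL v M' cv iv gv.
pose s0 := Num.max M M' + 1.
have big s : s0 <= s -> M < s /\ M' < s.
  move=> ss; have : Num.max M M' < s by apply: lt_le_trans ss; rewrite ltrDl.
  by rewrite gt_max => /andP[].
pose D t := cut u t + (-1) * cut v t.
have LD s : s0 <= s -> Lexp s D /\ rlap D s = 0.
  move=> /big[h1 h2]; have L2 := LexpZ (-1) (Lv s h2).
  split; first exact: LexpD (Lu s h1) L2.
  by rewrite /D (rlapD (Lu s h1) L2) (rlapZ _ (Lv s h2)) !rlap_cut E// mulN1r subrr.
have ae : {ae mu, forall t, D t = 0}.
  apply: (@lerch R D s0).
  - by move=> y y0; rewrite /D !cut_c// mulr0 addr0.
  - exact: proj1 (LD s0 (lexx _)).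
  - by move=> s ss; exact: proj2 (LD s ss).
apply: (ae_ccont_eq cu cv _ t0); apply: ae_imply ae _ => y /eqP.
by rewrite /D mulN1r subr_eq0 /cut => /eqP h y0; rewrite y0 in h.
Qed.

(** At a real point s both components of the transform are taken at s itself. *)
Lemma laplace_original_unique (F : T -> T) h h' : laplace_original F h ->
  laplace_original F h' -> forall t, 0 < t -> h t = h' t.
Proof.
move=> [ih ch [M gh Eh]] [ih' ch' [M' gh' Eh']] t t0; apply: comp_inj => c.
apply: (original_unique (u := fun t => comp c (h t)) (v := fun t => comp c (h' t))
   (M := M) (M' := M')) t0 => //.
- exact: comp_continuous.
- exact: comp_continuous.
- by move=> b b0; apply: comp_integrable; exact: ih.
- by move=> b b0; apply: comp_integrable; exact: ih'.
- exact: growth_comp.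
- exact: growth_comp.
move=> s Ms Ms'.
have hp (N : R) : N < s -> N + `|bc_Imj (bc_ofR s)| < bc_Re (bc_ofR s).
  by move=> Ns; apply/comp_half_plane => c'; rewrite comp_ofR.
have := congr1 (comp c) (etrans (Eh _ (hp M Ms)) (esym (Eh' _ (hp M' Ms')))).
rewrite !comp_laplace comp_ofR !claplace_closed//; exact: comp_continuous.
Qed.

(** For t >= 1 the power of t costs one unit in the exponential rate. *)
Lemma gweight_growth a (M : R) : exists K : R, 0 <= K /\ forall t, 1 <= t ->
  gweight a (- M) t <= K * expR ((M + 1) * t).
Proof.
have a1 : 0 < `|a - 1| + 1 by rewrite ltr_wpDl.
have [K hK] := @ln_linear_bound R _ 1 a1 ltr01.
exists (expR K); split=> [|t t1]; first exact: expR_ge0.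
have t0 : 0 < t by exact: lt_le_trans ltr01 t1.
rewrite /gweight -expRD ler_expR; have := hK t t0.
have l0 : 0 <= ln t by exact: ln_ge0.
have : (a - 1) * ln t <= (`|a - 1| + 1) * ln t.
  by apply: ler_wpM2r => //; apply: le_trans (ler_norm _) _; rewrite lerDl.
lra.
Qed.

Section Resolvents.
Variables (l : bool -> R) (m n r k : T) (F : T -> T) (b0 : bool -> C) (j0 : nat).
Variables (e : bool -> R -> C) (K M : bool -> R).
Hypothesis b0_gt0 : forall c, 0 < complex.Re (b0 c).
Hypothesis se : forall c, resolvent_spec (l c) (comp c m) (comp c n) (comp c r) (comp c k)
  (b0 c) j0 (e c) (K c) (M c).
Hypothesis FE : forall x, (forall c, M c < complex.Re (comp c x)) ->
  forall c, comp c (F x) = claplace (e c) (comp c x).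

Lemma resolvent_laplace_original : laplace_original F (fun t => of_comp (fun c => cut (e c) t)).
Proof.
set h := fun t => _.
have hE c : (fun t => comp c (h t)) = cut (e c).
  by apply/funext => t; rewrite /h comp_of_comp.
have hE1 : (fun t => bc1 (h t)) = cut (e true) := hE true.
have hE2 : (fun t => bc2 (h t)) = cut (e false) := hE false.
have ce c : ccont_pos (e c) by have [] := se c.
have cc c := ccont_pos_cut (ce c).
split.
- move=> b b0'.
  have ic c : cintegrable `[0, b] (cut (e c)).
    apply/(cintegrable_mkcond _ (@measurable_Ritv R `[0, b])).
    have := proj1 (cintegrable_mkcond _ (@measurable_Ritv R `]0, b]))
      (resolvent_locint (b0_gt0 c) (se c) b).
    apply: eq_cintegrable => // t _; rewrite !mem_setE !in_itv/= /cut.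
    case: (ltP 0 t) => t0; first by rewrite (ltW t0).
    by rewrite !if_same.
  by split; [rewrite hE1|rewrite hE2].
- move=> t t0; have [c1 c2] := cc true t t0; have [c3 c4] := cc false t t0.
  by split; [move: c1|move: c2|move: c3|move: c4]; rewrite -?hE1 -?hE2.
have M0 c : 0 <= M c by have [] := se c.
pose M' := Num.max (M true) (M false).
have MM c : M c <= M' by case: c; rewrite /M' le_max lexx ?orbT.
have gK c : exists K' : R, 0 <= K' /\ forall t, 1 <= t ->
    cnorm (cut (e c) t) <= K' * expR ((M' + 1) * t).
  have [G [G0 hG]] := gweight_growth (complex.Re (b0 c)) (M c).
  exists (`|K c| * G); split=> [|t t1]; first by rewrite mulr_ge0.
  have t0 : 0 < t by exact: lt_le_trans ltr01 t1.
  apply: le_trans (cnorm_le_c1norm _) _; rewrite /cut t0.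
  have [_ _ bd _] := se c; apply: le_trans (bd t t0) _.
  apply: (@le_trans _ _ (`|K c| * gweight (complex.Re (b0 c)) (- M c) t)).
    by rewrite ler_wpM2r ?ler_norm// ltW// gweight_gt0.
  rewrite -mulrA ler_wpM2l//; apply: le_trans (hG t t1) _.
  by rewrite ler_wpM2l// ler_expR ler_wpM2r ?lerD2r// ltW.
exists (M' + 1); last first.
  move=> x Mx; have hp := proj1 (comp_half_plane _ _) Mx.
  apply: comp_inj => c; rewrite comp_laplace.
  have -> : (fun t => comp c (h t) * cexp (- (comp c x * t%:C))) =
      (fun t => cut (e c) t * cexp (- (comp c x * t%:C))).
    by apply/funext => t; rewrite -hE.
  rewrite claplace_closed// FE; last first.
    move=> c'; apply: le_lt_trans (MM c') _; apply: le_lt_trans (hp c').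
    by rewrite lerDl.
  by apply: eq_cint => t; rewrite /= in_itv/= andbT /cut => ->.
have [K1 [K10 h1]] := gK true; have [K2 [K20 h2]] := gK false.
exists (K1 + K2); exists 1; split => // t /ltW t1.
rewrite (_ : bc1 (h t) = cut (e true) t); last by rewrite -hE1.
rewrite (_ : bc2 (h t) = cut (e false) t); last by rewrite -hE2.
by split; [apply: le_trans (h1 t t1) _|apply: le_trans (h2 t t1) _];
  rewrite ler_wpM2r ?expR_ge0 ?lerDl ?lerDr.
Qed.

(** The chosen inverse transform is some original, and originals agree on t > 0. *)
Lemma inverse_laplace_resolvent : laplace_original F (inverse_laplace F) /\
  forall c t, 0 < t -> comp c (inverse_laplace F t) = e c t.
Proof.
have hO := resolvent_laplace_original.
have iO : laplace_original F (inverse_laplace F).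
  by apply: (@xgetPex _ (fun=> 0) [set h | laplace_original F h]); exists (fun t => of_comp (fun c => cut (e c) t)).
split=> // c t t0.
by rewrite (laplace_original_unique iO hO t0) comp_of_comp /cut t0.
Qed.

End Resolvents.
End Inversion.

(** * The bicomplex equation *)

Section Symbols.
Variable R : realType.
Local Notation C := R[i].
Variables (l : R) (m n r k : C) (e : R -> C) (K M : R).

(** The transform of e times 1 + k / A is 1 / A, which is nonzero; hence so is
    A + k = A (1 + k / A). *)
Lemma resolvent_symbol z : resolvent_spec l m n r k n 1 e K M -> M < complex.Re z ->
  csymbol l m n r z + k != 0 /\ claplace e z = (csymbol l m n r z + k)^-1.
Proof.
move=> [M0 _ _ S] Mz; have [w0 E] := S z Mz.
have z0 : z != 0 by apply/eqP => zE; move: Mz; rewrite zE /= ltNge M0.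
have A0 : csymbol l m n r z != 0 by rewrite mulf_neq0 ?cpow_neq0.
rewrite expr1 (cpowN n z0) (cpowN l%:C w0) -invfM -/(csymbol l m n r z) in E.
set A := csymbol l m n r z in A0 E *.
have Ak : A + k != 0.
  apply/eqP => /eqP; rewrite addr_eq0 => /eqP AE.
  have kE : k = - A by rewrite AE opprK.
  move: E; rewrite kE mulNr divff// subrr mulr0 => /esym/eqP.
  by rewrite invr_eq0 (negPf A0).
split=> //; apply: (mulIf Ak); rewrite mulVf//.
have -> : A + k = A * (1 + k / A) by rewrite mulrDr mulr1 mulrCA divff// mulr1.
by rewrite mulrCA E divff.
Qed.

(** Here the transform of e times 1 + k / A is 1 / z, and A / z is the numerator. *)
Lemma initial_symbol z : resolvent_spec l m n r k 1 0 e K M -> M < complex.Re z ->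
  csymbol l m n r z + k != 0 -> claplace e z =
  cpow z (n - 1) * cpow (1 - r * cpow z (- m)) l%:C * (csymbol l m n r z + k)^-1.
Proof.
move=> [M0 _ _ S] Mz Ak; have [w0 E] := S z Mz.
have z0 : z != 0 by apply/eqP => zE; move: Mz; rewrite zE /= ltNge M0.
have A0 : csymbol l m n r z != 0 by rewrite mulf_neq0 ?cpow_neq0.
rewrite expr0 mulr1 in E.
have -> : cpow z (n - 1) * cpow (1 - r * cpow z (- m)) l%:C = cpow z (-1) * csymbol l m n r z.
  by rewrite addrC (cpowD _ _ z0) -mulrA.
rewrite -E; set A := csymbol l m n r z in A0 Ak E *.
apply: (mulIf Ak); rewrite -[RHS]mulrA mulVf// mulr1 -mulrA; congr (_ * _).
by field.
Qed.

End Symbols.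

Section Equation.
Variable R : realType.
Local Notation C := R[i].
Local Notation T := (bicomplex R).
Local Notation mu := (@lebesgue_measure R).

Lemma comp_equation (lc : bool -> R) (l m n r k : T) (f g : R -> T) c :
  (forall c, comp c l = (lc c)%:C) ->
  {ae mu, forall t : R, 0 < t -> prabhakar_derivative_exists l m n r f t /\
       prabhakar_derivative l m n r f t + k * f t = g t} ->
  let N := deriv_order (comp c n) in let nu : C := N%:R - comp c n in
  let D := cderiv N (fun s => comp c (f s)) in
  {ae mu, forall t, 0 < t ->
    cintegrable `[0, t] (fun y => prabhakar_kernel (lc c) (comp c m) nu (comp c r) (t - y) * D y) /\
    (if nu == 0 then D t else 0) +
    cint `[0, t] (fun y => prabhakar_kernel (lc c) (comp c m) nu (comp c r) (t - y) * D y) +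
    comp c k * comp c (f t) = comp c (g t)}.
Proof.
move=> lE ae N nu D; apply: ae_imply ae _ => t H t0; have [iH <-] := H t0.
have nuE : comp c (bc_deriv_order n - n) = nu.
  by rewrite (compD c (bc_deriv_order n)) compN comp_deriv_order.
have E : (fun y => comp c (prabhakar_integrand (- l) m (bc_deriv_order n - n) r
      (bc_deriv_N n f) t y)) =
    (fun y => prabhakar_kernel (lc c) (comp c m) nu (comp c r) (t - y) * D y).
  apply/funext => y; rewrite /prabhakar_integrand !compM comp_pow comp_prabhakar comp_deriv.
  by rewrite (compM c r) comp_pow (compD c _ (-1)) (compN c 1) comp1 nuE (compN c l) lE comp_ofR.
split; first by rewrite -E; exact: comp_integrable iH.
rewrite compD compM /prabhakar_derivative /prabhakar_integral compD comp_int E comp_idem.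
congr (_ + _ + _).
by rewrite -nuE /D /N; case: c {E nuE D nu N} => /=; rewrite /bc_deriv_N ?bc1_idem ?bc2_idem.
Qed.

End Equation.

Theorem theorem5p3 (R : realType) (l m n r k tau0 : bicomplex R) (l1 l2 : R)
    (f g : R -> bicomplex R)
    (hm : `|bc_Imj m| < bc_Re m)
    (hn : `|bc_Imj n| < bc_Re n)
    (hl : l = idem l1%:C l2%:C) (hl1 : 0 < l1 < 1) (hl2 : 0 < l2 < 1)
    (hfL : forall b : R, 0 < b -> L_T 0 b f)
    (hgL : forall b : R, 0 < b -> L_T 0 b g)
    (hfexp : of_exp_order f)
    (hgexp : of_exp_order g)
    (hfreg : prabhakar_regular n f)
    (hf0 : initial_value f tau0)
    (hf0' : higher_initial_values_zero n f)
    (heq : {ae (@lebesgue_measure R), forall t : R, 0 < t ->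
       prabhakar_derivative_exists l m n r f t /\
       prabhakar_derivative l m n r f t + k * f t = g t}) :
  let H : bicomplex R -> bicomplex R := fun x : bicomplex R =>
    1 / (bc_pow x n * bc_pow (1 - r * bc_pow x (- m)) l + k) in
  let Q : bicomplex R -> bicomplex R := fun x : bicomplex R =>
    bc_pow x (n - 1) * bc_pow (1 - r * bc_pow x (- m)) l
    / (bc_pow x n * bc_pow (1 - r * bc_pow x (- m)) l + k) in
  let h := inverse_laplace H in
  [/\ laplace_original H h,
      laplace_original Q (inverse_laplace Q) &
      forall t : R, 0 < t -> f t = bc_conv h g t + tau0 * inverse_laplace Q t].
Proof.
move=> H Q h.
pose lc c := if c then l1 else l2.
have lE c : comp c l = (lc c)%:C by rewrite hl comp_idem; case: c.
have lc01 c : 0 < lc c < 1 by case: c.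
have lc0 c : 0 < lc c by case/andP: (lc01 c).
have lc1 c : lc c < 1 by case/andP: (lc01 c).
have m0 c : 0 < complex.Re (comp c m) := comp_Re_gt0 c hm.
have n0 c : 0 < complex.Re (comp c n) := comp_Re_gt0 c hn.
have original (b0 : bool -> R[i]) (j0 : nat) : (forall c, 0 < complex.Re (b0 c)) ->
    exists p : bool -> (R -> R[i]) * (R * R), forall c,
      resolvent_spec (lc c) (comp c m) (comp c n) (comp c r) (comp c k) (b0 c) j0
        (p c).1 (p c).2.1 (p c).2.2.
  move=> b0p; have [c|p hp] := @boolp.choice bool _ (fun c p =>
      resolvent_spec (lc c) (comp c m) (comp c n) (comp c r) (comp c k) (b0 c) j0
        p.1 p.2.1 p.2.2); last by exists p.
  have [e [K [M S]]] := resolvent_original (comp c r) (comp c k) (ltW (lc0 c)) (ltW (lc1 c))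
    (m0 c) (n0 c) j0 (b0p c).
  by exists (e, (K, M)).
have one0 (c : bool) : 0 < complex.Re (1 : R[i]) := ltr01.
have [ph sh] := original _ 1%N n0.
have [pq sq] := original (fun=> 1) 0%N one0.
have [pB sB] := original (fun c => (deriv_order (comp c n))%:R) 0%N
  (fun c => ltac:(by rewrite cRe_nat ltr0n; exact: proj1 (deriv_order_bounds (n0 c)))).
have symE c x : comp c (bc_pow x n * bc_pow (1 - r * bc_pow x (- m)) l + k) =
    csymbol (lc c) (comp c m) (comp c n) (comp c r) (comp c x) + comp c k.
  by rewrite compD compM !comp_pow compD compN compM comp_pow compN comp1 lE.
have HE x : (forall c, (ph c).2.2 < complex.Re (comp c x)) ->
    forall c, comp c (H x) = claplace (ph c).1 (comp c x).
  move=> hx c; rewrite /H compM comp1 mul1r compV; last first.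
    by move=> c'; rewrite symE; exact: proj1 (resolvent_symbol (sh c') (hx c')).
  by rewrite symE -(proj2 (resolvent_symbol (sh c) (hx c))).
(* The half-plane for Q is shrunk so that the denominator is invertible there. *)
pose Mq c := Num.max (ph c).2.2 (pq c).2.2.
have sq' c : resolvent_spec (lc c) (comp c m) (comp c n) (comp c r) (comp c k) 1 0
    (pq c).1 `|(pq c).2.1| (Mq c).
  have [q0 qc qb qE] := sq c; split => //.
  - by rewrite le_max q0 orbT.
  - move=> t t0; apply: le_trans (qb t t0) _.
    apply: (@le_trans _ _ (`|(pq c).2.1| * gweight (complex.Re (1 : R[i])) (- (pq c).2.2) t)).
      by rewrite ler_wpM2r ?ler_norm// ltW// gweight_gt0.
    by rewrite ler_wpM2l// gweight_leM// le_max lexx orbT.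
  - by move=> z; rewrite gt_max => /andP[_]; exact: qE.
have QE x : (forall c, Mq c < complex.Re (comp c x)) ->
    forall c, comp c (Q x) = claplace (pq c).1 (comp c x).
  move=> hx c.
  have hx1 c' : (ph c').2.2 < complex.Re (comp c' x).
    by have := hx c'; rewrite gt_max => /andP[].
  have hx2 c' : (pq c').2.2 < complex.Re (comp c' x).
    by have := hx c'; rewrite gt_max => /andP[].
  have u c' := proj1 (resolvent_symbol (sh c') (hx1 c')).
  rewrite /Q compM compV; last by move=> c'; rewrite symE.
  rewrite symE (initial_symbol (sq c) (hx2 c) (u c)).
  by rewrite compM !comp_pow !compD !compN compM comp_pow compN comp1 lE.
have [oH hE] := inverse_laplace_resolvent n0 sh HE.
have [oQ qE] := inverse_laplace_resolvent one0 sq' QE.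
split=> // t t0; apply: comp_inj => c; rewrite compD compM comp_int (qE c t t0).
under eq_cint do rewrite compM.
have gL b : 0 < b -> cintegrable `[0, b] (fun s => comp c (g s)).
  by move=> b0; apply: comp_integrable; exact: hgL.
have fR : cAC_order (deriv_order (comp c n)) (fun s => comp c (f s)).
  by have [] := hfreg; case: (c).
have f0 : has_lim0 (fun s => comp c (f s)) (comp c tau0) by have [] := hf0; case: (c).
have f0' p : (0 < p < deriv_order (comp c n))%N -> has_lim0 (cderiv p (fun s => comp c (f s))) 0.
  by have [a b] := hf0'; case: (c) => /=; [exact: a|exact: b].
exact: (scalar_solution (lc0 c) (lc1 c) (m0 c) (n0 c) gL fR f0 f0' (comp_equation c lE heq)
  (sh c) (sq c) (sB c) (fun x x0 => hE c x x0) t0).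
Qed.
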